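(* Suppose that the mesh refinement satisfies Assumptions (R1), (R2), (R3) and that the marking strategy satisfies Assumption (M) (all stated in the context), and that the mesh-size function $h_0$ of the initial mesh satisfies $h_0<h_{\mathtt{fix}}$. Let $(\boldsymbol\sigma_\ell^{r},u_\ell^{c})\in \mathbb W_\ell\times\mathbb V_\ell$, $\ell=0,1,2,\dots$, be the sequence generated by the adaptive algorithm described in the context. Then $$\lim_{\ell\to\infty}|\!|\!|(\boldsymbol\sigma,u)-(\boldsymbol\sigma_\ell^{r},u_\ell^{c})|\!|\!|=0\quad\text{and}\quad \lim_{\ell\to\infty}\eta_\ell^{ls}(\boldsymbol\sigma_\ell^{r},u_\ell^{c})=0 .$$
   Context: **PDE.** $\Omega\subset\mathbb R^d$ ($d=2,3$) is a bounded, open, connected set with Lipschitz boundary. $A\in L^\infty(\Omega)^{d\times d}$ is symmetric and uniformly positive definite: $\Lambda_0\, y^Ty\le y^TA(x)y\le\Lambda_1\, y^Ty$ for all $y\in\mathbb R^d$, a.e. $x\in\Omega$, with $0<\Lambda_0\le\Lambda_1$; $\mathbf b\in L^\infty(\Omega)^d$, $c\in L^\infty(\Omega)$, $f_1\in L^2(\Omega)$, $\mathbf f_2\in L^2(\Omega)^d$. $(\cdot,\cdot)$ is the $L^2(\Omega)$ inner product; $\|\cdot\|_{0,\omega}$, $\|\cdot\|_{1,\omega}$ are the $L^2(\omega)$ and $H^1(\omega)$ norms (subscript $\omega$ omitted if $\omega=\Omega$). Let $a(w,v)=(A\nabla w,\nabla v)+(\mathbf b\cdot\nabla w+cw,v)$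 on $H_0^1(\Omega)$. It is assumed that the weak problem is well posed, i.e. there is $\beta>0$ with $\beta\le\inf_{w\in H_0^1(\Omega)}\sup_{v\in H_0^1(\Omega)}\frac{a(w,v)}{\|w\|_1\|v\|_1}$ and for every right-hand side in $H^{-1}(\Omega)$ there is a unique solution; $u\in H_0^1(\Omega)$ is the unique solution of $a(u,v)=(f_1,v)+(\mathbf f_2,\nabla v)$ for all $v\in H_0^1(\Omega)$, and $\boldsymbol\sigma=\mathbf f_2-A\nabla u\in H(\mathrm{div};\Omega)$. **Spaces and norms.** $\|\boldsymbol\tau\|_{H(\mathrm{div};\omega)}^2=\|\boldsymbol\tau\|_{0,\omega}^2+\|\nabla\cdot\boldsymbol\tau\|_{0,\omega}^2$; $\mathbb X=H(\mathrm{div};\Omega)\times H_0^1(\Omega)$ with norm $|\!|\!|(\boldsymbol\tau,v)|\!|\!|=(\|v\|_1^2+\|\boldsymbol\tau\|_{H(\mathrm{div};\Omega)}^2)^{1/2}$. **Meshes.** $\mathcal T_0$ is a conforming simplicial triangulation of $\Omega$. For a mesh $\mathcal T_\bullet$, $h_\bullet\in L^\infty(\Omega)$ is defined by $h_\bullet|_T=|T|^{1/d}$. $\mathrm{refine}(\mathcal T_\bullet,\mathcal M_\bullet)$ is the newest vertex bisection refinement of $\mathcal T_\bullet$ refining at least all marked elements $\mathcal M_\bullet\subset\mathcal T_\bullet$. $\mathbb T$ is the set of all meshes obtained from $\mathcal T_0$ by finitely many refinements. (R1) With a constant $0<q<1$: for a refinement $\mathcal T_\oplus$ of $\mathcal T_\bullet$,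 $h_\oplus\le h_\bullet$ a.e. in $\Omega$ and $h_\oplus\le q\,h_\bullet$ on every $T\in\mathcal T_\bullet\setminus\mathcal T_\oplus$. (R2) There is $\kappa>0$ depending only on $\mathcal T_0$ with $\mathrm{diam}(T)^d\le\kappa|T|$ for all $T\in\mathcal T_\bullet$, $\mathcal T_\bullet\in\mathbb T$. (R3) $\mathcal M_\bullet\cap\mathrm{refine}(\mathcal T_\bullet,\mathcal M_\bullet)=\emptyset$ for all $\mathcal T_\bullet\in\mathbb T$ and $\mathcal M_\bullet\subset\mathcal T_\bullet$. **Finite elements.** $\mathbb V_\bullet=\{v\in H_0^1(\Omega): v|_T\in P_1(T)\ \forall T\in\mathcal T_\bullet\}$; $\mathbb W_\bullet=\{\boldsymbol\tau\in H(\mathrm{div};\Omega):\boldsymbol\tau|_T\in P_0(T)^d+\mathbf x P_0(T)\ \forall T\in\mathcal T_\bullet\}$. The number $h_{\mathtt{fix}}>0$ is a fixed mesh size such that, if $h_0<h_{\mathtt{fix}}$, then for a constant $\beta_0>0$ one has $\beta_0\le\inf_{w\in\mathbb V_\bullet}\sup_{v\in\mathbb V_\bullet}\frac{a(w,v)}{\|w\|_1\|v\|_1}$ for all $\mathcal T_\bullet\in\mathbb T$. **Estimator.** Fix $\gamma\in[0,1]$ and let $B(\boldsymbol\tau,v;\gamma)=\gamma\,\mathbf b\cdot\nabla v-(1-\gamma)\mathbf b\cdot A^{-1}\boldsymbol\tau+cv$, $g(\gamma)=f_1-(1-\gamma)\mathbf b\cdot A^{-1}\mathbf f_2$. For $T\in\mathcal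 T_\bullet$, $$\eta_\bullet^{ls}(T;\boldsymbol\tau,v)=\big(\|A^{-1/2}\boldsymbol\tau+A^{1/2}\nabla v-A^{-1/2}\mathbf f_2\|_{0,T}^2+\|\nabla\cdot\boldsymbol\tau+B(\boldsymbol\tau,v;\gamma)-g(\gamma)\|_{0,T}^2\big)^{1/2},$$ and $\eta_\bullet^{ls}(\boldsymbol\tau,v)=\big(\sum_{T\in\mathcal T_\bullet}\eta_\bullet^{ls}(T;\boldsymbol\tau,v)^2\big)^{1/2}$. **Adaptive algorithm.** For $\ell=0,1,2,\dots$ (subscript $\ell$ meaning the object associated with $\mathcal T_\ell$): (i) compute $u_\ell^c\in\mathbb V_\ell$ with $a(u_\ell^c,v)=(f_1,v)+(\mathbf f_2,\nabla v)$ for all $v\in\mathbb V_\ell$; (ii) compute $\boldsymbol\sigma_\ell^r\in\mathbb W_\ell$ as the minimizer over $\boldsymbol\tau\in\mathbb W_\ell$ of $\|A^{-1/2}\boldsymbol\tau+A^{1/2}\nabla u_\ell^c-A^{-1/2}\mathbf f_2\|_0^2+\|\nabla\cdot\boldsymbol\tau+B(\boldsymbol\tau,u_\ell^c;\gamma)-g(\gamma)\|_0^2$; (iii) compute $\eta_\ell^{ls}(T;\boldsymbol\sigma_\ell^r,u_\ell^c)$ for all $T\in\mathcal T_\ell$; (iv) choose $\mathcal M_\ell\subset\mathcal T_\ell$ satisfying (M); (v) set $\mathcal T_{\ell+1}=\mathrm{refine}(\mathcal T_\ell,\mathcal M_\ell)$. **Assumption (M).** There is a fixed function $G:[0,\infty)\to[0,\infty)$,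 continuous at $0$ with $G(0)=0$, such that for all $\ell$, $\max_{T\in\mathcal T_\ell\setminus\mathcal M_\ell}\eta_\ell^{ls}(T;\boldsymbol\sigma_\ell^r,u_\ell^c)\le G\big(\max_{T\in\mathcal M_\ell}\eta_\ell^{ls}(T;\boldsymbol\sigma_\ell^r,u_\ell^c)\big)$ (a maximum over the empty set is $0$). *)

(* Defs.v *)
From HB Require Import structures.
From mathcomp Require Import all_boot all_order all_algebra.
From mathcomp Require Import finmap.
From mathcomp Require Import all_classical all_reals all_analysis.

Set Implicit Arguments.
Unset Strict Implicit.
Unset Printing Implicit Defensive.

Import Order.TTheory GRing.Theory Num.Theory.
Import numFieldNormedType.Exports.

Local Open Scope classical_set_scope.
Local Open Scope ring_scope.

(* Lebesgue measure on R^n, for the sigma-algebra generated by the coordinate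
   projections (that is, the Borel sigma-algebra). *)

Definition rV_display : measure_display. Proof. exact. Qed.

Section rV_measurable.
Context {R : realType} (n : nat).

Definition rV_coord (i : 'I_n) (x : 'rV[R]_n) : measurableTypeR R := x 0 i.

Let rV_set0 : g_sigma_preimage rV_coord set0.
Proof. exact: sigma_algebra0. Qed.

Let rV_setC A : g_sigma_preimage rV_coord A -> g_sigma_preimage rV_coord (~` A).
Proof. exact: sigma_algebraC. Qed.

Let rV_bigcup (F : _^nat) : (forall i, g_sigma_preimage rV_coord (F i)) ->
  g_sigma_preimage rV_coord (\bigcup_i (F i)).
Proof. exact: sigma_algebra_bigcup. Qed.

HB.instance Definition _ := @isMeasurable.Build rV_display
  'rV[R]_n (g_sigma_preimage rV_coord) rV_set0 rV_setC rV_bigcup.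

End rV_measurable.

Section lebesgue_rV.
Context {R : realType}.

Definition rV_cons n (p : measurableTypeR R * 'rV[R]_n) : 'rV[R]_n.+1 :=
  row_mx (\row_(_ < 1) (p.1 : R)) p.2 : 'rV[R]_(1 + n).

Lemma rV_cons0 n p : @rV_cons n p 0 ord0 = p.1.
Proof.
have := row_mxEl (\row_(_ < 1) (p.1 : R)) p.2 0 (ord0 : 'I_1).
by rewrite mxE => <-; congr (row_mx _ _ _ _); exact: val_inj.
Qed.

Lemma rV_consS n p (i : 'I_n) : @rV_cons n p 0 (lift ord0 i) = p.2 0 i.
Proof.
have := row_mxEr (\row_(_ < 1) (p.1 : R)) p.2 0 i.
by move=> <-; congr (row_mx _ _ _ _); exact: val_inj.
Qed.

Lemma measurable_rV_coord n (i : 'I_n) :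
  measurable_fun [set: 'rV[R]_n] (rV_coord i).
Proof.
move=> _ Y mY; rewrite setTI; apply: sub_sigma_algebra => /=.
rewrite -bigcup_seq/=; exists i => /=; first by rewrite mem_index_enum.
by exists Y => //; rewrite setTI.
Qed.

Lemma measurable_rV d (T : measurableType d) n (f : T -> 'rV[R]_n) :
  (forall i, measurable_fun [set: T] (rV_coord i \o f)) ->
  measurable_fun [set: T] f.
Proof.
move=> mf.
have sub : g_sigma_preimage (fun i => rV_coord i \o f) `<=` measurable.
  apply: smallest_sub; first exact: sigma_algebra_measurable.
  case: n => [|n] in f mf *; first by rewrite big_ord0.
  rewrite -bigcup_mkord_ord; apply: bigcup_sub => i Ii.
  by move=> A [B mB <-]; exact: mf.
rewrite g_sigma_preimage_comp in sub.
by move=> _ A mA; apply: sub; exists A.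
Qed.

Lemma measurable_rV_cons n : measurable_fun setT (@rV_cons n).
Proof.
apply: measurable_rV => i.
case: (unliftP ord0 i) => [j|] ->.
  rewrite (_ : _ \o _ = rV_coord j \o snd).
    apply: measurableT_comp; last exact: measurable_snd.
    exact: measurable_rV_coord.
  by apply/funext => p /=; rewrite /rV_coord rV_consS.
rewrite (_ : _ \o _ = fst); first exact: measurable_fst.
by apply/funext => p /=; rewrite /rV_coord rV_cons0.
Qed.

Section step.
Variables (n : nat) (m : {sigma_finite_measure set 'rV[R]_n -> \bar R}).

Definition rV_step : set 'rV[R]_n.+1 -> \bar R :=
  pushforward ((@lebesgue_measure R) \x m)%E (@rV_cons n).

Let m1 : {measure set (measurableTypeR R * 'rV[R]_n) -> \bar R} :=
  ((@lebesgue_measure R) \x m)%E.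

Let step0 : rV_step set0 = 0%E.
Proof. by rewrite /rV_step /pushforward preimage_set0 measure0. Qed.

Let step_ge0 A : (0 <= rV_step A)%E.
Proof. by rewrite /rV_step /pushforward; exact: (measure_ge0 m1). Qed.

Let step_sigma_additive : semi_sigma_additive rV_step.
Proof.
move=> F mF tF mUF; rewrite /rV_step /pushforward preimage_bigcup.
have mc A : measurable A -> measurable (@rV_cons n @^-1` A).
  by move=> mA; rewrite -[X in measurable X]setTI; exact: measurable_rV_cons.
apply: (@measure_semi_sigma_additive _ _ _ m1).
- by move=> i; exact: mc.
- apply/trivIsetP => /= i j _ _ ij; rewrite -preimage_setI.
  by move/trivIsetP : tF => /(_ _ _ _ _ ij) ->//; rewrite preimage_set0.
- by rewrite -preimage_bigcup; exact: mc.
Qed.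

HB.instance Definition _ :=
  isMeasure.Build _ _ _ rV_step step0 step_ge0 step_sigma_additive.

Let uncons (x : 'rV[R]_n.+1) : measurableTypeR R * 'rV[R]_n :=
  (x 0 ord0, \row_i x 0 (lift ord0 i)).

Let rV_consK : cancel (@rV_cons n) uncons.
Proof.
move=> [t y]; rewrite /uncons rV_cons0; congr (_, _).
by apply/rowP => i; rewrite mxE rV_consS.
Qed.

Let measurable_uncons : measurable_fun setT uncons.
Proof.
apply/measurable_fun_pairP; split.
  exact: (measurable_rV_coord (ord0 : 'I_n.+1)).
apply: measurable_rV => i.
rewrite (_ : _ \o _ = rV_coord (lift ord0 i)); last first.
  by apply/funext => x; rewrite /rV_coord /= mxE.
exact: measurable_rV_coord.
Qed.

Let step_sigma_finite : sigma_finite setT rV_step.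
Proof.
pose l : {sigma_finite_measure set (measurableTypeR R) -> \bar R} :=
  @lebesgue_measure R.
have /sigma_finiteP[F [TF ndF Foo]] := sigma_finiteT l.
have /sigma_finiteP[G [TG ndG Goo]] := sigma_finiteT m.
exists (fun k => uncons @^-1` (F k `*` G k)).
  rewrite predeqE => x; split => // _.
  have [i _ Fi] : (\bigcup_i F i) (uncons x).1 by rewrite -TF.
  have [j _ Gj] : (\bigcup_i G i) (uncons x).2 by rewrite -TG.
  exists (maxn i j) => //; split.
    by move: Fi; exact/subsetPset/ndF/leq_maxl.
  by move: Gj; exact/subsetPset/ndG/leq_maxr.
move=> k; have [mF Fk] := Foo k; have [mG Gk] := Goo k; split.
  rewrite -[X in measurable X]setTI; apply: measurable_uncons => //.
  exact: measurableX.
rewrite /rV_step /pushforward -comp_preimage.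
rewrite (_ : uncons \o _ = id); last first.
  by apply/funext => x /=; rewrite rV_consK.
by rewrite preimage_id product_measure1E// lte_mul_pinfty// ge0_fin_numE.
Qed.

HB.instance Definition _ :=
  Measure_isSigmaFinite.Build _ _ _ rV_step step_sigma_finite.

Definition rV_step_measure : {sigma_finite_measure set 'rV[R]_n.+1 -> \bar R} :=
  rV_step.

End step.

Fixpoint lebesgue_rV (n : nat) : {sigma_finite_measure set 'rV[R]_n -> \bar R} :=
  match n with
  | 0 => \d_(0 : 'rV[R]_0)
  | k.+1 => rV_step_measure (lebesgue_rV k)
  end.

End lebesgue_rV.

Section euclidean.
Context {R : realType} {d : nat}.

Definition dot (x y : 'rV[R]_d) : R := \sum_i x 0 i * y 0 i.

Definition enorm (x : 'rV[R]_d) : R := Num.sqrt (dot x x).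

Definition diam (E : set 'rV[R]_d) : R :=
  sup [set enorm (p.1 - p.2) | p in E `*` E].

(* Vectors are rows, so M acts on x as the column vector M x^T. *)
Definition mxact (M : 'M[R]_d) (x : 'rV[R]_d) : 'rV[R]_d := x *m M^T.

(* The symmetric positive semidefinite square root M^(1/2) (0 if there is none);
   M^(-1/2) is invmx (mxsqrt M). *)
Definition mxsqrt (M : 'M[R]_d) : 'M[R]_d :=
  xget 0 [set B : 'M[R]_d |
    [/\ B^T = B, forall y, 0 <= dot y (mxact B y) & B *m B = M]].

(* Near each boundary point, E is the open region strictly above the graph of a
   Lipschitz function gam along some unit direction e; only the values of gam on
   the hyperplane orthogonal to e matter. *)
Definition lipschitz_boundary (E : set 'rV[R]_d) : Prop :=
  forall x, (closure E `\` E°) x ->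
  exists (e : 'rV[R]_d) (gam : 'rV[R]_d -> R),
  [/\ enorm e = 1, exists k, forall y z, `|gam y - gam z| <= k * enorm (y - z)
    & \forall y \near x, E y <-> gam (y - dot y e *: e) < dot y e].

Definition lipschitz_domain (E : set 'rV[R]_d) : Prop :=
  [/\ bounded_set E, open E, connected E & lipschitz_boundary E].

End euclidean.

Section sobolev.
Context {R : realType} {d : nat}.
Local Notation V := 'rV[R]_d.
Local Notation leb := (@lebesgue_rV R d).
Implicit Types (E : set V) (f g v phi : V -> R) (F G tau : V -> V).

Definition ae_on E (P : V -> Prop) : Prop := {ae leb, forall x, E x -> P x}.

Definition Linfty E f : Prop :=
  measurable_fun E f /\ exists M : R, ae_on E (fun x => `|f x| <= M).

Definition L2 E f : Prop :=
  measurable_fun E f /\ leb.-integrable E (fun x => (f x ^+ 2)%:E).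

Definition L2v E F : Prop := forall i, L2 E (fun x => F x 0 i).

Definition ip E f g : R := \int[leb]_(x in E) (f x * g x).

Definition ipv E F G : R := \int[leb]_(x in E) dot (F x) (G x).

Definition normL2 E f : R := Num.sqrt (ip E f f).

Definition normL2v E F : R := Num.sqrt (ipv E F F).

Definition partial (i : 'I_d) f : V -> R := fun x => 'D_(delta_mx 0 i) f x.

Definition grad f : V -> V := fun x => \row_i partial i f x.

Definition smooth f : Prop := forall s : seq 'I_d,
  let g := foldr partial f s in
  continuous g /\ forall i x, derivable g x (delta_mx 0 i).

Definition test_fun E phi : Prop :=
  smooth phi /\
  exists K, [/\ compact K, K `<=` E & forall x, ~ K x -> phi x = 0].

Definition is_wgrad E v F : Prop :=
  L2v E F /\ forall phi i, test_fun E phi ->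
    ip E v (partial i phi) = - ip E (fun x => F x 0 i) phi.

Definition is_wdiv E tau g : Prop :=
  L2 E g /\ forall phi, test_fun E phi ->
    ipv E tau (grad phi) = - ip E g phi.

(* Weak derivatives are unique up to null sets; wgrad and wdiv pick one (and are
   meaningful only on H1 and Hdiv). *)
Definition wgrad E v : V -> V := xget (fun=> 0) [set F | is_wgrad E v F].

Definition wdiv E tau : V -> R := xget (fun=> 0) [set g | is_wdiv E tau g].

Definition H1 E v : Prop := L2 E v /\ exists F, is_wgrad E v F.

Definition Hdiv E tau : Prop := L2v E tau /\ exists g, is_wdiv E tau g.

Definition normH1 E v : R :=
  Num.sqrt (normL2 E v ^+ 2 + normL2v E (wgrad E v) ^+ 2).

Definition normHdiv E tau : R :=
  Num.sqrt (normL2v E tau ^+ 2 + normL2 E (wdiv E tau) ^+ 2).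

Definition H10 E v : Prop :=
  H1 E v /\ exists phi : nat -> V -> R, (forall n, test_fun E (phi n)) /\
    normH1 E (v \- phi n) @[n --> \oo] --> (0 : R).

Definition normX E tau v : R :=
  Num.sqrt (normH1 E v ^+ 2 + normHdiv E tau ^+ 2).

Definition Hminus1 E (ell : (V -> R) -> R) : Prop :=
  (forall (k : R) v w, H10 E v -> H10 E w ->
     ell (k \*o v \+ w) = k * ell v + ell w) /\
  exists C, forall v, H10 E v -> `|ell v| <= C * normH1 E v.

(* The infimum and supremum range over functions of nonzero norm, the quotient
   being undefined otherwise. *)
Definition inf_sup E (a : (V -> R) -> (V -> R) -> R) (S : set (V -> R)) : \bar R :=
  ereal_inf [set ereal_sup
      [set (a w v / (normH1 E w * normH1 E v))%:E
        | v in [set v | S v /\ normH1 E v != 0]]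
    | w in [set w | S w /\ normH1 E w != 0]].

End sobolev.

Section problem.
Context {R : realType} {d : nat}.
Local Notation V := 'rV[R]_d.

Record pde := Pde {
  dom : set V;
  coefA : V -> 'M[R]_d;
  coefb : V -> V;
  coefc : V -> R;
  rhs1 : V -> R;
  rhs2 : V -> V
}.

Implicit Types (p : pde) (v w : V -> R) (tau : V -> V).

Definition pde_data p : Prop :=
  [/\ lipschitz_domain (dom p),
      (forall i j, Linfty (dom p) (fun x => coefA p x i j)) /\
      (exists L0 L1 : R, 0 < L0 <= L1 /\ ae_on (dom p) (fun x =>
         (coefA p x)^T = coefA p x /\
         forall y, L0 * dot y y <= dot y (mxact (coefA p x) y) <= L1 * dot y y)),
      (forall i, Linfty (dom p) (fun x => coefb p x 0 i)) /\
      Linfty (dom p) (coefc p) &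
      L2 (dom p) (rhs1 p) /\ L2v (dom p) (rhs2 p)].

Definition pdeGrad p v : V -> V := wgrad (dom p) v.

Definition form p w v : R :=
  ipv (dom p) (fun x => mxact (coefA p x) (pdeGrad p w x)) (pdeGrad p v) +
  ip (dom p) (fun x => dot (coefb p x) (pdeGrad p w x) + coefc p x * w x) v.

Definition load p v : R :=
  ip (dom p) (rhs1 p) v + ipv (dom p) (rhs2 p) (pdeGrad p v).

Definition well_posed p : Prop :=
  (exists beta : R, 0 < beta /\
     (beta%:E <= inf_sup (dom p) (form p) (H10 (dom p)))%E) /\
  forall ell, Hminus1 (dom p) ell ->
    (exists2 w, H10 (dom p) w & forall v, H10 (dom p) v -> form p w v = ell v) /\
    (forall w w', H10 (dom p) w -> H10 (dom p) w' ->
       (forall v, H10 (dom p) v -> form p w v = ell v) ->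
       (forall v, H10 (dom p) v -> form p w' v = ell v) ->
       ae_on (dom p) (fun x => w x = w' x)).

Definition weak_solution p u : Prop :=
  H10 (dom p) u /\ forall v, H10 (dom p) v -> form p u v = load p v.

Definition flux p u : V -> V :=
  fun x => rhs2 p x - mxact (coefA p x) (pdeGrad p u x).

Definition lsB p (gamma : R) tau v : V -> R := fun x =>
  gamma * dot (coefb p x) (pdeGrad p v x)
  - (1 - gamma) * dot (coefb p x) (mxact (invmx (coefA p x)) (tau x))
  + coefc p x * v x.

Definition lsg p (gamma : R) : V -> R := fun x =>
  rhs1 p x - (1 - gamma) * dot (coefb p x) (mxact (invmx (coefA p x)) (rhs2 p x)).

(* The squared least-squares residual on a subset E of the domain. *)
Definition ls_sq p (gamma : R) (E : set V) tau v : R :=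
  normL2v E (fun x =>
    mxact (invmx (mxsqrt (coefA p x))) (tau x)
    + mxact (mxsqrt (coefA p x)) (pdeGrad p v x)
    - mxact (invmx (mxsqrt (coefA p x))) (rhs2 p x)) ^+ 2
  + normL2 E (fun x =>
      wdiv (dom p) tau x + lsB p gamma tau v x - lsg p gamma x) ^+ 2.

End problem.
Arguments pde : clear implicits.

Section meshes.
Context {R : realType} {d : nat}.
Local Notation V := 'rV[R]_d.

(* A tagged simplex (x_0, ..., x_d)_g: an ordered list of vertices together with
   a type g in {0, ..., d-1} (Maubach, Traxler, Stevenson); the refinement edge
   is x_0 x_d. *)
Definition simplex := (seq V * nat)%type.

Definition mesh := {fset simplex}.

Implicit Types (S : simplex) (T M : mesh) (E : set V).

Definition simplex_wf S : Prop :=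
  [/\ size S.1 = d.+1, (S.2 < d)%N &
      row_free (\matrix_(i < d) (S.1`_i.+1 - S.1`_0))].

Definition hull (s : seq V) : set V :=
  [set \sum_(i < size s) w i *: s`_i |
    w in [set w : nat -> R | (forall i, 0 <= w i) /\ \sum_(i < size s) w i = 1]].

(* Integrals over a simplex are taken over its interior, which is contained in
   the domain and differs from the closed simplex by a null set. *)
Definition elt S : set V := (hull S.1)°.

Definition vol S : R := fine (lebesgue_rV d (elt S)).

Definition triangulation E T : Prop :=
  [/\ forall S, S \in T -> simplex_wf S,
      closure E = \bigcup_(S in [set` T]) hull S.1,
      forall S S', S \in T -> S' \in T -> perm_eq S.1 S'.1 -> S = S' &
      forall S S', S \in T -> S' \in T ->
        hull S.1 `&` hull S'.1 = hull [seq x <- S.1 | x \in S'.1]].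

(* Newest vertex bisection in dimension d: with m the midpoint of x_0 x_d, the
   children of (x_0, ..., x_d)_g are
     (x_0, m, x_1, ..., x_g, x_(g+1), ..., x_(d-1))_(g+1 mod d)   and
     (x_d, m, x_1, ..., x_g, x_(d-1), ..., x_(g+1))_(g+1 mod d). *)
Definition midpoint S : V := 2^-1 *: (S.1`_0 + S.1`_d).

Definition middle S : seq V := behead (take d S.1).

Definition child1 S : simplex :=
  ([:: S.1`_0, midpoint S & middle S], (S.2.+1 %% d)%N).

Definition child2 S : simplex :=
  ([:: S.1`_d, midpoint S & take S.2 (middle S) ++ rev (drop S.2 (middle S))],
   (S.2.+1 %% d)%N).

Definition bisect T S : mesh := (T `\ S `|` [fset child1 S; child2 S])%fset.

Inductive bisections T : mesh -> Prop :=
| bisections0 : bisections T T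
| bisectionsS T' S : bisections T T' -> S \in T' -> bisections T (bisect T' S).

(* T' = refine(T, M): the coarsest conforming triangulation obtained from T by
   finitely many bisections in which all elements of M have been bisected. *)
Definition is_refine E T M T' : Prop :=
  let fine_enough T'' :=
    [/\ bisections T T'', triangulation E T'' & (M `&` T'' = fset0)%fset] in
  fine_enough T' /\ forall T'', fine_enough T'' -> bisections T' T''.

Inductive refines E T : mesh -> Prop :=
| refines0 : refines E T T
| refinesS T' M T'' : refines E T T' -> (M `<=` T')%fset ->
    is_refine E T' M T'' -> refines E T T''.

(* Defined off the null set of element boundaries. *)
Definition meshsize T (x : V) : R :=
  \sum_(S <- T) vol S `^ (d%:R^-1) * \1_(elt S) x.

Definition R1 E T0 : Prop := exists q : R, 0 < q < 1 /\
  forall T T', refines E T0 T -> refines E T T' ->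
    ae_on E (fun x => meshsize T' x <= meshsize T x) /\
    forall S, S \in (T `\` T')%fset ->
      ae_on (elt S) (fun x => meshsize T' x <= q * meshsize T x).

Definition R2 E T0 : Prop := exists kappa : R, 0 < kappa /\
  forall T S, refines E T0 T -> S \in T -> diam (hull S.1) ^+ d <= kappa * vol S.

Definition R3 E T0 : Prop := forall T M T', refines E T0 T -> (M `<=` T)%fset ->
  is_refine E T M T' -> (M `&` T' = fset0)%fset.

End meshes.
Arguments mesh : clear implicits.

Section adaptive.
Context {R : realType} {d : nat}.
Local Notation V := 'rV[R]_d.
Implicit Types (p : pde R d) (T : mesh R d) (S : @simplex R d).

Definition P1 p T (v : V -> R) : Prop :=
  H10 (dom p) v /\ forall S, S \in T ->
    exists (a : V) (k : R), ae_on (elt S) (fun x => v x = dot a x + k).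

Definition RT0 p T (tau : V -> V) : Prop :=
  Hdiv (dom p) tau /\ forall S, S \in T ->
    exists (a : V) (k : R), ae_on (elt S) (fun x => tau x = a + k *: x).

Definition is_hfix p T0 (hfix : R) : Prop := 0 < hfix /\
  (ae_on (dom p) (fun x => meshsize T0 x < hfix) ->
   exists beta0 : R, 0 < beta0 /\ forall T, refines (dom p) T0 T ->
     (beta0%:E <= inf_sup (dom p) (form p) (P1 p T))%E).

Definition eta_elt p (gamma : R) tau v S : R :=
  Num.sqrt (ls_sq p gamma (elt S) tau v).

Definition eta p (gamma : R) T tau v : R :=
  Num.sqrt (\sum_(S <- T) eta_elt p gamma tau v S ^+ 2).

Definition galerkin p T (uc : V -> R) : Prop :=
  P1 p T uc /\ forall v, P1 p T v -> form p uc v = load p v.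

Definition ls_recovery p (gamma : R) T uc (sr : V -> V) : Prop :=
  RT0 p T sr /\ forall tau, RT0 p T tau ->
    ls_sq p gamma (dom p) sr uc <= ls_sq p gamma (dom p) tau uc.

Definition adaptive_run p (gamma : R) T0 (T M : nat -> mesh R d)
    (sr : nat -> V -> V) (uc : nat -> V -> R) : Prop :=
  T 0%N = T0 /\ forall l,
  [/\ galerkin p (T l) (uc l), ls_recovery p gamma (T l) (uc l) (sr l),
      (M l `<=` T l)%fset & is_refine (dom p) (T l) (M l) (T l.+1)].

Definition marking p (gamma : R) (T M : nat -> mesh R d)
    (sr : nat -> V -> V) (uc : nat -> V -> R) : Prop :=
  exists G : R -> R,
  [/\ forall t, 0 <= t -> 0 <= G t, G t @[t --> 0^'+] --> G 0, G 0 = 0 &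
      forall l,
        \big[Num.max/0]_(S <- (T l `\` M l)%fset) eta_elt p gamma (sr l) (uc l) S
        <= G (\big[Num.max/0]_(S <- M l) eta_elt p gamma (sr l) (uc l) S)].

End adaptive.

(* Main.v *)
(* The first component of the residual r_l of the least-squares functional at (sr_l, uc_l),
   weighted with A^-1, is z_l = sr_l + A grad uc_l - f2, the second one is
   rho_l = div sr_l + B(sr_l, uc_l) - g; with L tau = (tau, div tau - (1 - gamma) b.A^-1 tau),
   minimality says that r_l is orthogonal to L tau for all tau in RT0(T_l).

   Quasi-optimality on nested spaces makes (uc_l) a Cauchy sequence in H1, hence (r_l) a Cauchy
   sequence in L2, with a limit r.  Every marked element S lowers the integral of the mesh size by
   at least (1 - q) |S|^(1 + 1/d), so the marked elements shrink and their indicators tend to zero;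
   by (M) all indicators tend to zero.  Thus r vanishes on elements that are never refined, and
   the mesh size tends to zero almost everywhere else.

   Testing with nodal interpolants I_l phi of test functions gives
   a(u - uc_l, phi) -> 0: where r does not vanish, grad I_l phi converges to grad phi, and
   shape regularity provides the domination.  The inf-sup condition then yields uc_l -> u.
   In the same way, r is orthogonal to L tau for all smooth tau, through a Raviart-Thomas
   field built from scalar interpolants.  This says that the extension of the second component of
   r by zero is weakly differentiable on the whole space; on a Lipschitz domain such a function is
   a limit of test functions, so the orthogonality extends to all tau in Hdiv.  Since
   r_l = L(sr_l - sigma) + o(1), r is orthogonal to itself, so r = 0. *)

From HB Require Import structures.
Require Import Defs.
From mathcomp Require Import all_boot all_order all_algebra finmap.
From mathcomp Require Import all_classical all_reals all_analysis.
From mathcomp Require Import ring lra.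
From mathcomp Require Import measurable_realfun.
From mathcomp Require spectral sesquilinear complex.
Set Implicit Arguments.
Unset Strict Implicit.
Unset Printing Implicit Defensive.
Import Order.TTheory GRing.Theory Num.Theory.
Import numFieldNormedType.Exports.
Local Open Scope classical_set_scope.
Local Open Scope ring_scope.

(** * Lebesgue measure on row vectors *)

Section lebesgue_rV_theory.
Context {R : realType}.
Local Notation leb := (@lebesgue_rV R).

(** Only the residual receives a limit, and completeness of L2 is the only completeness used; [uc]
    and [sr] are not given limits of their own before the exact solution is reached. Three obstacles
    shape the rest. The square root of [A] is chosen pointwise and comes without measurability, so
    the functional is rewritten with the weight [A^-1], whose entries are rational in those of [A].
    There is no trace theory: a zero trace is expressed by testing the zero extension with functions
    that need not vanish at the boundary, and the Lipschitz charts push supports inward before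
    mollification. There are no facet integrals: one nodal interpolation operator serves both
    discrete spaces, and its integration by parts holds because its product with a C1 function is
    globally Lipschitz, a case settled by difference quotients and translation invariance. Likewise,
    the nullity of element boundaries and the bounds of barycentric gradients come from counting
    disjoint translates in place of a change of variables. *)

Lemma lebesgue_measure_shift (t : R) (A : set (measurableTypeR R)) :
  measurable A ->
  lebesgue_measure ((fun x : R => x + t) @^-1` A) = lebesgue_measure A.
Proof.
move=> mA.
have mf : measurable_fun setT ((fun x : R => x + t) : measurableTypeR R -> measurableTypeR R).
  by apply: measurable_funD.
rewrite -[LHS]/(pushforward lebesgue_measure (fun x : R => x + t) A).
pose f := (fun x : R => x + t) : measurableTypeR R -> measurableTypeR R.
pose fm : {mfun measurableTypeR R >-> measurableTypeR R} := HB.pack f (isMeasurableFun.Build _ _ _ _ _ mf).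
apply/esym; apply: (@lebesgue_measure_unique _ (pushforward lebesgue_measure fm)) => // _ [[a b]] _ <-.
transitivity (lebesgue_measure [set` `](a - t), (b - t)]]).
  by rewrite !lebesgue_measure_itv/= !lte_fin ltrD2r; case: ifPn => // _; rewrite -!EFinD; congr EFin; ring.
congr (lebesgue_measure _).
by apply/seteqP; split => x /=; rewrite !in_itv/= /f ltrBlDr lerBrDr.
Qed.

(** For [r <= 0] the ball is empty, whereas in dimension 0 the right-hand side is the whole space;
    hence the positivity. *)
Lemma rV_ball (n : nat) (x : 'rV[R]_n) (r : R) : 0 < r ->
  ball x r = [set y | forall i, ball (x 0 i) r (y 0 i)].
Proof.
move=> r0; apply/seteqP; split => [y [_ xy] i|y xy]; first exact: xy.
by split => // i j; rewrite ord1.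
Qed.

Lemma measurable_rV_ball (n : nat) (x : 'rV[R]_n) (r : R) : measurable (ball x r).
Proof.
have [r0|r0] := ltP 0 r; last first.
  rewrite (_ : ball x r = set0)//.
  by apply/seteqP; split => // y [] /lt_geF; rewrite r0.
rewrite rV_ball//.
rewrite [X in measurable X](_ : _ = \big[setI/setT]_(i < n) (@rV_coord R n i @^-1` (ball (x 0 i) r))).
  apply: bigsetI_measurable => i _.
  rewrite -[X in measurable X]setTI; apply: (measurable_rV_coord i) => //.
  exact: measurable_ball.
rewrite -bigcap_seq; apply/seteqP; split => [y xy i _|y xy i]; first exact: xy.
by apply: (xy i) => /=; rewrite mem_index_enum.
Qed.

Definition rat_rV n : {ffun 'I_n -> rat} -> 'rV[R]_n := fun q => \row_i ratr (q i).

Lemma dense_rat_rV n (x : 'rV[R]_n) (e : R) : 0 < e -> exists q, ball x e (rat_rV q).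
Proof.
move=> e0.
have h i : exists q : rat, `|x 0 i - ratr q| < e.
  have := @dense_rat R (ball (x 0 i) e).
  case; [by exists (x 0 i); exact: ballxx|exact: ball_open|].
  by move=> y [/= xq [q _ qE]]; exists q; rewrite -qE in xq; exact: xq.
move: h => /choice[q hq]; exists [ffun i => q i].
by rewrite rV_ball// => i /=; rewrite mxE ffunE; exact: hq.
Qed.

(** The sigma-algebra is generated by the coordinates and not by the topology, so an open set is
    exhausted by countably many balls of the sup norm, which are boxes, with rational centres and
    radii [1/(k+1)]. *)
Lemma open_measurable_rV n (A : set 'rV[R]_n) : open A -> measurable A.
Proof.
move=> oA.
pose F (p : {ffun 'I_n -> rat} * nat) : set 'rV[R]_n :=
  if `[< ball (rat_rV p.1) (p.2.+1%:R^-1) `<=` A >] then ball (rat_rV p.1) (p.2.+1%:R^-1) else set0.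
pose G k := oapp F set0 (choice.unpickle k).
rewrite (_ : A = \bigcup_k G k).
  apply: bigcupT_measurable => k; rewrite /G; case: choice.unpickle => [p|]; last exact: measurable0.
  by rewrite /F /=; case: ifP => _; [exact: measurable_rV_ball|exact: measurable0].
apply/seteqP; split => [x Ax|x [k _]]; last first.
  rewrite /G; case: choice.unpickle => // p.
  by rewrite /= /F; case: asboolP => // h /h.
have /nbhs_ballP[e /= e0 eA] : nbhs x A by exact: open_nbhs_nbhs.
(* A ball of radius below [e/2] that contains [x] lies in the ball of radius [e] around [x]. *)
have [n0 n0e] : exists k : nat, k.+1%:R^-1 < e / 2.
  have e20 : 0 < e / 2 by rewrite divr_gt0.
  have /filter_ex[k hk] := near_infty_natSinv_lt (PosNum e20).
  by exists k.
have k0 : 0 < n0.+1%:R^-1 :> R by rewrite invr_gt0.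
have [q hq] := dense_rat_rV x k0.
exists (choice.pickle (q, n0)) => //; rewrite /G choice.pickleK /F /=; case: asboolP => [_|]; first exact: ball_sym.
case=> y hy; apply: eA.
rewrite (splitr e); apply: ball_triangle (le_ball (ltW n0e) hy).
exact: (le_ball (ltW n0e)).
Qed.

Lemma closed_measurable_rV n (A : set 'rV[R]_n) : closed A -> measurable A.
Proof.
by move=> /closed_openC/open_measurable_rV/measurableC; rewrite setCK.
Qed.

Lemma continuous_measurable_rV n (f : 'rV[R]_n -> R) :
  continuous f -> measurable_fun setT f.
Proof.
move=> /continuousP cf; apply: (measurability _ (RGenOpens.measurableE R)).
move=> _ [_ [a [b ->] <-]]; rewrite setTI; apply: open_measurable_rV.
exact/cf/interval_open.
Qed.

Lemma measurable_shift_rV n (t : 'rV[R]_n) :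
  measurable_fun setT (fun x : 'rV[R]_n => x + t).
Proof.
apply: measurable_rV => i.
rewrite (_ : _ \o _ = fun x : 'rV[R]_n => rV_coord i x + t 0 i); last first.
  by apply/funext => x; rewrite /rV_coord /= mxE.
by apply: measurable_funD; [exact: measurable_rV_coord|exact: measurable_cst].
Qed.

(** Induction on the dimension: the shift acts separately on the first coordinate and on the others,
    so the shifted product measure has the right values on rectangles, and these determine it. *)
Lemma lebesgue_rV_shift n (t : 'rV[R]_n) A : measurable A ->
  leb n ((fun x : 'rV[R]_n => x + t) @^-1` A) = leb n A.
Proof.
elim: n => [|n IH] in t A *.
  by move=> mA; congr (leb 0 _); apply/funext => x /=; rewrite (thinmx0 (x + t)) (thinmx0 x).
move=> mA.
pose t0 := t 0 ord0; pose t' := \row_i t 0 (lift ord0 i).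
pose sh (q : measurableTypeR R * 'rV[R]_n) : measurableTypeR R * 'rV[R]_n := (q.1 + t0, q.2 + t').
have msh : measurable_fun setT sh.
  apply/measurable_fun_pairP; split.
    rewrite (_ : _ \o _ = fun q : measurableTypeR R * 'rV[R]_n => q.1 + t0)//.
    by apply: measurable_funD => //; exact: measurable_fst.
  rewrite (_ : _ \o _ = (fun x : 'rV[R]_n => x + t') \o snd)//.
  by apply: measurableT_comp; [exact: measurable_shift_rV|exact: measurable_snd].
pose shm : {mfun _ >-> _} := HB.pack sh (isMeasurableFun.Build _ _ _ _ _ msh).
have shE q : rV_cons (sh q) = rV_cons q + t.
  apply/rowP => i; rewrite [RHS]mxE.
  by case: (unliftP ord0 i) => [j|] ->; rewrite ?rV_cons0 ?rV_consS// !mxE.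
have mc : measurable (@rV_cons R n @^-1` A).
  by rewrite -[X in measurable X]setTI; exact: measurable_rV_cons.
rewrite /= /rV_step /pushforward; apply/esym.
pose prodm : {measure set (measurableTypeR R * 'rV[R]_n) -> \bar R} :=
   (@lebesgue_measure R \x leb n)%E.
rewrite (@product_measure_unique _ _ _ _ _ (@lebesgue_measure R) (leb n) (pushforward prodm shm))//.
  by rewrite /pushforward; congr (prodm _); apply/seteqP; split => q /=; rewrite shE.
move=> X Y mX mY; rewrite /pushforward/=.
rewrite -[LHS]/(prodm (sh @^-1` (X `*` Y))).
rewrite (_ : sh @^-1` _ = ((fun x : R => x + t0) @^-1` X) `*` ((fun x : 'rV[R]_n => x + t') @^-1` Y)); last first.
  by apply/seteqP; split.
transitivity (lebesgue_measure ((fun x : R => (x + t0)%R) @^-1` X) *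
    leb n ((fun x : 'rV[R]_n => (x + t')%R) @^-1` Y))%E; first apply: product_measure1E.
- rewrite -[X in measurable X]setTI.
  have : measurable_fun setT (fun x : measurableTypeR R => (x + t0 : measurableTypeR R)) by apply: measurable_funD.
  exact.
- by rewrite -[X in measurable X]setTI; exact: measurable_shift_rV.
by congr (_ * _)%E; [exact: lebesgue_measure_shift|exact: IH].
Qed.

Lemma ge0_integral_shift n (t : 'rV[R]_n) (f : 'rV[R]_n -> \bar R) :
  measurable_fun setT f -> (forall x, 0 <= f x)%E ->
  (\int[leb n]_x f ((x : 'rV[R]_n) + t)%R = \int[leb n]_x f x)%E.
Proof.
move=> mf f0.
pose g := fun x : 'rV[R]_n => x + t.
pose gm : {mfun _ >-> _} := HB.pack g (isMeasurableFun.Build _ _ _ _ _ (measurable_shift_rV t)).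
have := @ge0_integral_pushforward _ _ _ _ R g (measurable_shift_rV t) (leb n) setT f measurableT mf (fun y _ => f0 y).
rewrite preimage_setT => /esym E.
rewrite -[LHS]/(\int[leb n]_x (f \o g) x)%E E.
apply: (@eq_measure_integral _ _ _ setT (leb n) (pushforward (leb n) gm)) => A mA _.
exact: lebesgue_rV_shift.
Qed.

Lemma integrable_shift n (t : 'rV[R]_n) (f : 'rV[R]_n -> \bar R) :
  (leb n).-integrable setT f -> (leb n).-integrable setT (fun x : 'rV[R]_n => f (x + t)).
Proof.
move=> /integrableP[mf fi]; apply/integrableP; split.
  exact: (measurableT_comp mf (measurable_shift_rV t)).
rewrite (ge0_integral_shift t (f := fun x => `|f x|%E))//.
exact: measurableT_comp.
Qed.

Lemma Rintegral_shift n (t : 'rV[R]_n) (f : 'rV[R]_n -> R) :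
  (leb n).-integrable setT (EFin \o f) ->
  \int[leb n]_x f ((x : 'rV[R]_n) + t)%R = \int[leb n]_x f x.
Proof.
move=> fi; rewrite /Rintegral; congr fine.
rewrite integralE [in RHS]integralE.
have mf := measurable_int _ fi.
congr (_ - _)%E.
  rewrite -[RHS](ge0_integral_shift t (measurable_funepos mf) (funepos_ge0 _)).
  by apply: eq_integral => x _; rewrite !funeposE.
rewrite -[RHS](ge0_integral_shift t (measurable_funeneg mf) (funeneg_ge0 _)).
  by apply: eq_integral => x _; rewrite !funenegE.
Qed.

Definition box n (a b : 'I_n -> R) : set 'rV[R]_n :=
  [set x | forall i, `]a i, b i]%classic (x 0 i)].

Lemma measurable_box n (a b : 'I_n -> R) : measurable (box a b).
Proof.
rewrite [X in measurable X](_ : _ = \big[setI/setT]_(i < n) (@rV_coord R n i @^-1` `]a i, b i]%classic)).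
  apply: bigsetI_measurable => i _.
  by rewrite -[X in measurable X]setTI; apply: (measurable_rV_coord i).
rewrite -bigcap_seq; apply/seteqP; split => [y xy i _|y xy i]; first exact: xy.
by apply: (xy i) => /=; rewrite mem_index_enum.
Qed.

Lemma lebesgue_box n (a b : 'I_n -> R) : (forall i, a i <= b i) ->
  leb n (box a b) = (\prod_i (b i - a i))%:E.
Proof.
elim: n => [|n IH] in a b *.
  by move=> _; rewrite big_ord0 /= diracE mem_set// => -[].
move=> ab; rewrite /= /rV_step /pushforward.
rewrite (_ : _ @^-1` _ = `]a ord0, b ord0]%classic `*`
   box (fun i => a (lift ord0 i)) (fun i => b (lift ord0 i))); last first.
  apply/seteqP; split => q /=.
    move=> h; split; first by have := h ord0; rewrite rV_cons0.
    by move=> i; have := h (lift ord0 i); rewrite rV_consS.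
  case=> h1 h2 i; case: (unliftP ord0 i) => [j|] ->; rewrite ?rV_cons0 ?rV_consS//.
rewrite product_measure1E//; last exact: measurable_box.
rewrite IH// big_ord_recl EFinM /= lebesgue_measure_itv /= lte_fin.
case: ltP => // ba; have/eqP -> : b ord0 == a ord0 by rewrite eq_le ba ab.
by rewrite subrr.
Qed.

Definition cube n (M : R) : set 'rV[R]_n := box (fun _ => - M) (fun _ => M).

Lemma rV_norm_le n (x : 'rV[R]_n) (M : R) : 0 <= M ->
  (`|x| <= M) <-> (forall i, `|x 0 i| <= M).
Proof.
move=> M0; split=> [xM i|h].
  apply: le_trans xM.
  rewrite [X in _ <= X]mx_normrE.
  by apply: (le_trans _ (le_bigmax _ _ (0, i))).
rewrite [X in X <= _]mx_normrE; apply: bigmax_le => // -[i j] _ /=.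
by rewrite ord1.
Qed.

Lemma bounded_lebesgue n (A : set 'rV[R]_n) : measurable A -> bounded_set A ->
  (leb n A < +oo)%E.
Proof.
move=> mA [M [_ hM]].
pose M1 := `|M| + 1.
have M1M : M < M1 by rewrite (le_lt_trans (ler_norm M))// ltrDl.
have M10 : 0 <= M1 by rewrite addr_ge0.
have h : (leb n A <= leb n (@cube n (M1 + 1)))%E.
  apply: le_measure; rewrite ?inE//; first exact: measurable_box.
  move=> x Ax i /=; rewrite in_itv /=.
  have /(rV_norm_le x M10)/(_ i) := hM _ M1M _ Ax.
  by rewrite ler_norml => /andP[? ?]; apply/andP; split; lra.
by apply: (le_lt_trans h); rewrite lebesgue_box ?ltry// => i; lra.
Qed.

End lebesgue_rV_theory.

(** * Galerkin and least-squares sequences *)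

Section semi_inner_product.
Context {R : realType} {X : lmodType R}.

Definition subspace (D : X -> Prop) :=
  D 0 /\ forall (a : R) x y, D x -> D y -> D (a *: x + y).

(** Only semidefinite, because functions that agree almost everywhere are not identified; the laws
    are relative to [D], because integrals of products are additive only on integrable functions. *)
Record semi_ip (D : X -> Prop) (s : X -> X -> R) : Prop := SemiIP {
  sip_sub : subspace D;
  sip_lin : forall a x y z, D x -> D y -> D z -> s (a *: x + y) z = a * s x z + s y z;
  sip_sym : forall x y, D x -> D y -> s x y = s y x;
  sip_ge0 : forall x, D x -> 0 <= s x x }.

Definition sip_norm (s : X -> X -> R) x := Num.sqrt (s x x).

Lemma subspaceD D x y : subspace D -> D x -> D y -> D (x + y).
Proof. by move=> [_ h] Dx Dy; have := h 1 _ _ Dx Dy; rewrite scale1r. Qed.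

Lemma subspaceZ D (a : R) x : subspace D -> D x -> D (a *: x).
Proof. by move=> [D0 h] Dx; have := h a _ _ Dx D0; rewrite addr0. Qed.

Lemma subspaceB D x y : subspace D -> D x -> D y -> D (x - y).
Proof.
by move=> sD Dx Dy; apply: subspaceD => //; rewrite -scaleN1r; exact: subspaceZ.
Qed.

Section theory.
Variables (D : X -> Prop) (s : X -> X -> R).
Hypothesis sp : semi_ip D s.
Local Notation nrm := (sip_norm s).
Let sD := sip_sub sp.

Lemma sip0l z : D z -> s 0 z = 0.
Proof.
move=> Dz; have := sip_lin sp (-1) (sD.1) (sD.1) Dz.
by rewrite scaler0 addr0 mulN1r addNr.
Qed.

Lemma sipDl x y z : D x -> D y -> D z -> s (x + y) z = s x z + s y z.
Proof. by move=> Dx Dy Dz; rewrite -[x in LHS]scale1r (sip_lin sp)// mul1r. Qed.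

Lemma sipZl a x z : D x -> D z -> s (a *: x) z = a * s x z.
Proof. by move=> Dx Dz; rewrite -[_ *: _]addr0 (sip_lin sp) ?sip0l ?addr0//; exact: sD.1. Qed.

Lemma sipBl x y z : D x -> D y -> D z -> s (x - y) z = s x z - s y z.
Proof.
move=> Dx Dy Dz; rewrite -scaleN1r sipDl ?sipZl ?mulN1r//; exact: subspaceZ.
Qed.

Lemma sipDr x y z : D x -> D y -> D z -> s z (x + y) = s z x + s z y.
Proof.
move=> Dx Dy Dz; rewrite (sip_sym sp) ?sipDl//; last exact: subspaceD.
by rewrite (sip_sym sp Dx)// (sip_sym sp Dy).
Qed.

Lemma sipBr x y z : D x -> D y -> D z -> s z (x - y) = s z x - s z y.
Proof.
move=> Dx Dy Dz; rewrite (sip_sym sp) ?sipBl//; last exact: subspaceB.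
by rewrite (sip_sym sp Dx)// (sip_sym sp Dy).
Qed.

Lemma sipZr a x z : D x -> D z -> s z (a *: x) = a * s z x.
Proof.
by move=> Dx Dz; rewrite (sip_sym sp) ?sipZl// 1?(sip_sym sp Dx)//; exact: subspaceZ.
Qed.

Lemma sip_norm_ge0 x : 0 <= nrm x. Proof. exact: sqrtr_ge0. Qed.

Lemma sip_norm_sq x : D x -> nrm x ^+ 2 = s x x.
Proof. by move=> Dx; rewrite sqr_sqrtr// (sip_ge0 sp). Qed.

Lemma sip_sqD x y : D x -> D y -> s (x + y) (x + y) = s x x + 2 * s x y + s y y.
Proof.
move=> Dx Dy; have Dxy := subspaceD sD Dx Dy.
rewrite sipDl// !sipDr// (sip_sym sp Dy Dx); ring.
Qed.

Lemma sip_sqB x y : D x -> D y -> s (x - y) (x - y) = s x x - 2 * s x y + s y y.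
Proof.
move=> Dx Dy; have Dxy := subspaceB sD Dx Dy.
rewrite sipBl// !sipBr// (sip_sym sp Dy Dx); ring.
Qed.

Lemma sip_CS x y : D x -> D y -> `|s x y| <= nrm x * nrm y.
Proof.
move=> Dx Dy.
have key t : 0 <= s x x * t ^+ 2 + 2 * s x y * t + s y y.
  have := sip_ge0 sp (subspaceD sD (subspaceZ t sD Dx) Dy).
  rewrite sip_sqD//; last exact: subspaceZ.
  rewrite !sipZl ?sipZr//; last exact: subspaceZ.
  by congr (0 <= _); ring.
have x0 := sip_ge0 sp Dx; have y0 := sip_ge0 sp Dy.
rewrite -sqrtrM// -sqrtr_sqr ler_wsqrtr//.
have [sx0|sx0] := eqVneq (s x x) 0; last first.
  have {}sx0 : 0 < s x x by rewrite lt_neqAle eq_sym sx0.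
  have := key (- s x y / s x x).
  rewrite (_ : _ + s y y = (s x x * s y y - s x y ^+ 2) / s x x); last by field; rewrite gt_eqF.
  by rewrite pmulr_lge0 ?invr_gt0// subr_ge0.
have [sxy0|sxy0] := eqVneq (s x y) 0; first by rewrite sxy0 expr0n/= mulr_ge0.
(* If [s x x = 0], the nonnegative quadratic [key] is affine in [t], and this [t] would give it the
   value -1. *)
exfalso; have := key (- (s y y + 1) / (2 * s x y)); rewrite sx0 mul0r add0r.
rewrite (_ : _ + s y y = -1); last by field.
by rewrite oppr_ge0 ler10.
Qed.

Lemma sip_CS_le x y : D x -> D y -> s x y <= nrm x * nrm y.
Proof. by move=> Dx Dy; apply: le_trans (sip_CS Dx Dy); exact: ler_norm. Qed.

Lemma sip_normZ a x : D x -> nrm (a *: x) = `|a| * nrm x.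
Proof.
move=> Dx; rewrite /nrm sipZl// ?sipZr//; last exact: subspaceZ.
by rewrite mulrA -expr2 sqrtrM ?sqr_ge0// sqrtr_sqr.
Qed.

Lemma sip_normN x : D x -> nrm (- x) = nrm x.
Proof. by move=> Dx; rewrite -scaleN1r sip_normZ// normrN1 mul1r. Qed.

Lemma sip_norm0 : nrm 0 = 0.
Proof. by rewrite /nrm sip0l ?sqrtr0//; exact: sD.1. Qed.

Lemma sip_triangle x y : D x -> D y -> nrm (x + y) <= nrm x + nrm y.
Proof.
move=> Dx Dy; rewrite -(@ler_pXn2r _ 2)// ?nnegrE ?addr_ge0 ?sip_norm_ge0//.
rewrite sip_norm_sq; last exact: subspaceD.
rewrite sip_sqD// sqrrD !sip_norm_sq// lerD2r lerD2l -mulr_natl.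
by have := sip_CS_le Dx Dy; lra.
Qed.

Lemma sip_triangleB x y : D x -> D y -> nrm (x - y) <= nrm x + nrm y.
Proof.
move=> Dx Dy; rewrite -(sip_normN Dy); apply: sip_triangle => //.
by rewrite -scaleN1r; exact: subspaceZ.
Qed.

Lemma sip_normBC x y : D x -> D y -> nrm (x - y) = nrm (y - x).
Proof. by move=> Dx Dy; rewrite -opprB sip_normN//; exact: subspaceB. Qed.

Lemma sip_triangle3 y x z : D x -> D y -> D z -> nrm (x - z) <= nrm (x - y) + nrm (y - z).
Proof.
move=> Dx Dy Dz; rewrite (_ : x - z = (x - y) + (y - z)); last by rewrite addrA subrK.
by apply: sip_triangle; exact: subspaceB.
Qed.

Lemma sip_parallelogram x y : D x -> D y ->
  s (x - y) (x - y) = 2 * s x x + 2 * s y y - 4 * s (2^-1 *: (x + y)) (2^-1 *: (x + y)).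
Proof.
move=> Dx Dy; have Dxy := subspaceD sD Dx Dy.
rewrite sipZl ?sipZr//; last exact: subspaceZ.
by rewrite sip_sqB// sip_sqD//; field.
Qed.

Section galerkin.
Variables (V : nat -> X -> Prop) (a : X -> X -> R) (f : X -> R) (u : nat -> X).
Variables (C beta Cf : R).
Hypotheses (sV : forall n, subspace (V n)) (VD : forall n x, V n x -> D x).
Hypothesis ndV : forall n m x, (n <= m)%N -> V n x -> V m x.
Hypothesis a_linl : forall k x y z, D x -> D y -> D z -> a (k *: x + y) z = k * a x z + a y z.
Hypothesis a_bnd : forall x y, D x -> D y -> a x y <= C * nrm x * nrm y.
Hypothesis f_bnd : forall x, D x -> f x <= Cf * nrm x.
Hypothesis b0 : 0 < beta.
Hypothesis infsup : forall n w, V n w -> nrm w != 0 ->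
  exists2 v, V n v & nrm v != 0 /\ beta * nrm w * nrm v <= a w v.
Hypothesis uV : forall n, V n (u n).
Hypothesis ugal : forall n v, V n v -> a (u n) v = f v.

(* Any element of the midpoint hull of a tail satisfies the Galerkin equations
   of that tail, and near-minimal elements form a Cauchy sequence: this replaces
   the weak limit of [u] without using completeness. *)
Inductive mid_hull (n : nat) : X -> Prop :=
| mid_base m : (n <= m)%N -> mid_hull n (u m)
| mid_half x y : mid_hull n x -> mid_hull n y -> mid_hull n (2^-1 *: (x + y)).

Let mid_D n x : mid_hull n x -> D x.
Proof.
elim=> [m _|y z _ Dy _ Dz]; first exact: VD (uV m).
by apply: subspaceZ => //; exact: subspaceD.
Qed.

Let mid_le n m x : (n <= m)%N -> mid_hull m x -> mid_hull n x.
Proof.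
move=> nm; elim=> [k mk|y z _ hy _ hz]; last exact: mid_half.
by apply: mid_base; exact: leq_trans mk.
Qed.

Let mid_V n x : mid_hull n x -> exists k, V k x.
Proof.
elim=> [m _|y z _ [k hy] _ [l hz]]; first by exists m.
exists (maxn k l); apply: subspaceZ => //; apply: subspaceD => //.
  by apply: ndV hy; exact: leq_maxl.
by apply: ndV hz; exact: leq_maxr.
Qed.

Let aDl x y z : D x -> D y -> D z -> a (x + y) z = a x z + a y z.
Proof. by move=> Dx Dy Dz; rewrite -[x in LHS]scale1r a_linl// mul1r. Qed.

Let aBl x y z : D x -> D y -> D z -> a (x - y) z = a x z - a y z.
Proof. by move=> Dx Dy Dz; rewrite addrC -scaleN1r a_linl// mulN1r addrC. Qed.

Let aZl k x z : D x -> D z -> a (k *: x) z = k * a x z.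
Proof.
move=> Dx Dz; have a0 : a 0 z = 0.
  by have := aBl (sD.1) (sD.1) Dz; rewrite !subrr.
by rewrite -[_ *: _]addr0 a_linl ?a0 ?addr0//; exact: sD.1.
Qed.

Let mid_gal n x v : mid_hull n x -> V n v -> a x v = f v.
Proof.
move=> hx Vv; elim: hx => [m nm|y z hy IHy hz IHz].
  by apply: ugal; exact: ndV Vv.
have [Dy Dz Dv] := And3 (mid_D hy) (mid_D hz) (VD Vv).
rewrite aZl ?aDl ?IHy ?IHz//; first by field.
exact: subspaceD.
Qed.

Let u_bnd n : nrm (u n) <= `|Cf| / beta.
Proof.
have [->|un0] := eqVneq (nrm (u n)) 0; first by rewrite divr_ge0// ltW.
have [v Vv [v0]] := infsup (uV n) un0.
rewrite ugal// => h; have {}v0 : 0 < nrm v by rewrite lt_neqAle eq_sym v0 sip_norm_ge0.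
rewrite ler_pdivlMr// -(ler_pM2r v0) [nrm _ * _]mulrC (le_trans h)//.
by rewrite (le_trans (f_bnd (VD Vv)))// ler_pM2r// ler_norm.
Qed.

Let B := (`|Cf| / beta) ^+ 2.
Let S n := [set s x x | x in mid_hull n].

Let S_has_inf n : has_inf (S n).
Proof.
split; first by exists (s (u n) (u n)); exists (u n) => //; exact: mid_base.
by exists 0 => _ [x hx <-]; apply: (sip_ge0 sp); exact: mid_D hx.
Qed.

Let m n := inf (S n).

Let m_le n x : mid_hull n x -> m n <= s x x.
Proof. by move=> hx; apply: ge_inf; [exact: (S_has_inf n).2|exists x]. Qed.

Let m_nd n k : (n <= k)%N -> m n <= m k.
Proof.
move=> nk; apply: lb_le_inf; first exact: (S_has_inf k).1.
by move=> _ [x hx <-]; apply: m_le; exact: mid_le hx.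
Qed.

Let m_bnd n : m n <= B.
Proof.
apply: (le_trans (m_le (mid_base (leqnn n)))).
rewrite -sip_norm_sq; last exact: VD (uV n).
by rewrite ler_pXn2r// ?nnegrE ?sip_norm_ge0// divr_ge0// ltW.
Qed.

Let m_cauchy (e : R) : 0 < e -> exists N, forall n k, (N <= n)%N -> (n <= k)%N -> m k - m n <= e.
Proof.
move=> e0; pose M := range m.
have sM : has_sup M.
  split; first by exists (m 0%N); exists 0%N.
  by exists B => _ [n _ <-].
have [_ [N _ <-] hN] := sup_adherent e0 sM.
exists N => n k Nn nk.
have h1 : m k <= sup M by apply: ub_le_sup; [exact: sM.2|exists k].
have h2 := m_nd Nn.
lra.
Qed.

Let cP n (e : R) : 0 < e -> exists2 x, mid_hull n x & s x x <= m n + e.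
Proof. by move=> e0; have [_ [x hx <-] /ltW] := inf_adherent e0 (S_has_inf n); exists x. Qed.

(** Parallelogram law: the midpoint of [x] and [y] is again in [mid_hull n], so its square norm is
    at least the infimum [m n], and what is left is at most [2 * (m k - m n) + 4 * e]. *)
Let near_min (e : R) : 0 < e -> exists N, forall n k x y, (N <= n)%N -> (n <= k)%N ->
  mid_hull n x -> s x x <= m n + e -> mid_hull k y -> s y y <= m k + e ->
  s (x - y) (x - y) <= 6 * e.
Proof.
move=> e0; have [N hN] := m_cauchy e0; exists N => n k x y Nn nk hx xe hy ye.
rewrite sip_parallelogram; [|exact: mid_D hx|exact: mid_D hy].
have := m_le (mid_half hx (mid_le nk hy)).
have := hN _ _ Nn nk.
lra.
Qed.

(** A near-minimal [c] is fixed; it lies in some [V j], so for large [k] the inf-sup condition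
    applies to [u k - c]. There [f v] equals [a c' v] for a near-minimal [c'] of the tail [k], and
    boundedness of [a] reduces [u k - c] to [c' - c], which is small by [near_min]. *)
Lemma galerkin_cauchy (e : R) : 0 < e -> exists N, forall n k, (N <= n)%N -> (N <= k)%N ->
  nrm (u n - u k) <= e.
Proof.
move=> e0; have C0 : 0 < `|C| + 1 by rewrite ltr_pwDr.
(* Chosen so that [C * d / beta] is at most [e / 2]; [near_min] is called with [d ^+ 2 / 6] in order
   to give [nrm (c' - c) <= d]. *)
pose d := beta * (e / 2) / (`|C| + 1).
have d0 : 0 < d by rewrite !(mulr_gt0, divr_gt0, invr_gt0).
have d20 : 0 < d ^+ 2 / 6 by rewrite divr_gt0// exprn_gt0.
have [N hN] := near_min d20.
have [c hc cm] := cP N d20.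
have [j Vj] := mid_V hc.
have key k : (maxn N j <= k)%N -> nrm (u k - c) <= e / 2.
  rewrite geq_max => /andP[Nk jk].
  have [->|w0] := eqVneq (nrm (u k - c)) 0; first by rewrite ltW// divr_gt0.
  have Vw : V k (u k - c) by apply: subspaceB => //; exact: ndV Vj.
  have [v Vv [v0 hv]] := infsup Vw w0.
  have {}v0 : 0 < nrm v by rewrite lt_neqAle eq_sym v0 sip_norm_ge0.
  have [c' hc' c'm] := cP k d20.
  have Dc := mid_D hc; have Dc' := mid_D hc'; have Dv := VD Vv.
  rewrite aBl// ?ugal// -?(mid_gal hc' Vv) -?aBl// in hv; last exact: VD (uV k).
  have hd : nrm (c' - c) <= d.
    rewrite sip_normBC// -(@ler_pXn2r _ 2)// ?nnegrE ?sip_norm_ge0 ?(ltW d0)//.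
    rewrite sip_norm_sq; last exact: subspaceB.
    apply: (le_trans (hN _ _ _ _ (leqnn N) Nk hc cm hc' c'm)).
    by rewrite le_eqVlt; apply/orP; left; apply/eqP; field.
  have := le_trans hv (a_bnd (subspaceB sD Dc' Dc) Dv).
  rewrite ler_pM2r// -ler_pdivlMl// => /le_trans; apply.
  rewrite ler_pdivrMl//.
  apply: (@le_trans _ _ ((`|C| + 1) * d)).
    apply: (@le_trans _ _ ((`|C| + 1) * nrm (c' - c))); last by rewrite ler_pM2l.
    by rewrite ler_wpM2r ?sip_norm_ge0// (le_trans (ler_norm C))// lerDl.
  by rewrite /d mulrCA divff ?mulr1// gt_eqF.
exists (maxn N j) => n k hn hk.
have Dn := VD (uV n); have Dk := VD (uV k).
rewrite (le_trans (sip_triangle3 Dn (mid_D hc) Dk))//.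
rewrite (splitr e); apply: lerD; first exact: key.
by rewrite sip_normBC ?key//; exact: mid_D hc.
Qed.

End galerkin.

Section least_squares.
Variables (Q : nat -> X -> Prop) (r q dd : nat -> X).
Hypotheses (sQ : forall n, subspace (Q n)) (QD : forall n x, Q n x -> D x).
Hypothesis ndQ : forall n m x, (n <= m)%N -> Q n x -> Q m x.
Hypothesis qQ : forall n, Q n (q n).
Hypothesis Dd : forall n, D (dd n).
Hypothesis rE : forall n, r n = q n + dd n.
Hypothesis rQ : forall n x, Q n x -> s (r n) x = 0.
Hypothesis d_cauchy : forall e : R, 0 < e -> exists N, forall n k, (N <= n)%N -> (N <= k)%N ->
  nrm (dd n - dd k) <= e.

Let Dr n : D (r n).
Proof. by rewrite rE; apply: subspaceD => //; exact: QD. Qed.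

(** The vector on the left is [r m - (q m - q l)], and [r m] is orthogonal to [Q m], which contains
    [q m - q l] by nestedness. *)
Let pyth l m : (l <= m)%N -> nrm (r l + (dd m - dd l)) ^+ 2 =
  nrm (r m) ^+ 2 + nrm (q m - q l) ^+ 2.
Proof.
move=> lm; have Qe : Q m (q m - q l) by apply: subspaceB => //; exact: ndQ (qQ l).
have De := QD Qe.
have -> : r l + (dd m - dd l) = r m - (q m - q l).
  rewrite !rE opprB addrACA subrr addr0 [q m + dd m]addrC addrACA subrr addr0.
  exact: addrC.
rewrite !sip_norm_sq//; last by exact: subspaceB.
by rewrite sip_sqB// (rQ Qe) mulr0 subr0.
Qed.

(** Up to the perturbation [dd m - dd l], the norms of the [r l] are nonincreasing by [pyth]. Once
    they are close to their infimum, the same identity leaves no room for [q m - q l]. *)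
Lemma least_squares_cauchy (e : R) : 0 < e -> exists N, forall n k, (N <= n)%N -> (N <= k)%N ->
  nrm (r n - r k) <= e.
Proof.
have mono N t : (forall n k, (N <= n)%N -> (N <= k)%N -> nrm (dd n - dd k) <= t) ->
  forall l m, (N <= l)%N -> (l <= m)%N -> nrm (r m) <= nrm (r l) + t /\
    nrm (q m - q l) ^+ 2 <= (nrm (r l) + t) ^+ 2 - nrm (r m) ^+ 2.
  move=> ht l m Nl lm.
  have h : nrm (r l + (dd m - dd l)) <= nrm (r l) + t.
    apply: le_trans (sip_triangle (Dr l) (subspaceB sD (Dd m) (Dd l))) _.
    by rewrite lerD2l ht// (leq_trans Nl).
  have h2 : nrm (r l + (dd m - dd l)) ^+ 2 <= (nrm (r l) + t) ^+ 2.
    rewrite ler_pXn2r// ?nnegrE ?sip_norm_ge0//.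
    by apply: le_trans h; exact: sip_norm_ge0.
  split; last by move: h2; rewrite pyth//; lra.
  apply: le_trans h; rewrite -(@ler_pXn2r _ 2)// ?nnegrE ?sip_norm_ge0//.
  by rewrite pyth// lerDl sqr_ge0.
have [N1 hN1] := d_cauchy ltr01.
pose B := nrm (r N1) + 1.
have B0 : 0 <= B by rewrite addr_ge0// sip_norm_ge0.
have rB m : (N1 <= m)%N -> nrm (r m) <= B by move=> hm; exact: (mono _ _ hN1 _ _ (leqnn _) hm).1.
move=> e0.
(* Errors of total size [3 * t] accumulate above [inf S], and [(inf S + 3 * t) ^+ 2 - inf S ^+ 2] is
   at most [t * (6 * B + 9 * e)]. The second bound brings this below [(e / 4) ^+ 2]; the first takes
   care of [dd m - dd l]. *)
pose t := Num.min (e / 8) (e ^+ 2 / (64 * (6 * B + 9 * e))).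
have Be0 : 0 < 64 * (6 * B + 9 * e) by rewrite mulr_gt0// ltr_wpDl ?mulr_ge0// mulr_gt0.
have t0 : 0 < t by rewrite lt_min !divr_gt0// exprn_gt0.
have [N2 hN2] := d_cauchy t0.
pose N := maxn N1 N2.
have hN n k : (N <= n)%N -> (N <= k)%N -> nrm (dd n - dd k) <= t.
  by rewrite !geq_max => /andP[_ ?] /andP[_ ?]; exact: hN2.
pose S := [set nrm (r l) | l in [set l | (N <= l)%N]].
have iS : has_inf S.
  split; first by exists (nrm (r N)); exists N => /=.
  by exists 0 => _ [l _ <-]; exact: sip_norm_ge0.
have [_ [L /= NL <-] hL] := inf_adherent t0 iS.
have iSle l : (N <= l)%N -> inf S <= nrm (r l).
  by move=> hl; apply: ge_inf; [exact: iS.2|exists l].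
have i0 : 0 <= inf S by apply: lb_le_inf; [exact: iS.1|move=> _ [l _ <-]; exact: sip_norm_ge0].
have key l m : (L <= l)%N -> (l <= m)%N -> nrm (q m - q l) <= e / 4.
  move=> Ll lm; have Nl := leq_trans NL Ll; have Nm := leq_trans Nl lm.
  have [_ h] := mono _ _ hN _ _ Nl lm.
  have [h1 _] := mono _ _ hN _ _ NL Ll.
  have h2 := iSle _ Nm.
  have hB : inf S <= B.
    by apply: le_trans (iSle _ Nl) (rB _ _); move: Nl; rewrite geq_max => /andP[].
  have te : t <= e by rewrite ge_min; apply/orP; left; lra.
  have te2 : t * (6 * B + 9 * e) <= (e / 4) ^+ 2.
    have : t <= e ^+ 2 / (64 * (6 * B + 9 * e)) by rewrite ge_min lexx orbT.
    rewrite ler_pdivlMr//; have := sqr_ge0 e; rewrite expr_div_n; nra.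
  rewrite -(@ler_pXn2r _ 2)// ?nnegrE ?sip_norm_ge0 ?divr_ge0 ?(ltW e0)//.
  apply: le_trans h _; apply: le_trans te2.
  have h3 : nrm (r l) + t <= inf S + 3 * t by lra.
  have h4 : (nrm (r l) + t) ^+ 2 <= (inf S + 3 * t) ^+ 2.
    by rewrite ler_pXn2r// ?nnegrE ?addr_ge0 ?sip_norm_ge0 ?mulr_ge0 ?(ltW t0).
  have h5 : inf S ^+ 2 <= nrm (r m) ^+ 2 by rewrite ler_pXn2r// ?nnegrE ?sip_norm_ge0.
  nra.
have key2 l m : (L <= l)%N -> (l <= m)%N -> nrm (r m - r l) <= e / 2.
  move=> Ll lm; have Nl := leq_trans NL Ll; have Nm := leq_trans Nl lm.
  rewrite !rE (_ : _ - _ = (q m - q l) + (dd m - dd l)); last by rewrite opprD addrACA.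
  apply: le_trans (sip_triangle _ _) _; try exact: subspaceB; try (apply: subspaceB => //; exact: QD).
  have h1 := key _ _ Ll lm; have h2 := hN _ _ Nm Nl.
  have : t <= e / 8 by rewrite ge_min lexx.
  lra.
exists L => n k Ln Lk.
apply: le_trans (sip_triangle3 (Dr n) (Dr L) (Dr k)) _.
have h1 := key2 _ _ (leqnn L) Ln; have h2 := key2 _ _ (leqnn L) Lk.
rewrite (sip_normBC (Dr L) (Dr k)); lra.
Qed.

End least_squares.
End theory.
End semi_inner_product.

(** * Square integrable functions *)

Section integrable_facts.
Context {R : realType} {n : nat}.
Local Notation V := 'rV[R]_n.
Local Notation leb := (@lebesgue_rV R n).
Implicit Types (E : set V) (f g h : V -> R).

Lemma ae_on_imp E (P Q : V -> Prop) : (forall x, E x -> P x -> Q x) -> ae_on E P -> ae_on E Q.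
Proof. by move=> h; rewrite /ae_on; apply: filterS => x hx Ex; apply: h => //; exact: hx. Qed.

Lemma ae_on_all E (P : V -> Prop) : (forall x, E x -> P x) -> ae_on E P.
Proof. by move=> h; rewrite /ae_on; apply: aeW => x Ex; exact: h. Qed.

Lemma ae_on_and E (P Q : V -> Prop) : ae_on E P -> ae_on E Q -> ae_on E (fun x => P x /\ Q x).
Proof.
move=> hP hQ; rewrite /ae_on in hP hQ *.
by apply: filterS2 hP hQ => x h1 h2 Ex; split; [exact: h1|exact: h2].
Qed.

Lemma ae_on_nat E (P : nat -> V -> Prop) : (forall k, ae_on E (P k)) -> ae_on E (fun x => forall k, P k x).
Proof.
by move=> h; have := ae_foralln h; apply: filterS => x hx Ex k; exact: hx.
Qed.

Lemma ae_on_count E (I : countType) (P : I -> V -> Prop) :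
  (forall i, ae_on E (P i)) -> ae_on E (fun x => forall i, P i x).
Proof.
move=> h; apply: (@ae_on_imp _ (fun x => forall k, forall i : I, choice.pickle i = k -> P i x)).
  by move=> x _ hx i; exact: hx.
apply: ae_on_nat => k; case E1 : (@choice.pickle_inv I k) => [i|].
  apply: ae_on_imp (h i) => x _ hx j jk.
  by move: E1; rewrite -jk choice.pickleK_inv => -[->].
by apply: ae_on_all => x _ j jk; move: E1; rewrite -jk choice.pickleK_inv.
Qed.

Lemma ae_on_sub E F (P : V -> Prop) : F `<=` E -> ae_on E P -> ae_on F P.
Proof. by move=> FE; rewrite /ae_on; apply: filterS => x h /FE. Qed.

Definition intble E f := leb.-integrable E (EFin \o f).

Lemma intble_meas E f : measurable E -> intble E f -> measurable_fun E f.
Proof. by move=> mE /measurable_int/measurable_EFinP. Qed.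

Lemma intbleD E f g : measurable E -> intble E f -> intble E g -> intble E (fun x => f x + g x).
Proof. by move=> mE hf hg; have := integrableD mE hf hg. Qed.

Lemma intbleB E f g : measurable E -> intble E f -> intble E g -> intble E (fun x => f x - g x).
Proof. by move=> mE hf hg; have := integrableB mE hf hg. Qed.

Lemma intbleZ E a f : measurable E -> intble E f -> intble E (fun x => a * f x).
Proof. by move=> mE hf; have := integrableZl mE a hf. Qed.

Lemma intble_sum E (I : Type) (s : seq I) (P : pred I) (F : I -> V -> R) :
  measurable E -> (forall i, P i -> intble E (F i)) -> intble E (fun x => \sum_(i <- s | P i) F i x).
Proof.
move=> mE hF; have := @integrable_sum _ _ _ leb E mE I s P (fun i => EFin \o F i) hF.
by apply: eq_integrable => // x _ /=; rewrite sumEFin.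
Qed.

Lemma intble_norm E f : measurable E -> intble E f -> intble E (fun x => `|f x|).
Proof. by move=> mE hf; have := integrable_norm hf. Qed.

Lemma intble_le E f g : measurable E -> measurable_fun E f -> (forall x, E x -> `|f x| <= g x) ->
  intble E g -> intble E f.
Proof.
move=> mE mf fg ig; apply: (le_integrable mE _ _ ig); first exact/measurable_EFinP.
by move=> x Ex /=; rewrite lee_fin (le_trans (fg _ Ex))// ler_norm.
Qed.

Lemma intble_eq E f g : measurable E -> (forall x, E x -> f x = g x) -> intble E f -> intble E g.
Proof.
by move=> mE fg; apply: eq_integrable => // x; rewrite inE => Ex /=; rewrite fg.
Qed.

Lemma intble_cst E (c : R) : measurable E -> (leb E < +oo)%E -> intble E (fun _ => c).
Proof.
move=> mE fE; apply: measurable_bounded_integrable => //.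
by exists `|c|; split; rewrite ?num_real// => M cM x _; exact: ltW.
Qed.

Lemma intbleS E F f : measurable E -> measurable F -> F `<=` E -> intble E f -> intble F f.
Proof. by move=> mE mF FE; exact: integrableS. Qed.

Lemma RintD E f g : measurable E -> intble E f -> intble E g ->
  \int[leb]_(x in E) (f x + g x) = \int[leb]_(x in E) f x + \int[leb]_(x in E) g x.
Proof. by move=> mE hf hg; rewrite RintegralD. Qed.

Lemma RintB E f g : measurable E -> intble E f -> intble E g ->
  \int[leb]_(x in E) (f x - g x) = \int[leb]_(x in E) f x - \int[leb]_(x in E) g x.
Proof. by move=> mE hf hg; rewrite RintegralB. Qed.

Lemma RintZ E a f : measurable E -> intble E f ->
  \int[leb]_(x in E) (a * f x) = a * \int[leb]_(x in E) f x.
Proof. by move=> mE hf; rewrite RintegralZl. Qed.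

Lemma RintN E f : measurable E -> intble E f ->
  \int[leb]_(x in E) (- f x) = - \int[leb]_(x in E) f x.
Proof.
move=> mE hf; rewrite -mulN1r -RintZ//; apply: eq_Rintegral => x _.
by rewrite mulN1r.
Qed.

Lemma Rint0 E : \int[leb]_(x in E) (0 : R) = 0.
Proof. by rewrite /Rintegral integral0. Qed.

Lemma Rint_sum E (I : Type) (s : seq I) (P : pred I) (F : I -> V -> R) :
  measurable E -> (forall i, P i -> intble E (F i)) ->
  \int[leb]_(x in E) (\sum_(i <- s | P i) F i x) = \sum_(i <- s | P i) \int[leb]_(x in E) F i x.
Proof.
move=> mE hF; elim: s => [|i s IH].
  by rewrite big_nil -[RHS](Rint0 E); apply: eq_Rintegral => x _; rewrite big_nil.
rewrite big_cons -IH; case: ifPn => Pi; last first.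
  by apply: eq_Rintegral => x _; rewrite big_cons (negbTE Pi).
rewrite -RintD//; [|exact: hF|exact: intble_sum].
by apply: eq_Rintegral => x _; rewrite big_cons Pi.
Qed.

Lemma Rint_le E f g : measurable E -> intble E f -> intble E g ->
  (forall x, E x -> f x <= g x) -> \int[leb]_(x in E) f x <= \int[leb]_(x in E) g x.
Proof. by move=> mE hf hg h; exact: le_Rintegral. Qed.

Lemma Rint_ae_eq E f g : measurable E -> measurable_fun E f -> measurable_fun E g ->
  ae_on E (fun x => f x = g x) -> \int[leb]_(x in E) f x = \int[leb]_(x in E) g x.
Proof.
move=> mE mf mg fg; rewrite /Rintegral; congr fine; apply: ae_eq_integral => //; try exact/measurable_EFinP.
by rewrite /ae_on in fg; apply: filterS fg => x h Ex; rewrite /= h.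
Qed.

Lemma intble_ae_eq E f g : measurable E -> measurable_fun E g ->
  ae_on E (fun x => f x = g x) -> intble E f -> intble E g.
Proof.
move=> mE mg fg fi; apply/integrableP; split; first exact/measurable_EFinP.
have /integrableP[_] := fi; congr (_ < _)%E; apply: ae_eq_integral => //.
- by apply: measurableT_comp => //; apply/measurable_EFinP; exact: intble_meas fi.
- by apply: measurableT_comp => //; apply/measurable_EFinP.
by rewrite /ae_on in fg; apply: filterS fg => x h Ex; rewrite /= h.
Qed.

Lemma Rint_ae_le E f g : measurable E -> intble E f -> intble E g ->
  ae_on E (fun x => f x <= g x) -> \int[leb]_(x in E) f x <= \int[leb]_(x in E) g x.
Proof.
move=> mE hf hg h; have mf := intble_meas mE hf; have mg := intble_meas mE hg.
(* The maximum turns an inequality that holds almost everywhere into one that holds everywhere,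
   without changing the integral of [g]. *)
have mm : measurable_fun E (fun x => Num.max (f x) (g x)) by exact: measurable_maxr.
have E1 : ae_on E (fun x => g x = Num.max (f x) (g x)).
  by apply: ae_on_imp h => x Ex h; rewrite max_r.
rewrite (Rint_ae_eq mE mg mm E1); apply: Rint_le => //.
  exact: intble_ae_eq E1 hg.
by move=> x _; rewrite le_max lexx.
Qed.

Lemma Rint_norm E f : measurable E -> intble E f ->
  `|\int[leb]_(x in E) f x| <= \int[leb]_(x in E) `|f x|.
Proof. by move=> mE hf; exact: le_normr_Rintegral. Qed.

Lemma Rint_subset E F f : measurable E -> measurable F -> F `<=` E -> intble E f ->
  (forall x, E x -> 0 <= f x) -> \int[leb]_(x in F) f x <= \int[leb]_(x in E) f x.
Proof.
move=> mE mF FE fi f0; rewrite /Rintegral; apply: fine_le.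
- exact: integrable_fin_num (intbleS mE mF FE fi).
- exact: integrable_fin_num fi.
by apply: ge0_subset_integral => //; exact: (measurable_int _ fi).
Qed.

Lemma Rint_eq0 E f : measurable E -> intble E f -> (forall x, E x -> 0 <= f x) ->
  \int[leb]_(x in E) f x = 0 -> ae_on E (fun x => f x = 0).
Proof.
move=> mE fi f0 h.
have h2 : (\int[leb]_(x in E) `|(f x)%:E| = 0)%E.
  rewrite (eq_integral (fun x => (f x)%:E)); last first.
    by move=> x; rewrite inE => Ex; rewrite gee0_abs// lee_fin f0.
  move: h; rewrite /Rintegral => h.
  by rewrite -[LHS]fineK ?h//; exact: integrable_fin_num fi.
have /(ae_eq_integral_abs leb mE) : measurable_fun E (EFin \o f) by exact: (measurable_int _ fi).
by case=> + _ => /(_ h2); apply: filterS => x hx Ex; have [] := hx Ex.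
Qed.

Lemma Rint_dct E (F : nat -> V -> R) f g : measurable E ->
  (forall k, measurable_fun E (F k)) -> measurable_fun E f -> intble E g ->
  ae_on E (fun x => F k x @[k --> \oo] --> f x) ->
  (forall k, ae_on E (fun x => `|F k x| <= g x)) ->
  intble E f /\ \int[leb]_(x in E) `|F k x - f x| @[k --> \oo] --> (0 : R).
Proof.
move=> mE mF mf gi cF bF.
have mF' k : measurable_fun E (EFin \o F k) by apply/measurable_EFinP; exact: mF.
have mf' : measurable_fun E (EFin \o f) by apply/measurable_EFinP.
have c1 : {ae leb, forall x, E x -> (fun k => (EFin \o F k) x) @ \oo --> (EFin \o f) x}.
  by rewrite /ae_on in cF; apply: filterS cF => x h Ex; apply: cvg_EFin; [exact: nearW|exact: h].
have b1 : {ae leb, forall x k, E x -> (`|(EFin \o F k) x| <= (EFin \o g) x)%E}.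
  by have h := ae_on_nat bF; rewrite /ae_on in h; apply: filterS h => x h k Ex; rewrite lee_fin; exact: h.
have [h1 h2 _] := dominated_convergence mE mF' mf' c1 gi b1.
by split => //; exact: (fine_cvg h2).
Qed.

Lemma Rint_cvg E (F : nat -> V -> R) f : measurable E ->
  (forall k, intble E (F k)) -> intble E f ->
  \int[leb]_(x in E) `|F k x - f x| @[k --> \oo] --> (0 : R) ->
  \int[leb]_(x in E) F k x @[k --> \oo] --> \int[leb]_(x in E) f x.
Proof.
move=> mE iF fi /cvgrPdist_le h; apply/cvgrPdist_le => e e0.
have := h e e0; apply: filterS => k; rewrite sub0r normrN; apply: le_trans.
rewrite distrC -RintB// (le_trans (Rint_norm _ _))//; first exact: intbleB.
exact: ler_norm.
Qed.

(** [f] is split into its excess over a level [K] and a part bounded by [K]: the integral of the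
    excess is small by dominated convergence, and the bounded part contributes at most [K] times the
    measure of [A k]. *)
Lemma Rint_abs_continuous E f (A : nat -> set V) : measurable E -> intble E f ->
  (forall x, E x -> 0 <= f x) ->
  (forall k, measurable (A k)) -> (forall k, A k `<=` E) ->
  (forall k, (leb (A k) < +oo)%E) ->
  fine (leb (A k)) @[k --> \oo] --> (0 : R) ->
  \int[leb]_(x in A k) f x @[k --> \oo] --> (0 : R).
Proof.
move=> mE fi f0 mA AE fA cA.
have mf := intble_meas mE fi.
pose F k x := Num.max (f x - k%:R) 0.
have mF k : measurable_fun E (F k).
  apply: measurable_maxr => //; apply: measurable_funB => //.
have Fb k x : E x -> `|F k x| <= f x.
  by move=> Ex; rewrite ger0_norm ?le_max ?lexx ?orbT// ge_max f0// andbT lerBlDr lerDl.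
have [_ hF] : intble E (fun=> 0) /\ \int[leb]_(x in E) `|F k x - 0| @[k --> \oo] --> (0 : R).
  apply: (@Rint_dct _ _ _ f) => //; last by move=> k; apply: ae_on_all => x; exact: Fb.
  apply: ae_on_all => x Ex; apply: cvg_near_cst.
  near=> k; rewrite /F max_r// subr_le0.
  by near: k; exact: nbhs_infty_ger.
apply/cvgrPdist_le => e e0.
have e20 : 0 < e / 2 by rewrite divr_gt0.
have /cvgrPdist_le/(_ _ e20)/filter_ex[K] := hF; rewrite sub0r normrN => hK.
have FK : \int[leb]_(x in E) F K x <= e / 2.
  apply: le_trans hK; apply: le_trans (ler_norm _); rewrite le_eqVlt; apply/orP; left; apply/eqP.
  by apply: eq_Rintegral => x _; rewrite subr0 ger0_norm// le_max lexx orbT.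
have K0 : 0 < e / 2 / (K%:R + 1) by rewrite divr_gt0// ltr_wpDl.
have /cvgrPdist_le/(_ _ K0) := cA; apply: filterS => k; rewrite !sub0r !normrN.
move=> hk.
have fiA : intble (A k) f by exact: intbleS fi.
have FiE : intble E (F K) by exact: intble_le (mF K) (Fb K) fi.
have FiA : intble (A k) (F K) by exact: intbleS FiE.
have ciA : intble (A k) (fun _ => K%:R) by exact: intble_cst.
rewrite ger0_norm; last by apply: Rintegral_ge0 => x /AE; exact: f0.
apply: (@le_trans _ _ (\int[leb]_(x in A k) (F K x + K%:R))).
  by apply: Rint_le => // [|x _]; [exact: intbleD|rewrite -lerBlDr le_max lexx].
rewrite RintD// (splitr e); apply: lerD.
  apply: le_trans FK; apply: Rint_subset => // x _.
  by rewrite le_max lexx orbT.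
rewrite Rintegral_cst//.
have [h1|h1] := ltP 0 (fine (leb (A k))); last first.
  by apply: (@le_trans _ _ 0); [rewrite mulr_ge0_le0|exact: ltW].
apply: (@le_trans _ _ ((K%:R + 1) * fine (leb (A k)))).
  by rewrite ler_pM2r// lerDl.
rewrite -ler_pdivlMl// ?ltr_wpDl//; apply: le_trans (ler_norm _) _.
by rewrite mulrC.
Unshelve. all: by end_near. Qed.

End integrable_facts.

Section L2_theory.
Context {R : realType} {n : nat}.
Local Notation V := 'rV[R]_n.
Local Notation leb := (@lebesgue_rV R n).
Implicit Types (E : set V) (f g h : V -> R).

Lemma L2_intble E f : L2 E f -> intble E (fun x => f x ^+ 2).
Proof. by case. Qed.

Lemma L2M E f g : measurable E -> L2 E f -> L2 E g -> intble E (fun x => f x * g x).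
Proof.
move=> mE [mf fi] [mg gi].
apply: (@intble_le _ _ E _ (fun x => f x ^+ 2 + g x ^+ 2)) => //.
- exact: measurable_funM.
- move=> x _; rewrite ler_norml; have := sqr_ge0 (f x - g x); have := sqr_ge0 (f x + g x).
  by have := sqr_ge0 (f x); have := sqr_ge0 (g x); nra.
- exact: intbleD.
Qed.

Lemma L2_lin E a f g : measurable E -> L2 E f -> L2 E g -> L2 E (fun x => a * f x + g x).
Proof.
move=> mE hf hg; split.
  apply: measurable_funD; last exact: hg.1.
  by apply: measurable_funM => //; exact: hf.1.
have i1 : intble E (fun x => a ^+ 2 * f x ^+ 2 + 2 * a * (f x * g x) + g x ^+ 2).
  apply: intbleD => //; last exact: hg.2.
  by apply: intbleD => //; apply: intbleZ => //; [exact: hf.2|exact: L2M].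
by apply: intble_eq i1 => // x _; ring.
Qed.

Lemma L2_cst0 E : measurable E -> L2 E (fun=> 0).
Proof.
move=> mE; split; first exact: measurable_cst.
have : intble E (fun=> 0) by exact: integrable0.
by apply: intble_eq => // x _; rewrite expr0n.
Qed.

Lemma L2_add E f g : measurable E -> L2 E f -> L2 E g -> L2 E (fun x => f x + g x).
Proof.
move=> mE hf hg; have := L2_lin 1 mE hf hg.
by rewrite (_ : (fun x => 1 * f x + g x) = fun x => f x + g x)//; apply/funext => x; rewrite mul1r.
Qed.

Lemma L2_scale E a f : measurable E -> L2 E f -> L2 E (fun x => a * f x).
Proof.
move=> mE hf; have := L2_lin a mE hf (L2_cst0 mE).
by rewrite (_ : (fun x => a * f x + 0) = fun x => a * f x)//; apply/funext => x; rewrite addr0.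
Qed.

Lemma L2_sub E f g : measurable E -> L2 E f -> L2 E g -> L2 E (fun x => f x - g x).
Proof.
move=> mE hf hg; have := L2_lin (-1) mE hg hf.
by rewrite (_ : (fun x => -1 * g x + f x) = fun x => f x - g x)//; apply/funext => x; rewrite mulN1r addrC.
Qed.

Lemma L2_opp E f : measurable E -> L2 E f -> L2 E (fun x => - f x).
Proof.
move=> mE hf; have := L2_scale (-1) mE hf.
by rewrite (_ : (fun x => -1 * f x) = fun x => - f x)//; apply/funext => x; rewrite mulN1r.
Qed.

Lemma L2_sum E (I : Type) (s : seq I) (P : pred I) (F : I -> V -> R) : measurable E ->
  (forall i, P i -> L2 E (F i)) -> L2 E (fun x => \sum_(i <- s | P i) F i x).
Proof.
move=> mE hF; elim: s => [|i s IH].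
  rewrite (_ : (fun x => _) = fun=> 0); first exact: L2_cst0.
  by apply/funext => x; rewrite big_nil.
case: (boolP (P i)) => Pi.
  rewrite (_ : (fun x => _) = fun x => F i x + \sum_(j <- s | P j) F j x).
    by apply: L2_add => //; exact: hF.
  by apply/funext => x; rewrite big_cons Pi.
rewrite (_ : (fun x => _) = fun x => \sum_(j <- s | P j) F j x)//.
by apply/funext => x; rewrite big_cons (negbTE Pi).
Qed.

Lemma L2_le E f g : measurable E -> measurable_fun E f ->
  ae_on E (fun x => `|f x| <= `|g x|) -> L2 E g -> L2 E f.
Proof.
move=> mE mf fg [mg gi]; split => //.
have mf2 : measurable_fun E (fun x => f x ^+ 2) by exact: measurable_funX.
(* The bound by [g] holds only almost everywhere; the minimum is dominated everywhere. *)
pose m x := Num.min (f x ^+ 2) (g x ^+ 2).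
have mi : intble E m.
  apply: intble_le gi => //.
    by apply: measurable_minr => //; exact: measurable_funX.
  move=> x _; rewrite ger0_norm ?le_min ?sqr_ge0//.
  by rewrite ge_min lexx orbT.
apply: intble_ae_eq mi => //; apply: ae_on_imp fg => x _ h.
by rewrite /m min_l// -real_normK ?num_real// -[leRHS]real_normK ?num_real// ler_pXn2r ?nnegrE.
Qed.

Lemma L2_bounded_mul E f h (M : R) : measurable E -> measurable_fun E h ->
  ae_on E (fun x => `|h x| <= M) -> L2 E f -> L2 E (fun x => h x * f x).
Proof.
move=> mE mh hM hf; apply: (@L2_le _ _ (fun x => M * f x)) => //; last exact: L2_scale.
- by apply: measurable_funM => //; exact: hf.1.
- apply: ae_on_imp hM => x _ hx; rewrite !normrM ler_wpM2r//.
  exact: le_trans hx (ler_norm _).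
Qed.

Lemma L2_bounded E f (M : R) : measurable E -> (leb E < +oo)%E -> measurable_fun E f ->
  ae_on E (fun x => `|f x| <= M) -> L2 E f.
Proof.
move=> mE fE mf fM; apply: (@L2_le _ _ (fun=> M)) => //.
  by apply: ae_on_imp fM => x _ h; exact: le_trans h (ler_norm _).
by split; [exact: measurable_cst|exact: intble_cst].
Qed.

Lemma L2_restr E F f : measurable E -> measurable F -> F `<=` E -> L2 E f -> L2 F f.
Proof.
move=> mE mF FE [mf fi]; split; first exact: measurable_funS mf.
exact: intbleS fi.
Qed.

Lemma L2_sip E : measurable E -> semi_ip (@L2 R n E) (@ip R n E).
Proof.
move=> mE; split.
- split; first exact: L2_cst0.
  by move=> a f g hf hg; exact: L2_lin.
- move=> a f g h hf hg hh; rewrite /ip -RintZ -?RintD//; try exact: L2M; last first.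
    by apply: intbleZ => //; exact: L2M.
  apply: eq_Rintegral => x _; rewrite -[_ x]/(a * f x + g x); ring.
- by move=> f g hf hg; apply: eq_Rintegral => x _; rewrite mulrC.
- by move=> f hf; apply: Rintegral_ge0 => x _; rewrite -expr2 sqr_ge0.
Qed.

Lemma ip_intble E f g : measurable E -> L2 E f -> L2 E g -> intble E (fun x => f x * g x).
Proof. exact: L2M. Qed.

Lemma ip_ae E f f' g g' : measurable E -> L2 E f -> L2 E f' -> L2 E g -> L2 E g' ->
  ae_on E (fun x => f x = f' x) -> ae_on E (fun x => g x = g' x) -> ip E f g = ip E f' g'.
Proof.
move=> mE hf hf' hg hg' h1 h2; apply: Rint_ae_eq => //.
- exact: intble_meas (L2M mE hf hg).
- exact: intble_meas (L2M mE hf' hg').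
- by apply: ae_on_imp (ae_on_and h1 h2) => x _ [-> ->].
Qed.

Lemma normL2_sq E f : normL2 E f ^+ 2 = \int[leb]_(x in E) (f x ^+ 2).
Proof.
rewrite sqr_sqrtr; last by apply: Rintegral_ge0 => x _; rewrite -expr2 sqr_ge0.
by [].
Qed.

Lemma normL2_eq0 E f : measurable E -> L2 E f -> normL2 E f = 0 -> ae_on E (fun x => f x = 0).
Proof.
move=> mE hf /(congr1 (fun x => x ^+ 2)); rewrite normL2_sq expr0n/= => h.
have := Rint_eq0 mE hf.2 (fun x _ => sqr_ge0 (f x)) h.
by apply: ae_on_imp => x _ /eqP; rewrite sqrf_eq0 => /eqP.
Qed.

(** Riesz-Fischer: along a fast subsequence the increments are absolutely summable almost
    everywhere, which gives a measurable pointwise limit; Fatou's lemma then bounds its distance to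
    every late term of the full sequence. The finite measure of [E] allows the increments to be
    summed in L1. *)
Lemma L2_complete E (F : nat -> V -> R) : measurable E -> (leb E < +oo)%E ->
  (forall k, L2 E (F k)) ->
  (forall e : R, 0 < e -> exists N, forall k l, (N <= k)%N -> (N <= l)%N -> normL2 E (F k - F l) <= e) ->
  exists f, L2 E f /\ normL2 E (F k - f) @[k --> \oo] --> (0 : R).
Proof.
move=> mE fE hF cF; have sp := L2_sip mE.
have p2 k : 0 < 2^-1 ^+ k :> R by rewrite exprn_gt0.
have [phi hphi] := choice (fun k => cF _ (p2 k)).
(* A sum in place of a maximum: it is at least every [phi i] with [i <= k], and the summand [k]
   makes it unbounded. *)
pose psi k := (k + \sum_(i < k.+1) phi i)%N.
have psile k l : (k <= l)%N -> (phi k <= psi l)%N.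
  by move=> kl; rewrite /psi (bigD1 (inord k))//= inordK// addnCA leq_addr.
have mFk k : measurable_fun E (F k) by exact: (hF k).1.
pose G k x := `|F (psi k.+1) x - F (psi k) x|.
have hG k : L2 E (F (psi k.+1) - F (psi k)) by apply: L2_sub.
have iG k : intble E (G k).
  have h1 : L2 E (fun=> 1) by apply: (@L2_bounded _ _ 1) => //; apply: ae_on_all => x _; rewrite normr1.
  apply: intble_norm => //; have := L2M mE (hG k) h1.
  by apply: intble_eq => // x _; rewrite mulr1.
pose MM : R := normL2 E (fun=> 1).
have GM k : \int[leb]_(x in E) G k x <= 2^-1 ^+ k * MM.
  have h1 : L2 E (fun=> 1) by apply: (@L2_bounded _ _ 1) => //; apply: ae_on_all => x _; rewrite normr1.
  have hG' : L2 E (G k).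
    split; first exact: intble_meas (iG k).
    by apply: intble_eq (hG k).2 => // x _; rewrite /G real_normK ?num_real.
  have := sip_CS_le sp hG' h1.
  rewrite /ip (_ : \int[leb]_(x in E) (G k x * 1) = \int[leb]_(x in E) G k x); last first.
    by apply: eq_Rintegral => x _; rewrite mulr1.
  move=> /le_trans; apply; apply: ler_wpM2r; first exact: sqrtr_ge0.
  have -> : sip_norm (@ip R n E) (G k) = normL2 E (F (psi k.+1) - F (psi k)).
    rewrite /sip_norm /normL2 /ip; congr Num.sqrt; apply: eq_Rintegral => x _.
    by rewrite /G -!expr2 real_normK ?num_real.
  apply: hphi; exact: psile.
have mGe k : measurable_fun E (fun x => (G k x)%:E) by exact: measurable_int (iG k).
pose S x := (\big[+%E/0]_(0 <= k <oo) (G k x)%:E)%E.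
have G0 k x : E x -> (0 <= (G k x)%:E)%E by move=> _; rewrite lee_fin /G normr_ge0.
have mS : measurable_fun E S.
  by apply: ge0_emeasurable_sum => // k x Ex _; exact: G0.
have S0 x : (0 <= S x)%E by apply: nneseries_ge0 => k _ _; rewrite lee_fin /G normr_ge0.
have Sfin : (\int[leb]_(x in E) S x < +oo)%E.
  rewrite integral_nneseries//.
  apply: (@le_lt_trans _ _ (\big[+%E/0]_(0 <= k <oo) ((2 * MM) / (2 ^ (k + 1))%:R)%:E)%E).
    apply: lee_nneseries => [k _ _|k _]; first by apply: integral_ge0 => x; exact: G0.
    have /fineK <- := integrable_fin_num mE (iG k); rewrite lee_fin.
    apply: (le_trans (GM k)); rewrite addn1 expnS natrM natrX exprVn invfM.
    by rewrite le_eqVlt; apply/orP; left; apply/eqP; set w := 2 ^- k; field.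
  have := @cvg_geometric_eseries_half R (2 * MM) 0.
  by move=> /cvg_lim; rewrite /eseries /= => ->//; rewrite ltry.
have Sint : leb.-integrable E S.
  apply/integrableP; split => //; rewrite (eq_integral S)// => x _.
  by rewrite gee0_abs.
pose A := E `&` [set x | (S x < +oo)%E].
have mA : measurable A by exact: emeasurable_fun_infty_o.
have aeA : ae_on E A.
  have := integrable_ae mE Sint; rewrite /ae_on; apply: filterS => x h Ex; split => //=.
  by have := h Ex; rewrite ge0_fin_numE.
have cv x : A x -> cvgn (fun k => F (psi k) x).
  move=> [Ex /= Sx].
  have c1 : cvgn [normed series (telescope (fun k => F (psi k) x))].
    apply: nondecreasing_is_cvgn.
      by apply: nondecreasing_series => k _ _ /=.
    exists (fine (S x)) => _ [N _ <-].
    rewrite -lee_fin fineK ?ge0_fin_numE// /series /= -sumEFin.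
    by apply: nneseries_lim_ge => k _ _; rewrite lee_fin.
  have /cvg_ex[l hl] := normed_cvg c1.
  apply/cvg_ex; exists (F (psi 0%N) x + l).
  rewrite (_ : (fun k => F (psi k) x) = (fun k => F (psi 0%N) x + series (telescope (fun k => F (psi k) x)) k)).
    by apply: cvgD => //; exact: cvg_cst.
  by apply/funext => k; rewrite -eq_sum_telescope.
(* Cut off outside the set of convergence, so that the limit exists at every point of [E] and is
   measurable. *)
pose H k x := F (psi k) x * \1_A x.
pose f x := lim (H k x @[k --> \oo]).
have cH x : E x -> H k x @[k --> \oo] --> f x.
  move=> Ex; have [Ax|Ax] := pselect (A x).
    suff : cvgn (fun k => H k x) by [].
    rewrite (_ : (fun k => H k x) = fun k => F (psi k) x); first exact: cv.
    by apply/funext => k; rewrite /H indicE mem_set// mulr1.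
  suff : cvgn (fun k => H k x) by [].
  apply/cvg_ex; exists 0; rewrite (_ : (fun k => H k x) = cst 0); first exact: cvg_cst.
  by apply/funext => k; rewrite /H indicE memNset// mulr0.
have mI : measurable_fun E (\1_A : V -> R) by apply: measurable_funTS; exact: measurable_indic.
have mH k : measurable_fun E (H k) by apply: measurable_funM => //.
have mf : measurable_fun E f by exact: (measurable_fun_cvg mH cH).
have key (e : R) N : 0 < e -> (forall k l, (N <= k)%N -> (N <= l)%N -> normL2 E (F k - F l) <= e) ->
  forall m, (N <= m)%N -> L2 E (fun x => f x - F m x) /\ normL2 E (fun x => f x - F m x) <= e.
  move=> e0 hN m Nm.
  pose g k x := ((H (k + N)%N x - F m x * \1_A x) ^+ 2)%:E.
  have mg k : measurable_fun E (g k).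
    apply/measurable_EFinP/measurable_funX/measurable_funB => //.
    exact: measurable_funM.
  have mfA : measurable_fun E (fun x => f x - F m x * \1_A x).
    by apply: measurable_funB => //; exact: measurable_funM.
  have ft : (\int[leb]_(x in E) limn_einf (g^~ x) <= limn_einf (fun k => \int[leb]_(x in E) g k x))%E.
    by apply: fatou => // k x _; rewrite lee_fin sqr_ge0.
  have B k : (\int[leb]_(x in E) g k x <= (e ^+ 2)%:E)%E.
    have Nk : (N <= psi (k + N))%N by rewrite /psi -addnA; exact: leq_trans (leq_addr _ N) (leq_addl k _).
    have hL : L2 E (fun x => F (psi (k + N)) x - F m x) by exact: L2_sub.
    apply: (@le_trans _ _ (\int[leb]_(x in E) ((F (psi (k + N)) x - F m x) ^+ 2)%:E)%E).
      apply: ge0_le_integral => //.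
      - by move=> x _; rewrite lee_fin sqr_ge0.
      - exact: measurable_int hL.2.
      move=> x _; rewrite lee_fin /H -mulrBl exprMn ler_piMr ?sqr_ge0//.
    rewrite -[leLHS]fineK; last exact: integrable_fin_num hL.2.
    rewrite lee_fin -[leLHS]/(\int[leb]_(x in E) ((F (psi (k + N)%N) x - F m x) ^+ 2)) -normL2_sq.
    rewrite ler_pXn2r ?nnegrE ?sqrtr_ge0 ?(ltW e0)//.
    exact: hN.
  have ft2 : (\int[leb]_(x in E) ((f x - F m x * \1_A x) ^+ 2)%:E <= (e ^+ 2)%:E)%E.
    rewrite (eq_integral (fun x => limn_einf (g^~ x))); last first.
      move=> x; rewrite inE => Ex; apply/esym; apply: (cvg_limn_einf_sup _).1.
      apply: cvg_EFin; first exact: nearW.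
      have h1 : H (k + N)%N x @[k --> \oo] --> f x by rewrite (cvg_shiftn N (fun k => H k x)); exact: cH.
      have h2 : H (k + N)%N x - F m x * \1_A x @[k --> \oo] --> f x - F m x * \1_A x.
        by apply: cvgB => //; exact: cvg_cst.
      by rewrite expr2; exact: (cvgM h2 h2).
    apply: (le_trans ft).
    rewrite limn_einf_lim (cvg_lim (@ereal_hausdorff R) (@cvg_einfs_sup R _)).
    apply: ub_ereal_sup => _ [k _ <-]; apply: le_trans (B k).
    by apply: ereal_inf_lbound; exists k => //=.
  have LA : L2 E (fun x => f x - F m x * \1_A x).
    split => //; apply/integrableP; split; first exact/measurable_EFinP/measurable_funX.
    rewrite (eq_integral (fun x => ((f x - F m x * \1_A x) ^+ 2)%:E)); last first.
      by move=> x _; rewrite gee0_abs// lee_fin sqr_ge0.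
    by apply: le_lt_trans ft2 _; rewrite ltry.
  have mm : measurable_fun E (fun x => f x - F m x) by exact: measurable_funB.
  have aeq : ae_on E (fun x => f x - F m x * \1_A x = f x - F m x).
    by apply: ae_on_imp aeA => x _ Ax; rewrite indicE mem_set// mulr1.
  have LF : L2 E (fun x => f x - F m x).
    by apply: L2_le LA => //; apply: ae_on_imp aeq => x _ ->.
  split => //; rewrite -(@ler_pXn2r _ 2)// ?nnegrE ?sqrtr_ge0 ?(ltW e0)//.
  rewrite normL2_sq -(@Rint_ae_eq _ _ _ (fun x => (f x - F m x * \1_A x) ^+ 2))//.
  - by rewrite -lee_fin /Rintegral fineK//; exact: integrable_fin_num LA.2.
  - exact: measurable_funX.
  - exact: measurable_funX.
  - by apply: ae_on_imp aeq => x _ ->.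
have Lf : L2 E f.
  have [N hN] := cF _ ltr01.
  have [h1 _] := key _ _ ltr01 hN N (leqnn _).
  have := L2_add mE h1 (hF N).
  by rewrite (_ : (fun x => _) = f)//; apply/funext => x; rewrite subrK.
exists f; split => //; apply/cvgrPdist_le => e e0.
have [N hN] := cF _ e0.
near=> m.
have Nm : (N <= m)%N by near: m; exact: nbhs_infty_ge.
have [_ h2] := key _ _ e0 hN m Nm.
rewrite sub0r normrN ger0_norm ?sqrtr_ge0//; apply: le_trans h2.
rewrite le_eqVlt; apply/orP; left; apply/eqP; congr Num.sqrt.
by apply: eq_Rintegral => x _; rewrite -[(F m - f) x]/(F m x - f x); ring.
Unshelve. all: by end_near. Qed.

End L2_theory.

(** * Smooth functions *)

Section is_derive_facts.
Context {R : realType} {V : normedModType R}.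

Lemma is_derive_cvg (f : V -> R) (x v : V) (l : R) :
  h^-1 * (f (h *: v + x) - f x) @[h --> 0^'] --> l -> is_derive x v f l.
Proof.
move=> h; have d : derivable f x v by apply/cvg_ex; exists l.
by split => //; exact: cvg_lim h.
Qed.

Lemma is_derive_cvgP (f : V -> R) (x v : V) (l : R) :
  is_derive x v f l -> h^-1 * (f (h *: v + x) - f x) @[h --> 0^'] --> l.
Proof. by case=> /cvg_ex[m hm] <-; rewrite /derive (cvg_lim _ hm). Qed.

Lemma is_derive_quadratic (f : V -> R) (x v : V) (l C : R) :
  (forall h : R, `|f (h *: v + x) - f x - h * l| <= C * h ^+ 2) ->
  is_derive x v f l.
Proof.
move=> hC; apply: is_derive_cvg; apply/cvgrPdist_le => e e0.
have C0 : 0 < `|C| + 1 by rewrite ltr_pwDr.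
near=> h.
have h0 : h != 0 by near: h; exact: nbhs_dnbhs_neq.
have hle : `|h| <= e / (`|C| + 1).
  near: h; apply: dnbhs0_le; exact: divr_gt0.
have -> : l - h^-1 * (f (h *: v + x) - f x) = - h^-1 * (f (h *: v + x) - f x - h * l).
  by field.
rewrite normrM normrN normfV ler_pdivrMl ?normr_gt0//.
apply: (le_trans (hC h)).
rewrite -real_normK ?num_real// expr2 mulrA mulrC ler_pM2l ?normr_gt0//.
apply: (@le_trans _ _ ((`|C| + 1) * `|h|)).
  by rewrite ler_wpM2r// (le_trans (ler_norm C))// lerDl.
by rewrite -ler_pdivlMl// mulrC.
Unshelve. all: by end_near.
Qed.

End is_derive_facts.

Section smooth_bump.
Context {R : realType}.

(* Smoothness by coinduction: every function of the family has its derivative in the family. *)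
Definition cinf (f : R -> R) : Prop := exists S : set (R -> R), S f /\
  forall g, S g -> exists2 g' : R -> R, S g' & forall x : R, is_derive x (1 : R) g (g' x).

(** The functions [P(1/x) exp(-1/x)], extended by zero, form a family closed under differentiation:
    the derivative belongs to the polynomial [X^2 (P - P')]. *)
Definition flat_exp (P : {poly R}) (x : R) : R :=
  if 0 < x then P.[x^-1] * expR (- x^-1) else 0.

Lemma exp_dominates n (y : R) : 0 < y -> y ^+ n * expR (- y) <= n`!%:R.
Proof.
move=> y0; rewrite expRN ler_pdivrMr ?expR_gt0//.
rewrite -ler_pdivrMl ?ltr0n ?fact_gt0// mulrC.
case: n => [|n].
  by rewrite expr0 fact0 divr1; apply: le_trans (expR_ge1Dx y); rewrite lerDl ltW.
by apply: le_trans (expR_ge1Dxn n (ltW y0)); rewrite lerDr.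
Qed.

(** The delicate point is the origin, where a quadratic bound gives the derivative 0 through
    [is_derive_quadratic]. The two powers of [x] are paid for by two more powers of [1/x] in
    [exp_dominates]. *)
Lemma flat_exp_bound (P : {poly R}) : exists C : R, forall x : R, `|flat_exp P x| <= C * x ^+ 2.
Proof.
exists (\sum_(i < size P) `|P`_i| * (i.+2)`!%:R) => x; rewrite /flat_exp.
case: ltP => [x0|_]; last first.
  by rewrite normr0 mulr_ge0 ?sqr_ge0// sumr_ge0// => i _; rewrite mulr_ge0.
have y0 : 0 < x^-1 by rewrite invr_gt0.
rewrite -ler_pdivrMr ?exprn_gt0// -exprVn.
rewrite normrM (ger0_norm (expR_ge0 _)) horner_coef.
rewrite -mulrA; apply: (@le_trans _ _ ((\sum_(i < size P) `|P`_i| * x^-1 ^+ i) * (expR (- x^-1) * x^-1 ^+ 2))).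
  rewrite ler_wpM2r ?mulr_ge0 ?expR_ge0 ?sqr_ge0 ?(ltW y0)//.
  apply: (le_trans (ler_norm_sum _ _ _)); apply: ler_sum => i _.
  by rewrite normrM normrX (gtr0_norm y0).
rewrite mulr_suml; apply: ler_sum => i _.
rewrite -mulrA ler_wpM2l//; apply: le_trans (exp_dominates i.+2 y0).
by rewrite !exprS expr0 le_eqVlt; apply/orP; left; apply/eqP; ring.
Qed.

Lemma cinf_flat_exp P : cinf (flat_exp P).
Proof.
exists (range flat_exp); split; first by exists P.
move=> _ [{}P _ <-]; exists (flat_exp ('X^2 * (P - P^`()))) => [|x]; first by exists ('X^2 * (P - P^`())).
have [x0|x0|->] := ltgtP x 0.
- rewrite {2}/flat_exp ltNge (ltW x0)/=.
  apply: (@near_eq_is_derive _ _ _ (cst (0:R))).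
    near=> y; rewrite /flat_exp ltNge ltW//.
    by near: y; exact: lt_nbhsl.
- rewrite {2}/flat_exp x0.
  have dV : is_derive x (1:R) (fun y : R => y^-1) (- x ^- 2).
    have x0' : (id x : R) != 0 by rewrite gt_eqF.
    have h := @is_deriveV R id x 1 1 x0' (is_derive_id _ _).
    by apply: (is_derive_eq h); rewrite -[_ *: _]/(_ * _) mulr1.
  have d1 : is_derive x (1:R) (fun y : R => P.[y^-1]) (P^`().[x^-1] * - x ^- 2).
    exact: (@is_derive1_comp R (horner P) (fun y : R => y^-1)).
  have dN : is_derive x (1:R) (fun y : R => - y^-1) (x ^- 2).
    by have h := is_deriveN dV; apply: (is_derive_eq h); rewrite opprK.
  have d2 : is_derive x (1:R) (fun y : R => expR (- y^-1)) (expR (- x^-1) * x ^- 2).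
    exact: (@is_derive1_comp R expR (fun y : R => - y^-1)).
  have d3 := is_deriveM d1 d2.
  have h : \forall y \near x, P.[y^-1] * expR (- y^-1) = flat_exp P y.
    near=> y; rewrite /flat_exp ifT//.
    by near: y; exact: lt_nbhsr.
  apply: (is_derive_eq (near_eq_is_derive h d3)).
  by rewrite !hornerE /= -!exprVn -![_ *: _]/(_ * _); ring.
- rewrite {2}/flat_exp ltxx; have [C hC] := flat_exp_bound P.
  apply: (@is_derive_quadratic _ _ _ _ _ _ C) => h.
  rewrite addr0 {2}/flat_exp ltxx mulr0 !subr0; apply: le_trans (hC _) _.
  by rewrite -[h *: 1]/(h * 1) mulr1.
Unshelve. all: by end_near.
Qed.

(** The Leibniz rule turns a product into a sum of products, so the family stable under
    differentiation is the closure of the products under addition. *)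
Inductive prod_sums (S T : set (R -> R)) : set (R -> R) :=
| prod_sums1 f g : S f -> T g -> prod_sums S T (f \* g)
| prod_sumsD f g : prod_sums S T f -> prod_sums S T g -> prod_sums S T (f \+ g).

Lemma cinfM f g : cinf f -> cinf g -> cinf (f \* g).
Proof.
move=> [S [Sf hS]] [T [Tg hT]]; exists (prod_sums S T); split; first exact: prod_sums1.
move=> p; elim=> [f1 g1 Sf1 Tg1|f1 g1 _ [f1' Sf1' hf] _ [g1' Sg1' hg]].
  have [f1' Sf1' hf] := hS _ Sf1; have [g1' Tg1' hg] := hT _ Tg1.
  exists ((f1 \* g1') \+ (f1' \* g1)); first by apply: prod_sumsD; exact: prod_sums1.
  move=> x; have := @is_deriveM _ _ f1 g1 x 1 _ _ (hf x) (hg x).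
  by move=> h; apply: is_derive_eq; rewrite /= [f1' x * _]mulrC.
exists (f1' \+ g1'); first exact: prod_sumsD.
by move=> x; exact: is_deriveD.
Qed.

Lemma cinf_affine f a b : cinf f -> cinf (fun x => f (a * x + b)).
Proof.
move=> [S [Sf hS]].
exists [set h | exists k g, S g /\ h = fun x => k * g (a * x + b)]; split.
  by exists 1, f; split => //; apply/funext => x; rewrite mul1r.
move=> _ [k [g [Sg ->]]]; have [g' Sg' hg] := hS _ Sg.
exists (fun x => (k * a) * g' (a * x + b)); first by exists (k * a), g'.
move=> x.
have d : is_derive x (1:R) (fun x => a * x + b) a.
  apply: (@is_derive_quadratic _ _ _ _ _ _ 0) => h.
  rewrite mul0r -[h *: 1]/(h * 1); rewrite (_ : _ - _ = 0) ?normr0//; ring.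
have := @is_deriveZ R R R _ k x 1 _ (@is_derive1_comp R g (fun x => a * x + b) x _ _ (hg _) d).
by move=> h; apply: is_derive_eq; rewrite -[k *: _]/(k * _); ring.
Qed.

Lemma cinf_continuous f : cinf f -> continuous f.
Proof.
move=> [S [Sf /(_ _ Sf)[f' _ h]]] x.
apply: differentiable_continuous; apply/derivable1_diffP.
by have [] := h x.
Qed.

Definition bump1 (c r x : R) : R := flat_exp 1 (r + (x - c)) * flat_exp 1 (r - (x - c)).

Lemma cinf_bump1 c r : cinf (bump1 c r).
Proof.
rewrite (_ : bump1 c r = (fun x => flat_exp 1 (1 * x + (r - c))) \* (fun x => flat_exp 1 (- 1 * x + (r + c)))).
  by apply: cinfM; apply: cinf_affine; exact: cinf_flat_exp.
by apply/funext => x /=; rewrite /bump1; congr (flat_exp _ _ * flat_exp _ _); ring.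
Qed.

Lemma flat_exp_ge0 x : 0 <= flat_exp 1 x.
Proof. by rewrite /flat_exp hornerC mul1r; case: ifP => // _; exact: expR_ge0. Qed.

Lemma flat_exp_gt0 x : (0 < flat_exp 1 x) = (0 < x).
Proof. by rewrite /flat_exp hornerC mul1r; case: ifP => // _; rewrite ?expR_gt0 ?ltxx. Qed.

Lemma bump1_ge0 c r x : 0 <= bump1 c r x.
Proof. by rewrite mulr_ge0// flat_exp_ge0. Qed.

Lemma bump1_gt0 c r x : 0 < r -> (0 < bump1 c r x) = (`|x - c| < r).
Proof.
move=> r0; rewrite ltr_norml lt_neqAle bump1_ge0 andbT eq_sym mulf_eq0 negb_or.
have neq x1 : (flat_exp 1 x1 != 0) = (0 < x1) by rewrite -flat_exp_gt0 [RHS]lt_neqAle flat_exp_ge0 andbT eq_sym.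
by rewrite !neq -ltrBlDl sub0r subr_gt0.
Qed.

End smooth_bump.

(** * Square roots of positive semidefinite matrices *)

Section psd_square_root.
Import spectral sesquilinear complex.
Context {R : realType}.
Local Notation C := (complex R).

Lemma lagrange_interpolation (f : R -> R) (s : seq R) : uniq s ->
  exists q : {poly R}, forall x, x \in s -> q.[x] = f x.
Proof.
elim: s => [|a s IH] /=; first by exists 0.
move=> /andP[as_ us]; have [q hq] := IH us.
pose p := \prod_(c <- s) ('X - c%:P).
have pa : p.[a] != 0 by rewrite -rootE root_prod_XsubC.
exists (q + ((f a - q.[a]) / p.[a]) *: p) => x; rewrite inE !hornerE.
move=> /predU1P[->|xs]; first by field.
have /eqP -> : p.[x] == 0 by rewrite -rootE root_prod_XsubC.
by rewrite mulr0 addr0 hq.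
Qed.

Lemma trmx_horner n (A : 'M[R]_n.+1) (q : {poly R}) : A^T = A ->
  (horner_mx A q)^T = horner_mx A q.
Proof.
move=> sA; elim/poly_ind: q => [|q c IH]; first by rewrite rmorph0 trmx0.
rewrite rmorphD rmorphM /= horner_mx_X horner_mx_C linearD /= tr_scalar_mx trmx_mul IH sA.
by congr (_ + _); have := comm_horner_mx2 A q 'X; rewrite horner_mx_X => /esym.
Qed.

Lemma similar_diagM (F : numClosedFieldType) n (P : 'M[F]_n) (d1 d2 : 'rV[F]_n) : P \in unitmx ->
  (invmx P *m diag_mx d1 *m P) *m (invmx P *m diag_mx d2 *m P) =
  invmx P *m diag_mx (\row_i (d1 0 i * d2 0 i)) *m P.
Proof.
move=> uP; rewrite -!mulmxA; congr (_ *m _); rewrite !mulmxA mulmxK//.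
by rewrite -mulmx_diag.
Qed.

Lemma similar_diagD (F : numClosedFieldType) n (P : 'M[F]_n) (d : 'rV[F]_n) (c : F) : P \in unitmx ->
  invmx P *m diag_mx d *m P + c%:M = invmx P *m diag_mx (\row_i (d 0 i + c)) *m P.
Proof.
move=> uP; have -> : c%:M = invmx P *m c%:M *m P.
  by rewrite -scalemx1 -scalemxAr mulmx1 -scalemxAl mulVmx.
rewrite -mulmxDl -mulmxDr; congr (_ *m _ *m _); apply/matrixP => i j; rewrite !mxE.
by case: eqP => _; rewrite ?mulr1n ?mulr0n ?addr0.
Qed.

Lemma dot_ge0 n (x : 'rV[R]_n) : 0 <= dot x x.
Proof. by apply: sumr_ge0 => i _; rewrite -expr2 sqr_ge0. Qed.

Lemma dot_eq0 n (x : 'rV[R]_n) : dot x x = 0 -> x = 0.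
Proof.
move=> h; apply/rowP => i; rewrite mxE.
have : x 0 i * x 0 i = 0.
  apply/eqP; rewrite -[_ == 0]/(_ == 0) eq_le -expr2 sqr_ge0 andbT expr2 -h /dot (bigD1 i)//= lerDl.
  by apply: sumr_ge0 => j _; rewrite -expr2 sqr_ge0.
by move/eqP; rewrite mulf_eq0 orbb => /eqP.
Qed.

Lemma similar_diag_ext (F : numClosedFieldType) n (P : 'M[F]_n) (d1 d2 : 'rV[F]_n) :
  (forall i, d1 0 i = d2 0 i) -> invmx P *m diag_mx d1 *m P = invmx P *m diag_mx d2 *m P.
Proof. by move=> /rowP ->. Qed.

(* A symmetric positive semidefinite matrix is annihilated by a polynomial with
   simple nonnegative real roots, so its functional calculus can be evaluated by
   Lagrange interpolation and stays real. *)
Lemma psd_calculus n (A : 'M[R]_n.+1) : A^T = A ->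
  (forall y, 0 <= dot y (mxact A y)) ->
  exists a : 'I_n.+1 -> R, (forall i, 0 <= a i) /\
  exists Phi : (R -> R) -> 'M[R]_n.+1,
    [/\ forall f, (Phi f)^T = Phi f,
        forall f g h, (forall i, f (a i) * g (a i) = h (a i)) -> Phi f *m Phi g = Phi h &
        forall f, (forall i, f (a i) = a i) -> Phi f = A].
Proof.
move=> sA pA.
pose rc : {rmorphism R -> C} := real_complex R.
have rcI : injective rc by move=> x y [].
pose Ac := map_mx rc A.
have hermA : Ac \is hermsymmx.
  apply: realsym_hermsym.
    apply/is_hermitianmxP; rewrite expr0 scale1r map_mx_id//.
    by rewrite /Ac map_trmx sA.
  by apply/mxOverP => i j; rewrite mxE; apply/complex_realP; exists (A i j).
pose P := spectralmx Ac; pose D := spectral_diag Ac.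
have uP : P \in unitmx by exact: spectral_unit.
have AE : Ac = invmx P *m diag_mx D *m P.
  by have /hermitian_normalmx/orthomx_spectralP := hermA.
have /boolp.choice[a aE] : forall i, exists x : R, D 0 i = rc x.
  move=> i.
  by have /mxOverP/(_ 0 i)/complex_realP := hermitian_spectral_diag_real hermA.
clearbody P D.
exists a; split.
  move=> i.
  have PA : P *m Ac = diag_mx D *m P.
    by rewrite AE -[invmx P *m _ *m P]mulmxA mulKVmx.
  pose v := row i P.
  have vA : v *m Ac = D 0 i *: v by rewrite /v -row_mul PA mul_diag_mx rowE; apply/rowP => j; rewrite -rowE !mxE.
  have v0 : v != 0.
    apply/negP => /eqP v0.
    have h : row i (P *m invmx P) = 0 by rewrite row_mul -/v v0 mul0mx.
    move: h; rewrite mulmxV// => /rowP/(_ i); rewrite !mxE eqxx => /eqP.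
    by rewrite oner_eq0.
  have ReM (z : C) (k : R) : Re (z * rc k) = Re z * k.
    by case: z => x y /=; rewrite mulr0 subr0.
  have ImM (z : C) (k : R) : Im (z * rc k) = Im z * k.
    by case: z => x y /=; rewrite mulr0 add0r.
  have ReD (s : seq 'I_n.+1) (F : 'I_n.+1 -> C) : Re (\sum_(j <- s) F j) = \sum_(j <- s) Re (F j).
    elim: s => [|j s IH]; first by rewrite !big_nil.
    by rewrite !big_cons -IH; case: (F j) => ? ?; case: (\sum_(_ <- s) _).
  have ImD (s : seq 'I_n.+1) (F : 'I_n.+1 -> C) : Im (\sum_(j <- s) F j) = \sum_(j <- s) Im (F j).
    elim: s => [|j s IH]; first by rewrite !big_nil.
    by rewrite !big_cons -IH; case: (F j) => ? ?; case: (\sum_(_ <- s) _).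
  have eig (w : 'rV[R]_n.+1) : w *m A = a i *: w -> w != 0 -> 0 <= a i.
    move=> wA w0; have := pA w; rewrite /mxact sA wA.
    have -> : dot w (a i *: w) = a i * dot w w.
      by rewrite /dot mulr_sumr; apply: eq_bigr => j _; rewrite mxE mulrCA.
    rewrite pmulr_lge0// lt_neqAle dot_ge0 andbT eq_sym.
    by apply: contra w0 => /eqP/dot_eq0 ->.
  (* The eigenvalue is real, so the real and imaginary parts of the complex eigenvector are real
     eigenvectors or zero, and they do not both vanish. *)
  pose x := \row_j Re (v 0 j); pose y := \row_j Im (v 0 j).
  have xA : x *m A = a i *: x.
    apply/rowP => j; have /rowP/(_ j) := vA; rewrite !mxE => /(congr1 (@Re R)).
    rewrite aE mulrC ReM [a i * _]mulrC => <-; rewrite ReD; apply: eq_bigr => k _.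
    by rewrite !mxE -ReM.
  have yA : y *m A = a i *: y.
    apply/rowP => j; have /rowP/(_ j) := vA; rewrite !mxE => /(congr1 (@Im R)).
    rewrite aE mulrC ImM [a i * _]mulrC => <-; rewrite ImD; apply: eq_bigr => k _.
    by rewrite !mxE -ImM.
  have [x0|x0] := eqVneq x 0; last exact: eig xA x0.
  have [y0|y0] := eqVneq y 0; last exact: eig yA y0.
  exfalso; move/negP: v0; apply; apply/eqP/rowP => j.
  have /rowP/(_ j) := x0; have /rowP/(_ j) := y0; rewrite !mxE.
  by case: (P i j) => /= p q -> ->.
have /boolp.choice[q hq] : forall f : R -> R, exists p : {poly R}, forall i, p.[a i] = f (a i).
  move=> f.
  have [p hp] := lagrange_interpolation f (undup_uniq [seq a i | i <- enum 'I_n.+1]).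
  by exists p => i; apply: hp; rewrite mem_undup map_f// mem_enum.
pose Phi f := horner_mx A (q f).
have hornerE p : map_mx rc (horner_mx A p) = invmx P *m diag_mx (\row_i rc p.[a i]) *m P.
  elim/poly_ind: p => [|p c IH].
    rewrite rmorph0 map_mx0 (_ : \row_i _ = 0); first by rewrite linear0 mulmx0 mul0mx.
    by apply/rowP => i; rewrite !mxE horner0 rmorph0.
  rewrite rmorphD rmorphM /= horner_mx_X horner_mx_C map_mxD map_mxM IH -/Ac AE.
  rewrite (@similar_diagM C _ P _ _ uP) map_scalar_mx (@similar_diagD C _ P _ _ uP).
  apply: similar_diag_ext => i; rewrite !mxE aE.
  by rewrite !hornerE rmorphD rmorphM.
have PhiE f : map_mx rc (Phi f) = invmx P *m diag_mx (\row_i rc (f (a i))) *m P.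
  rewrite /Phi hornerE; apply: similar_diag_ext => i.
  by rewrite !mxE hq.
have mapI (X Y : 'M[R]_n.+1) : map_mx rc X = map_mx rc Y -> X = Y.
  by move=> /matrixP h; apply/matrixP => i j; have := h i j; rewrite !mxE => /rcI.
exists Phi; split.
- by move=> f; exact: trmx_horner.
- move=> f g h fgh; apply: mapI; rewrite map_mxM !PhiE.
  rewrite (@similar_diagM C _ P _ _ uP).
  by apply: similar_diag_ext => i; rewrite !mxE -fgh rmorphM.
- move=> f fa; apply: mapI; rewrite PhiE -/Ac AE.
  by apply: similar_diag_ext => i; rewrite !mxE fa aE.
Qed.

Lemma mxsqrt_spec n (A : 'M[R]_n) : A^T = A -> (forall y, 0 <= dot y (mxact A y)) ->
  [/\ (mxsqrt A)^T = mxsqrt A, forall y, 0 <= dot y (mxact (mxsqrt A) y) &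
      mxsqrt A *m mxsqrt A = A].
Proof.
move=> sA pA; rewrite /mxsqrt; case: xgetP => [B -> //|/(_ _) h]; exfalso.
case: n A sA pA h => [|n] A sA pA h.
  (* In dimension 0 any matrix, [A] itself included, is its own square root. *)
  by apply: (h A); split => //; rewrite [LHS]flatmx0 [RHS]flatmx0.
have [a [a0 [Phi [PhiT PhiM PhiA]]]] := psd_calculus sA pA.
(* The fourth root is there for positivity: [Phi s2] is the square of the symmetric matrix [Phi s4],
   so its quadratic form is a sum of squares. *)
pose s2 x : R := Num.sqrt x; pose s4 x : R := Num.sqrt (Num.sqrt x).
have s44 : Phi s4 *m Phi s4 = Phi s2.
  by apply: PhiM => i; rewrite -expr2 sqr_sqrtr// sqrtr_ge0.
apply: (h (Phi s2)); split; first exact: PhiT.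
- move=> y; rewrite /mxact PhiT -s44.
  have -> : dot y (y *m (Phi s4 *m Phi s4)) = dot (y *m Phi s4) (y *m Phi s4).
    have dotE (x z : 'rV[R]_n.+1) : dot x z = (x *m z^T) 0 0.
      by rewrite mxE; apply: eq_bigr => i _; rewrite mxE.
    by rewrite !dotE !trmx_mul PhiT !mulmxA.
  exact: dot_ge0.
- rewrite (PhiM _ _ id) ?PhiA// => i.
  by rewrite -expr2 sqr_sqrtr.
Qed.

End psd_square_root.

(** * Calculus along coordinate lines *)

Section line_calculus.
Context {R : realType} {d : nat}.
Local Notation V := 'rV[R]_d.
Local Notation e_ i := (delta_mx 0 i : V).

Lemma smooth_coind (S : set (V -> R)) (f : V -> R) : S f ->
  (forall g, S g -> continuous g /\ forall i, S (partial i g) /\ forall x, derivable g x (e_ i)) ->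
  smooth f.
Proof.
move=> Sf hS s.
have h : S (foldr (@partial R d) f s).
  by elim: s => //= i s IH; exact: ((hS _ IH).2 i).1.
by split; [exact: (hS _ h).1|move=> i x; exact: ((hS _ h).2 i).2].
Qed.

Lemma smooth_partial f i : smooth f -> smooth (@partial R d i f).
Proof. by move=> h s; have := h (rcons s i); rewrite foldr_rcons. Qed.

Lemma smooth_continuous (f : V -> R) : smooth f -> continuous f.
Proof. by move=> /(_ [::])[]. Qed.

Lemma smooth_derivable (f : V -> R) i x : smooth f -> derivable f x (e_ i).
Proof. by move=> /(_ [::])[_]; exact. Qed.

Definition C1 (f : V -> R) := continuous f /\ forall i,
  (forall x, derivable f x (e_ i)) /\ continuous (partial i f).

Lemma smooth_C1 f : smooth f -> C1 f.
Proof.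
move=> h; split; first exact: smooth_continuous.
move=> i; split=> [x|]; first exact: smooth_derivable.
exact/smooth_continuous/smooth_partial.
Qed.

Lemma is_derive_partial (f : V -> R) i x : derivable f x (e_ i) ->
  is_derive x (e_ i) f (partial i f x).
Proof. by move=> h; split. Qed.

Lemma is_derive_line (f : V -> R) (x v : V) (t l : R) :
  is_derive (x + t *: v) v f l -> is_derive t (1 : R) (fun s : R => f (x + s *: v)) l.
Proof.
move=> /is_derive_cvgP h; apply: is_derive_cvg.
apply: cvg_trans h; apply: near_eq_cvg; near=> s.
congr (_ * (f _ - _)); rewrite -[s *: 1]/(s * 1) mulr1 scalerDl.
by rewrite addrCA.
Unshelve. all: by end_near. Qed.

Lemma line_MVT (f : V -> R) (x v : V) (g : V -> R) (h : R) :
  (forall y, is_derive y v f (g y)) ->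
  exists t : R, `|t| <= `|h| /\ f (x + h *: v) - f x = h * g (x + t *: v).
Proof.
move=> hd; pose F s := f (x + s *: v).
have dF s : is_derive s (1:R) F (g (x + s *: v)) by apply: is_derive_line.
have cF : continuous F.
  move=> s; apply: differentiable_continuous; apply/derivable1_diffP.
  by have [] := dF s.
have F0 : F 0 = f x by rewrite /F scale0r addr0.
have [h0|h0|->] := ltgtP h 0.
- have [|c] := @MVT R F (fun s => g (x + s *: v)) h 0 h0 => //.
    exact: continuous_subspaceT.
  rewrite in_itv /= => /andP[hc c0] E; exists c; split.
    by rewrite (ltr0_norm c0) (ltr0_norm h0) lerN2 ltW.
  by rewrite -F0 -opprB -/(F h) E sub0r mulrN opprK mulrC.
- have [|c] := @MVT R F (fun s => g (x + s *: v)) 0 h h0 => //.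
    exact: continuous_subspaceT.
  rewrite in_itv /= => /andP[hc c0] E; exists c; split.
    by rewrite (gtr0_norm h0) (gtr0_norm hc) ltW.
  by rewrite -F0 -/(F h) E subr0 mulrC.
- by exists 0; split => //; rewrite scale0r addr0 subrr mul0r.
Qed.

Lemma partial_MVT (f : V -> R) i (x : V) (h : R) :
  (forall x, derivable f x (e_ i)) ->
  exists t : R, `|t| <= `|h| /\ f (x + h *: e_ i) - f x = h * partial i f (x + t *: e_ i).
Proof. by move=> hd; apply: line_MVT => y; exact: is_derive_partial. Qed.

Lemma norm_delta_le (i : 'I_d) (t : R) : `|t *: e_ i| <= `|t|.
Proof.
rewrite [leLHS]mx_normrE; apply: bigmax_le => // -[j k] _ /=; rewrite !mxE.
by rewrite normrM ler_piMr//; case: (_ && _); rewrite ?normr1 ?normr0.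
Qed.

(** Exchanging the coordinates one after the other splits an increment of a function into increments
    along the axes, where the mean value theorem applies. *)
Definition rV_hybrid (x y : V) (k : nat) : V := \row_i if (i < k)%N then y 0 i else x 0 i.

Lemma rV_hybrid0 x y : rV_hybrid x y 0 = x.
Proof. by apply/rowP => i; rewrite mxE ltn0. Qed.

Lemma rV_hybridd x y : rV_hybrid x y d = y.
Proof. by apply/rowP => i; rewrite mxE ltn_ord. Qed.

Lemma rV_hybridS x y (i : 'I_d) : rV_hybrid x y i.+1 = rV_hybrid x y i + (y 0 i - x 0 i) *: e_ i.
Proof.
apply/rowP => j; rewrite !mxE eqxx /= ltnS leq_eqVlt.
have [->|ij] := eqVneq j i; first by rewrite eqxx ltnn mulr1 addrC subrK.
by rewrite (negbTE (_ : (j : nat) != i)) ?mulr0 ?addr0.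
Qed.

Lemma rV_hybrid_telescope (F : V -> R) x y :
  F y - F x = \sum_(i < d) (F (rV_hybrid x y i.+1) - F (rV_hybrid x y i)).
Proof.
rewrite -(big_mkord xpredT (fun i => F (rV_hybrid x y i.+1) - F (rV_hybrid x y i))).
by rewrite telescope_sumr// rV_hybridd rV_hybrid0.
Qed.

Lemma coord_le_norm (x : V) i : `|x 0 i| <= `|x|.
Proof.
by rewrite [leRHS]mx_normrE; apply: (le_trans _ (le_bigmax _ _ (0, i))).
Qed.

Lemma hybrid_dist (x y : V) k : `|rV_hybrid x y k - x| <= `|y - x|.
Proof.
rewrite [leLHS]mx_normrE; apply: bigmax_le => // -[j i] _ /=; rewrite !mxE ord1.
case: ifP => _; last by rewrite subrr normr0.
by have := coord_le_norm (y - x) i; rewrite !mxE.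
Qed.

Lemma bounded_partial_lipschitz (f : V -> R) (M : R) :
  (forall i x, derivable f x (e_ i)) -> (forall i x, `|partial i f x| <= M) ->
  forall x y, `|f y - f x| <= (M * d%:R) * `|y - x|.
Proof.
move=> hd hM x y; rewrite rV_hybrid_telescope.
apply: (le_trans (ler_norm_sum _ _ _)).
apply: (@le_trans _ _ (\sum_(i < d) M * `|y - x|)); last first.
  by rewrite sumr_const card_ord -mulrnAl mulr_natr.
apply: ler_sum => i _; rewrite rV_hybridS.
have [t [_ ->]] := partial_MVT (rV_hybrid x y i) (y 0 i - x 0 i) (hd i).
rewrite normrM mulrC; apply: ler_pM => //.
by have := coord_le_norm (y - x) i; rewrite !mxE.
Qed.

Lemma C1_frechet (f : V -> R) (x : V) (e : R) : C1 f -> 0 < e -> exists r : R, 0 < r /\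
  forall y, `|y - x| <= r ->
  `|f y - f x - \sum_(i < d) partial i f x * (y 0 i - x 0 i)| <= e * `|y - x|.
Proof.
move=> [_ hf] e0.
have e1 : 0 < e / d.+1%:R by rewrite divr_gt0.
have near_i i : exists r : R, 0 < r /\ forall y, `|y - x| < r -> `|partial i f y - partial i f x| <= e / d.+1%:R.
  have /cvgrPdist_le/(_ _ e1) := (hf i).2 x.
  move=> /nbhs_normP[r /= r0 hr]; exists r; split => // y xy.
  by rewrite distrC; apply: hr => /=; rewrite distrC.
have /boolp.choice[r hr] := near_i.
pose r0 := \big[Num.min/1]_(i < d) (r i).
have r00 : 0 < r0.
  rewrite /r0; elim/big_ind: _ => // [a b a0 b0|i _]; first by rewrite lt_min a0 b0.
  by have [] := hr i.
have r0i i : r0 <= r i by rewrite /r0 (bigD1 i)//= ge_min lexx.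
(* The intermediate points are at most twice as far from [x] as [y] is, so this radius keeps them
   within [r0]. *)
exists (r0 / 4); split; first by rewrite divr_gt0.
move=> y xy; rewrite rV_hybrid_telescope -sumrB.
apply: (le_trans (ler_norm_sum _ _ _)).
apply: (@le_trans _ _ (\sum_(i < d) (e / d.+1%:R) * `|y - x|)); last first.
  rewrite sumr_const card_ord -mulrnAl; apply: ler_wpM2r => //.
  rewrite -mulrnAl -mulr_natr -mulrA ler_piMr ?(ltW e0)//.
  by rewrite ler_pdivrMr// mul1r ler_nat.
apply: ler_sum => i _; rewrite rV_hybridS.
have [t [ht ->]] := partial_MVT (rV_hybrid x y i) (y 0 i - x 0 i) (hf i).1.
rewrite mulrC -mulrBl normrM; apply: ler_pM => //; last first.
  by have := coord_le_norm (y - x) i; rewrite !mxE.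
have [_ h] := hr i; apply: h.
rewrite addrAC; apply: (@le_lt_trans _ _ (`|y - x| + `|y - x|)).
  apply: (le_trans (ler_normD _ _)); apply: lerD; first exact: hybrid_dist.
  apply: (le_trans (norm_delta_le _ _)); apply: (le_trans ht).
  by have := coord_le_norm (y - x) i; rewrite !mxE.
have := r0i i; clearbody r0; clear -xy r00; lra.
Qed.

Lemma C1M f g : C1 f -> C1 g -> C1 (fun x => f x * g x).
Proof.
move=> [cf hf] [cg hg]; split; first by move=> x; exact: cvgM (cf x) (cg x).
move=> i; have D x := @is_deriveM _ _ f g x (e_ i) _ _
  (is_derive_partial ((hf i).1 x)) (is_derive_partial ((hg i).1 x)).
have E : partial i (fun x => f x * g x) = fun x => f x * partial i g x + g x * partial i f x.
  by apply/funext => x; rewrite /partial; case: (D x).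
split; first by move=> x; case: (D x).
rewrite E => x.
have c1 := @continuousM R V f (partial i g) x (cf x) ((hg i).2 x).
have c2 := @continuousM R V g (partial i f) x (cg x) ((hf i).2 x).
exact: (continuousD c1 c2).
Qed.

Lemma partialM (f g : V -> R) i x : derivable f x (e_ i) -> derivable g x (e_ i) ->
  partial i (fun x => f x * g x) x = f x * partial i g x + g x * partial i f x.
Proof.
move=> hf hg; rewrite /partial.
by case: (@is_deriveM _ _ f g x (e_ i) _ _ (is_derive_partial hf) (is_derive_partial hg)).
Qed.

Lemma partialD (f g : V -> R) i x : derivable f x (e_ i) -> derivable g x (e_ i) ->
  partial i (fun x => f x + g x) x = partial i f x + partial i g x.
Proof. by move=> hf hg; rewrite /partial -deriveD. Qed.

Lemma partial_coord i j x : is_derive x (e_ i) (fun y : V => y 0 j) ((i == j)%:R : R).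
Proof.
apply: (@is_derive_quadratic _ _ _ _ _ _ 0) => h.
by rewrite !mxE eqxx /= mul0r eq_sym addrK subrr normr0.
Qed.

Lemma third_add_lt (m : R) : 0 < m -> m / 3 + m / 3 < m.
Proof. by move=> ?; lra. Qed.

Lemma dist_half_half (e a b c : R) : `|a - b| <= e / 2 -> `|a - c| <= e / 2 -> `|b - c| <= e.
Proof. by rewrite !ler_norml => /andP[? ?] /andP[? ?]; apply/andP; split; lra. Qed.

Lemma smooth_schwarz (f : V -> R) i j x : smooth f -> partial i (partial j f) x = partial j (partial i f) x.
Proof.
move=> sf; apply/eqP; rewrite -subr_eq0 -normr_le0; apply/ler_addgt0Pl => e e0.
rewrite addr0.
have e20 : 0 < e / 2 by rewrite divr_gt0.
have cont k l : exists r : R, 0 < r /\ forall y, `|y - x| < r ->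
  `|partial k (partial l f) y - partial k (partial l f) x| <= e / 2.
  have c : continuous (partial k (partial l f)).
    by apply: smooth_continuous; do 2 apply: smooth_partial.
  have /cvgrPdist_le/(_ _ e20) := c x.
  move=> /nbhs_normP[r /= r0 hr]; exists r; split => // y xy.
  by rewrite distrC; apply: hr => /=; rewrite distrC.
have [r1 [r10 h1]] := cont i j; have [r2 [r20 h2]] := cont j i.
(* The points provided by the mean value theorem lie within [2 * h] of [x], which has to stay below
   both radii. *)
pose h := Num.min r1 r2 / 3.
have h0 : 0 < h by rewrite divr_gt0// lt_min r10 r20.
(* Both iterated second differences of [f] equal [h^2] times a mixed derivative at a nearby point. *)
have sd k l : exists y : V, `|y - x| <= h + h /\
  f (x + h *: e_ k + h *: e_ l) - f (x + h *: e_ k) - (f (x + h *: e_ l) - f x) =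
  h * (h * partial l (partial k f) y).
  pose F y := f (y + h *: e_ l) - f y.
  have dF y : is_derive y (e_ k) F (partial k f (y + h *: e_ l) - partial k f y).
    have d1 := is_derive_partial (@smooth_derivable f k y sf).
    have d2 : is_derive y (e_ k) (fun y => f (y + h *: e_ l)) (partial k f (y + h *: e_ l)).
      have /is_derive_cvgP c := is_derive_partial (@smooth_derivable f k (y + h *: e_ l) sf).
      apply: is_derive_cvg; apply: cvg_trans c; apply: near_eq_cvg; near=> t.
      by rewrite addrA.
    exact: is_deriveB.
  have [t [ht E]] := line_MVT x h dF.
  have [s [hs Es]] := partial_MVT (x + t *: e_ k) h (fun y => @smooth_derivable _ l y (@smooth_partial f k sf)).
  exists (x + t *: e_ k + s *: e_ l); split; last by rewrite -Es -E.
  rewrite -[x + _ + _]addrA [x + _]addrC addrK; apply: (le_trans (ler_normD _ _)).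
  have hh : `|h| = h by rewrite gtr0_norm.
  by apply: lerD; apply: (le_trans (norm_delta_le _ _)); rewrite -hh.
have [y1 [y1x E1]] := sd i j; have [y2 [y2x E2]] := sd j i.
have E : partial j (partial i f) y1 = partial i (partial j f) y2.
  have E3 : h * (h * partial j (partial i f) y1) = h * (h * partial i (partial j f) y2).
    have sw (a b c w : R) : a - b - (c - w) = a - c - (b - w) by ring.
    refine (etrans (esym E1) (etrans _ E2)); clear -sw; clearbody h.
    have -> : x + h *: e_ i + h *: e_ j = x + h *: e_ j + h *: e_ i by exact: addrAC.
    exact: sw.
  have hn : h != 0 by rewrite gt_eqF.
  by move: E3 => /(mulfI hn)/(mulfI hn).
have hm : h + h < Num.min r1 r2 by apply: third_add_lt; rewrite lt_min r10 r20.
have hr1 : h + h < r1 by apply: (lt_le_trans hm); rewrite ge_min lexx.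
have hr2 : h + h < r2 by apply: (lt_le_trans hm); rewrite ge_min lexx orbT.
have := h1 _ (le_lt_trans y2x hr1); have := h2 _ (le_lt_trans y1x hr2).
rewrite E => p1 p2; exact: dist_half_half p2 p1.
Unshelve. all: by end_near. Qed.

End line_calculus.

(** * Translations in L2 *)

Section L2_dominated.
Context {R : realType} {n : nat}.
Local Notation V := 'rV[R]_n.
Local Notation leb := (@lebesgue_rV R n).

Lemma normL2_cvg0 (E : set V) (F : nat -> V -> R) :
  \int[leb]_(x in E) (F k x ^+ 2) @[k --> \oo] --> (0 : R) -> normL2 E (F k) @[k --> \oo] --> (0 : R).
Proof.
move=> /cvgrPdist_le h; apply/cvgrPdist_le => e e0.
have e20 : 0 < e ^+ 2 by rewrite exprn_gt0.
have := h _ e20; apply: filterS => k; rewrite !sub0r !normrN => hk.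
rewrite ger0_norm ?sqrtr_ge0// -(@ler_pXn2r _ 2)// ?nnegrE ?sqrtr_ge0 ?(ltW e0)//.
by rewrite normL2_sq; exact: le_trans (ler_norm _) hk.
Qed.

Lemma L2_dct (E : set V) (F : nat -> V -> R) (f g : V -> R) : measurable E ->
  (forall k, measurable_fun E (F k)) -> measurable_fun E f -> L2 E g ->
  ae_on E (fun x => F k x @[k --> \oo] --> f x) ->
  (forall k, ae_on E (fun x => `|F k x| <= g x)) ->
  L2 E f /\ normL2 E (fun x => F k x - f x) @[k --> \oo] --> (0 : R).
Proof.
move=> mE mF mf Lg cF Fg.
have fg : ae_on E (fun x => `|f x| <= g x).
  apply: ae_on_imp (ae_on_and cF (ae_on_nat Fg)) => x _ [c h].
  have c2 : `|F k x| @[k --> \oo] --> `|f x| by exact: cvg_norm.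
  by rewrite -(cvg_lim (@Rhausdorff R) c2); apply: limr_le; [exact: cvgP c2|exact: nearW].
have Lf : L2 E f.
  by apply: (L2_le mE mf _ Lg); apply: ae_on_imp fg => x _ h; exact: le_trans h (ler_norm _).
split => //; apply: normL2_cvg0.
pose G k x := (F k x - f x) ^+ 2.
have mG k : measurable_fun E (G k) by apply: measurable_funX; exact: measurable_funB.
have cG : ae_on E (fun x => G k x @[k --> \oo] --> (fun=> (0 : R)) x).
  apply: ae_on_imp cF => x _ c.
  have c0 : F k x - f x @[k --> \oo] --> (0 : R).
    by rewrite -[X in _ --> X](subrr (f x)); apply: cvgB => //; exact: cvg_cst.
  rewrite -[X in _ --> X](mulr0 (0 : R)); exact: (cvgM c0 c0).
have bG k : ae_on E (fun x => `|G k x| <= 4 * g x ^+ 2).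
  apply: ae_on_imp (ae_on_and (Fg k) fg) => x _ [h1 h2].
  rewrite ger0_norm ?sqr_ge0// /G -[(F k x - f x) ^+ 2]real_normK ?num_real//.
  have h3 : `|F k x - f x| <= 2 * g x.
    by apply: (le_trans (ler_normB _ _)); lra.
  have -> : 4 * g x ^+ 2 = (2 * g x) ^+ 2 by ring.
  by rewrite ler_pXn2r// ?nnegrE//; exact: le_trans h3.
have i4 : intble E (fun x => 4 * g x ^+ 2) by apply: intbleZ => //; exact: Lg.2.
have [_ h] := Rint_dct mE mG (measurable_cst _) i4 cG bG.
move: h; apply: cvg_trans; apply: near_eq_cvg; near=> k.
by apply: eq_Rintegral => x _; rewrite subr0 ger0_norm ?sqr_ge0.
Unshelve. all: by end_near. Qed.

End L2_dominated.

Section translation_continuity.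
Context {R : realType} {n : nat}.
Local Notation V := 'rV[R]_n.
Local Notation leb := (@lebesgue_rV R n).
Local Notation T := [set: V].
Implicit Types (f g : V -> R) (z : V).

Definition translate z f : V -> R := fun x => f (x + z).

Let mT : measurable T. Proof. exact: measurableT. Qed.
Let sp := @L2_sip R n T mT.

Lemma L2_translate z f : L2 T f -> L2 T (translate z f).
Proof.
move=> [mf fi]; split.
  by apply: (measurableT_comp mf); exact: measurable_shift_rV.
exact: (@integrable_shift R n z (fun x => (f x ^+ 2)%:E) fi).
Qed.

Lemma normL2_translate z f : L2 T f -> normL2 T (translate z f) = normL2 T f.
Proof.
move=> [mf fi]; congr Num.sqrt.
have := @Rintegral_shift R n z (fun x => f x ^+ 2) fi.
rewrite /ip => <-.
by apply: eq_Rintegral => x _; rewrite expr2.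
Qed.

(** Continuity of translations in L2 is proved by closure properties: it passes to linear
    combinations, to products of functions bounded by 1 and to dominated limits, hence from
    Lipschitz functions of bounded support to localized indicators, simple functions and finally all
    of L2. *)
Definition L2_uc f := L2 T f /\ forall e : R, 0 < e -> exists r : R, 0 < r /\
  forall z, `|z| < r -> normL2 T (translate z f - f) <= e.

Lemma normL2_le f g : L2 T f -> L2 T g -> (forall x, `|f x| <= `|g x|) -> normL2 T f <= normL2 T g.
Proof.
move=> hf hg fg; rewrite /normL2 ler_wsqrtr//; apply: Rint_le => //; try exact: L2M.
move=> x _; rewrite -!expr2 -real_normK ?num_real// -[leRHS]real_normK ?num_real//.
by rewrite ler_pXn2r ?nnegrE.
Qed.

Lemma normL2D f g : L2 T f -> L2 T g -> normL2 T (f + g) <= normL2 T f + normL2 T g.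
Proof. exact: (sip_triangle sp). Qed.

Lemma normL2Z a f : L2 T f -> normL2 T (a *: f) = `|a| * normL2 T f.
Proof. exact: (sip_normZ sp). Qed.

Lemma L2_ucD f g : L2_uc f -> L2_uc g -> L2_uc (f + g).
Proof.
move=> [Lf hf] [Lg hg]; split; first exact: L2_add.
move=> e e0; have e20 : 0 < e / 2 by rewrite divr_gt0.
have [r [r0 hr]] := hf _ e20; have [s [s0 hs]] := hg _ e20.
exists (Num.min r s); rewrite lt_min r0 s0; split => // z; rewrite lt_min => /andP[zr zs].
have -> : translate z (f + g) - (f + g) = (translate z f - f) + (translate z g - g).
  by apply/funext => x; rewrite /translate !fctE opprD addrACA.
apply: (le_trans (normL2D _ _)); try by apply: L2_sub => //; exact: L2_translate.
by rewrite (splitr e) lerD ?hr ?hs.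
Qed.

Lemma L2_ucZ a f : L2_uc f -> L2_uc (a *: f).
Proof.
move=> [Lf hf]; split; first exact: L2_scale.
move=> e e0; have a0 : 0 < `|a| + 1 by rewrite ltr_pwDr.
have [r [r0 hr]] := hf _ (divr_gt0 e0 a0); exists r; split => // z zr.
have -> : translate z (a *: f) - (a *: f) = a *: (translate z f - f).
  by apply/funext => x; rewrite /translate !fctE scalerBr.
rewrite normL2Z; last by apply: L2_sub => //; exact: L2_translate.
apply: (@le_trans _ _ ((`|a| + 1) * (e / (`|a| + 1)))).
  by apply: ler_pM => //; rewrite ?sqrtr_ge0 ?lerDl ?hr.
by rewrite mulrC divfK// gt_eqF.
Qed.

Lemma L2_uc_lim f : L2 T f -> (forall e : R, 0 < e -> exists g, L2_uc g /\ normL2 T (f - g) <= e) -> L2_uc f.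
Proof.
move=> Lf h; split => // e e0; have e30 : 0 < e / 3 by rewrite divr_gt0.
have [g [[Lg hg] fg]] := h _ e30; have [r [r0 hr]] := hg _ e30.
exists r; split => // z zr.
have Lfg : L2 T (f - g) by exact: L2_sub.
have -> : translate z f - f = translate z (f - g) + ((translate z g - g) + (-1) *: (f - g)).
  by apply/funext => x; rewrite /translate !fctE scaleN1r; ring.
have L1 := L2_translate z Lfg.
have L2' : L2 T (translate z g - g) by apply: L2_sub => //; exact: L2_translate.
have L3 : L2 T (-1 *: (f - g)) by exact: L2_scale.
apply: (le_trans (normL2D L1 (L2_add mT L2' L3))).
rewrite normL2_translate//; have := normL2D L2' L3; rewrite normL2Z// normrN1 mul1r.
by have := hr _ zr; lra.
Qed.

Lemma L2_uc_seq f (F : nat -> V -> R) g : L2 T g -> measurable_fun T f ->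
  (forall k, L2_uc (F k)) -> (forall k x, `|F k x| <= g x) ->
  (forall x, F k x @[k --> \oo] --> f x) -> L2_uc f.
Proof.
move=> Lg mf hF Fg cF.
have [Lf h] := L2_dct mT (fun k => (hF k).1.1) mf Lg (ae_on_all (fun x _ => cF x))
  (fun k => ae_on_all (fun x _ => Fg k x)).
apply: L2_uc_lim => // e e0.
have /cvgrPdist_le/(_ _ e0)/filter_ex[k] := h; rewrite sub0r normrN => hk.
exists (F k); split => //.
have -> : f - F k = -1 *: (fun x => F k x - f x).
  by apply/funext => x; rewrite !fctE scaleN1r opprB.
rewrite normL2Z; last by apply: L2_sub => //; exact: (hF k).1.
by rewrite normrN1 mul1r; exact: le_trans (ler_norm _) hk.
Qed.

Lemma L2_ucM f g : (forall x, `|f x| <= 1) -> (forall x, `|g x| <= 1) ->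
  L2_uc f -> L2_uc g -> L2_uc (fun x => f x * g x).
Proof.
move=> f1 g1 [Lf hf] [Lg hg].
have bm h1 h2 : (forall x, `|h1 x| <= 1) -> L2 T h1 -> L2 T h2 ->
    L2 T (fun x => h1 x * h2 x) /\ normL2 T (fun x => h1 x * h2 x) <= normL2 T h2.
  move=> b1 L1 L2h; have LL : L2 T (fun x => h1 x * h2 x).
    by apply: (@L2_bounded_mul _ _ _ _ _ 1) => //; [exact: L1.1|exact: ae_on_all].
  split => //; apply: normL2_le => // x; rewrite normrM ler_piMl//.
split; first by have [] := bm f g f1 Lf Lg.
move=> e e0; have e20 : 0 < e / 2 by rewrite divr_gt0.
have [r [r0 hr]] := hf _ e20; have [s [s0 hs]] := hg _ e20.
exists (Num.min r s); rewrite lt_min r0 s0; split => // z; rewrite lt_min => /andP[zr zs].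
have -> : translate z (fun x => f x * g x) - (fun x => f x * g x) =
  (fun x => translate z g x * (translate z f - f) x) + (fun x => f x * (translate z g - g) x).
  by apply/funext => x; rewrite /translate !fctE; ring.
have L1 := L2_sub mT (L2_translate z Lf) Lf.
have L2' := L2_sub mT (L2_translate z Lg) Lg.
have [A1 A2] := bm (translate z g) _ (fun x => g1 (x + z)) (L2_translate z Lg) L1.
have [B1 B2] := bm f _ f1 Lf L2'.
apply: (le_trans (normL2D A1 B1)); rewrite (splitr e); apply: lerD.
  exact: le_trans A2 (hr _ zr).
exact: le_trans B2 (hs _ zs).
Qed.

Definition lipschitz_fun f := exists L : R, 0 <= L /\ forall x y, `|f y - f x| <= L * `|y - x|.

Lemma lipschitz_fun_continuous f : lipschitz_fun f -> continuous f.
Proof.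
move=> [L [L0 hL]] x.
apply/(@cvgrPdist_le R R V (nbhs (x : V)) (nbhs_filter (x : V)) f (f x)) => e e0.
have e1 : 0 < e / (L + 1) by rewrite divr_gt0// ltr_wpDl.
have := @nbhsx_ballx R V x _ e1; apply: filterS => y; rewrite -ball_normE /= => xy.
apply: (le_trans (hL _ _)).
apply: (@le_trans _ _ ((L + 1) * `|x - y|)); first by rewrite ler_wpM2r// lerDl.
by rewrite mulrC -ler_pdivlMr ?ltr_wpDl// ltW.
Qed.

Lemma lipschitz_fun_measurable f : lipschitz_fun f -> measurable_fun T f.
Proof. by move=> /lipschitz_fun_continuous; exact: continuous_measurable_rV. Qed.

Lemma lipschitz_funM f g : (forall x, `|f x| <= 1) -> (forall x, `|g x| <= 1) ->
  lipschitz_fun f -> lipschitz_fun g -> lipschitz_fun (fun x => f x * g x).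
Proof.
move=> f1 g1 [L [L0 hL]] [K [K0 hK]]; exists (L + K); rewrite addr_ge0//; split => // x y.
have -> : f y * g y - f x * g x = g y * (f y - f x) + f x * (g y - g x) by ring.
apply: (le_trans (ler_normD _ _)); rewrite mulrDl !normrM; apply: lerD.
  by apply: le_trans (hL x y); rewrite ler_piMl.
by apply: le_trans (hK x y); rewrite ler_piMl.
Qed.

Definition cball0 (M : R) : set V := [set x | `|x| <= M].

Lemma closed_cball0 M : closed (cball0 M).
Proof.
rewrite (_ : cball0 M = (fun x : V => `|x|) @^-1` [set r | r <= M])//.
apply: closed_comp; last exact: closed_le.
by move=> x _; exact: norm_continuous.
Qed.

Lemma measurable_cball0 M : measurable (cball0 M).
Proof. by apply: closed_measurable_rV; exact: closed_cball0. Qed.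

Lemma cball0_fin M : (leb (cball0 M) < +oo)%E.
Proof.
apply: bounded_lebesgue; first exact: measurable_cball0.
by exists M; split; rewrite ?num_real// => K MK x /= xM; exact: le_trans xM (ltW MK).
Qed.

Lemma L2_indic (A : set V) : measurable A -> (leb A < +oo)%E -> L2 T (\1_A : V -> R).
Proof.
move=> mA fA; split; first exact: measurable_indic.
have -> : (fun x : V => ((\1_A x : R) ^+ 2)%:E) = (fun x => (\1_A x)%:E).
  by apply/funext => x; rewrite indicE; case: (x \in A); rewrite ?expr1n ?expr0n.
apply/integrableP; split.
  by apply/measurable_EFinP; exact: measurable_indic.
rewrite (eq_integral (fun x => (\1_A x)%:E)); last by move=> x _; rewrite gee0_abs// lee_fin indicE.
by rewrite integral_indic// setIT.
Qed.

(** For shifts [z] of norm at most 1 the difference vanishes outside the ball of radius [M + 1] and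
    is bounded by [L] times the norm of [z]. *)
Lemma L2_uc_lipschitz f M : lipschitz_fun f -> (forall x, M < `|x| -> f x = 0) -> L2_uc f.
Proof.
move=> lf f0; have mf := lipschitz_fun_measurable lf.
have [L [L0 hL]] := lf.
have ind_le (h : V -> R) K c : 0 <= c -> (forall x, K < `|x| -> h x = 0) -> (forall x, `|h x| <= c) ->
    forall x, `|h x| <= `|(c *: (\1_(cball0 K) : V -> R)) x|.
  move=> c0 h0 hc x; rewrite -[(_ *: _) x]/(c * \1_(cball0 K) x) indicE.
  have [xK|xK] := leP `|x| K; last by rewrite h0// normr0.
  have -> : x \in cball0 K by rewrite inE.
  by rewrite mulr1 [leRHS]ger0_norm.
have M0 : 0 <= `|M| by [].
pose B := L * (`|M| + 1 + (`|M| + 1)).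
have B0 : 0 <= B by rewrite mulr_ge0// !addr_ge0.
have L2c K c : L2 T (c *: (\1_(cball0 K) : V -> R)).
  by apply: L2_scale => //; apply: L2_indic; [exact: measurable_cball0|exact: cball0_fin].
have fB x : `|f x| <= `|f 0| + B.
  have [xM|xM] := leP `|x| M; last by rewrite f0// normr0 addr_ge0.
  rewrite -[f x](subrK (f 0)) addrC; apply: (le_trans (ler_normD _ _)); rewrite lerD2l.
  apply: (le_trans (hL _ _)); apply: ler_wpM2l => //; rewrite subr0.
  by have := ler_norm M; lra.
have Lf : L2 T f.
  apply: (L2_le mT mf _ (L2c M (`|f 0| + B))); apply: ae_on_all => x _.
  by apply: ind_le => //; rewrite addr_ge0.
split => // e e0.
pose N := normL2 T (\1_(cball0 (M + 1)) : V -> R).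
have N0 : 0 <= N by exact: sqrtr_ge0.
exists (Num.min 1 (e / ((L + 1) * (N + 1)))).
have LN : 0 < (L + 1) * (N + 1) by rewrite mulr_gt0// ltr_wpDl.
rewrite lt_min ltr01 divr_gt0//; split => // z; rewrite lt_min => /andP[z1 ze].
apply: (@le_trans _ _ (normL2 T ((L * `|z|) *: (\1_(cball0 (M + 1)) : V -> R)))).
  apply: normL2_le => //; first by apply: L2_sub => //; exact: L2_translate.
  apply: ind_le; first by rewrite mulr_ge0.
    move=> x xM; rewrite -[(_ - _) x]/(f (x + z) - f x) !f0 ?subrr//.
      by apply: lt_trans xM; rewrite ltrDl.
    have := ler_normB (x + z) z; rewrite addrK; lra.
  move=> x; rewrite -[(_ - _) x]/(f (x + z) - f x); apply: (le_trans (hL _ _)).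
  by rewrite addrC addKr.
rewrite normL2Z; last by apply: L2_indic; [exact: measurable_cball0|exact: cball0_fin].
rewrite -/N ger0_norm ?mulr_ge0// mulrAC.
move: ze; rewrite ltr_pdivlMr// => /ltW; apply: le_trans; rewrite mulrC ler_wpM2l//.
by rewrite ler_pM// lerDl.
Qed.

Definition cutoff (M : R) : V -> R := fun x => Num.max 0 (Num.min 1 (M + 1 - `|x|)).

Lemma clamp_lip (a b : R) : `|Num.max 0 (Num.min 1 a) - Num.max 0 (Num.min 1 b)| <= `|a - b|.
Proof.
rewrite /Num.max /Num.min ler_norml; case: (ltP 1 a) => ?; case: (ltP 1 b) => ?;
  case: ltP => ?; case: ltP => ?; have := ler_norm (a - b); have := ler_norm (b - a);
  rewrite (distrC b a) => ? ?; apply/andP; split; lra.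
Qed.

Lemma clamp01 (a : R) : 0 <= Num.max 0 (Num.min 1 a) <= 1.
Proof. by rewrite le_max lexx ge_max ler01 ge_min lexx. Qed.

Lemma cutoff01 M x : `|cutoff M x| <= 1.
Proof. by have /andP[? ?] := clamp01 (M + 1 - `|x|); rewrite ger0_norm. Qed.

Lemma cutoff_lip M : lipschitz_fun (cutoff M).
Proof.
exists 1; split => // x y; apply: (le_trans (clamp_lip _ _)); rewrite mul1r.
rewrite (_ : _ - _ = `|x| - `|y|); last by ring.
by rewrite distrC; exact: ler_dist_dist.
Qed.

Lemma cutoff0 M x : M + 1 < `|x| -> cutoff M x = 0.
Proof. by move=> h; rewrite /cutoff max_l// ge_min; apply/orP; right; lra. Qed.

Lemma cutoff1 M x : `|x| <= M -> cutoff M x = 1.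
Proof. by move=> h; rewrite /cutoff min_l ?max_r//; lra. Qed.

Lemma cutoffM M x : cutoff M x * cutoff (M + 2) x = cutoff M x.
Proof.
have [h|h] := ltP (M + 1) `|x|; first by rewrite cutoff0// mul0r.
by rewrite (@cutoff1 (M + 2)) ?mulr1//; lra.
Qed.

Lemma L2_uc_cutoff M : L2_uc (cutoff M).
Proof. by apply: (@L2_uc_lipschitz _ (M + 1)); [exact: cutoff_lip|exact: cutoff0]. Qed.

(** The cutoff makes the indicator of a set of infinite measure square integrable. The sets with
    this property form a sigma-algebra that contains the half-spaces. *)
Definition uc_set : set (set V) :=
  [set A | measurable A /\ forall M : R, L2_uc (fun x => \1_A x * cutoff M x)].

Lemma uc_setC A : uc_set A -> uc_set (~` A).
Proof.
move=> [mA hA]; split; first exact: measurableC.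
move=> M; have := L2_ucD (L2_uc_cutoff M) (L2_ucZ (-1) (hA M)).
congr L2_uc; apply/funext => x; rewrite !fctE scaleN1r !indicE in_setC.
by case: (x \in A) => /=; rewrite ?mul1r ?mul0r ?subrr ?subr0.
Qed.

Lemma indic_cutoff01 (A : set V) M x : `|\1_A x * cutoff M x| <= 1.
Proof.
rewrite normrM indicE; case: (x \in A); rewrite ?normr1 ?normr0 ?mul1r ?mul0r//.
exact: cutoff01.
Qed.

Lemma uc_setI A B : uc_set A -> uc_set B -> uc_set (A `&` B).
Proof.
move=> [mA hA] [mB hB]; split; first exact: measurableI.
(* [cutoff (M + 2)] equals 1 wherever [cutoff M] is nonzero, so the product of the two localized
   indicators is localized by [cutoff M] alone. *)
move=> M; have := L2_ucM (indic_cutoff01 A M) (indic_cutoff01 B (M + 2)) (hA M) (hB (M + 2)).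
congr L2_uc; apply/funext => x; rewrite !indicE in_setI.
case: (x \in A); case: (x \in B); rewrite /= ?mul1r ?mul0r ?mulr0//.
exact: cutoffM.
Qed.

Lemma uc_setU A B : uc_set A -> uc_set B -> uc_set (A `|` B).
Proof.
move=> hA hB; rewrite -[A `|` B]setCK setCU; apply: uc_setC.
by apply: uc_setI; exact: uc_setC.
Qed.

Lemma uc_set_lim (F : nat -> V -> R) (A : set V) : measurable A ->
  (forall k M, L2_uc (fun x => F k x * cutoff M x)) -> (forall k x, `|F k x| <= 1) ->
  (forall x, F k x @[k --> \oo] --> (\1_A x : R)) -> uc_set A.
Proof.
move=> mA hF F1 cF; split => // M.
apply: (@L2_uc_seq _ (fun k x => F k x * cutoff M x) (cutoff M)) => //.
- exact: (L2_uc_cutoff M).1.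
- apply: measurable_funM; first exact: measurable_indic.
  by apply: lipschitz_fun_measurable; exact: cutoff_lip.
- move=> k x; have /andP[c0 _] := clamp01 (M + 1 - `|x|).
  by rewrite normrM (ger0_norm (c0 : 0 <= cutoff M x)) ler_piMl.
- by move=> x; apply: cvgM; [exact: cF|exact: cvg_cst].
Qed.

Lemma uc_set0 : uc_set set0.
Proof.
split => // M; have := L2_ucZ 0 (L2_uc_cutoff M); congr L2_uc; apply/funext => x.
by rewrite -[LHS]/(0 * cutoff M x) indicE in_set0.
Qed.

Lemma uc_set_bigcup (F : nat -> set V) : (forall k, uc_set (F k)) -> uc_set (\bigcup_k F k).
Proof.
move=> hF; have hU k : uc_set (\big[setU/set0]_(i < k) F i).
  elim: k => [|k IH]; first by rewrite big_ord0; exact: uc_set0.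
  by rewrite big_ord_recr /=; exact: uc_setU.
apply: (@uc_set_lim (fun k => \1_(\big[setU/set0]_(i < k) F i))).
- by apply: bigcupT_measurable => k; exact: (hF k).1.
- by move=> k M; exact: (hU k).2.
- by move=> k x; rewrite indicE; case: (x \in _); rewrite ?normr1 ?normr0.
move=> x; apply: cvg_near_cst; have [[k _ Fkx]|h] := pselect ((\bigcup_k F k) x).
  near=> m; rewrite !indicE !mem_set//; first by exists k.
  rewrite -bigcup_mkord; exists k => //=; near: m; exact: nbhs_infty_gt.
apply: nearW => m; rewrite !indicE !memNset//.
by rewrite -bigcup_mkord => -[k _ Fkx]; apply: h; exists k.
Unshelve. all: by end_near. Qed.

(** Ramps of slope [k] in the coordinate [i], clipped to values between 0 and 1, are Lipschitz and
    converge everywhere to the indicator of the open half-space. *)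
Lemma uc_set_halfspace (i : 'I_n) (a : R) : uc_set (@rV_coord R n i @^-1` `]a, +oo[%classic).
Proof.
pose F k : V -> R := fun x => Num.max 0 (Num.min 1 (k%:R * (x 0 i - a))).
have F01 k x : `|F k x| <= 1.
  by have /andP[? ?] := clamp01 (k%:R * (x 0 i - a)); rewrite ger0_norm.
apply: (@uc_set_lim F) => //.
- by rewrite -[X in measurable X]setTI; apply: (measurable_rV_coord i).
- move=> k M; apply: (@L2_uc_lipschitz _ (M + 1)); last by move=> x /cutoff0 ->; rewrite mulr0.
  apply: lipschitz_funM => //; [exact: cutoff01| |exact: cutoff_lip].
  exists k%:R; split => // x y; apply: (le_trans (clamp_lip _ _)).
  rewrite -mulrBr normrM ger0_norm// ler_wpM2l//.
  have -> : y 0 i - a - (x 0 i - a) = (y - x) 0 i by rewrite !mxE; ring.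
  by rewrite [leRHS]mx_normrE; apply: (le_trans _ (le_bigmax _ _ (0, i))).
move=> x; apply: cvg_near_cst; rewrite indicE.
have [xa|xa] := ltP a (x 0 i).
  rewrite mem_set; last by rewrite /= in_itv/= andbT.
  near=> k; rewrite /F min_l ?max_r//.
  rewrite -ler_pdivrMr ?subr_gt0//; near: k; exact: nbhs_infty_ger.
rewrite memNset; last by rewrite /= in_itv/= andbT; apply/negP; rewrite -leNgt.
apply: nearW => k; rewrite /F max_l// ge_min; apply/orP; right.
by rewrite mulr_ge0_le0// subr_le0.
Unshelve. all: by end_near. Qed.

Lemma uc_set_measurable (A : set V) : measurable A -> uc_set A.
Proof.
have sig : sigma_algebra [set: V] uc_set.
  split; first exact: uc_set0.
  - by move=> B hB; rewrite setTD; exact: uc_setC.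
  - exact: uc_set_bigcup.
apply: smallest_sub => //.
rewrite -bigcup_seq; apply: bigcup_sub => i _ _ [Y mY <-]; rewrite setTI.
pose G := [set Y : set R | uc_set (@rV_coord R n i @^-1` Y)].
have sG : sigma_algebra [set: R] G.
  split; rewrite /G /=; first by rewrite preimage_set0; exact: uc_set0.
  - by move=> B hB; rewrite setTD preimage_setC; exact: uc_setC.
  - by move=> F hF; rewrite preimage_bigcup; exact: uc_set_bigcup.
have h : (@ocitv R).-sigma.-measurable Y := mY.
rewrite RGenOInfty.measurableE in h.
by apply: (smallest_sub sG _ h) => // _ [a ->]; exact: uc_set_halfspace.
Qed.

Lemma L2_uc_sum (I : Type) (s : seq I) (F : I -> V -> R) : (forall i, L2_uc (F i)) ->
  L2_uc (fun x => \sum_(i <- s) F i x).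
Proof.
move=> hF; elim: s => [|i s IH].
  have := L2_ucZ 0 (L2_uc_cutoff 0); congr L2_uc; apply/funext => x.
  by rewrite big_nil -[LHS]/(0 * _) mul0r.
have := L2_ucD (hF i) IH; congr L2_uc; apply/funext => x.
by rewrite big_cons.
Qed.

Lemma cvg_cutoff (x : V) : cutoff k%:R x @[k --> \oo] --> (1 : R).
Proof.
apply: cvg_near_cst; near=> k; rewrite cutoff1//.
near: k; exact: nbhs_infty_ger.
Unshelve. all: by end_near. Qed.

Import HBNNSimple.

Lemma L2_uc_ge0 f : L2 T f -> (forall x, 0 <= f x) -> L2_uc f.
Proof.
move=> Lf f0.
have mf : measurable_fun T (EFin \o f) by apply/measurable_EFinP; exact: Lf.1.
have fe0 x : T x -> (0 <= (EFin \o f) x)%E by rewrite lee_fin.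
pose g := nnsfun_approx mT mf.
have cg x : g k x @[k --> \oo] --> f x.
  have h := @cvg_nnsfun_approx _ _ R T mT _ mf fe0 x I.
  exact: (fine_cvg h).
have gf k x : g k x <= f x.
  rewrite -(cvg_lim (@Rhausdorff R) (cg x)).
  apply: (@nondecreasing_cvgn_le R (fun k => g k x)); last exact: cvgP (cg x).
  by move=> a b ab; have /lefP := nd_nnsfun_approx mT mf ab; exact.
apply: (@L2_uc_seq _ (fun k x => g k x * cutoff k%:R x) f) => //.
- exact: Lf.1.
- move=> k.
  have -> : (fun x => g k x * cutoff k%:R x) =
      (fun x => \sum_(y <- fset_set (range (g k))) (y * (\1_(g k @^-1` [set y]) x * cutoff k%:R x))).
    apply/funext => x; rewrite fimfunE fsbig_finite//= mulr_suml.
    by apply: eq_bigr => y _; rewrite mulrA.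
  apply: L2_uc_sum => y; apply: L2_ucZ.
  by have [_] := uc_set_measurable (measurable_sfunP (g k) (measurable_set1 y)).
- move=> k x; have /andP[c0 c1] := clamp01 (k%:R + 1 - `|x|).
  rewrite ger0_norm; last by rewrite mulr_ge0//; exact: fun_ge0.
  apply: le_trans (gf k x); rewrite ler_piMr//; exact: fun_ge0.
- move=> x; rewrite -[X in _ --> X]mulr1; apply: cvgM; [exact: cg|exact: cvg_cutoff].
Qed.

Lemma L2_translate_continuous f : L2 T f -> L2_uc f.
Proof.
move=> Lf.
have Lp : L2 T (fun x => Num.max (f x) 0).
  apply: (L2_le mT _ _ Lf); first by apply: measurable_maxr => //; exact: Lf.1.
  apply: ae_on_all => x _; rewrite ger0_norm; last by rewrite le_max lexx orbT.
  by rewrite ge_max ler_norm normr_ge0.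
have Ln : L2 T (fun x => Num.max (- f x) 0).
  apply: (L2_le mT _ _ Lf).
    by apply: measurable_maxr => //; apply: measurable_funN; exact: Lf.1.
  apply: ae_on_all => x _; rewrite ger0_norm; last by rewrite le_max lexx orbT.
  by rewrite ge_max -normrN ler_norm normr_ge0.
have h1 := L2_uc_ge0 Lp (fun x => ltac:(by rewrite le_max lexx orbT)).
have h2 := L2_uc_ge0 Ln (fun x => ltac:(by rewrite le_max lexx orbT)).
have := L2_ucD h1 (L2_ucZ (-1) h2); congr L2_uc; apply/funext => x.
rewrite -[LHS]/(Num.max (f x) 0 + -1 * Num.max (- f x) 0) mulN1r.
rewrite /Num.max oppr_lt0; case: ltgtP => [h|h|h]; rewrite ?subr0 ?opprK ?add0r//.
by rewrite h addr0.
Qed.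

End translation_continuity.

(** * Lipschitz functions *)

Section lipschitz_gluing.
Context {R : realType}.

(** Closed pieces may alternate infinitely often along the interval, so no ordered subdivision is
    available. The bound is carried to the supremum [m] of the good points, and beyond it by a piece
    that accumulates at [m] from the right. *)
Lemma line_glue (I : finType) (C : I -> set R) (f : R -> R) (L a b : R) :
  a <= b -> (forall i, closed (C i)) -> (forall t, a <= t <= b -> exists i, C i t) ->
  (forall i s t, C i s -> C i t -> `|f t - f s| <= L * `|t - s|) ->
  `|f b - f a| <= L * (b - a).
Proof.
move=> ab cC cov lip.
pose A := [set m | a <= m <= b /\ `|f m - f a| <= L * (m - a)].
have Aa : A a by split; rewrite ?lexx ?ab// !subrr normr0 mulr0.
have sA : has_sup A by split; [exists a|exists b => m [/andP[]]].
pose m := sup A.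
have am : a <= m by apply: ub_le_sup => //; exact: sA.2.
have mb : m <= b by apply: ge_sup; [exists a|move=> x [/andP[]]].
(* Every neighbourhood of [m] meets [A] inside one fixed piece containing [m]. *)
have step i : (forall e : R, 0 < e -> exists t, [/\ A t, C i t & `|m - t| < e]) -> C i m /\ A m.
  move=> h; have Cm : C i m.
    have := cC i; rewrite closure_id => ->; move=> B /nbhs_normP[e /= e0 eB].
    have [t [_ Ct te]] := h e e0; exists t; split => //; exact: eB.
  split => //; split; first by rewrite am mb.
  apply/ler_addgt0Pl => e e0.
  have L0 : 0 < 2 * `|L| + 1 by rewrite ltr_wpDl// mulr_ge0.
  have [t [[/andP[a_t t_b] At] Ct te]] := h (e / (2 * `|L| + 1)) (divr_gt0 e0 L0).
  have h1 := lip _ _ _ Ct Cm.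
  have h2 : `|f m - f a| <= L * `|m - t| + L * (t - a).
    have -> : f m - f a = (f m - f t) + (f t - f a) by rewrite addrA subrK.
    by apply: (le_trans (ler_normD _ _)); exact: lerD.
  apply: (le_trans h2).
  have -> : L * (t - a) = L * (m - a) - L * (m - t) by ring.
  have h3 : L * `|m - t| <= `|L| * `|m - t| by rewrite ler_wpM2r// ler_norm.
  have h4 : - (L * (m - t)) <= `|L| * `|m - t| by rewrite -normrM -normrN ler_norm.
  have h5 : (2 * `|L| + 1) * `|m - t| <= e by rewrite mulrC -ler_pdivlMr// ltW.
  have h6 : 0 <= `|m - t| by [].
  lra.
(* Pigeonhole: finitely many pieces cover the points that accumulate at [m], so one of them is met
   at arbitrarily small distance. *)
have near_piece (P : set R) : (forall e : R, 0 < e -> exists t, [/\ P t, a <= t <= b & `|m - t| < e]) ->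
    exists i, forall e : R, 0 < e -> exists t, [/\ P t, C i t & `|m - t| < e].
  move=> h; apply: contrapT => /forallNP no.
  have /boolp.choice[r hr] : forall i, exists r : R, 0 < r /\ forall t, P t -> C i t -> r <= `|m - t|.
    move=> i; have := no i => /existsNP[r /not_implyP[r0 hr]]; exists r; split => // t Pt Ct.
    by rewrite leNgt; apply/negP => tr; apply: hr; exists t.
  pose r0 := \big[Num.min/1]_i r i.
  have r00 : 0 < r0.
    rewrite /r0; elim/big_ind: _ => // [x y x0 y0|i _]; first by rewrite lt_min x0 y0.
    by have [] := hr i.
  have [t [Pt tab tr]] := h _ r00.
  have [i Ci] := cov _ tab.
  have := (hr i).2 _ Pt Ci; apply/negP; rewrite -ltNge; apply: (lt_le_trans tr).
  by rewrite /r0 (bigD1 i)//= ge_min lexx.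
have Am : A m.
  have [|i hi] := near_piece A; last by have [] := step i hi.
  move=> e e0; have [t At te] := sup_adherent e0 sA; exists t; split => //; first by case: At.
  by rewrite ger0_norm; [rewrite /m; lra|rewrite subr_ge0; apply: ub_le_sup => //; exact: sA.2].
have [->|mb'] := eqVneq b m; first by have [] := Am.
exfalso; have {mb'}mltb : m < b by rewrite lt_neqAle eq_sym mb'.
have [|i hi] := near_piece [set t | m < t].
  move=> e e0; exists (m + Num.min (b - m) (e / 2)).
  have h : 0 < Num.min (b - m) (e / 2) by rewrite lt_min subr_gt0 mltb divr_gt0.
  have h1 : Num.min (b - m) (e / 2) <= b - m by rewrite ge_min lexx.
  have h2 : Num.min (b - m) (e / 2) <= e / 2 by rewrite ge_min lexx orbT.
  split; first by rewrite /= ltrDl.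
  - by apply/andP; split; lra.
  - by rewrite opprD addNKr normrN gtr0_norm//; lra.
have Cm : C i m.
  have := cC i; rewrite closure_id => ->; move=> B /nbhs_normP[e /= e0 eB].
  have [t [_ Ct te]] := hi e e0; exists t; split => //; exact: eB.
have [t [/= mt Ct tb]] := hi (b - m) ltac:(by rewrite subr_gt0).
have : A t.
  rewrite ltr0_norm ?subr_lt0// in tb.
  split; first by apply/andP; split; lra.
  have h1 := lip _ _ _ Cm Ct; have [_ h2] := Am.
  have -> : f t - f a = (f t - f m) + (f m - f a) by rewrite addrA subrK.
  apply: (le_trans (ler_normD _ _)); apply: (le_trans (lerD h1 h2)).
  by rewrite gtr0_norm ?subr_gt0// -mulrDr addrA subrK.
by move=> At; have : t <= m by [apply: ub_le_sup => //; exact: sA.2]; rewrite leNgt mt.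
Qed.

Lemma segment_glue (V : normedModType R) (I : finType) (C : I -> set V) (f : V -> R) (L : R) :
  (forall i, closed (C i)) -> (forall x, exists i, C i x) ->
  (forall i x y, C i x -> C i y -> `|f y - f x| <= L * `|y - x|) ->
  forall x y, `|f y - f x| <= L * `|y - x|.
Proof.
move=> cC cov lip x y.
pose g (t : R) := f (x + t *: (y - x)).
have c : continuous (fun t : R => x + t *: (y - x)).
  move=> t; apply: (@continuousD _ _ _ (fun=> x) (fun t : R => t *: (y - x))).
    exact: cst_continuous.
  exact: scalel_continuous.
have := @line_glue I (fun i => (fun t : R => x + t *: (y - x)) @^-1` (C i)) g (L * `|y - x|) 0 1 ler01.
have g1 : g 1 = f y by rewrite /g scale1r addrC subrK.
have g0 : g 0 = f x by rewrite /g scale0r addr0.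
rewrite subr0 mulr1 g1 g0; apply.
- by move=> i; apply: closed_comp => // t _; exact: c.
- by move=> t _; exact: cov.
- move=> i s t Cs Ct; apply: (le_trans (lip i _ _ Cs Ct)).
  rewrite opprD addrACA subrr add0r -scalerBl normrZ.
  by rewrite -[leRHS]mulrA (mulrC `|y - x|).
Qed.

End lipschitz_gluing.

Section lipschitz_weak_gradient.
Context {R : realType} {d : nat}.
Local Notation V := 'rV[R]_d.
Local Notation leb := (@lebesgue_rV R d).
Local Notation e_ i := (delta_mx 0 i : V).
Local Notation T := [set: V].

Lemma lt_of_add1 (M a b c : R) : M + 1 < a -> c <= 1 -> a <= b + c -> M < b.
Proof. by move=> ? ? ?; lra. Qed.

Lemma intble_indic (A : set V) : measurable A -> (leb A < +oo)%E -> intble T (\1_A : V -> R).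
Proof.
move=> mA fA; have [_ h] := L2_indic mA fA; apply: intble_eq h => // x _.
by rewrite indicE; case: (x \in A); rewrite ?expr1n ?expr0n.
Qed.

Lemma intble_bounded_support (f : V -> R) (B M : R) : measurable_fun T f ->
  (forall x, `|f x| <= B) -> (forall x, M < `|x| -> f x = 0) -> intble T f.
Proof.
move=> mf fB f0.
have := intbleZ B measurableT (intble_indic (measurable_cball0 M) (cball0_fin M)).
apply: intble_le => // x _; rewrite indicE.
case: (boolP (x \in _)) => [_|]; first by rewrite mulr1.
by rewrite notin_setE /cball0 /= mulr0 => /negP; rewrite -ltNge => /f0 ->; rewrite normr0.
Qed.

(* Difference quotients integrate to zero by translation invariance, and the
   Lipschitz bound dominates them. *)
Lemma Rint_lipschitz_partial (w g : V -> R) (M : R) (i : 'I_d) : lipschitz_fun w ->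
  (forall x, M < `|x| -> w x = 0) -> measurable_fun T g ->
  ae_on T (fun x => is_derive x (e_ i) w (g x)) ->
  intble T g /\ \int[leb]_x g x = 0.
Proof.
move=> lw w0 mg dw; have mw := lipschitz_fun_measurable lw.
have [L [L0 hL]] := lw.
have iw : intble T w.
  apply: (@intble_bounded_support _ (`|w 0| + L * `|M|) M) => // x.
  have [xM|Mx] := leP `|x| M; last first.
    by rewrite w0// normr0 addr_ge0// mulr_ge0.
  have -> : w x = w 0 + (w x - w 0) by rewrite addrC subrK.
  apply: (le_trans (ler_normD _ _)); rewrite lerD2l.
  apply: (le_trans (hL _ _)); rewrite subr0 ler_wpM2l//.
  exact: le_trans xM (ler_norm _).
pose h k : R := k.+1%:R^-1.
have h0 k : 0 < h k by rewrite invr_gt0.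
have h1 k : h k <= 1 by rewrite invf_le1// ler1n.
pose D k x := (h k)^-1 * (w (x + h k *: e_ i) - w x).
have mD k : measurable_fun T (D k).
  apply: measurable_funM => //; apply: measurable_funB => //.
  exact: (measurableT_comp mw (measurable_shift_rV (h k *: e_ i))).
have iws k : intble T (fun x => w (x + h k *: e_ i)) := integrable_shift (h k *: e_ i) iw.
have D0 k : \int[leb]_x D k x = 0.
  rewrite RintZ//; last exact: intbleB.
  by rewrite RintB// (Rintegral_shift (h k *: e_ i) iw) subrr mulr0.
pose b x := L * \1_(@cball0 R d (M + 1)) x.
have ib : intble T b.
  exact: intbleZ _ (intble_indic (measurable_cball0 _) (cball0_fin _)).
have Db k x : `|D k x| <= b x.
  rewrite /b /D indicE; case: (boolP (x \in _)) => [_|]; last first.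
    rewrite notin_setE /cball0 /= mulr0 => /negP; rewrite -ltNge => Mx.
    have Mx' : M < `|x + h k *: e_ i|.
      have : `|x| <= `|x + h k *: e_ i| + `|h k *: e_ i|.
        by have := ler_normB (x + h k *: e_ i) (h k *: e_ i); rewrite addrK.
      have : `|h k *: e_ i| <= 1.
        by apply: (le_trans (norm_delta_le _ _)); rewrite gtr0_norm.
      by move=> p1 p2; exact: lt_of_add1 Mx p1 p2.
    rewrite !w0 ?subrr ?mulr0 ?normr0//.
    by apply: lt_trans Mx; rewrite ltrDl.
  rewrite mulr1 normrM gtr0_norm ?invr_gt0// mulrC ler_pdivrMr//.
  apply: (le_trans (hL _ _)); rewrite ler_wpM2l// addrC addKr.
  by apply: (le_trans (norm_delta_le _ _)); rewrite gtr0_norm.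
have cD : ae_on T (fun x => D k x @[k --> \oo] --> g x).
  apply: ae_on_imp dw => x _ /is_derive_cvgP c.
  have c2 := (cvgr_dnbhsP (fun t : R => t^-1 * (w (t *: e_ i + x) - w x)) 0 (g x)).1 c h.
  have c3 : h k @[k --> \oo] --> (0 : R) by exact: cvg_harmonic.
  rewrite (_ : (fun k => D k x) = fun k => (h k)^-1 * (w (h k *: e_ i + x) - w x)).
    exact: c2 (conj (fun k => lt0r_neq0 (h0 k)) c3).
  by apply/funext => k; rewrite /D [x + _]addrC.
have [ig h2] := Rint_dct measurableT mD mg ib cD (fun k => ae_on_all (fun x _ => Db k x)).
split => //.
have iD k : intble T (D k) by apply: intble_le (mD k) _ ib => // x _; exact: Db.
have := Rint_cvg measurableT iD ig h2.
rewrite (_ : (fun k => _) = fun=> 0); last by apply/funext => k; exact: D0.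
by move=> c; apply/esym; apply: (cvg_unique (@Rhausdorff R) _ c); exact: cvg_cst.
Qed.

End lipschitz_weak_gradient.

(** * Mollification *)

Section mollification.
Context {R : realType} {d : nat}.
Local Notation V := 'rV[R]_d.
Local Notation leb := (@lebesgue_rV R d).
Local Notation e_ i := (delta_mx 0 i : V).
Local Notation T := [set: V].

Definition bounded_support (f : V -> R) := exists M : R, forall x, M < `|x| -> f x = 0.

Definition mollifier (k : V -> R) := smooth k /\ bounded_support k.

Lemma partial_out (f : V -> R) i (x : V) (U : set V) : open U -> U x -> (forall y, U y -> f y = 0) ->
  partial i f x = 0.
Proof.
move=> oU Ux f0.
have c : h^-1 * (f (h *: e_ i + x) - f x) @[h --> (0:R)^'] --> (0 : R).
  apply: cvg_near_cst.
  have cc : h *: e_ i + x @[h --> (0:R)] --> x.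
    have := @cvgD _ _ _ _ _ (fun h : R => h *: e_ i) (fun=> x) 0 x.
    rewrite add0r; apply; last exact: cvg_cst.
    have := @scalel_continuous R V (e_ i) 0; rewrite /continuous_at scale0r; exact.
  have nU : nbhs x U by apply: open_nbhs_nbhs.
  near=> t; have Ut : U (t *: e_ i + x) by near: t; apply: nbhs_dnbhs; exact: (cc _ nU).
  by rewrite !f0// subrr mulr0.
by case: (is_derive_cvg c).
Unshelve. all: by end_near. Qed.

Lemma bounded_support_partial f i : bounded_support f -> bounded_support (partial i f).
Proof.
move=> [M hM]; exists M => x Mx.
apply: (@partial_out _ _ _ [set y : V | M < `|y|]) => //.
rewrite (_ : [set y : V | M < `|y|] = (fun y : V => `|y|) @^-1` [set r | M < r])//.
apply: open_comp; last exact: open_gt.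
by move=> y _; exact: norm_continuous.
Qed.

Lemma mollifier_partial k i : mollifier k -> mollifier (partial i k).
Proof. by move=> [sk bk]; split; [exact: smooth_partial|exact: bounded_support_partial]. Qed.

Lemma continuous_bounded_cball (f : V -> R) (M : R) : continuous f ->
  exists B : R, forall x, `|x| <= M -> `|f x| <= B.
Proof.
move=> cf.
have cK : compact (@cball0 R d M).
  apply: bounded_closed_compact; last exact: closed_cball0.
  by exists M; split; rewrite ?num_real// => K MK x /= xM; exact: le_trans xM (ltW MK).
have := @continuous_compact _ _ f _ (continuous_subspaceT cf) cK.
move=> /compact_bounded[B [_ hB]]; exists (B + 1) => x xM.
by apply: (hB (B + 1)); [rewrite ltrDl|exists x].
Qed.

Lemma continuous_bounded_support (f : V -> R) : continuous f -> bounded_support f ->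
  exists B : R, forall x, `|f x| <= B.
Proof.
move=> cf [M hM]; have [B hB] := continuous_bounded_cball M cf.
exists (Num.max B 0) => x; rewrite le_max.
by have [xM|/hM->] := leP `|x| M; [rewrite hB|rewrite normr0 lexx orbT].
Qed.

Lemma C1_lipschitz f : C1 f -> bounded_support f -> lipschitz_fun f.
Proof.
move=> [cf hf] sf.
have /boolp.choice[B hB] : forall i, exists B : R, forall x, `|partial i f x| <= B.
  move=> i; apply: continuous_bounded_support; first exact: (hf i).2.
  exact: bounded_support_partial.
pose M := \sum_i `|B i|.
have M0 : 0 <= M by exact: sumr_ge0.
exists (M * d%:R); split; first exact: mulr_ge0.
apply: bounded_partial_lipschitz => [i x|i x]; first exact: (hf i).1.
apply: (le_trans (hB i x)); apply: (le_trans (ler_norm _)).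
by rewrite /M (bigD1 i)//= lerDl; exact: sumr_ge0.
Qed.

(* Row vectors carry the topology twice, as matrices and as a normed module. *)
Lemma continuous_rV (g : V -> R) : (forall x : V, @continuous_at V R x g) <-> continuous g.
Proof. by []. Qed.

Lemma continuous_translate (g : V -> R) (z : V) : continuous g -> continuous (fun x : V => g (x + z)).
Proof.
move=> /continuous_rV cg; apply/continuous_rV => x.
have c : @continuous_at V V x (fun y => y + z).
  by apply: (@continuousD R V V id (fun=> z)); [exact: cvg_id|exact: cst_continuous].
have h := @continuous_comp V V R (fun y : V => y + z : V) g x c (cg (x + z)).
exact h.
Qed.

Lemma continuousZ_rV (a : R) (g : V -> R) : continuous g -> continuous (fun x : V => a * g x).
Proof.
move=> /continuous_rV cg; apply/continuous_rV => x.
have h := @continuousM R V (fun=> a) g x (@cst_continuous V R a x) (cg x).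
exact h.
Qed.

Lemma continuous_coord_comp (g : R -> R) i : continuous g -> continuous (fun x : V => g (x 0 i)).
Proof.
move=> cg; apply/continuous_rV => x.
have c : @continuous_at V R x (fun x : V => x 0 i) by exact: coord_continuous.
have h := @continuous_comp V R R (fun x : V => x 0 i) g x c (cg _).
exact h.
Qed.

Lemma smoothZ (a : R) (f : V -> R) : smooth f -> smooth (fun x => a * f x).
Proof.
move=> sf; apply: (@smooth_coind _ _ [set h | exists2 g, smooth g & h = fun x => a * g x]); first by exists f.
move=> _ [g sg ->]; split.
  exact/continuousZ_rV/smooth_continuous.
move=> j; have D2 x : is_derive x (e_ j) (fun x => a * g x) (a * partial j g x).
  exact: is_deriveZ (is_derive_partial (@smooth_derivable _ _ g j x sg)).
split; last by move=> x; case: (D2 x).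
exists (partial j g); first exact: smooth_partial.
by apply/funext => x; case: (D2 x).
Qed.

Lemma mollifierZ a k : mollifier k -> mollifier (fun x => a * k x).
Proof.
by move=> [sk [M hM]]; split; [exact: smoothZ|exists M => x /hM->; rewrite mulr0].
Qed.

(** The kernel is not reflected: one supported near [c] samples [f] near [x + c], and each
    derivative in [x] produces a minus sign. *)
Definition conv (f k : V -> R) : V -> R := fun x => \int[leb]_y (f y * k (y - x)).

Lemma intble_conv f k x : intble T f -> mollifier k -> intble T (fun y => f y * k (y - x)).
Proof.
move=> fi [sk bk]; have [B hB] := continuous_bounded_support (smooth_continuous sk) bk.
have mk := continuous_measurable_rV (smooth_continuous sk).
apply: (@intble_le _ _ _ _ (fun y => B * `|f y|)) => //.
- apply: measurable_funM; first exact: intble_meas fi.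
  exact: (measurableT_comp mk (measurable_shift_rV (- x))).
- by move=> y _; rewrite normrM mulrC ler_wpM2r.
- by apply: intbleZ => //; exact: intble_norm.
Qed.

Lemma intble_mul_mollifier f k : intble T f -> mollifier k -> intble T (fun y => f y * k y).
Proof.
move=> fi mk; have := intble_conv 0 fi mk; congr intble; apply/funext => y.
by rewrite subr0.
Qed.

Lemma convN f k x : intble T f -> mollifier k -> conv f (fun y => - k y) x = - conv f k x.
Proof.
move=> fi mk; rewrite /conv -RintN//; last exact: intble_conv.
by apply: eq_Rintegral => y _; rewrite mulrN.
Qed.

Lemma mollifier_taylor k i : mollifier k -> exists C : R, 0 <= C /\
  forall x (h : R), `|k (x + h *: e_ i) - k x - h * partial i k x| <= C * h ^+ 2.
Proof.
move=> mk; have mk1 := mollifier_partial i mk; have mk2 := mollifier_partial i mk1.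
have [B hB] := continuous_bounded_support (smooth_continuous mk2.1) mk2.2.
exists `|B|; split => // x h.
have [t [th ->]] := partial_MVT x h (fun y => @smooth_derivable _ _ k i y mk.1).
have [s [_ E]] := partial_MVT x t (fun y => @smooth_derivable _ _ _ i y mk1.1).
rewrite -mulrBr E !normrM mulrA mulrC.
apply: ler_pM => //; first by apply: (le_trans (hB _)); exact: ler_norm.
by rewrite -[leRHS]real_normK ?num_real// expr2 ler_wpM2l.
Qed.

(** The second-order Taylor remainder of the kernel is bounded uniformly in the base point, so the
    error after integration is at most [h ^+ 2] times a multiple of the L1 norm of [f]. *)
Lemma is_derive_conv f k i x : intble T f -> mollifier k ->
  is_derive x (e_ i) (conv f k) (- conv f (partial i k) x).
Proof.
move=> fi mk; have mk1 := mollifier_partial i mk.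
have [C [C0 hC]] := mollifier_taylor i mk.
pose A := \int[leb]_y `|f y|.
apply: (@is_derive_quadratic _ _ _ _ _ _ (C * A)) => h.
have I1 := intble_conv (h *: e_ i + x) fi mk; have I2 := intble_conv x fi mk.
have I3 := intble_conv x fi mk1.
have I4 : intble T (fun y => h * (f y * partial i k (y - x))) by exact: intbleZ.
have I5 := intbleB measurableT I1 I2.
have -> : conv f k (h *: e_ i + x) - conv f k x - h * - conv f (partial i k) x =
  \int[leb]_y (f y * (k (y - (h *: e_ i + x)) - k (y - x) - - h * partial i k (y - x))).
  rewrite /conv mulrN opprK -RintB// -RintZ// -RintD//; apply: eq_Rintegral => y _; ring.
have I6 : intble T (fun y => f y * (k (y - (h *: e_ i + x)) - k (y - x) - - h * partial i k (y - x))).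
  by apply: intble_eq (intbleD measurableT I5 I4) => // y _; ring.
apply: (le_trans (Rint_norm measurableT I6)).
have I7 : intble T (fun y => `|f y|) by exact: intble_norm.
have -> : C * A * h ^+ 2 = \int[leb]_y ((C * h ^+ 2) * `|f y|) by rewrite RintZ// mulrAC.
apply: Rint_le => //; [exact: intble_norm|exact: intbleZ|].
move=> y _; rewrite normrM mulrC ler_wpM2r//.
have := hC (y - x) (- h); rewrite sqrrN scaleNr.
by have -> : y - (h *: e_ i + x) = y - x - h *: e_ i by rewrite opprD addrA addrAC.
Qed.

Lemma conv_lipschitz f k : intble T f -> mollifier k -> lipschitz_fun (conv f k).
Proof.
move=> fi mk; have [L [L0 hL]] := C1_lipschitz (smooth_C1 mk.1) mk.2.
have I7 : intble T (fun y => `|f y|) by exact: intble_norm.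
exists (L * \int[leb]_y `|f y|); split; first by rewrite mulr_ge0// Rintegral_ge0.
move=> x1 x2; have I1 := intble_conv x1 fi mk; have I2 := intble_conv x2 fi mk.
rewrite /conv -RintB//; apply: (le_trans (Rint_norm measurableT (intbleB measurableT I2 I1))).
rewrite mulrAC -RintZ//; apply: Rint_le => //.
- by apply: intble_norm => //; exact: intbleB.
- exact: intbleZ.
- move=> y _; rewrite -mulrBr normrM mulrC ler_wpM2r//.
  apply: (le_trans (hL _ _)); rewrite ler_wpM2l// distrC.
  by rewrite opprD opprK addrACA subrr add0r [- x1 + _]addrC.
Qed.

Lemma smooth_conv f k : intble T f -> mollifier k -> smooth (conv f k).
Proof.
move=> fi mk; apply: (@smooth_coind _ _ [set conv f k | k in mollifier]); first by exists k.
move=> _ [k1 mk1 <-]; split; first exact/lipschitz_fun_continuous/conv_lipschitz.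
move=> i; have D x := is_derive_conv i x fi mk1; split => [|x]; last by case: (D x).
have mN : mollifier (fun x => - partial i k1 x).
  have := mollifierZ (-1) (mollifier_partial i mk1); congr mollifier.
  by apply/funext => x; rewrite mulN1r.
exists (fun x => - partial i k1 x) => //; apply/funext => x.
by rewrite /partial; case: (D x) => _ ->; rewrite convN//; exact: mollifier_partial.
Qed.

Lemma mollifier_translate k z : mollifier k -> mollifier (fun x => k (x + z)).
Proof.
move=> [sk [M hM]]; split; last first.
  exists (M + `|z|) => x Mx; apply: hM.
  have := ler_normB (x + z) z; rewrite addrK => h.
  by rewrite -(ltrD2r `|z|); exact: lt_le_trans Mx h.
apply: (@smooth_coind _ _ [set f | exists2 g, smooth g & f = fun x => g (x + z)]); first by exists k.
move=> _ [g sg ->].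
have D2 x j : is_derive x (e_ j) (fun x => g (x + z)) (partial j g (x + z)).
  have /is_derive_cvgP c := is_derive_partial (@smooth_derivable _ _ g j (x + z) sg).
  apply: is_derive_cvg; apply: cvg_trans c; apply: near_eq_cvg; near=> t.
  by rewrite addrA.
split.
  exact/continuous_translate/smooth_continuous.
move=> j; split; last by move=> x; case: (D2 x j).
exists (partial j g); first exact: smooth_partial.
by apply/funext => x; case: (D2 x j).
Unshelve. all: by end_near. Qed.

Lemma partial_translate (k : V -> R) (z x : V) i : derivable k (x + z) (e_ i) ->
  partial i (fun x => k (x + z)) x = partial i k (x + z).
Proof.
move=> h; have /is_derive_cvgP c := is_derive_partial h.
have : is_derive x (e_ i) (fun x => k (x + z)) (partial i k (x + z)).
  apply: is_derive_cvg; apply: cvg_trans c; apply: near_eq_cvg; near=> t.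
  by rewrite addrA.
by case.
Unshelve. all: by end_near. Qed.

Lemma mollifier_intble k : mollifier k -> intble T k.
Proof.
move=> [sk bk]; have [B hB] := continuous_bounded_support (smooth_continuous sk) bk.
have [M hM] := bk; apply: (intble_bounded_support _ hB hM).
exact: continuous_measurable_rV (smooth_continuous sk).
Qed.

Lemma measurable_addp : measurable_fun [set: V * V] (fun p : V * V => p.1 + p.2).
Proof.
apply: measurable_rV => i.
rewrite (_ : _ \o _ = fun p : V * V => rV_coord i p.1 + rV_coord i p.2); last first.
  by apply/funext => p; rewrite /rV_coord /= mxE.
apply: measurable_funD.
  by apply: measurableT_comp; [exact: measurable_rV_coord|exact: measurable_fst].
by apply: measurableT_comp; [exact: measurable_rV_coord|exact: measurable_snd].
Qed.

Lemma conv_shift f k x : intble T f -> mollifier k -> conv f k x = \int[leb]_z (f (x + z) * k z).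
Proof.
move=> fi mk; rewrite /conv -(Rintegral_shift x (intble_conv x fi mk)).
by apply: eq_Rintegral => z _; rewrite addrK [z + x]addrC.
Qed.

(** [k] is a probability density and [m] is the mean of [f (x + z) - f x] under it; the gap between
    the two sides is the variance, the integral of a nonnegative function. *)
Lemma conv_jensen f k x : L2 T f -> intble T f -> mollifier k -> (forall z, 0 <= k z) ->
  \int[leb]_z k z = 1 ->
  intble T (fun z => (f (x + z) - f x) ^+ 2 * k z) /\
  (conv f k x - f x) ^+ 2 <= \int[leb]_z ((f (x + z) - f x) ^+ 2 * k z).
Proof.
move=> Lf fi mk k0 k1; pose m := conv f k x - f x.
have ik := mollifier_intble mk.
have fix1 : intble T (fun z => f (x + z) * k z).
  have := intble_mul_mollifier (integrable_shift x fi) mk.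
  by apply: intble_eq => // z _; rewrite /= addrC.
have fix2 : intble T (fun z => f (x + z) ^+ 2 * k z).
  have := intble_mul_mollifier (integrable_shift x Lf.2) mk.
  by apply: intble_eq => // z _; rewrite /= addrC.
have ih : intble T (fun z => f (x + z) * k z - f x * k z) by apply: intbleB => //; exact: intbleZ.
have iG : intble T (fun z => (f (x + z) - f x) ^+ 2 * k z).
  have h1 := intbleD measurableT fix2 (intbleD measurableT (intbleZ (- 2 * f x) measurableT fix1) (intbleZ (f x ^+ 2) measurableT ik)).
  by apply: intble_eq h1 => // z _; ring.
have Em : m = \int[leb]_z (f (x + z) * k z - f x * k z).
  by rewrite RintB// ?RintZ// ?k1 ?mulr1 -?conv_shift//; exact: intbleZ.
split => //; rewrite -/m -subr_ge0.
have -> : \int[leb]_z ((f (x + z) - f x) ^+ 2 * k z) - m ^+ 2 =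
  \int[leb]_z ((f (x + z) - f x - m) ^+ 2 * k z).
  have i1 := intbleZ (- 2 * m) measurableT ih; have i2 := intbleZ (m ^+ 2) measurableT ik.
  have E : (fun z => (f (x + z) - f x - m) ^+ 2 * k z) = fun z => (f (x + z) - f x) ^+ 2 * k z +
    ((- 2 * m) * (f (x + z) * k z - f x * k z) + m ^+ 2 * k z) by apply/funext => z; ring.
  rewrite E RintD//; last exact: intbleD.
  by rewrite RintD// RintZ// RintZ// k1 -Em; ring.
by apply: Rintegral_ge0 => z _; rewrite mulr_ge0// sqr_ge0.
Qed.

(** By Jensen and Tonelli the squared error is at most the average, with weights [k z], of the
    squared L2 distances between [f] and its translates by [z]. *)
Lemma conv_approx f k (e : R) : L2 T f -> intble T f -> mollifier k -> (forall z, 0 <= k z) ->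
  \int[leb]_z k z = 1 -> 0 <= e ->
  (forall z, k z != 0 -> normL2 T (translate z f - f) <= e) ->
  L2 T (conv f k) /\ normL2 T (conv f k - f) <= e.
Proof.
move=> Lf fi mk k0 k1 e0 he.
have mT : measurable [set: V] by exact: measurableT.
have mkk := continuous_measurable_rV (smooth_continuous mk.1).
have mc : measurable_fun T (conv f k).
  by apply: continuous_measurable_rV; apply: smooth_continuous; exact: smooth_conv.
have mf := Lf.1.
pose G (p : V * V) : \bar R := ((f (p.1 + p.2) - f p.1) ^+ 2 * k p.2)%:E.
have G0 p : (0 <= G p)%E by rewrite lee_fin mulr_ge0// sqr_ge0.
have mG : measurable_fun setT G.
  apply/measurable_EFinP; apply: measurable_funM.
    apply: measurable_funX; apply: measurable_funB.
      exact: (measurableT_comp mf measurable_addp).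
    exact: (measurableT_comp mf measurable_fst).
  exact: (measurableT_comp mkk measurable_snd).
have mm : measurable_fun T (conv f k - f) by apply: measurable_funB.
have key : (\int[leb]_x (((conv f k - f) x ^+ 2)%:E) <= (e ^+ 2)%:E)%E.
  apply: (@le_trans _ _ (\int[leb]_x \int[leb]_z G (x, z))%E).
    apply: ge0_le_integral => //.
    - by move=> x _; rewrite lee_fin sqr_ge0.
    - by apply/measurable_EFinP; exact: measurable_funX.
    - exact: measurable_fun_fubini_tonelli_F.
    - move=> x _; have [iG h] := conv_jensen x Lf fi mk k0 k1.
      have := integrable_fin_num measurableT iG.
      move=> /fineK <-; rewrite lee_fin; exact: h.
  rewrite (@fubini_tonelli _ _ _ _ _ leb leb G mG G0).
  apply: (@le_trans _ _ (\int[leb]_z (e ^+ 2 * k z)%:E)%E); last first.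
    have ik := intbleZ (e ^+ 2) measurableT (mollifier_intble mk).
    have E := RintZ (e ^+ 2) measurableT (mollifier_intble mk); rewrite k1 mulr1 in E.
    by rewrite -[in leRHS]E /Rintegral fineK//; exact: integrable_fin_num ik.
  apply: ge0_le_integral => //.
  - by move=> z _; apply: integral_ge0.
  - exact: measurable_fun_fubini_tonelli_G.
  - by apply/measurable_EFinP; apply: measurable_funM.
  - move=> z _; rewrite /G /=.
    have Lz : L2 T (translate z f - f) by apply: L2_sub => //; exact: L2_translate.
    have -> : (fun x => ((f (x + z) - f x) ^+ 2 * k z)%:E) = EFin \o (fun x => k z * (translate z f - f) x ^+ 2).
      by apply/funext => x; rewrite /= mulrC.
    have /fineK <- := integrable_fin_num measurableT (intbleZ (k z) measurableT Lz.2).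
    have := RintZ (k z) measurableT Lz.2; rewrite /Rintegral => ->.
    rewrite -/(Rintegral leb T _) lee_fin mulrC -normL2_sq.
    have [kz|kz] := eqVneq (k z) 0; first by rewrite kz !mulr0.
    rewrite ler_wpM2r// lerXn2r ?nnegrE ?sqrtr_ge0//; exact: he.
have Lm : L2 T (conv f k - f).
  split => //; apply/integrableP; split; first by apply/measurable_EFinP; exact: measurable_funX.
  apply: le_lt_trans (ltry (e ^+ 2)); apply: le_trans key.
  rewrite le_eqVlt; apply/orP; left; apply/eqP; apply: eq_integral => x _.
  by rewrite gee0_abs// lee_fin sqr_ge0.
split.
  have := L2_add measurableT Lm Lf; congr L2; apply/funext => x.
  by rewrite -[LHS]/(conv f k x - f x + f x) subrK.
rewrite -(ler_pXn2r (n := 2)) ?nnegrE ?sqrtr_ge0// normL2_sq -lee_fin.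
apply: le_trans key; rewrite /Rintegral fineK//.
exact: integrable_fin_num Lm.2.
Qed.

Definition bump (c : V) (r : R) : V -> R := fun x => \prod_i bump1 (c 0 i) r (x 0 i).

Lemma continuous_prod (s : seq 'I_d) (f : 'I_d -> V -> R) : (forall i, continuous (f i)) ->
  continuous (fun x => \prod_(i <- s) f i x).
Proof.
move=> cf; elim: s => [|i s IH].
  by rewrite (_ : (fun x => _) = fun=> 1); [exact: cst_continuous|apply/funext => x; rewrite big_nil].
rewrite (_ : (fun x => _) = fun x => f i x * \prod_(j <- s) f j x); last first.
  by apply/funext => x; rewrite big_cons.
by move=> x; exact: (@continuousM R V _ _ x (cf i x) (IH x)).
Qed.

(** A partial derivative replaces one factor by its derivative, so products of [cinf] functions of
    the single coordinates are a family closed under [partial]. *)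
Lemma smooth_prod (g : 'I_d -> R -> R) : (forall i, cinf (g i)) -> smooth (fun x : V => \prod_i g i (x 0 i)).
Proof.
move=> hg; apply: (@smooth_coind _ _ [set f | exists g : 'I_d -> R -> R, (forall i, cinf (g i)) /\ f = fun x : V => \prod_i g i (x 0 i)]); first by exists g.
move=> _ [{}g [{}hg ->]]; split.
  apply: (@continuous_prod _ (fun i x => g i (x 0 i))) => i.
  by apply: continuous_coord_comp; exact: cinf_continuous.
move=> i.
have [g' [cg' dg']] : exists g' : R -> R, cinf g' /\ forall x : R, is_derive x (1 : R) (g i) (g' x).
  have [S [Sg hS]] := hg i; have [g' Sg' dg'] := hS _ Sg; exists g'; split => //.
  by exists S.
pose g1 j := if j == i then g' else g j.
have D (x : V) : is_derive x (e_ i) (fun x : V => \prod_i g i (x 0 i)) (\prod_j g1 j (x 0 j)).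
  have c := is_derive_cvgP (dg' (x 0 i)).
  have P y (x' : V) : (forall j, j != i -> x' 0 j = x 0 j) -> x' 0 i = y ->
      \prod_j g j (x' 0 j) = (\prod_(j | j != i) g j (x 0 j)) * g i y.
    move=> h <-; rewrite (bigD1 i)//= mulrC; congr (_ * _).
    by apply: eq_bigr => j ji; rewrite h.
  apply: is_derive_cvg.
  have -> : \prod_j g1 j (x 0 j) = (\prod_(j | j != i) g j (x 0 j)) * g' (x 0 i).
    rewrite (bigD1 i)//= {1}/g1 eqxx mulrC; congr (_ * _).
    by apply: eq_bigr => j ji; rewrite /g1 (negbTE ji).
  have -> : (fun h : R => h^-1 * (\prod_i0 g i0 ((h *: e_ i + x) 0 i0) - \prod_i0 g i0 (x 0 i0))) =
     fun h : R => (\prod_(j | j != i) g j (x 0 j)) * (h^-1 * (g i (h *: 1 + x 0 i) - g i (x 0 i))).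
    apply/funext => h; rewrite (P (h *: 1 + x 0 i) (h *: e_ i + x)); last 2 first.
    - by move=> j ji; rewrite !mxE (negbTE ji) andbF mulr0 add0r.
    - by rewrite !mxE !eqxx.
    by rewrite (P (x 0 i) x)//; ring.
  by apply: cvgM => //; exact: cvg_cst.
split; last by move=> x; case: (D x).
exists g1; split; last by apply/funext => x; case: (D x).
by move=> j; rewrite /g1; case: eqP.
Qed.

Lemma bump_ge0 c r x : 0 <= bump c r x.
Proof. by apply: prodr_ge0 => i _; exact: bump1_ge0. Qed.

Lemma norm_lt_coord (x c : V) (r : R) : 0 < r ->
  `|x - c| < r <-> forall i, `|x 0 i - c 0 i| < r.
Proof.
move=> r0; have E := rV_ball c r0; rewrite distrC.
have -> : (`|c - x| < r) = (ball c r x) :> Prop by rewrite -ball_normE.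
by rewrite E; split=> H i; have := H i; rewrite -ball_normE /= distrC.
Qed.

Lemma bump_gt0 c r x : 0 < r -> 0 < bump c r x <-> `|x - c| < r.
Proof.
move=> r0; rewrite norm_lt_coord//; split.
  move=> h i; rewrite -bump1_gt0// lt_neqAle bump1_ge0 andbT eq_sym; apply/eqP => b0.
  by move: h; rewrite /bump (bigD1 i)//= b0 mul0r ltxx.
by move=> h; apply: prodr_gt0 => i _; rewrite bump1_gt0.
Qed.

Lemma ball_not_null (c : V) (r : R) : 0 < r -> ~ ae_on T (fun x => ~ `|x - c| < r).
Proof.
move=> r0 [N [mN N0 hN]].
pose B := box (fun i => c 0 i - r / 2) (fun i => c 0 i + r / 3).
have BN : B `<=` N.
  move=> x Bx; apply: hN => /= /(_ I); apply.
  apply/norm_lt_coord => // i; have := Bx i; rewrite /= in_itv /= => /andP[? ?].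
  by rewrite ltr_norml; apply/andP; split; lra.
have h : (leb B <= leb N)%E by apply: le_measure => //; rewrite inE//; exact: measurable_box.
have N0' : leb N = 0%E := N0.
move: h; rewrite N0' lebesgue_box; last by move=> i; lra.
rewrite lee_fin leNgt => /negP; apply; apply: prodr_gt0 => i _; lra.
Qed.

Lemma mollifier_exists (c : V) (r : R) : 0 < r -> exists k : V -> R,
  [/\ mollifier k, forall z, 0 <= k z, \int[leb]_z k z = 1 & forall z, k z != 0 -> `|z - c| < r].
Proof.
move=> r0.
have sb : smooth (bump c r).
  by apply: (@smooth_prod (fun i => bump1 (c 0 i) r)) => i; exact: cinf_bump1.
have b0 z : bump c r z != 0 -> `|z - c| < r.
  by move=> h; apply/bump_gt0 => //; rewrite lt_neqAle eq_sym h bump_ge0.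
have mb : mollifier (bump c r).
  split => //; exists (`|c| + r) => x xr; apply/eqP; apply/negPn/negP => /b0 h.
  have := ler_normD (x - c) c; rewrite subrK leNgt => /negP; apply.
  by apply: le_lt_trans xr; rewrite addrC lerD2l ltW.
have ib := mollifier_intble mb.
pose A := \int[leb]_z bump c r z.
have A0 : 0 < A.
  rewrite lt_neqAle Rintegral_ge0 ?andbT; last by move=> *; exact: bump_ge0.
  rewrite eq_sym; apply/eqP => hA.
  have := Rint_eq0 measurableT ib (fun x _ => bump_ge0 c r x) hA.
  move=> h; apply: (@ball_not_null c r r0); apply: ae_on_imp h => x _ h /bump_gt0 -/(_ r0).
  by rewrite h ltxx.
exists (fun x => A^-1 * bump c r x); split.
- exact: mollifierZ.
- by move=> z; rewrite mulr_ge0 ?bump_ge0// invr_ge0 ltW.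
- by rewrite RintZ// mulVf// gt_eqF.
- by move=> z; rewrite mulf_eq0 negb_or => /andP[_]; exact: b0.
Qed.

End mollification.

(** * Weak derivatives *)

Lemma cvg0_le {R : realType} (u w : nat -> R) : (forall n, 0 <= u n <= w n) ->
  w n @[n --> \oo] --> (0 : R) -> u n @[n --> \oo] --> (0 : R).
Proof.
move=> h /cvgrPdist_le hw; apply/cvgrPdist_le => e e0; have := hw e e0.
apply: filterS => n; rewrite !sub0r !normrN; apply: le_trans.
by have /andP[h1 h2] := h n; rewrite !ger0_norm// (le_trans h1).
Qed.

Lemma add_lt_third {R : realType} (a b c e : R) : a < c -> b < 2 * c -> c < e / 3 -> a + b < e.
Proof. by move=> ? ? ?; lra. Qed.

Section extension_by_zero.
Context {R : realType} {d : nat}.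
Local Notation V := 'rV[R]_d.
Local Notation leb := (@lebesgue_rV R d).
Local Notation e_ i := (delta_mx 0 i : V).
Local Notation T := [set: V].
Variable E : set V.
Hypothesis mE : measurable E.

Lemma restrictE (f : V -> R) x : (f \_ E) x = if x \in E then f x else 0.
Proof. by rewrite patchE; case: ifP. Qed.

Lemma restrictN (f : V -> R) x : ~ E x -> (f \_ E) x = 0.
Proof. by move=> Ex; rewrite restrictE memNset. Qed.

Lemma restrictT (f : V -> R) x : E x -> (f \_ E) x = f x.
Proof. by move=> Ex; rewrite restrictE mem_set. Qed.

Lemma intble_ext f : intble E f <-> intble T (f \_ E).
Proof.
rewrite /intble (_ : EFin \o (f \_ E) = (EFin \o f) \_ E); last first.
  by apply/funext => x; rewrite /= !patchE; case: ifP.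
exact: integrable_mkcond.
Qed.

Lemma L2_ext f : L2 E f -> L2 T (f \_ E).
Proof.
move=> [mf fi]; split; first by apply/(measurable_restrictT _ mE).
have /intble_ext h : intble E (fun x => f x ^+ 2) := fi.
apply: intble_eq h => // x _; rewrite !restrictE.
by case: ifP => // _; rewrite expr0n.
Qed.

Lemma Rint_ext f : \int[leb]_(x in E) f x = \int[leb]_x (f \_ E) x.
Proof. exact: Rintegral_mkcond. Qed.

Lemma ip_extl f g : ip E f g = ip T (f \_ E) g.
Proof.
rewrite /ip Rint_ext; apply: eq_Rintegral => x _; rewrite !restrictE.
by case: ifP => // _; rewrite mul0r.
Qed.

Lemma L2_fin_intble f : (leb E < +oo)%E -> L2 E f -> intble E f.
Proof.
move=> fE Lf; have L1 : L2 E (fun=> 1 : R).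
  by apply: (@L2_bounded _ _ E _ 1) => //; apply: ae_on_all => x _; rewrite normr1.
by apply: intble_eq (L2M mE Lf L1) => // x _; rewrite mulr1.
Qed.

Lemma L2_setT f : L2 T f -> L2 E f.
Proof. by apply: L2_restr. Qed.

Lemma ae_on_null (P : V -> Prop) (N : set V) : measurable N -> leb N = 0%E ->
  (forall x, E x -> ~ N x -> P x) -> ae_on E P.
Proof.
move=> mN N0 h; exists N; split => // x /= hx; apply: contrapT => Nx; apply: hx => Ex.
exact: h.
Qed.

End extension_by_zero.

Section test_functions.
Context {R : realType} {d : nat}.
Local Notation V := 'rV[R]_d.
Local Notation leb := (@lebesgue_rV R d).
Local Notation e_ i := (delta_mx 0 i : V).
Local Notation T := [set: V].
Implicit Types (E : set V) (phi : V -> R).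

Lemma compact_cball (c : V) (r : R) : compact [set x | `|x - c| <= r].
Proof.
apply: bounded_closed_compact.
  exists (`|c| + r); split; rewrite ?num_real// => K MK x /= xr.
  apply: le_trans (ltW MK); have := ler_normD (x - c) c; rewrite subrK => h.
  by apply: (le_trans h); rewrite addrC lerD2l.
rewrite (_ : [set x | `|x - c| <= r] = (fun x : V => `|x - c|) @^-1` [set s | s <= r])//.
apply: closed_comp; last exact: closed_le.
move=> x _; have /continuous_rV h := @continuous_translate R d (fun x : V => `|x|) (- c) (fun x => @norm_continuous R V x).
exact: h.
Qed.

Lemma test_fun_mollifier E phi : test_fun E phi -> mollifier phi.
Proof.
move=> [sp [K [cK _ K0]]]; split => //.
have [M [_ hM]] := compact_bounded cK; exists (M + 1) => x Mx; apply: K0 => Kx.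
by have := hM (M + 1) ltac:(by rewrite ltrDl) x Kx; rewrite /= leNgt Mx.
Qed.

Lemma compact_closed_rV (K : set V) : compact K -> closed K.
Proof. by apply: compact_closed; exact: norm_hausdorff. Qed.

Lemma test_fun_partial E phi i : test_fun E phi -> test_fun E (partial i phi).
Proof.
move=> [sp [K [cK KE K0]]]; split; first exact: smooth_partial.
exists K; split => // x Kx; apply: (@partial_out _ _ _ _ _ (~` K)) => //.
by apply: closed_openC; exact: compact_closed_rV.
Qed.

Lemma test_fun_out E phi x : test_fun E phi -> ~ E x -> phi x = 0.
Proof. by move=> [_ [K [_ KE K0]]] Ex; apply: K0 => /KE. Qed.

Lemma smooth0 : smooth (fun _ : V => 0 : R).
Proof.
apply: (@smooth_coind _ _ [set (fun _ : V => 0 : R)]) => // _ ->.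
split; first exact: cst_continuous.
move=> i; have D x : is_derive x (e_ i) (fun _ : V => 0 : R) 0 by exact: is_derive_cst.
by split; [apply/funext => x; case: (D x)|move=> x; case: (D x)].
Qed.

Lemma smooth_lin (a : R) f g : smooth f -> smooth g -> smooth (fun x : V => a * f x + g x).
Proof.
move=> sf sg; apply: (@smooth_coind _ _ [set h | exists f1 g1, [/\ smooth f1, smooth g1 & h = fun x : V => a * f1 x + g1 x]]); first by exists f, g.
move=> _ [f1 [g1 [sf1 sg1 ->]]]; split.
  have c1 := @continuousZ_rV R d a _ (smooth_continuous sf1); have c2 := smooth_continuous sg1.
  apply/continuous_rV => x; have h := @continuousD R R V _ _ x (c1 x) (c2 x); exact: h.
move=> i; have D x : is_derive x (e_ i) (fun x => a * f1 x + g1 x) (a * partial i f1 x + partial i g1 x).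
  have d1 := @is_deriveZ _ _ _ f1 a x (e_ i) _ (is_derive_partial (@smooth_derivable _ _ f1 i x sf1)).
  have d2 := is_derive_partial (@smooth_derivable _ _ g1 i x sg1).
  have := is_deriveD d1 d2; exact.
split; last by move=> x; case: (D x).
exists (partial i f1), (partial i g1); split; try exact: smooth_partial.
by apply/funext => x; case: (D x).
Qed.

Lemma test_fun0 E : test_fun E (fun=> 0).
Proof. by split; [exact: smooth0|exists set0; split => //; exact: compact0]. Qed.

Lemma test_fun_lin E a phi psi : test_fun E phi -> test_fun E psi -> test_fun E (a *: phi + psi).
Proof.
move=> [s1 [K1 [cK1 KE1 K10]]] [s2 [K2 [cK2 KE2 K20]]]; split; first exact: smooth_lin.
exists (K1 `|` K2); split; first exact: compactU.
  by move=> x [/KE1|/KE2].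
move=> x h; rewrite -[LHS]/(a * phi x + psi x) K10 ?K20 ?mulr0 ?addr0// => h1; apply: h; by [left|right].
Qed.

Lemma mollifier_L2 k : mollifier k -> L2 T k.
Proof.
move=> mk; split; first exact: continuous_measurable_rV (smooth_continuous mk.1).
have := intble_mul_mollifier (mollifier_intble mk) mk.
by apply: intble_eq.
Qed.

Lemma test_fun_L2 E phi : measurable E -> test_fun E phi -> L2 E phi.
Proof. by move=> mE /test_fun_mollifier/mollifier_L2; exact: L2_setT. Qed.

(** On a ball whose double lies in [E], the translated kernels [k (y - x)] are themselves test
    functions, so the mollifications of [f] vanish there while they approximate [f] in L2. Countably
    many rational balls cover [E]. *)
Lemma fundamental_lemma E (f : V -> R) : open E -> (leb E < +oo)%E -> L2 E f ->
  (forall phi, test_fun E phi -> ip E f phi = 0) -> ae_on E (fun x => f x = 0).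
Proof.
move=> oE fE Lf h; have mE := open_measurable_rV oE.
pose F := f \_ E.
have LF : L2 T F by exact: L2_ext.
have iF : intble T F by apply/(intble_ext mE); exact: L2_fin_intble.
have loc (q : V) (r : R) : 0 < r -> (forall x, `|x - q| < 2 * r -> E x) ->
    ae_on E (fun x => `|x - q| < r -> f x = 0).
  move=> r0 qE; pose B := [set x : V | `|x - q| < r].
  have mB : measurable B.
    rewrite (_ : B = ball q r); first exact: measurable_rV_ball.
    by apply/seteqP; split => x; rewrite -ball_normE /B /= distrC.
  have LB : L2 B F by apply: L2_setT.
  have n0 : normL2 B F = 0.
    apply/eqP; rewrite eq_le sqrtr_ge0 andbT; apply/ler_addgt0Pl => e e0; rewrite addr0.
    have [_ /(_ _ e0)[s [s0 hs]]] := L2_translate_continuous LF.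
    have sr : 0 < Num.min s r by rewrite lt_min s0 r0.
    have [k [mk k0 k1 ks]] := mollifier_exists (0 : V) sr.
    have [Lc cF] : L2 T (conv F k) /\ normL2 T (conv F k - F) <= e.
      apply: conv_approx => //; first exact: ltW.
      move=> z /ks; rewrite subr0 lt_min => /andP[zs _]; exact: hs.
    have c0 x : B x -> conv F k x = 0.
      move=> Bx; rewrite /conv -[LHS]/(ip T F (fun y => k (y - x))) -ip_extl//; apply: h; split.
        by have [] := mollifier_translate (- x) mk.
      exists [set y | `|y - x| <= r]; split; first exact: compact_cball.
        move=> y /= yx; apply: qE; have := ler_normD (y - x) (x - q); rewrite addrA subrK => hh.
        apply: (le_lt_trans hh); rewrite mulr2n mulrDl mul1r; apply: ler_ltD => //; exact: Bx.
      move=> y /= yx; apply/eqP; apply/negPn/negP => /ks; rewrite subr0 lt_min => /andP[_ yr].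
      by apply: yx; exact: ltW.
    apply: le_trans cF; rewrite /normL2 ler_wsqrtr//.
    have Lm : L2 T (conv F k - F) by exact: L2_sub.
    apply: (@le_trans _ _ (ip B (conv F k - F) (conv F k - F))); last first.
      apply: Rint_subset => //; first exact: (L2M _ Lm Lm).
      by move=> x _; rewrite -expr2 sqr_ge0.
    rewrite le_eqVlt; apply/orP; left; apply/eqP; apply: eq_Rintegral => x; rewrite inE => Bx.
    by rewrite -[(conv F k - F) x]/(conv F k x - F x) c0// sub0r mulrNN.
  have := normL2_eq0 mB LB n0; rewrite /ae_on; apply: filterS => x hx Ex xq.
  by rewrite -(hx xq) /F restrictT.
(* Inclusion of the double ball in [E] is made a premise, so that the family can be indexed by all
   rational balls. *)
pose P (p : {ffun 'I_d -> rat} * nat) : V -> Prop := fun x =>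
  (forall y : V, `|y - rat_rV p.1| < 2 * p.2.+1%:R^-1 -> E y) -> `|x - rat_rV p.1| < p.2.+1%:R^-1 -> f x = 0.
have hP p : ae_on E (P p).
  have [hp|hp] := pselect (forall y : V, `|y - rat_rV p.1| < 2 * p.2.+1%:R^-1 -> E y).
    by apply: ae_on_imp (loc (rat_rV p.1) p.2.+1%:R^-1 _ hp) => [x _ hx _|]; [exact: hx|rewrite invr_gt0].
  by apply: ae_on_all => x _ /hp.
apply: ae_on_imp (ae_on_count hP) => x Ex hx.
move: oE; rewrite openE => /(_ x Ex) /nbhs_ballP[e /= e0 eE].
have e30 : 0 < e / 3 by rewrite divr_gt0.
have [n hn] := ltr_add_invr (e30 : 0 < e / 3); rewrite add0r in hn.
have n0 : 0 < n.+1%:R^-1 :> R by rewrite invr_gt0.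
have [q hq] := dense_rat_rV x n0; rewrite -ball_normE /= in hq.
apply: (hx (q, n)) => //= y yq; apply: eE; rewrite -ball_normE /=.
have := ler_normD (x - rat_rV q) (rat_rV q - y); rewrite addrA subrK => hh.
apply: (le_lt_trans hh); rewrite (distrC (rat_rV q)).
exact: add_lt_third hq yq hn.
Qed.

End test_functions.

Section weak_derivatives.
Context {R : realType} {d : nat}.
Local Notation V := 'rV[R]_d.
Local Notation leb := (@lebesgue_rV R d).
Local Notation e_ i := (delta_mx 0 i : V).
Local Notation T := [set: V].
Variable E : set V.
Hypotheses (oE : open E) (fE : (leb E < +oo)%E).
Implicit Types (v w phi : V -> R) (F G tau : V -> V).
Let mE : measurable E := open_measurable_rV oE.
Let sp := L2_sip mE.

Lemma dotDl (x y z : V) : dot (x + y) z = dot x z + dot y z.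
Proof. by rewrite /dot -big_split; apply: eq_bigr => i _; rewrite /= mxE mulrDl. Qed.

Lemma dotC (x y : V) : dot x y = dot y x.
Proof. by apply: eq_bigr => i _; rewrite mulrC. Qed.

Lemma dotDr (x y z : V) : dot z (x + y) = dot z x + dot z y.
Proof. by rewrite dotC dotDl !(dotC z). Qed.

Lemma dotZl a (x y : V) : dot (a *: x) y = a * dot x y.
Proof. by rewrite /dot mulr_sumr; apply: eq_bigr => i _; rewrite mxE mulrA. Qed.

Lemma dotZr a (x y : V) : dot y (a *: x) = a * dot y x.
Proof. by rewrite dotC dotZl dotC. Qed.

Lemma dotNl (x y : V) : dot (- x) y = - dot x y.
Proof. by rewrite -scaleN1r dotZl mulN1r. Qed.

Lemma dotNr (x y : V) : dot y (- x) = - dot y x.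
Proof. by rewrite dotC dotNl dotC. Qed.

Lemma dotBl (x y z : V) : dot (x - y) z = dot x z - dot y z.
Proof. by rewrite dotDl dotNl. Qed.

Lemma dotBr (x y z : V) : dot z (x - y) = dot z x - dot z y.
Proof. by rewrite dotDr dotNr. Qed.

Lemma dot_sqr_ge0 (x : V) : 0 <= dot x x.
Proof. by apply: sumr_ge0 => i _; rewrite -expr2 sqr_ge0. Qed.

Lemma L2v_sub : subspace (@L2v R d E).
Proof.
split=> [i|a F G hF hG i].
  rewrite (_ : (fun x => _) = fun=> 0); first exact: L2_cst0.
  by apply/funext => x; rewrite mxE.
have := L2_lin a mE (hF i) (hG i); congr L2; apply/funext => x.
by rewrite !mxE.
Qed.

Lemma L2v_dot F G : L2v E F -> L2v E G -> intble E (fun x => dot (F x) (G x)).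
Proof. by move=> hF hG; apply: intble_sum => // i _; exact: L2M. Qed.

Lemma ipv_sum F G : L2v E F -> L2v E G ->
  ipv E F G = \sum_i ip E (fun x => F x 0 i) (fun x => G x 0 i).
Proof. by move=> hF hG; rewrite /ipv /dot Rint_sum// => i _; exact: L2M. Qed.

Lemma ipC v w : ip E v w = ip E w v.
Proof. by apply: eq_Rintegral => x _; rewrite mulrC. Qed.

Lemma ipvC F G : ipv E F G = ipv E G F.
Proof. by apply: eq_Rintegral => x _; rewrite dotC. Qed.

Lemma L2v_sip : semi_ip (@L2v R d E) (@ipv R d E).
Proof.
split.
- exact: L2v_sub.
- move=> a F G H hF hG hH; rewrite /ipv -RintZ//; last exact: L2v_dot.
  rewrite -RintD//; [|by apply: intbleZ => //; exact: L2v_dot|exact: L2v_dot].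
  by apply: eq_Rintegral => x _; rewrite -dotZl -dotDl.
- by move=> F G _ _; apply: eq_Rintegral => x _; rewrite dotC.
- by move=> F _; apply: Rintegral_ge0 => x _; exact: dot_sqr_ge0.
Qed.

Lemma ipv_ae F F' G G' : L2v E F -> L2v E F' -> L2v E G -> L2v E G' ->
  ae_on E (fun x => F x = F' x) -> ae_on E (fun x => G x = G' x) -> ipv E F G = ipv E F' G'.
Proof.
move=> hF hF' hG hG' h1 h2; apply: Rint_ae_eq => //.
- exact: intble_meas (L2v_dot hF hG).
- exact: intble_meas (L2v_dot hF' hG').
- by apply: ae_on_imp (ae_on_and h1 h2) => x _ [-> ->].
Qed.

Lemma is_wgrad_unique v F G : is_wgrad E v F -> is_wgrad E v G -> ae_on E (fun x => F x = G x).
Proof.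
move=> [LF hF] [LG hG].
have h i : ae_on E (fun x => F x 0 i = G x 0 i).
  have : ae_on E (fun x => F x 0 i - G x 0 i = 0).
    apply: fundamental_lemma => //; first exact: L2_sub.
    move=> phi tp; have Lp := test_fun_L2 mE tp.
    rewrite -[LHS]/(ip E ((fun x => F x 0 i) - (fun x => G x 0 i)) phi) (sipBl sp)//.
    by rewrite -[X in X - _]opprK -hF// -[X in _ - X]opprK -hG// subrr.
  by apply: ae_on_imp => x _ /eqP; rewrite subr_eq0 => /eqP.
by apply: ae_on_imp (ae_on_count h) => x _ hx; apply/rowP.
Qed.

Lemma is_wdiv_unique tau f g : is_wdiv E tau f -> is_wdiv E tau g -> ae_on E (fun x => f x = g x).
Proof.
move=> [Lf hf] [Lg hg].
have : ae_on E (fun x => f x - g x = 0).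
  apply: fundamental_lemma => //; first exact: L2_sub.
  move=> phi tp; have Lp := test_fun_L2 mE tp.
  rewrite -[LHS]/(ip E (f - g) phi) (sipBl sp)//.
  by rewrite -[X in X - _]opprK -hf// -[X in _ - X]opprK -hg// subrr.
by apply: ae_on_imp => x _ /eqP; rewrite subr_eq0 => /eqP.
Qed.

Lemma wgradP v : H1 E v -> is_wgrad E v (wgrad E v).
Proof. by move=> [_ [F hF]]; exact: (@xgetPex _ (fun=> 0) [set F | is_wgrad E v F] (ex_intro _ F hF)). Qed.

Lemma wdivP tau : Hdiv E tau -> is_wdiv E tau (wdiv E tau).
Proof. by move=> [_ [g hg]]; exact: (@xgetPex _ (fun=> 0) [set g | is_wdiv E tau g] (ex_intro _ g hg)). Qed.

Lemma wgrad_ae v F : L2 E v -> is_wgrad E v F -> ae_on E (fun x => wgrad E v x = F x).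
Proof.
move=> Lv hF; apply: (@is_wgrad_unique v) => //; apply: wgradP; split => //; by exists F.
Qed.

Lemma wdiv_ae tau g : L2v E tau -> is_wdiv E tau g -> ae_on E (fun x => wdiv E tau x = g x).
Proof.
move=> Lt hg; apply: (@is_wdiv_unique tau) => //; apply: wdivP; split => //; by exists g.
Qed.

Lemma wgrad_L2 v : H1 E v -> L2v E (wgrad E v).
Proof. by move=> /wgradP[]. Qed.

Lemma wdiv_L2 tau : Hdiv E tau -> L2 E (wdiv E tau).
Proof. by move=> /wdivP[]. Qed.

Lemma is_wgrad_lin a v w F G : L2 E v -> L2 E w -> is_wgrad E v F -> is_wgrad E w G ->
  is_wgrad E (a *: v + w) (a *: F + G).
Proof.
move=> Lv Lw [LF hF] [LG hG]; split; first exact: (L2v_sub.2 a F G).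
move=> phi i tp; have Lp := test_fun_L2 mE tp.
have Lpp := test_fun_L2 mE (test_fun_partial i tp).
rewrite (sip_lin sp)// hF// hG//.
have -> : (fun x => (a *: F + G) x 0 i) = a *: (fun x => F x 0 i) + (fun x => G x 0 i).
  by apply/funext => x; rewrite !mxE.
by rewrite (sip_lin sp)//; ring.
Qed.

Lemma grad_L2 phi : test_fun E phi -> L2v E (grad phi).
Proof.
move=> tp i; have := test_fun_L2 mE (test_fun_partial i tp); congr L2.
by apply/funext => x; rewrite mxE.
Qed.

Lemma is_wdiv_lin a F G f g : L2v E F -> L2v E G -> is_wdiv E F f -> is_wdiv E G g ->
  is_wdiv E (a *: F + G) (a *: f + g).
Proof.
move=> LF LG [Lf hf] [Lg hg]; split; first exact: L2_lin.
move=> phi tp; have Lp := test_fun_L2 mE tp.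
have Lpp := grad_L2 tp.
by rewrite (sip_lin L2v_sip)// hf// hg// (sip_lin sp)//; ring.
Qed.

Lemma H1_sub : subspace (@H1 R d E).
Proof.
split.
  split; first exact: L2_cst0.
  exists (fun=> 0); split; first exact: L2v_sub.1.
  move=> phi i _; rewrite /ip; under eq_Rintegral do rewrite mul0r.
  by under [in RHS]eq_Rintegral do rewrite mxE mul0r; rewrite Rint0 oppr0.
move=> a v w hv hw; split; first by apply: L2_lin => //; [exact: hv.1|exact: hw.1].
exists (a *: wgrad E v + wgrad E w); apply: is_wgrad_lin => //; [exact: hv.1|exact: hw.1|exact: wgradP|exact: wgradP].
Qed.

Lemma wgrad_lin a v w : H1 E v -> H1 E w ->
  ae_on E (fun x => wgrad E (a *: v + w) x = a *: wgrad E v x + wgrad E w x).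
Proof.
move=> hv hw; apply: (@wgrad_ae (a *: v + w) (a *: wgrad E v + wgrad E w)).
  by apply: L2_lin => //; [exact: hv.1|exact: hw.1].
by apply: is_wgrad_lin => //; [exact: hv.1|exact: hw.1|exact: wgradP|exact: wgradP].
Qed.

Lemma Hdiv_sub : subspace (@Hdiv R d E).
Proof.
split.
  split; first exact: L2v_sub.1.
  exists (fun=> 0); split; first exact: L2_cst0.
  move=> phi tp; rewrite (sip0l L2v_sip); last exact: grad_L2.
  by have := sip0l sp (test_fun_L2 mE tp) => ->; rewrite oppr0.
move=> a F G hF hG; split; first by apply: L2v_sub.2; [exact: hF.1|exact: hG.1].
exists (a *: wdiv E F + wdiv E G); apply: is_wdiv_lin => //; [exact: hF.1|exact: hG.1|exact: wdivP|exact: wdivP].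
Qed.

Lemma wdiv_lin a F G : Hdiv E F -> Hdiv E G ->
  ae_on E (fun x => wdiv E (a *: F + G) x = a * wdiv E F x + wdiv E G x).
Proof.
move=> hF hG; apply: (@wdiv_ae (a *: F + G) (a *: wdiv E F + wdiv E G)).
  by apply: L2v_sub.2; [exact: hF.1|exact: hG.1].
by apply: is_wdiv_lin => //; [exact: hF.1|exact: hG.1|exact: wdivP|exact: wdivP].
Qed.

Definition ipH1 v w : R := ip E v w + ipv E (wgrad E v) (wgrad E w).

Lemma H1_sip : semi_ip (@H1 R d E) ipH1.
Proof.
split.
- exact: H1_sub.
- move=> a v w z hv hw hz; rewrite /ipH1 (sip_lin sp) ?(hv.1, hw.1, hz.1)//; try by case: hv; case: hw; case: hz.
  have -> : ipv E (wgrad E (a *: v + w)) (wgrad E z) = ipv E (a *: wgrad E v + wgrad E w) (wgrad E z).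
    apply: ipv_ae; try exact: wgrad_L2.
    + by apply: wgrad_L2; exact: H1_sub.2.
    + by apply: L2v_sub.2; exact: wgrad_L2.
    + exact: wgrad_lin.
    + exact: ae_on_all.
  rewrite (sip_lin L2v_sip); try exact: wgrad_L2.
  by rewrite mulrDr addrACA.
- by move=> v w _ _; rewrite /ipH1 (ipC v w) (ipvC (wgrad E v)).
- move=> v hv; apply: addr_ge0; first by apply: (sip_ge0 sp); exact: hv.1.
  by apply: (sip_ge0 L2v_sip); exact: wgrad_L2.
Qed.

Lemma normH1E v : H1 E v -> normH1 E v = sip_norm ipH1 v.
Proof.
move=> hv; rewrite /normH1 /sip_norm /ipH1 !sqr_sqrtr//.
  by apply: (sip_ge0 L2v_sip); exact: wgrad_L2.
by apply: (sip_ge0 sp); exact: hv.1.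
Qed.

(** The product of two test functions is C1 with bounded support, so its partial derivatives
    integrate to zero; the Leibniz rule turns this into integration by parts. *)
Lemma test_fun_H1 phi : test_fun E phi -> H1 E phi /\ is_wgrad E phi (grad phi).
Proof.
move=> tp; have h : is_wgrad E phi (grad phi).
  split; first exact: grad_L2.
  move=> psi i tpsi.
  have mphi := test_fun_mollifier tp; have mpsi := test_fun_mollifier tpsi.
  have cphi := smooth_C1 mphi.1; have cpsi := smooth_C1 mpsi.1.
  have c1 := C1M cphi cpsi.
  have s1 : bounded_support (fun x => phi x * psi x).
    by have [M hM] := mphi.2; exists M => x /hM ->; rewrite mul0r.
  have D x : partial i (fun x => phi x * psi x) x = phi x * partial i psi x + psi x * partial i phi x.
    by apply: partialM; [exact: (cphi.2 i).1|exact: (cpsi.2 i).1].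
  have [M hM] := s1.
  have mp : measurable_fun T (partial i (fun x => phi x * psi x)).
    exact: continuous_measurable_rV (c1.2 i).2.
  have [ig I0] := Rint_lipschitz_partial (C1_lipschitz c1 s1) hM mp
    (ae_on_all (fun x _ => is_derive_partial ((c1.2 i).1 x))).
  have Lp := mollifier_L2 mphi; have Lq := mollifier_L2 mpsi.
  have Lpi := mollifier_L2 (mollifier_partial i mphi); have Lqi := mollifier_L2 (mollifier_partial i mpsi).
  have sub : \int[leb]_(x in E) partial i (fun x => phi x * psi x) x = 0.
    rewrite -[RHS]I0 Rint_ext; apply: eq_Rintegral => x _; rewrite restrictE.
    case: ifPn => //; rewrite notin_setE => Ex.
    by rewrite D (test_fun_out tp Ex) (test_fun_out (test_fun_partial i tp) Ex) mul0r mulr0 addr0.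
  have LpE := test_fun_L2 mE tp; have LqE := test_fun_L2 mE tpsi.
  have LpiE := test_fun_L2 mE (test_fun_partial i tp); have LqiE := test_fun_L2 mE (test_fun_partial i tpsi).
  apply/eqP; rewrite -addr_eq0 /ip -RintD//; last 2 first.
  - exact: L2M.
  - have := L2M mE LpiE LqE; apply: intble_eq => // x _; by rewrite mxE.
  rewrite -sub; apply/eqP; apply: eq_Rintegral => x _; rewrite D mxE; ring.
by split => //; split; [exact: test_fun_L2|exists (grad phi)].
Qed.

Lemma H10P v : H10 E v <-> H1 E v /\ exists phi : nat -> V -> R, (forall n, test_fun E (phi n)) /\
  sip_norm ipH1 (v - phi n) @[n --> \oo] --> (0 : R).
Proof.
have e (phi : nat -> V -> R) : H1 E v -> (forall n, test_fun E (phi n)) ->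
  (fun n => normH1 E (v \- phi n)) = fun n => sip_norm ipH1 (v - phi n).
  move=> hv tp; apply/funext => n; rewrite -normH1E//.
  by apply: (subspaceB H1_sub) => //; case: (test_fun_H1 (tp n)).
by split=> -[hv [phi [tp h]]]; split => //; exists phi; split => //; move: h; rewrite e.
Qed.

Lemma H10_H1 v : H10 E v -> H1 E v.
Proof. by case. Qed.

Lemma test_fun_H10 phi : test_fun E phi -> H10 E phi.
Proof.
move=> tp; apply/H10P; split; first by case: (test_fun_H1 tp).
exists (fun=> phi); split => //; rewrite subrr (sip_norm0 H1_sip); exact: cvg_cst.
Qed.

Lemma H10_sub : subspace (@H10 R d E).
Proof.
split; first by apply: test_fun_H10; exact: test_fun0.
move=> a v w /H10P[hv [phi [tphi cphi]]] /H10P[hw [psi [tpsi cpsi]]].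
apply/H10P; split; first exact: H1_sub.2.
exists (fun n => a *: phi n + psi n); split; first by move=> n; exact: test_fun_lin.
apply: (@cvg0_le _ _ (fun n => `|a| * sip_norm ipH1 (v - phi n) + sip_norm ipH1 (w - psi n))) => [n|].
  rewrite sqrtr_ge0 /=.
  have h1 := (test_fun_H1 (tphi n)).1; have h2 := (test_fun_H1 (tpsi n)).1.
  have -> : a *: v + w - (a *: phi n + psi n) = a *: (v - phi n) + (w - psi n).
    by rewrite scalerBr opprD addrACA.
  have hb1 := subspaceB H1_sub hv h1; have hb2 := subspaceB H1_sub hw h2.
  rewrite -(sip_normZ H1_sip)//; apply: (sip_triangle H1_sip) => //.
  exact: (subspaceZ _ H1_sub).
have := cvgD (cvgM (cvg_cst `|a|) cphi) cpsi; rewrite mulr0 addr0; exact.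
Qed.

End weak_derivatives.

(** * Extension by zero across a Lipschitz boundary *)

Section scalar_facts.
Context {R : realFieldType}.
Implicit Types a b c e m r s : R.

Lemma lt_half_add a b s : b <= s / 2 -> a < s / 2 -> b + a < s.
Proof. by move=> ? ?; lra. Qed.

Lemma le_of_dist a b e : `|a - b| <= e -> a < 0 -> b <= e.
Proof. by rewrite ler_norml => /andP[h _] ?; lra. Qed.

Lemma eq_refl_le a b : a = b -> a <= b.
Proof. by move=> ->. Qed.

Lemma quarter_add a b r : a < r / 2 -> b < r / 4 -> a + b <= r / 4 * 3.
Proof. by move=> ? ?; lra. Qed.

Lemma quarter_sub a b c r : r < a -> b < r / 4 -> a <= c + b -> r / 4 * 3 < c.
Proof. by move=> ? ? ?; lra. Qed.

Lemma shrink_lt m a : 0 < m -> 0 <= a -> m / (2 * (a + 1)) * a < m.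
Proof.
move=> m0 a0; have h : 0 < 2 * (a + 1) by lra.
by rewrite mulrAC ltr_pdivrMr// ltr_pM2l//; lra.
Qed.

End scalar_facts.

Section norms.
Context {R : realType} {d : nat}.
Local Notation V := 'rV[R]_d.

Lemma dot_le_norm (x y : V) : `|dot x y| <= d%:R * `|x| * `|y|.
Proof.
apply: (le_trans (ler_norm_sum _ _ _)).
apply: (@le_trans _ _ (\sum_(i < d) `|x| * `|y|)); last first.
  by rewrite sumr_const card_ord -[X in X <= _]mulr_natl mulrA.
by apply: ler_sum => i _; rewrite normrM ler_pM//; exact: coord_le_norm.
Qed.

Lemma enorm_le_norm (x : V) : enorm x <= d%:R * `|x|.
Proof.
have h : 0 <= d%:R * `|x| by rewrite mulr_ge0.
rewrite /enorm -[leRHS]ger0_norm// -sqrtr_sqr ler_wsqrtr//.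
apply: (le_trans (ler_norm _)); apply: (le_trans (dot_le_norm _ _)).
rewrite exprMn expr2 expr2 -mulrA ler_wpM2r ?mulr_ge0//.
by case: (d) => [|n]; rewrite ?mulr0//; rewrite ler_peMl// ler1n.
Qed.

Lemma norm_le_enorm (x : V) : `|x| <= enorm x.
Proof.
rewrite rV_norm_le ?sqrtr_ge0// => i.
rewrite -sqrtr_sqr ler_wsqrtr// /dot (bigD1 i)//= expr2 lerDl.
by apply: sumr_ge0 => j _; rewrite -expr2 sqr_ge0.
Qed.

Lemma nbhs_rVP (x : V) (P : V -> Prop) : (\forall y \near x, P y) <->
  exists e : R, 0 < e /\ forall y, `|y - x| < e -> P y.
Proof.
split.
  move=> /nbhs_ballP[e /= e0 eP]; exists e; split => // y yx; apply: eP.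
  by rewrite -ball_normE /= distrC.
move=> [e [e0 eP]]; apply/nbhs_ballP; exists e => //= y; rewrite -ball_normE /= distrC; exact: eP.
Qed.

Lemma closure_rVP (A : set V) (x : V) : closure A x <->
  forall e : R, 0 < e -> exists y, A y /\ `|y - x| < e.
Proof.
split.
  move=> cA e e0; have [|y [Ay yx]] := cA [set y | `|y - x| < e]; last by exists y.
  by apply/nbhs_rVP; exists e; split.
move=> h B /nbhs_rVP[e [e0 eB]]; have [y [Ay yx]] := h e e0.
by exists y; split => //; exact: eB.
Qed.

End norms.

Section lipschitz_domains.
Context {R : realType} {d : nat}.
Local Notation V := 'rV[R]_d.
Variable E : set V.
Hypothesis lE : lipschitz_domain E.

Lemma lipschitz_domain_open : open E. Proof. by case: lE. Qed.

Lemma lipschitz_domain_fin : (@lebesgue_rV R d E < +oo)%E.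
Proof. have [bE oE _ _] := lE; apply: bounded_lebesgue => //; exact: open_measurable_rV. Qed.

Lemma bounded_closure (M : R) : (forall x, E x -> `|x| <= M) -> forall x, closure E x -> `|x| <= M.
Proof.
move=> hM x cx; apply/ler_addgt0Pl => e e0; have /closure_rVP/(_ e e0)[y [Ey yx]] := cx.
have := ler_normB y (y - x); rewrite opprB addrCA subrr addr0 addrC => h.
by apply: (le_trans h); apply: lerD; [exact: ltW|exact: hM].
Qed.

Lemma lipschitz_domain_bound : exists M : R, forall x, closure E x -> `|x| <= M.
Proof.
have [[M [_ hM]] _ _ _] := lE; exists (M + 1); apply: bounded_closure => x Ex.
by apply: (hM (M + 1)) => //; rewrite ltrDl.
Qed.

Lemma compact_closure : compact (closure E).
Proof.
apply: bounded_closed_compact; last exact: closed_closure.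
have [M hM] := lipschitz_domain_bound; exists M; split; rewrite ?num_real// => K MK x /hM h.
exact: le_trans h (ltW MK).
Qed.

(* [g] measures the signed height below the graph. *)
Lemma boundary_chart x : closure E x -> ~ E x -> exists (e : V) (g : V -> R) (s : R),
  [/\ 0 < s, lipschitz_fun g, forall y t, g (y + t *: e) = g y - t &
    forall y, `|y - x| < s -> E y <-> g y < 0].
Proof.
move=> cx Ex; have [_ oE _ bE] := lE.
have : (closure E `\` E°) x by split => //; rewrite (interior_id E).1.
move=> /bE[e [gam [e1 [k hk] /nbhs_rVP[s [s0 hs]]]]].
have ee : dot e e = 1.
  by have := congr1 (fun z => z ^+ 2) e1; rewrite /enorm sqr_sqrtr ?dot_sqr_ge0// expr1n.
exists e, (fun y => gam (y - dot y e *: e) - dot y e), s; split => //.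
- have en : `|e| <= 1 by rewrite -e1; exact: norm_le_enorm.
  exists (`|k| * (d%:R * (1 + d%:R)) + d%:R); split; first by rewrite addr_ge0// mulr_ge0// mulr_ge0// addr_ge0.
  move=> y z; have h1 : `|dot (z - y) e| <= d%:R * `|z - y|.
    apply: (le_trans (dot_le_norm _ _)).
    by rewrite -mulrA ler_wpM2l// ler_piMr.
  have -> : gam (z - dot z e *: e) - dot z e - (gam (y - dot y e *: e) - dot y e) =
     (gam (z - dot z e *: e) - gam (y - dot y e *: e)) - dot (z - y) e by rewrite dotBl; ring.
  apply: (le_trans (ler_normB _ _)); rewrite mulrDl; apply: lerD => //.
  apply: (le_trans (hk _ _)); rewrite -mulrA.
  apply: (@le_trans _ _ (`|k| * enorm (z - dot z e *: e - (y - dot y e *: e)))).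
    by rewrite ler_wpM2r ?ler_norm// sqrtr_ge0.
  rewrite ler_wpM2l//; apply: (le_trans (enorm_le_norm _)); rewrite -mulrA ler_wpM2l//.
  have -> : z - dot z e *: e - (y - dot y e *: e) = (z - y) - dot (z - y) e *: e.
    by rewrite dotBl scalerBl !opprB addrACA [RHS]addrACA; congr (_ + _); exact: addrC.
  apply: (le_trans (ler_normB _ _)); rewrite mulrDl mul1r lerD2l normrZ.
  by apply: le_trans h1; rewrite ler_piMr.
- move=> y t; rewrite dotDl dotZl ee mulr1 scalerDl opprD addrACA subrr addr0 opprD addrA //.
- move=> y /hs ->; by rewrite subr_lt0.
Qed.

Lemma closure_chart (x : V) (g : V -> R) (s : R) : lipschitz_fun g ->
  (forall y, `|y - x| < s -> E y <-> g y < 0) ->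
  forall y, `|y - x| < s -> closure E y -> g y <= 0.
Proof.
move=> [L [L0 hL]] hs y yx cy; apply/ler_addgt0Pl => e e0; rewrite addr0.
have e1 : 0 < Num.min (s - `|y - x|) (e / (L + 1)).
  by rewrite lt_min subr_gt0 yx divr_gt0// ltr_wpDl.
have /closure_rVP/(_ _ e1)[z [Ez]] := cy; rewrite lt_min => /andP[h1 h2].
have zx : `|z - x| < s.
  have := ler_normD (z - y) (y - x); rewrite addrA subrK => h.
  by apply: (le_lt_trans h); rewrite -ltrBrDr.
have gz := (hs z zx).1 Ez.
apply: le_of_dist gz; rewrite distrC; apply: (le_trans (hL _ _)).
apply: (@le_trans _ _ ((L + 1) * `|z - y|)).
  by rewrite distrC ler_wpM2r// lerDl.
by rewrite mulrC -ler_pdivlMr ?ltr_wpDl// ltW.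
Qed.

(** A Lipschitz domain has no slits: at an interior point of the closure outside [E], a small step
    against the direction of the chart would stay in the closure and yet make [g] positive. The
    lemma places the open elements of a mesh inside the domain. *)
Lemma interior_closure_sub : (closure E)° `<=` E.
Proof.
move=> x ix; apply: contrapT => Ex.
have cx : closure E x by exact: interior_subset.
have [e [g [s [s0 lg ge hs]]]] := boundary_chart cx Ex.
have [r [r0 hr]] := (nbhs_rVP _ _).1 (ix : \forall y \near x, closure E y).
have e1 : 0 < `|e| + 1 by rewrite ltr_wpDl.
pose t := Num.min r s / (2 * (`|e| + 1)).
have rs : 0 < Num.min r s by rewrite lt_min r0 s0.
have t0 : 0 < t by rewrite divr_gt0// mulr_gt0.
have te : `|x + (- t) *: e - x| < Num.min r s.
  by rewrite addrAC subrr add0r normrZ normrN (gtr0_norm t0); exact: shrink_lt.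
move: te; rewrite lt_min => /andP[tr ts].
have := closure_chart lg hs ts (hr _ tr); rewrite ge opprK.
have xx : `|x - x| < s by rewrite subrr normr0.
have : 0 <= g x by rewrite leNgt; apply/negP => /((hs x xx).2).
move: t0; clearbody t; clear; lra.
Qed.

(** Near a boundary point [g] decreases strictly along the direction of the chart, so small shifts
    in this direction carry the closure into [E]; around a point of [E] the direction 0 serves. *)
Lemma good_radius x : closure E x -> exists (r : R) (e : V) (t0 : R),
  [/\ 0 < r, 0 < t0 & forall t y, 0 < t < t0 -> closure E y -> `|y - x| <= r -> E (y + t *: e)].
Proof.
move=> cx; have [Ex|Ex] := pselect (E x).
  have := lipschitz_domain_open; rewrite openE => /(_ x Ex).
  move=> h; have [s [s0 hs]] := (nbhs_rVP _ _).1 h.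
  exists (s / 2), 0, 1; split => //; first by rewrite divr_gt0.
  move=> t y _ _ yx; rewrite scaler0 addr0; apply: hs; apply: (le_lt_trans yx).
  by rewrite ltr_pdivrMr// ltr_pMr// ltr1n.
have [e [g [s [s0 lg ge hs]]]] := boundary_chart cx Ex.
have e1 : 0 < `|e| + 1 by rewrite ltr_wpDl.
exists (s / 2), e, (s / 2 / (`|e| + 1)); split; rewrite ?divr_gt0//.
move=> t y /andP[t0 t1] cy yx.
have yx' : `|y - x| < s.
  by apply: (le_lt_trans yx); rewrite ltr_pdivrMr// ltr_pMr// ltr1n.
apply/(hs _ _).2; last first.
  by rewrite ge; have := closure_chart lg hs yx' cy; move: t0; clear; lra.
rewrite addrAC; apply: (le_lt_trans (ler_normD _ _)).
have : `|t *: e| < s / 2.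
  rewrite normrZ gtr0_norm//; apply: (@le_lt_trans _ _ (t * (`|e| + 1))).
    by rewrite ler_wpM2l ?(ltW t0)// lerDl.
  by rewrite -ltr_pdivlMr.
exact: lt_half_add.
Qed.

End lipschitz_domains.

(** * Functions whose extension by zero is weakly differentiable *)

Section zero_extension.
Context {R : realType} {d : nat}.
Local Notation V := 'rV[R]_d.
Local Notation leb := (@lebesgue_rV R d).
Local Notation e_ i := (delta_mx 0 i : V).
Local Notation T := [set: V].
Variable E : set V.
Hypothesis lE : lipschitz_domain E.
Let oE : open E := lipschitz_domain_open lE.
Let fE := lipschitz_domain_fin lE.
Let mE : measurable E := open_measurable_rV oE.
Let mT : measurable T := measurableT.
Implicit Types (f : V -> R) (q : V -> V).

(** The functions [phi] need not vanish near the boundary of [E]: this expresses the zero trace of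
    [f] without traces. *)
Definition ext_grad f q : Prop := [/\ L2 T f, (forall i, L2 T (fun x => q x 0 i)),
  (forall x, ~ E x -> f x = 0), (forall x, ~ E x -> q x = 0) &
  forall phi, C1 phi -> bounded_support phi -> forall i,
    ip T f (partial i phi) = - ip T (fun x => q x 0 i) phi].

Definition approximable f q : Prop := forall e : R, 0 < e -> exists phi, [/\ test_fun E phi,
  normL2 T (f - phi) <= e & forall i, normL2 T ((fun x => q x 0 i) - partial i phi) <= e].

(** Compactness makes the room around the shifted set uniform in its points. *)
Lemma compact_thick (K O : set V) (v : V) : compact K -> open O -> (forall y, K y -> O (y + v)) ->
  exists s : R, 0 < s /\ forall y w, K y -> `|w| < s -> O (y + v + w).
Proof.
move=> cK oO KO.
pose P (s : R) (y : V) := forall w, `|w| < s -> O (y + v + w).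
have F0 : Filter (0 : R)^'+ by exact: filter_filter.
have nc : forall x, K x -> \forall x' \near x & s \near (0 : R)^'+, P s x'.
  move=> x Kx; have := oO; rewrite openE => /(_ _ (KO x Kx)) h.
  have [e [e0 he]] := (nbhs_rVP _ _).1 h.
  exists ([set y : V | `|y - x| < e / 2], [set s : R | s < e / 2]) => /=.
    split; first by apply/nbhs_rVP; exists (e / 2); split => //; rewrite divr_gt0.
    by apply: nbhs_right_lt; rewrite divr_gt0.
  move=> [y s] /= [yx se] w ws; apply: he.
  have -> : y + v + w - (x + v) = (y - x) + w by rewrite (addrAC y) opprD addrACA subrr addr0 addrAC.
  apply: (le_lt_trans (ler_normD _ _)); apply: lt_half_add; first exact: ltW.
  exact: lt_trans ws se.
have H := (compact_near_coveringP K).1 cK R (0 : R)^'+ P F0 nc.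
have H2 : \forall s \near (0 : R)^'+, 0 < s by exact: nbhs_right_gt.
near ((0 : R)^'+) => s; exists s; split.
  by near: s.
have : K `<=` P s by near: s.
by move=> KP y w Ky; exact: KP.
Unshelve. all: by end_near. Qed.

Lemma ext_grad_intble f q : ext_grad f q -> intble T f /\ forall i, intble T (fun x => q x 0 i).
Proof.
move=> [Lf Lq f0 q0 _].
have h (g : V -> R) : L2 T g -> (forall x, ~ E x -> g x = 0) -> intble T g.
  move=> Lg g0; have := L2_fin_intble mE fE (L2_setT mE Lg); move/(intble_ext mE).
  apply: intble_eq => // x _; have [Ex|Ex] := pselect (E x); first by rewrite restrictT.
  by rewrite restrictN// g0.
by split=> [|i]; apply: h => // x /q0 ->; rewrite mxE.
Qed.

(** The function is pushed into the domain by [t *: e] and mollified at a smaller scale, in one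
    convolution: the kernel is centred at [- (t *: e)], so the value at [x] samples [f] near
    [x - t *: e]. The identity in [ext_grad], tested with this kernel, makes convolution commute
    with the weak gradient. *)
Lemma approximable_local f q (x0 e : V) (r t0 : R) : ext_grad f q -> 0 < t0 ->
  (forall x, r < `|x - x0| -> f x = 0 /\ q x = 0) ->
  (forall t y, 0 < t < t0 -> closure E y -> `|y - x0| <= r -> E (y + t *: e)) -> approximable f q.
Proof.
move=> fq t00 out push ep ep0; have [if_ iq] := ext_grad_intble fq.
have [Lf Lq f0 q0 wk] := fq.
have [rho [rho0 hf hq]] : exists rho : R, [/\ 0 < rho,
    forall z, `|z| < rho -> normL2 T (translate z f - f) <= ep &
    forall i z, `|z| < rho -> normL2 T (translate z (fun x => q x 0 i) - (fun x => q x 0 i)) <= ep].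
  have [_ /(_ _ ep0)[r1 [r10 h1]]] := L2_translate_continuous Lf.
  have /boolp.choice[r2 hr2] : forall i, exists r2 : R, 0 < r2 /\ forall z, `|z| < r2 ->
      normL2 T (translate z (fun x => q x 0 i) - (fun x => q x 0 i)) <= ep.
    by move=> i; have [_ /(_ _ ep0)] := L2_translate_continuous (Lq i).
  pose r3 := \big[Num.min/r1]_i r2 i.
  have r30 : 0 < r3.
    rewrite /r3; elim/big_ind: _ => // [a b a0 b0|i _]; first by rewrite lt_min a0 b0.
    by case: (hr2 i).
  have r32 i : r3 <= r2 i by rewrite /r3 (bigD1 i)//= ge_min lexx.
  exists (Num.min r1 r3); split; first by rewrite lt_min r10 r30.
    by move=> z; rewrite lt_min => /andP[/h1].
  move=> i z; rewrite lt_min => /andP[_ zr]; apply: (hr2 i).2; exact: lt_le_trans zr (r32 i).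
(* Small enough for the push to be admissible and to use at most half of the shift [rho] tolerated
   by the L2 continuity; the radius of the kernel uses the other half. *)
pose t := Num.min (t0 / 2) (rho / 2 / (2 * (`|e| + 1))).
have e1 : 0 < 2 * (`|e| + 1) by rewrite mulr_gt0// ltr_wpDl.
have tt : 0 < t < t0.
  rewrite lt_min !divr_gt0//= gt_min; apply/orP; left.
  by rewrite ltr_pdivrMr// ltr_pMr// ltr1n.
have te : `|t *: e| <= rho / 2.
  have /andP[tp _] := tt; rewrite normrZ gtr0_norm//.
  apply: (@le_trans _ _ (rho / 2 / (2 * (`|e| + 1)) * `|e|)).
    by rewrite ler_wpM2r// /t ge_min lexx orbT.
  by apply: ltW; apply: shrink_lt; rewrite // divr_gt0.
pose K := closure E `&` [set y | `|y - x0| <= r].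
have cK : compact K.
  apply: compact_closedI; first exact: compact_closure.
  by apply: compact_closed_rV; exact: compact_cball.
have KE y : K y -> E (y + t *: e) by move=> [cy yr]; exact: push.
have [s [s0 hs]] := compact_thick cK oE KE.
have sr : 0 < Num.min (s / 2) (rho / 2) by rewrite lt_min !divr_gt0.
have [k [mk k0 k1 ks]] := mollifier_exists (- (t *: e)) sr.
have kz z : k z != 0 -> `|z| < rho.
  move=> /ks; rewrite opprK lt_min => /andP[_ zr].
  have := ler_normB (z + t *: e) (t *: e); rewrite addrK => h.
  by apply: (le_lt_trans h); rewrite addrC; exact: lt_half_add.
pose phi := conv f k.
have D i x : is_derive x (e_ i) phi (conv (fun y => q y 0 i) k x).
  have h := is_derive_conv i x if_ mk; apply: (is_derive_eq h).
  have mt := mollifier_translate (- x) mk.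
  have -> : conv f (partial i k) x = ip T f (partial i (fun y => k (y - x))).
    apply: eq_Rintegral => y _; congr (_ * _).
    by rewrite partial_translate//; exact: smooth_derivable mk.1.
  by rewrite (wk _ (smooth_C1 mt.1) mt.2 i) opprK.
have Dp i : partial i phi = conv (fun y => q y 0 i) k.
  by apply/funext => x; rewrite /partial; case: (D i x).
exists phi; split.
- split; first exact: smooth_conv.
  (* [phi] vanishes off [U], and points in the closure of [U] are still closer than [s] to the
     pushed compact set, hence in [E]. *)
  pose U := [set x | exists y, K y /\ `|x - (y + t *: e)| < s / 2].
  have UE : closure U `<=` E.
    have s20 : 0 < s / 2 by rewrite divr_gt0.
    move=> x /closure_rVP/(_ (s / 2) s20)[x' [[y [Ky x'y]] xx']].
    have -> : x = y + t *: e + (x - (y + t *: e)) by rewrite addrC subrK.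
    apply: hs => //; have := ler_normD (x - x') (x' - (y + t *: e)); rewrite addrA subrK => h.
    apply: (le_lt_trans h); apply: lt_half_add => //; by rewrite distrC ltW.
  exists (closure U); split => //.
    have h0 := @closed_closure _ U; have h00 := compact_closure lE; have h1 := subclosed_compact h0 h00; apply: h1.
    by move=> x /UE; exact: subset_closure.
  move=> x Ux; rewrite /phi /conv; under eq_Rintegral => y _.
    have -> : f y * k (y - x) = 0; last by over.
    have [->|fy] := eqVneq (f y) 0; first by rewrite mul0r.
    have [->|ky] := eqVneq (k (y - x)) 0; first by rewrite mulr0.
    exfalso; apply: Ux; apply: subset_closure; exists y; split.
      split; first by apply: subset_closure; apply: contrapT => /f0/eqP; rewrite (negbTE fy).
      by rewrite /= leNgt; apply/negP => /out[/eqP]; rewrite (negbTE fy).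
    have := ks _ ky; rewrite opprK lt_min => /andP[h _].
    by rewrite distrC addrAC.
  exact: Rint0.
- have [Lc h] := conv_approx Lf if_ mk k0 k1 (ltW ep0) (fun z h => hf z (kz z h)).
  exact: le_trans (eq_refl_le (sip_normBC (L2_sip mT) Lf Lc)) h.
- move=> i; rewrite Dp; have [Lc h] := conv_approx (Lq i) (iq i) mk k0 k1 (ltW ep0) (fun z h => hq i z (kz z h)).
  exact: le_trans (eq_refl_le (sip_normBC (L2_sip mT) (Lq i) Lc)) h.
Qed.

(** The function is the indicator of the ball of radius [3 * r / 4], mollified at scale [r / 4]. *)
Lemma plateau (x0 : V) (r : R) : 0 < r -> exists psi : V -> R, [/\ mollifier psi,
  forall x, `|x - x0| < r / 2 -> psi x = 1 & forall x, r < `|x - x0| -> psi x = 0].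
Proof.
move=> r0; have r4 : 0 < r / 4 by rewrite divr_gt0.
have [k [mk k0 k1 ks]] := mollifier_exists (0 : V) r4.
pose B := [set x : V | `|x - x0| <= r / 4 * 3].
have cB : closed B by apply: compact_closed_rV; exact: compact_cball.
have mB := closed_measurable_rV cB.
have fB : (leb B < +oo)%E.
  apply: bounded_lebesgue => //; exists (`|x0| + r / 4 * 3); split; rewrite ?num_real// => K MK x /= xr.
  apply: le_trans (ltW MK); have := ler_normD (x - x0) x0; rewrite subrK => h.
  by apply: (le_trans h); rewrite addrC lerD2l.
have iB := intble_indic mB fB.
have c1 x : `|x - x0| < r / 2 -> conv (\1_B) k x = 1.
  move=> xr; rewrite conv_shift// -[RHS]k1; apply: eq_Rintegral => z _.
  have [->|/ks zr] := eqVneq (k z) 0; first by rewrite mulr0.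
  rewrite subr0 in zr; rewrite indicE mem_set ?mul1r// /B /= addrAC.
  by apply: (le_trans (ler_normD _ _)); exact: quarter_add.
have c0 x : r < `|x - x0| -> conv (\1_B) k x = 0.
  move=> xr; rewrite conv_shift// -[RHS](@Rint0 R d T); apply: eq_Rintegral => z _.
  have [->|/ks zr] := eqVneq (k z) 0; first by rewrite mulr0.
  rewrite subr0 in zr; rewrite indicE memNset ?mul0r// /B /= addrAC => /le_gtF; rewrite (@quarter_sub _ `|x - x0| `|z|)//.
  by have := ler_normB (x - x0 + z) z; rewrite addrK.
exists (conv (\1_B) k); split => //; split; first exact: smooth_conv.
exists (`|x0| + r) => x xr; apply: c0.
rewrite -(ltrD2l `|x0|); apply: (lt_le_trans xr).
by have := ler_normD x0 (x - x0); rewrite addrCA subrr addr0.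
Qed.

Lemma partial_cst_out (f : V -> R) (c : R) i (x : V) (U : set V) : open U -> U x ->
  (forall y, U y -> f y = c) -> (forall y, derivable f y (e_ i)) -> partial i f x = 0.
Proof.
move=> oU Ux fc df.
have d0 : derivable (fun _ : V => - c) x (e_ i) by exact: derivable_cst.
have := @partial_out _ _ (fun y => f y + - c) i x U oU Ux.
rewrite partialD// {2}/partial derive_cst addr0; apply.
by move=> y /fc ->; rewrite subrr.
Qed.

Lemma open_cball_out (x0 : V) (r : R) : open [set x : V | r < `|x - x0|].
Proof.
rewrite (_ : [set x : V | r < `|x - x0|] = ~` [set x | `|x - x0| <= r]).
  by apply: closed_openC; apply: compact_closed_rV; exact: compact_cball.
by apply/seteqP; split => x /=; rewrite real_ltNge ?num_real//; move/negP.
Qed.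

Lemma open_ball_in (x0 : V) (r : R) : open [set x : V | `|x - x0| < r].
Proof.
rewrite openE => x /= xr; apply/nbhs_rVP; exists (r - `|x - x0|); rewrite subr_gt0; split => // y yx.
have := ler_normD (y - x) (x - x0); rewrite addrA subrK => h.
by apply: (le_lt_trans h); rewrite -ltrBrDr.
Qed.

Lemma mollifier_bound (k : V -> R) : mollifier k -> exists M : R, forall x, `|k x| <= M.
Proof. by move=> mk; apply: continuous_bounded_support; [exact: smooth_continuous mk.1|exact: mk.2]. Qed.

Lemma L2_mul_mollifier f k : L2 T f -> mollifier k -> L2 T (fun x => f x * k x).
Proof.
move=> Lf mk; have [M hM] := mollifier_bound mk.
have mkm := continuous_measurable_rV (smooth_continuous mk.1).
have := L2_bounded_mul mT mkm (ae_on_all (fun x _ => hM x)) Lf.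
by congr L2; apply/funext => x; rewrite mulrC.
Qed.

Lemma continuous_L2 (g : V -> R) : continuous g -> bounded_support g -> L2 T g.
Proof.
move=> cg sg; have [B hB] := continuous_bounded_support cg sg; have [M hM] := sg.
have mg := continuous_measurable_rV cg.
split => //; apply: (intble_bounded_support (B := B ^+ 2) (M := M)).
- exact: measurable_funX.
- move=> x; rewrite normrX lerXn2r ?nnegrE//; exact: le_trans (hB x).
- by move=> x /hM->; rewrite expr0n.
Qed.

Lemma ext_grad_mul f q psi : ext_grad f q -> mollifier psi ->
  ext_grad (fun x => f x * psi x) (fun x => psi x *: q x + f x *: grad psi x).
Proof.
move=> [Lf Lq f0 q0 wk] mp.
have Ci i := mollifier_partial i mp.
split.
- exact: L2_mul_mollifier.
- move=> i; have := L2_add mT (L2_mul_mollifier (Lq i) mp) (L2_mul_mollifier Lf (Ci i)).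
  by congr L2; apply/funext => x; rewrite !mxE mulrC.
- by move=> x /f0 ->; rewrite mul0r.
- by move=> x Ex; rewrite f0// q0// scaler0 scale0r addr0.
move=> phi cphi sphi i.
have cpsi := smooth_C1 mp.1.
have sp : bounded_support (fun x => psi x * phi x).
  by have [M hM] := sphi; exists M => x /hM->; rewrite mulr0.
have := wk _ (C1M cpsi cphi) sp i.
have L1 : L2 T (fun x => f x * psi x) := L2_mul_mollifier Lf mp.
have L2_ := L2_mul_mollifier Lf (Ci i).
have L3 := L2_mul_mollifier (Lq i) mp.
have Lp := continuous_L2 cphi.1 sphi.
have Lpp := continuous_L2 (cphi.2 i).2 (bounded_support_partial i sphi).
have E1 : ip T f (partial i (fun x => psi x * phi x)) =
   ip T (fun x => f x * psi x) (partial i phi) + ip T (fun x => f x * partial i psi x) phi.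
  rewrite /ip -RintD//; try exact: L2M.
  apply: eq_Rintegral => x _; rewrite partialM; first by ring.
    exact: (cpsi.2 i).1.
  exact: (cphi.2 i).1.
rewrite E1 => h; apply: (addIr (ip T (fun x => f x * partial i psi x) phi)); rewrite h.
have -> : ip T (fun x => q x 0 i) (fun x => psi x * phi x) = ip T (fun x => q x 0 i * psi x) phi.
  by apply: eq_Rintegral => x _; ring.
have -> : ip T (fun x => (psi x *: q x + f x *: grad psi x) 0 i) phi =
    ip T (fun x => q x 0 i * psi x) phi + ip T (fun x => f x * partial i psi x) phi.
  by rewrite /ip -RintD//; try exact: L2M; apply: eq_Rintegral => x _; rewrite !mxE; ring.
by rewrite opprD addrNK.
Qed.

Lemma ext_gradB f g p q : ext_grad f p -> ext_grad g q -> ext_grad (f - g) (p - q).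
Proof.
move=> [Lf Lp f0 p0 wf] [Lg Lq g0 q0 wg]; split.
- exact: L2_sub.
- by move=> i; have := L2_sub mT (Lp i) (Lq i); congr L2; apply/funext => x; rewrite !mxE.
- by move=> x Ex; rewrite -[LHS]/(f x - g x) f0// g0// subrr.
- by move=> x Ex; rewrite -[LHS]/(p x - q x) p0// q0// subrr.
move=> phi cphi sphi i.
have L1 := continuous_L2 cphi.1 sphi; have L1p := continuous_L2 (cphi.2 i).2 (bounded_support_partial i sphi).
rewrite (sipBl (L2_sip mT))// wf// wg//.
have -> : (fun x => (p - q) x 0 i) = (fun x => p x 0 i) - (fun x => q x 0 i).
  by apply/funext => x; rewrite !mxE.
by rewrite (sipBl (L2_sip mT))// opprB opprK addrC.
Qed.

Lemma approximable0 f q : (forall x, f x = 0) -> (forall x, q x = 0) -> approximable f q.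
Proof.
move=> f0 q0 e e0; exists (fun=> 0).
have -> : f = fun=> 0 by apply/funext.
have -> : q = fun=> 0 by apply/funext.
have n0 : normL2 T (fun=> 0) = 0 :> R by rewrite /normL2 /ip; under eq_Rintegral do rewrite mulr0; rewrite Rint0 sqrtr0.
split; first exact: test_fun0.
  rewrite (_ : _ - _ = fun=> 0) ?n0 ?ltW//; by apply/funext => x; rewrite -[LHS]/(0 - 0) subrr.
move=> i; rewrite (_ : _ - _ = fun=> 0) ?n0 ?ltW//; apply/funext => x.
rewrite -[LHS]/((0 : V) 0 i - partial i (fun=> 0) x) mxE.
by rewrite /partial derive_cst subrr.
Qed.

Lemma approximableD f g p q : ext_grad f p -> ext_grad g q -> approximable f p -> approximable g q ->
  approximable (f + g) (p + q).
Proof.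
move=> [Lf Lp _ _ _] [Lg Lq _ _ _] hf hg e e0.
have e20 : 0 < e / 2 by rewrite divr_gt0.
have [phi [tp n1 n2]] := hf _ e20; have [psi [tq m1 m2]] := hg _ e20.
exists (1 *: phi + psi); split; first exact: test_fun_lin.
  have L1 := mollifier_L2 (test_fun_mollifier tp); have L2_ := mollifier_L2 (test_fun_mollifier tq).
  have -> : f + g - (1 *: phi + psi) = (f - phi) + (g - psi) by rewrite scale1r opprD addrACA.
  apply: (le_trans (normL2D _ _)); try exact: L2_sub.
  by rewrite (splitr e); exact: lerD.
move=> i; have L1 := mollifier_L2 (test_fun_mollifier (test_fun_partial i tp)).
have L2_ := mollifier_L2 (test_fun_mollifier (test_fun_partial i tq)).
have -> : (fun x => (p + q) x 0 i) - partial i (1 *: phi + psi) =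
    ((fun x => p x 0 i) - partial i phi) + ((fun x => q x 0 i) - partial i psi).
  apply/funext => x; rewrite scale1r.
  have -> : (partial i (phi + psi)) = fun x => partial i phi x + partial i psi x.
    apply/funext => y; apply: partialD; apply: smooth_derivable; [exact: tp.1|exact: tq.1].
  by rewrite -[LHS]/((p x + q x) 0 i - (partial i phi x + partial i psi x)) mxE opprD addrACA.
apply: (le_trans (normL2D _ _)); try exact: L2_sub.
by rewrite (splitr e); exact: lerD.
Qed.

(* Peel off one ball of the cover at a time. *)
Lemma approximable_cover (r t0 : V -> R) (e : V -> V) (s : seq V) :
  (forall c, closure E c -> [/\ 0 < r c, 0 < t0 c &
     forall t y, 0 < t < t0 c -> closure E y -> `|y - c| <= r c -> E (y + t *: e c)]) ->
  (forall c, c \in s -> closure E c) ->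
  forall f q, ext_grad f q ->
  (forall x, (forall c, c \in s -> r c / 2 <= `|x - c|) -> f x = 0 /\ q x = 0) -> approximable f q.
Proof.
move=> hr; elim: s => [_ f q _ h|c s IH cs f q fq h].
  by apply: approximable0 => x; have [] := h x.
have [rc tc push] := hr c (cs c (mem_head _ _)).
have [psi [mp psi1 psi0]] := plateau c rc.
pose f1 x := f x * psi x; pose q1 x := psi x *: q x + f x *: grad psi x.
have e1 : ext_grad f1 q1 := ext_grad_mul fq mp.
have e2 := ext_gradB fq e1.
have -> : f = f1 + (f - f1) by rewrite addrC subrK.
have -> : q = q1 + (q - q1) by rewrite addrC subrK.
have dp i y : derivable psi y (e_ i) by apply: smooth_derivable; exact: mp.1.
apply: approximableD => //.
  apply: (approximable_local e1 tc _ push) => x xr; split; first by rewrite /f1 psi0// mulr0.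
  rewrite /q1 psi0// scale0r add0r; suff -> : grad psi x = 0 by rewrite scaler0.
  apply/rowP => i; rewrite !mxE; exact: (partial_cst_out (@open_cball_out c (r c)) _ psi0).
apply: IH => //; first by move=> c' cs'; apply: cs; rewrite inE cs' orbT.
move=> x hx; have [xr|rx] := ltP `|x - c| (r c / 2).
  have g0 : grad psi x = 0.
    apply/rowP => i; rewrite !mxE.
    exact: (partial_cst_out (@open_ball_in c (r c / 2)) _ psi1).
  split; first by rewrite -[LHS]/(f x - f x * psi x) psi1// mulr1 subrr.
  by rewrite -[LHS]/(q x - (psi x *: q x + f x *: grad psi x)) psi1// g0 scaler0 addr0 scale1r subrr.
have [fx qx] : f x = 0 /\ q x = 0.
  by apply: h => c'; rewrite inE => /orP[/eqP->|/hx].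
split; first by rewrite -[LHS]/(f x - f x * psi x) fx mul0r subrr.
by rewrite -[LHS]/(q x - (psi x *: q x + f x *: grad psi x)) fx qx scaler0 scale0r addr0 subrr.
Qed.

Lemma ext_grad_approximable f q : ext_grad f q -> approximable f q.
Proof.
move=> fq; have [_ _ f0 q0 _] := fq.
have /boolp.choice[g hg] : forall c, exists g : R * V * R, closure E c ->
    [/\ 0 < g.1.1, 0 < g.2 &
     forall t y, 0 < t < g.2 -> closure E y -> `|y - c| <= g.1.1 -> E (y + t *: g.1.2)].
  move=> c; have [cc|cc] := pselect (closure E c); last by exists (0, 0, 0).
  by have [r [e [t0 h]]] := good_radius lE cc; exists (r, e, t0).
have := compact_closure lE; rewrite compact_cover => /(_ V (closure E) (fun c => [set x | `|x - c| < (g c).1.1 / 2])).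
case=> [c cc|x cx|D' sub cov].
- exact: open_ball_in.
- by exists x => //=; rewrite subrr normr0; have [? _ _] := hg x cx; rewrite divr_gt0.
apply: (@approximable_cover (fun c => (g c).1.1) (fun c => (g c).2) (fun c => (g c).1.2) (enum_fset D')) => //.
  by move=> c cD; have := sub c cD; rewrite inE.
move=> x hx; suff Ex : ~ E x by rewrite f0// q0.
move=> /subset_closure/cov[c /= cD xc]; have := hx c cD; by rewrite leNgt xc.
Qed.

Lemma ext_grad_wgrad f q : ext_grad f q -> is_wgrad E f q.
Proof.
move=> [Lf Lq f0 q0 wk]; split; first by move=> i; exact: L2_setT.
have ext (g : V -> R) : (forall x, ~ E x -> g x = 0) -> g \_ E = g.
  move=> g0; apply/funext => x; have [Ex|Ex] := pselect (E x); first by rewrite restrictT.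
  by rewrite restrictN// g0.
move=> phi i tp; have mp := test_fun_mollifier tp.
rewrite (ip_extl E f) (ip_extl E (fun x => q x 0 i)) (ext _ f0) ext; last first.
  by move=> x /q0 ->; rewrite mxE.
by apply: wk; [exact: smooth_C1 mp.1|exact: mp.2].
Qed.

Lemma ext_grad_H10 f q : ext_grad f q -> H10 E f.
Proof.
move=> fq; have [Lf Lq f0 q0 wk] := fq; have wf := ext_grad_wgrad fq.
have Hf : H1 E f by split; [exact: L2_setT|exists q].
apply/(H10P oE); split => //.
have /boolp.choice[phi hphi] : forall n : nat, exists phi, [/\ test_fun E phi,
  normL2 T (f - phi) <= n.+1%:R^-1 & forall i, normL2 T ((fun x => q x 0 i) - partial i phi) <= n.+1%:R^-1].
  by move=> n; apply: ext_grad_approximable => //; rewrite invr_gt0.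
exists phi; split; first by move=> n; case: (hphi n).
(* One term for the function and one for each of the [d] derivatives, each of norm at most
   [1/(n+1)]. *)
apply: (@cvg0_le _ _ (fun n => Num.sqrt (d.+1%:R) * n.+1%:R^-1)) => [n|]; last first.
  by have := cvgM (cvg_cst (Num.sqrt (d.+1%:R : R))) (@cvg_harmonic R); rewrite mulr0; exact.
rewrite sqrtr_ge0 /=; have [tp n1 n2] := hphi n.
have [hp wp] := test_fun_H1 oE tp.
have n0 : 0 <= n.+1%:R^-1 :> R by [].
rewrite -[X in _ * X]ger0_norm// -sqrtr_sqr -sqrtrM// ler_wsqrtr//.
have bnd (g : V -> R) : L2 T g -> normL2 T g <= n.+1%:R^-1 -> ip E g g <= n.+1%:R^-1 ^+ 2.
  move=> Lg h; apply: (@le_trans _ _ (ip T g g)).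
    by apply: Rint_subset => //; [exact: L2M|move=> x _; rewrite -expr2 sqr_ge0].
  have -> : ip T g g = normL2 T g ^+ 2 by rewrite sqr_sqrtr// (sip_ge0 (L2_sip mT)).
  by rewrite lerXn2r ?nnegrE ?sqrtr_ge0.
rewrite /ipH1 -natr1 mulrDl mul1r addrC; apply: lerD; last first.
  by apply: bnd => //; apply: L2_sub => //; exact: mollifier_L2 (test_fun_mollifier tp).
have Ld : H1 E (f - phi n) by apply: (subspaceB (H1_sub oE)).
have wd : is_wgrad E (f - phi n) (q - grad (phi n)).
  have := is_wgrad_lin oE (-1) hp.1 Hf.1 wp wf.
  by rewrite !scaleN1r ![- _ + _]addrC.
have Ld2 := wd.1; have Lw := wgrad_L2 Ld.
have ae := wgrad_ae oE fE Ld.1 wd.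
rewrite (ipv_ae oE Lw Ld2 Lw Ld2 ae ae) ipv_sum//.
apply: (@le_trans _ _ (\sum_(i < d) n.+1%:R^-1 ^+ 2)); last by rewrite sumr_const card_ord mulr_natl.
apply: ler_sum => i _.
have -> : (fun x => (q - grad (phi n)) x 0 i) = (fun x => q x 0 i) - partial i (phi n).
  by apply/funext => x; rewrite !mxE.
apply: bnd => //; apply: L2_sub => //; exact: mollifier_L2 (test_fun_mollifier (test_fun_partial i tp)).
Qed.

End zero_extension.

(** * Simplices *)

Section packing.
Context {R : realType} {d : nat}.
Local Notation V := 'rV[R]_d.
Local Notation leb := (@lebesgue_rV R d).
Local Notation e_ i := (delta_mx 0 i : V).

(** Counting disjoint translates inside a fixed set bounds measures without a change of variables;
    it yields both the nullity of hyperplanes and the size of barycentric gradients. *)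
Lemma packing (A B : set V) (v : V) (N : nat) : measurable A -> measurable B ->
  (forall k x, (k < N)%N -> A x -> B (x + k%:R *: v)) ->
  (forall k l x y, (k < l)%N -> A x -> A y -> x + k%:R *: v = y + l%:R *: v -> False) ->
  (N%:R%:E * leb A <= leb B)%E.
Proof.
move=> mA mB sub dis; pose F k := (fun x : V => x + - (k%:R *: v)) @^-1` A.
have mF k : measurable (F k).
  by rewrite -[F k]setTI; exact: (measurable_shift_rV _ measurableT mA).
have -> : (N%:R%:E * leb A = leb (\big[setU/set0]_(k < N) F k))%E.
  rewrite measure_bigsetU//; last first.
    apply/trivIsetP => k l _ _ kl; apply/seteqP; split=> // x [Fk Fl].
    have [h|h|h] := ltngtP k l.
    + by apply: (dis _ _ _ _ h Fk Fl); rewrite !subrK.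
    + by apply: (dis _ _ _ _ h Fl Fk); rewrite !subrK.
    + by rewrite h eqxx in kl.
  rewrite (eq_bigr (fun=> leb A)) => [|k _]; last exact: lebesgue_rV_shift.
  by rewrite big_const_ord; elim: (N) => [|m IH]; rewrite ?mul0e//= -natr1 EFinD ge0_muleDl ?lee_fin// mul1e IH addeC.
apply: le_measure; rewrite ?inE//; first exact: bigsetU_measurable.
move=> x; rewrite -bigcup_mkord => -[k /= kN Fk].
by have := sub _ _ kN Fk; rewrite subrK.
Qed.

Lemma lipschitz_affine (a : V) (k : R) : lipschitz_fun (fun x => dot a x + k).
Proof.
exists (d%:R * `|a|); split; first by rewrite mulr_ge0.
by move=> x y; rewrite opprD addrACA subrr addr0 -dotBr; exact: dot_le_norm.
Qed.

Lemma archimedean_null (m L : R) : 0 <= m -> (forall N : nat, N%:R * m <= L) -> m = 0.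
Proof.
move=> m0 h; apply/eqP; rewrite eq_le m0 andbT leNgt; apply/negP => mp.
have L0 : 0 <= L by have := h 0%N; rewrite mul0r.
have := archi_boundP (divr_ge0 L0 m0); rewrite ltr_pdivrMr// => H.
by have := h (Num.bound (L / m)); rewrite leNgt H.
Qed.

(** Translates of a bounded piece of the level set by different multiples of [a / N] are disjoint,
    and the first [N] of them stay in one ball independent of [N]; so [N] times the measure of the
    piece is bounded. *)
Lemma affine_level_null (a : V) (c : R) : a != 0 -> leb [set x | dot a x = c] = 0%E.
Proof.
move=> a0; have aa : 0 < dot a a.
  rewrite lt_neqAle dot_sqr_ge0 andbT eq_sym; apply: contra a0 => /eqP h.
  by have := norm_le_enorm a; rewrite /enorm h sqrtr0 normr_le0.
pose H := [set x : V | dot a x = c].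
have mH : measurable H.
  have := lipschitz_fun_measurable (lipschitz_affine a 0) measurableT (measurable_set1 c).
  rewrite setTI; congr measurable; apply/seteqP; split => x; rewrite /H /= addr0//.
pose Z (n : nat) := H `&` @cball0 R d n%:R.
have mZ n : measurable (Z n) by apply: measurableI => //; exact: measurable_cball0.
have Z0 n : leb (Z n) = 0%E.
  have fin M : leb (@cball0 R d M) \is a fin_num by rewrite ge0_fin_numE//; exact: cball0_fin.
  have fZ : leb (Z n) \is a fin_num.
    rewrite ge0_fin_numE//; apply: le_lt_trans (cball0_fin n%:R).
    by apply: le_measure; rewrite ?inE//; [exact: measurable_cball0|exact: subIsetr].
  rewrite -(fineK fZ); congr (_%:E).
  apply: (@archimedean_null _ (fine (leb (@cball0 R d (n%:R + `|a|))))); first exact: fine_ge0.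
  move=> N; have [->|N0] := posnP N; first by rewrite mul0r fine_ge0.
  have := @packing (Z n) (@cball0 R d (n%:R + `|a|)) (N%:R^-1 *: a) N (mZ n) (measurable_cball0 _).
  rewrite -(fineK (fin (n%:R + `|a|))) -{1}(fineK fZ) -EFinM lee_fin; apply.
    move=> k x kN [_ xn]; apply: (le_trans (ler_normD _ _)); apply: lerD => //.
    rewrite scalerA normrZ ler_piMl// ger0_norm//.
    by rewrite ler_pdivrMr ?ltr0n// mul1r ler_nat ltnW.
  move=> k l x y kl [hx _] [hy _] /(congr1 (dot a)); rewrite !dotDr !dotZr hx hy.
  have u : (N%:R^-1 * dot a a) != 0 by rewrite mulf_neq0 ?gt_eqF// invr_gt0 ltr0n.
  move=> /addrI/(mulIf u)/eqP; rewrite eqr_nat => /eqP E; by rewrite E ltnn in kl.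
rewrite -/H; apply: measure_negligible => //.
have -> : H = \bigcup_n Z n.
  apply/seteqP; split => [x Hx|x [n _ []]//].
  exists (Num.bound `|x|) => //; split => //; exact: ltW (archi_boundP _).
by apply: negligible_bigcup => n; exists (Z n); split => //; exact: Z0.
Qed.

Lemma packing_arith1 (x0 x D t N s : R) : - D <= x - x0 -> x - x0 <= D -> 0 < D -> - (N * s) <= t -> t <= N * s ->
  x0 - 2 * D - N * s < t + x <= x0 + D + N * s.
Proof. by move=> *; apply/andP; split; lra. Qed.

Lemma packing_arith2 (x0 x D : R) : - D <= x - x0 -> x - x0 <= D -> 0 < D ->
  x0 - 2 * D < x <= x0 + D.
Proof. by move=> *; apply/andP; split; lra. Qed.

Lemma packing_arith3 (b c n l k : R) : b + n = c + l -> n + 1 <= l -> 0 < b + k < 1 -> 0 < c + k < 1 -> False.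
Proof. by move=> ? ? /andP[? ?] /andP[? ?]; lra. Qed.

Lemma packing_arith4 (N m D s P : R) : 0 < N -> 0 <= P -> N * m <= (3 * D + 2 * N * s) * P -> 3 * D < N * s ->
  m <= 3 * s * P.
Proof.
move=> N0 P0 h hD; rewrite -(ler_pM2l N0); apply: (le_trans h).
by rewrite mulrA ler_wpM2r//; lra.
Qed.

(** The affine function has values strictly between 0 and 1 on [A] and grows by 1 along [s *: e_ j],
    so translates by multiples of this vector are disjoint. [N] of them fit in a box of length
    [3 * D + 2 * N * |s|], and once [3 * D < N * |s|], division by [N] gives the bound. *)
Lemma slope_bound (A : set V) (a x0 : V) (k D : R) (j : 'I_d) : measurable A -> (leb A < +oo)%E -> 0 < D ->
  (forall x, A x -> 0 < dot a x + k < 1) -> (forall x i, A x -> `|x 0 i - x0 0 i| <= D) ->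
  `|a 0 j| * fine (leb A) <= 3 * (3 * D) ^+ d.-1.
Proof.
move=> mA fA D0 A01 AD.
have [->|aj0] := eqVneq (a 0 j) 0; first by rewrite normr0 mul0r mulr_ge0// exprn_ge0// mulr_ge0// ltW.
pose s := (a 0 j)^-1; have s0 : 0 < `|s| by rewrite normr_gt0 invr_eq0.
have [N hN] : exists N : nat, 3 * D / `|s| < N%:R.
  by exists (Num.bound (3 * D / `|s|)); apply: archi_boundP; rewrite divr_ge0// mulr_ge0// ltW.
have N0 : 0 < N%:R :> R by apply: lt_trans hN; rewrite divr_gt0// mulr_gt0.
have hN' : 3 * D < N%:R * `|s| by rewrite -ltr_pdivrMr.
(* The sign of [s] is unknown, so the box is extended both ways along the axis [j]; the lower side
   gets [2 * D] because boxes are open there. *)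
pose lo i := if i == j then x0 0 i - 2 * D - N%:R * `|s| else x0 0 i - 2 * D.
pose hi i := if i == j then x0 0 i + D + N%:R * `|s| else x0 0 i + D.
have := @packing A (box lo hi) (s *: e_ j) N mA (measurable_box _ _).
have sub n x : (n < N)%N -> A x -> box lo hi (x + n%:R *: (s *: e_ j)).
  move=> nN Ax i; have := AD x i Ax; rewrite ler_norml => /andP[h1 h2].
  rewrite /= in_itv /= !mxE eqxx /lo /hi; have [E|ij] /= := eqVneq i j.
    subst i.
    rewrite mulr1; have : `|n%:R * s| <= N%:R * `|s|.
      by rewrite normrM normr_nat ler_wpM2r// ler_nat ltnW.
    by rewrite ler_norml [x 0 j + _]addrC => /andP[h3 h4]; exact: packing_arith1.
  by rewrite !mulr0 addr0; exact: packing_arith2.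
have dis n l x y : (n < l)%N -> A x -> A y -> x + n%:R *: (s *: e_ j) = y + l%:R *: (s *: e_ j) -> False.
  move=> nl Ax Ay /(congr1 (dot a)); rewrite !dotDr !dotZr.
  have -> : dot a (e_ j) = a 0 j.
    rewrite /dot (bigD1 j)//= !mxE !eqxx mulr1 big1 ?addr0// => i ij.
    by rewrite !mxE (negbTE ij) mulr0.
  rewrite /s mulVf// !mulr1 => h.
  have nl1 : n%:R + 1 <= l%:R :> R by rewrite natr1 ler_nat.
  exact: packing_arith3 h nl1 (A01 x Ax) (A01 y Ay).
move=> /(_ sub dis).
have hl i : hi i - lo i = if i == j then 3 * D + 2 * N%:R * `|s| else 3 * D.
  by rewrite /lo /hi; case: ifP => _; ring.
have Ns0 : 0 < N%:R * `|s| by rewrite mulr_gt0.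
have D3 : 0 < 3 * D by rewrite mulr_gt0.
rewrite lebesgue_box; last first.
  move=> i; rewrite -subr_ge0 hl; case: ifP => _; last exact: ltW.
  by rewrite addr_ge0 ?(ltW D3)// -mulrA mulr_ge0// ltW.
have fA' : leb A \is a fin_num by rewrite ge0_fin_numE.
rewrite -{1}(fineK fA') -EFinM lee_fin.
have -> : \prod_i (hi i - lo i) = (3 * D + 2 * N%:R * `|s|) * (3 * D) ^+ d.-1.
  rewrite (bigD1 j)//= hl eqxx; congr (_ * _).
  rewrite (eq_bigr (fun=> 3 * D)) => [|i /negbTE ij]; last by rewrite hl ij.
  by rewrite (prodr_const (predC1 j)) cardC1 card_ord.
have P0 : 0 <= (3 * D) ^+ d.-1 by rewrite exprn_ge0// ltW.
move=> h; have := packing_arith4 N0 P0 h hN'.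
rewrite mulrAC -ler_pdivrMr// {1}/s normfV invrK mulrC; exact.
Qed.

End packing.

Section simplices.
Context {R : realType} {d : nat}.
Local Notation V := 'rV[R]_d.
Local Notation leb := (@lebesgue_rV R d).
Local Notation e_ i := (delta_mx 0 i : V).

Definition simplex_mx (S : @simplex R d) : 'M[R]_d := \matrix_(i < d) (S.1`_i.+1 - S.1`_0).

(** The gradients of the barycentric coordinates: columns of the inverse edge matrix, and for the
    vertex 0 minus their sum. *)
Definition bgrad (S : @simplex R d) (i : 'I_d.+1) : V :=
  if unlift ord0 i is Some j then \row_k invmx (simplex_mx S) k j
  else - \sum_j \row_k invmx (simplex_mx S) k j.

Definition bary (S : @simplex R d) (i : 'I_d.+1) (x : V) : R :=
  dot (bgrad S i) (x - S.1`_0) + (i == ord0)%:R.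

Lemma dot_suml (I : Type) (s : seq I) (P : pred I) (F : I -> V) (x : V) :
  dot (\sum_(i <- s | P i) F i) x = \sum_(i <- s | P i) dot (F i) x.
Proof.
elim/big_rec2: _ => [|i y z _ <-]; last by rewrite dotDl.
by rewrite /dot big1// => i _; rewrite mxE mul0r.
Qed.

Lemma dot_sumr (I : Type) (s : seq I) (P : pred I) (F : I -> V) (x : V) :
  dot x (\sum_(i <- s | P i) F i) = \sum_(i <- s | P i) dot x (F i).
Proof. by rewrite dotC dot_suml; apply: eq_bigr => i _; rewrite dotC. Qed.

Lemma sum_bgrad S : \sum_i bgrad S i = 0.
Proof.
rewrite big_ord_recl /bgrad unlift_none addrC.
by under eq_bigr do rewrite liftK; rewrite subrr.
Qed.

Lemma sum_bary S x : \sum_i bary S i x = 1.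
Proof.
rewrite big_split /= -dot_suml sum_bgrad.
have -> : dot 0 (x - S.1`_0) = 0 by rewrite /dot big1// => i _; rewrite mxE mul0r.
by rewrite add0r big_ord_recl eqxx big1 ?addr0.
Qed.

Lemma bary_affine S i x : bary S i x = dot (bgrad S i) x + ((i == ord0)%:R - dot (bgrad S i) (S.1`_0)).
Proof. by rewrite /bary dotBr addrA addrAC. Qed.

Section one_simplex.
Variable S : @simplex R d.
Hypothesis wS : simplex_wf S.

Lemma simplex_mx_unit : simplex_mx S \in unitmx.
Proof. by case: wS => _ _; rewrite row_free_unit. Qed.

Lemma simplex_size : size S.1 = d.+1. Proof. by case: wS. Qed.

Lemma bary_lift j x : bary S (lift ord0 j) x = ((x - S.1`_0) *m invmx (simplex_mx S)) 0 j.
Proof.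
rewrite /bary /bgrad liftK addr0 mxE; apply: eq_bigr => k _.
by rewrite mxE mulrC.
Qed.

Lemma bary_comb x : \sum_i bary S i x *: S.1`_i = x.
Proof.
have E : (x - S.1`_0) *m invmx (simplex_mx S) *m simplex_mx S = x - S.1`_0.
  by rewrite -mulmxA mulVmx ?mulmx1// simplex_mx_unit.
have E2 : \sum_(j < d) bary S (lift ord0 j) x *: (S.1`_j.+1 - S.1`_0) = x - S.1`_0.
  rewrite -[RHS]E mulmx_sum_row; apply: eq_bigr => j _.
  by rewrite bary_lift rowK.
apply: (addIr (- S.1`_0)); rewrite -[RHS]E2 big_ord_recl /=.
have -> : bary S ord0 x = 1 - \sum_(j < d) bary S (lift ord0 j) x.
  by rewrite -(sum_bary S x) big_ord_recl addrK.
have gen (a p w : V) : a - p + w - a = w - p by rewrite addrAC (addrAC a) subrr add0r addrC.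
rewrite scalerBl scale1r gen.
rewrite scaler_suml -sumrB; apply: eq_bigr => j _.
by rewrite scalerBr.
Qed.

Lemma bary_vertex i (j : 'I_d.+1) : bary S i (S.1`_j) = (i == j)%:R.
Proof.
have lif k : bary S (lift ord0 k) (S.1`_j) = (lift ord0 k == j)%:R.
  rewrite bary_lift; case: (unliftP ord0 j) => [j' ->|->].
    have -> : S.1`_(lift ord0 j') - S.1`_0 = row j' (simplex_mx S) by rewrite rowK.
    rewrite -row_mul mulmxV ?simplex_mx_unit// !mxE (inj_eq lift_inj).
    by rewrite eq_sym.
  by rewrite subrr mul0mx mxE.
case: (unliftP ord0 i) => [k ->|->]; first exact: lif.
have -> : bary S ord0 (S.1`_j) = 1 - \sum_(k < d) bary S (lift ord0 k) (S.1`_j).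
  by rewrite -(sum_bary S (S.1`_j)) big_ord_recl addrK.
under eq_bigr do rewrite lif.
case: (unliftP ord0 j) => [j' ->|->]; last by rewrite big1 ?subr0.
rewrite (bigD1 j')//= eqxx big1 ?addr0 ?subrr// => k kj.
by rewrite (inj_eq lift_inj) (negbTE kj).
Qed.

Lemma bary_combination i (I : Type) (s : seq I) (w : I -> R) (y : I -> V) : \sum_(k <- s) w k = 1 ->
  bary S i (\sum_(k <- s) w k *: y k) = \sum_(k <- s) w k * bary S i (y k).
Proof.
move=> w1; rewrite bary_affine dot_sumr.
have E (K : R) : K = \sum_(k <- s) w k * K by rewrite -mulr_suml w1 mul1r.
rewrite [X in _ + X]E -big_split /=; apply: eq_bigr => k _.
by rewrite dotZr -mulrDr -bary_affine.
Qed.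

Lemma hullP x : hull S.1 x <-> forall i, 0 <= bary S i x.
Proof.
split=> [[w /= [w0 w1] <-] i|h].
  rewrite bary_combination//; apply: sumr_ge0 => k _; rewrite mulr_ge0//.
  have kd : (k < d.+1)%N by rewrite -simplex_size.
  by rewrite (bary_vertex i (Ordinal kd)).
exists (fun k => bary S (inord k) x) => /=.
  split; first by move=> k; exact: h.
  rewrite simplex_size -[RHS](sum_bary S x); apply: eq_bigr => k _.
  by rewrite inord_val.
rewrite simplex_size -[RHS]bary_comb; apply: eq_bigr => k _.
by rewrite inord_val.
Qed.

Lemma continuous_bary i : continuous (bary S i).
Proof.
apply: lipschitz_fun_continuous.
have := lipschitz_affine (bgrad S i) ((i == ord0)%:R - dot (bgrad S i) (S.1`_0)).
by congr lipschitz_fun; apply/funext => x; rewrite bary_affine.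
Qed.

Lemma closed_hull : closed (hull S.1).
Proof.
have -> : hull S.1 = \bigcap_(i in [set: 'I_d.+1]) (bary S i @^-1` [set t | 0 <= t]).
  by apply/seteqP; split => x; [move=> /hullP h i _; exact: h|move=> h; apply/hullP => i; exact: h].
apply: closed_bigI => i _; apply: closed_comp; last exact: closed_ge.
by move=> x _; exact: continuous_bary.
Qed.

Lemma eltP x : elt S x <-> forall i, 0 < bary S i x.
Proof.
split=> [ex i|h].
  have [e [e0 he]] := (nbhs_rVP _ _).1 (ex : \forall y \near x, hull S.1 y).
  rewrite lt_neqAle eq_sym ((hullP x).1 (interior_subset ex))// andbT; apply/eqP => b0.
  (* [u] points away from the vertex [i]: along it the [i]-th coordinate, already 0, decreases at
     unit rate and becomes negative inside the hull. *)
  pose u := x - S.1`_i; pose t := e / 2 / (`|u| + 1).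
  have u1 : 0 < `|u| + 1 by rewrite ltr_wpDl.
  have t0 : 0 < t by rewrite !divr_gt0.
  have hy : hull S.1 (x + t *: u).
    apply: he; rewrite addrAC subrr add0r normrZ gtr0_norm// /t mulrAC ltr_pdivrMr//.
    apply: (@le_lt_trans _ _ (e / 2 * (`|u| + 1))); first by rewrite ler_wpM2l ?lerDl// divr_ge0// ltW.
    by rewrite ltr_pM2r// ltr_pdivrMr// ltr_pMr// ltr1n.
  have := (hullP _).1 hy i; rewrite bary_affine dotDr dotZr.
  have -> : dot (bgrad S i) u = -1.
    have := bary_vertex i i; rewrite eqxx /= => h1.
    have -> : dot (bgrad S i) u = bary S i x - bary S i (S.1`_i) by rewrite !bary_affine dotBr; ring.
    by rewrite b0 h1 sub0r.
  rewrite addrAC -bary_affine b0 add0r mulrN1 oppr_ge0 => /(lt_le_trans t0).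
  by rewrite ltxx.
suff op : \forall y \near x, forall i, 0 < bary S i y.
  by move: op; rewrite /elt /interior; apply: filterS => y hy; apply/hullP => i; exact: ltW.
have H i : \forall y \near x, 0 < bary S i y.
  have /continuous_rV c := @continuous_bary i.
  have /cvgrPdist_lt/(_ _ (h i)) := c x; apply: filterS => y.
  by rewrite ltr_norml => /andP[_]; rewrite ltrBlDr -ltrBlDl subrr.
exact: (@filter_forall V 'I_d.+1 (fun i y => 0 < bary S i y) (nbhs x) (nbhs_filter x) H).
Qed.

Lemma open_elt : open (elt S). Proof. exact: open_interior. Qed.

Lemma measurable_elt : measurable (elt S). Proof. by apply: open_measurable_rV; exact: open_elt. Qed.

Lemma elt_hull x : elt S x -> hull S.1 x. Proof. exact: interior_subset. Qed.

Lemma hull_bound : exists M : R, forall x, hull S.1 x -> `|x| <= M.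
Proof.
exists (\sum_(i < d.+1) `|S.1`_i|) => x /hullP h; rewrite -{1}(bary_comb x).
apply: (le_trans (ler_norm_sum _ _ _)); apply: ler_sum => i _.
rewrite normrZ ger0_norm// ler_piMl// -(sum_bary S x) (bigD1 i)//= lerDl.
by apply: sumr_ge0 => j _.
Qed.

Lemma elt_fin : (leb (elt S) < +oo)%E.
Proof.
apply: bounded_lebesgue; first exact: measurable_elt.
have [M hM] := hull_bound; exists M; split; rewrite ?num_real// => K MK x /elt_hull/hM h.
exact: le_trans h (ltW MK).
Qed.

Lemma dist_diam x y : hull S.1 x -> hull S.1 y -> `|x - y| <= diam (hull S.1).
Proof.
move=> hx hy; apply: (le_trans (norm_le_enorm _)); apply: ub_le_sup; last by exists (x, y).
have [M hM] := hull_bound; exists (d%:R * (M + M)) => _ [[a b] [/= ha hb] <-].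
apply: (le_trans (enorm_le_norm _)); rewrite ler_wpM2l//.
by apply: (le_trans (ler_normB _ _)); apply: lerD; exact: hM.
Qed.

Lemma vertex_hull (j : 'I_d.+1) : hull S.1 (S.1`_j).
Proof. by apply/hullP => i; rewrite bary_vertex ler0n. Qed.

Lemma bgrad_neq0 i : (0 < d)%N -> bgrad S i != 0.
Proof.
move=> d0; apply/eqP => g0; pose k : 'I_d.+1 := if i == ord0 then ord_max else ord0.
have ki : (i == k) = false.
  rewrite /k; case: ifP => [/eqP ->|//]; apply/eqP => /(congr1 val) /= h.
  by rewrite -h in d0.
have := bary_vertex i i; have := bary_vertex i k; rewrite ki eqxx !bary_affine g0.
have z (v : V) : dot 0 v = 0 by rewrite /dot big1// => j _; rewrite mxE mul0r.
by rewrite !z => -> /eqP; rewrite eq_sym oner_eq0.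
Qed.

Lemma hull_elt_null : (0 < d)%N -> leb (hull S.1 `\` elt S) = 0%E.
Proof.
move=> d0; apply: measure_negligible.
  by apply: measurableD; [apply: closed_measurable_rV; exact: closed_hull|exact: measurable_elt].
apply: (@negligibleS _ _ _ _ (\bigcup_k [set x | exists i : 'I_d.+1, i = k :> nat /\ bary S i x = 0])).
  move=> x [/hullP h ne]; apply: contrapT => no; apply: ne; apply/eltP => i.
  rewrite lt_neqAle h andbT eq_sym; apply/eqP => b0; apply: no; exists i => //.
  by exists i.
apply: negligible_bigcup => k.
have [kd|kd] := ltnP k d.+1; last first.
  apply: (negligibleS _ (negligible_set0 leb)).
  by move=> x /= [i [ik _]]; have := ltn_ord i; rewrite ik ltnNge kd.
pose i := Ordinal kd.
pose c := - ((i == ord0)%:R - dot (bgrad S i) (S.1`_0)).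
exists [set x | dot (bgrad S i) x = c]; split.
- have := lipschitz_fun_measurable (lipschitz_affine (bgrad S i) 0) measurableT (measurable_set1 c).
  by rewrite setTI; congr measurable; apply/seteqP; split => x; rewrite /= addr0.
- by apply: affine_level_null; exact: bgrad_neq0.
- move=> x /= [j [jk]]; have -> : j = i by exact: val_inj.
  by rewrite bary_affine => /eqP; rewrite addr_eq0 => /eqP.
Qed.

Lemma vol_ge0 : 0 <= vol S. Proof. by rewrite fine_ge0. Qed.

Lemma vol_fin : leb (elt S) = (vol S)%:E.
Proof. by rewrite /vol fineK// ge0_fin_numE//; exact: elt_fin. Qed.

Lemma diam_gt0 : (0 < d)%N -> 0 < diam (hull S.1).
Proof.
move=> d0; have h := dist_diam (vertex_hull ord0) (vertex_hull ord_max).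
apply: lt_le_trans h; rewrite normr_gt0 subr_eq0; apply/eqP => E.
have := bary_vertex ord0 ord0; have := bary_vertex ord0 ord_max; rewrite -E => -> /=.
case: eqVneq => [/(congr1 val) /= h|_]; first by rewrite -h in d0.
by move/eqP; rewrite eq_sym oner_eq0.
Qed.

Lemma elt_bary01 i x : (0 < d)%N -> elt S x -> 0 < bary S i x < 1.
Proof.
move=> d0 /eltP h; rewrite h /= -(sum_bary S x) (bigD1 i)//= ltrDl.
pose k : 'I_d.+1 := if i == ord0 then ord_max else ord0.
have ki : k != i.
  rewrite /k; case: ifP => [/eqP ->|]; last by rewrite eq_sym => ->.
  by apply/eqP => /(congr1 val) /= h1; rewrite h1 in d0.
rewrite (bigD1 k)//=; apply: ltr_pwDl; first exact: h.
by apply: sumr_ge0 => j _; exact: ltW.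
Qed.

(* [d.-1.+1 = d] turns [diam^d <= kappa vol] into a bound of the gradients by [1 / diam]. *)
Lemma bgrad_bound (kappa : R) i j : (0 < d)%N -> 0 < kappa -> diam (hull S.1) ^+ d <= kappa * vol S ->
  `|bgrad S i 0 j| * diam (hull S.1) <= kappa * 3 ^+ d.
Proof.
move=> d0 k0 hk; have D0 := diam_gt0 d0; set D := diam (hull S.1) in hk D0 *.
have h := @slope_bound _ _ (elt S) (bgrad S i) (S.1`_0) ((i == ord0)%:R - dot (bgrad S i) (S.1`_0)) D j
  measurable_elt elt_fin D0.
have : `|bgrad S i 0 j| * vol S <= 3 * (3 * D) ^+ d.-1.
  apply: h => [x ex|x k ex]; first by rewrite -bary_affine; exact: elt_bary01.
  have := dist_diam (elt_hull ex) (vertex_hull ord0); apply: le_trans.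
  by have := coord_le_norm (x - S.1`_0) k; rewrite !mxE.
move=> {}h; rewrite -(@ler_pM2r _ (D ^+ d.-1)) ?exprn_gt0// -mulrA -exprS prednK//.
apply: (@le_trans _ _ (`|bgrad S i 0 j| * (kappa * vol S))); first by rewrite ler_wpM2l.
rewrite mulrCA -mulrA ler_pM2l//; apply: (le_trans h).
by rewrite exprMn mulrA -exprS prednK.
Qed.

(** The gradient of the affine function that takes the values of [f] at the vertices. *)
Definition agrad (f : V -> R) : V := \sum_(i < d.+1) f (S.1`_i) *: bgrad S i.

Definition aff (f : V -> R) (x : V) : R := \sum_(i < d.+1) f (S.1`_i) * bary S i x.

Lemma aff_affine f : exists k : R, forall x, aff f x = dot (agrad f) x + k.
Proof.
exists (\sum_(i < d.+1) f (S.1`_i) * ((i == ord0)%:R - dot (bgrad S i) (S.1`_0))) => x.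
rewrite /agrad dot_suml -big_split /=; apply: eq_bigr => i _.
by rewrite bary_affine dotZl mulrDr.
Qed.

Lemma aff_combination f (s : seq V) (w : nat -> R) : {subset s <= S.1} ->
  \sum_(k < size s) w k = 1 ->
  aff f (\sum_(k < size s) w k *: s`_k) = \sum_(k < size s) w k * f s`_k.
Proof.
move=> sS w1; rewrite /aff; under eq_bigr do rewrite bary_combination// mulr_sumr.
rewrite exchange_big /=; apply: eq_bigr => k _.
have /(nthP 0)[j jd <-] : s`_k \in S.1 by apply: sS; rewrite mem_nth.
rewrite simplex_size in jd; rewrite (bigD1 (Ordinal jd))//= (bary_vertex _ (Ordinal jd)) eqxx mulr1.
rewrite big1 ?addr0 1?mulrC// => i ij.
by rewrite (bary_vertex i (Ordinal jd)) (negbTE ij) !mulr0.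
Qed.

Lemma vertices_uniq : uniq S.1.
Proof.
apply/(uniqP 0) => i j; rewrite !inE simplex_size => id_ jd E.
have := bary_vertex (Ordinal id_) (Ordinal id_); rewrite eqxx /= E.
rewrite (bary_vertex (Ordinal id_) (Ordinal jd)).
by case: eqVneq => [/(congr1 val)//|_ /eqP]; rewrite eq_sym oner_eq0.
Qed.

Lemma bary_notin (s : seq V) (w : nat -> R) (i : 'I_d.+1) : {subset s <= S.1} -> S.1`_i \notin s ->
  \sum_(k < size s) w k = 1 -> bary S i (\sum_(k < size s) w k *: s`_k) = 0.
Proof.
move=> sS ni w1; rewrite bary_combination// big1// => k _.
have ks : s`_k \in s by rewrite mem_nth.
have /(nthP 0)[j jd E] := sS _ ks; rewrite simplex_size in jd.
rewrite -E (bary_vertex i (Ordinal jd)); case: eqVneq => [ij|]; last by rewrite mulr0.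
by move: ni; rewrite ij /= E ks.
Qed.

Lemma agrad_dot f a k : (forall i : 'I_d.+1, f (S.1`_i) = dot a (S.1`_i) + k) -> agrad f = a.
Proof.
move=> h; have [c hc] := aff_affine f.
have E x : aff f x = dot a x + k.
  rewrite -{2}(bary_comb x) dot_sumr -[k]mulr1 -(sum_bary S x) mulr_sumr -big_split /=.
  by apply: eq_bigr => i _; rewrite h dotZr; ring.
apply/rowP => j.
have dj (v : V) : dot v (e_ j) = v 0 j.
  rewrite /dot (bigD1 j)//= !mxE !eqxx mulr1 big1 ?addr0// => i ij.
  by rewrite !mxE (negbTE ij) mulr0.
have z (v : V) : dot v 0 = 0 by rewrite /dot big1// => i _; rewrite mxE mulr0.
have := E (e_ j); have := E 0; rewrite !hc !z !add0r !dj => -> /addIr; exact.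
Qed.

End one_simplex.
End simplices.

(** * Nodal interpolation *)

Section bisection_hulls.
Context {R : realType} {d : nat}.
Local Notation V := 'rV[R]_d.

Lemma hull_nth (s : seq V) (v : V) : v \in s -> hull s v.
Proof.
move=> /(nthP 0)[j js <-]; exists (fun k => (k == j)%:R) => /=.
  split; first by move=> k; rewrite ler0n.
  rewrite (bigD1 (Ordinal js))//= eqxx big1 ?addr0// => i /negbTE ij.
  by rewrite -[(i : nat) == j]/(i == Ordinal js) ij.
rewrite (bigD1 (Ordinal js))//= eqxx scale1r big1 ?addr0// => i /negbTE ij.
by rewrite -[(i : nat) == j]/(i == Ordinal js) ij scale0r.
Qed.

Lemma hull_convex (s : seq V) (x y : V) (t : R) : 0 <= t <= 1 -> hull s x -> hull s y ->
  hull s ((1 - t) *: x + t *: y).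
Proof.
move=> /andP[t0 t1] [w [w0 w1] <-] [u [u0 u1] <-].
exists (fun k => (1 - t) * w k + t * u k) => /=.
  split; first by move=> k; rewrite addr_ge0// mulr_ge0// subr_ge0.
  by rewrite big_split /= -!mulr_sumr w1 u1 !mulr1 subrK.
rewrite !scaler_sumr -big_split /=; apply: eq_bigr => k _.
by apply/rowP => j; rewrite !mxE; ring.
Qed.

Lemma hull_sub (s s' : seq V) : (forall v, v \in s' -> hull s v) -> hull s' `<=` hull s.
Proof.
move=> h x [w [w0 w1] <-].
have /boolp.choice[W hW] : forall k : 'I_(size s'), exists W : nat -> R,
    ((forall i, 0 <= W i) /\ \sum_(i < size s) W i = 1) /\ \sum_(i < size s) W i *: s`_i = s'`_k.
  by move=> k; have [W hW E] := h s'`_k (mem_nth _ (ltn_ord k)); exists W.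
exists (fun i => \sum_(k < size s') w k * W k i) => /=.
  split; first by move=> i; apply: sumr_ge0 => k _; rewrite mulr_ge0//; have [[? _] _] := hW k.
  rewrite exchange_big /= -[RHS]w1; apply: eq_bigr => k _.
  by rewrite -mulr_sumr; have [[_ ->] _] := hW k; rewrite mulr1.
under eq_bigr do rewrite scaler_suml.
rewrite exchange_big /=; apply: eq_bigr => k _.
have [_ <-] := hW k; rewrite scaler_sumr; apply: eq_bigr => i _.
by rewrite scalerA.
Qed.

Lemma middle_sub (S : @simplex R d) : {subset middle S <= S.1}.
Proof. by move=> x /mem_behead/mem_take. Qed.

Lemma middle_size (S : @simplex R d) : (0 < d)%N -> size S.1 = d.+1 -> (size (middle S)).+2 = d.+1.
Proof. by move=> d0 sS; rewrite /middle size_behead size_takel ?sS// prednK. Qed.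

Lemma midpoint_hull (S : @simplex R d) : size S.1 = d.+1 -> hull S.1 (midpoint S).
Proof.
move=> sS; have h2 : 0 <= (2^-1 : R) <= 1 by rewrite invr_ge0 ler0n /= invf_le1// ler1n.
have := hull_convex h2 (hull_nth (mem_nth 0 (_ : 0 < size S.1)%N)) (hull_nth (mem_nth 0 (_ : d < size S.1)%N)).
rewrite sS => /(_ isT (ltnSn d)); rewrite /midpoint scalerDr.
by have -> : (1 - 2^-1 : R) = 2^-1 by field.
Qed.

Lemma children_hull (S S' : @simplex R d) : (0 < d)%N -> size S.1 = d.+1 ->
  S' = child1 S \/ S' = child2 S -> size S'.1 = d.+1 /\ hull S'.1 `<=` hull S.1.
Proof.
move=> d0 sS h.
have v0 : S.1`_0 \in S.1 by rewrite mem_nth// sS.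
have vd : S.1`_d \in S.1 by rewrite mem_nth// sS.
have mid := midpoint_hull sS.
case: h => ->; split=> /=; try apply: hull_sub => v; rewrite ?size_cat ?size_rev -?size_cat ?cat_take_drop ?middle_size// !inE.
  by move=> /or3P[/eqP->|/eqP->//|/middle_sub/hull_nth//]; exact: hull_nth.
move=> /or3P[/eqP->|/eqP->//|]; first exact: hull_nth.
rewrite mem_cat mem_rev => /orP[/mem_take|/mem_drop]; by move=> /middle_sub/hull_nth.
Qed.

(** The meshes inside a chain of bisections need not be conforming, so only the number of vertices
    and the inclusion of hulls are carried along. This is what makes the discrete spaces nested. *)
Lemma bisections_hull (T T' : mesh R d) : (0 < d)%N -> (forall S, S \in T -> size S.1 = d.+1) ->
  bisections T T' -> forall S', S' \in T' ->
  size S'.1 = d.+1 /\ exists2 S, S \in T & hull S'.1 `<=` hull S.1.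
Proof.
move=> d0 sT; elim=> [|T1 S bT IH ST1] S' S'T; first by split; [exact: sT|exists S'].
move: S'T; rewrite /bisect in_fsetU in_fsetD1 in_fset2 => /orP[/andP[_ S'T1]|h]; first exact: IH.
have [sS [S0 S0T S0h]] := IH S ST1.
have [|s1 s2] := @children_hull S S' d0 sS; first by case/orP: h => /eqP; [left|right].
by split => //; exists S0 => //; exact: subset_trans S0h.
Qed.

End bisection_hulls.

Section triangulated_domain.
Context {R : realType} {d : nat}.
Local Notation V := 'rV[R]_d.
Local Notation leb := (@lebesgue_rV R d).
Local Notation e_ i := (delta_mx 0 i : V).
Local Notation TT := [set: V].
Variables (E : set V) (T : mesh R d).
Hypotheses (d0 : (0 < d)%N) (lE : lipschitz_domain E) (tT : triangulation E T).
Let oE : open E := lipschitz_domain_open lE.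
Let fE := lipschitz_domain_fin lE.
Let mE : measurable E := open_measurable_rV oE.
Let mT : measurable TT := measurableT.

Lemma mesh_wf S : S \in T -> simplex_wf S. Proof. by case: tT => h _ _ _; exact: h. Qed.

Lemma mesh_hull_closure S : S \in T -> hull S.1 `<=` closure E.
Proof. by case: tT => _ -> _ _ ST x hx; exists S. Qed.

Lemma mesh_cover x : closure E x -> exists2 S, S \in T & hull S.1 x.
Proof. by case: tT => _ -> _ _ [S ST hx]; exists S. Qed.

Lemma elt_sub S : S \in T -> elt S `<=` E.
Proof.
by move=> ST x ex; apply: (interior_closure_sub lE); move: ex; rewrite /elt /interior; apply: filterS; exact: mesh_hull_closure.
Qed.

Lemma mesh_common S S' x : S \in T -> S' \in T -> hull S.1 x -> hull S'.1 x ->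
  hull [seq y <- S.1 | y \in S'.1] x.
Proof. by case: tT => _ _ _ h ST ST' hx hx'; rewrite -h. Qed.

(** A common point is a combination of common vertices, while an interior point has all its
    coordinates positive; so all vertices are common, and a triangulation has no two elements with
    the same vertices. *)
Lemma elt_disjoint S S' x : S \in T -> S' \in T -> elt S x -> elt S' x -> S = S'.
Proof.
move=> ST ST' ex ex'; have wS := mesh_wf ST; have wS' := mesh_wf ST'.
case: (tT) => _ _ inj _; apply: inj => //.
have [w [w0 w1] xE] := mesh_common ST ST' (elt_hull ex) (elt_hull ex').
have sub : {subset [seq y <- S.1 | y \in S'.1] <= S.1} by move=> y; rewrite mem_filter => /andP[].
have SS' : {subset S.1 <= S'.1}.
  move=> y yS; apply: contrapT => /negP yS'.
  have /(nthP 0)[j jd jE] := yS; rewrite (simplex_size wS) in jd.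
  have := (eltP wS x).1 ex (Ordinal jd).
  rewrite -xE bary_notin ?ltxx//= jE mem_filter; by rewrite (negbTE yS').
apply: uniq_perm; [exact: vertices_uniq|exact: vertices_uniq|].
have [|_ h] := uniq_min_size (vertices_uniq wS) SS'; last exact: h.
by rewrite (simplex_size wS) (simplex_size wS').
Qed.

(** A common point is a combination of common vertices, and on such a combination either interpolant
    uses only the values of [f] at these vertices. *)
Lemma aff_conforming f S S' x : S \in T -> S' \in T -> hull S.1 x -> hull S'.1 x ->
  aff S f x = aff S' f x.
Proof.
move=> ST ST' hx hx'; have [w [w0 w1] <-] := mesh_common ST ST' hx hx'.
rewrite !aff_combination//; try exact: mesh_wf.
  by move=> y; rewrite mem_filter => /andP[].
by move=> y; rewrite mem_filter => /andP[].
Qed.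

Lemma mesh_ae : ae_on TT (fun x => ~ closure E x \/ exists2 S, S \in T & elt S x).
Proof.
have h S : S \in T -> ae_on TT (fun x => hull S.1 x -> elt S x).
  move=> ST; have wS := mesh_wf ST.
  apply: (@ae_on_null _ _ _ _ (hull S.1 `\` elt S)).
  - by apply: measurableD; [apply: closed_measurable_rV; exact: closed_hull|exact: measurable_elt].
  - exact: hull_elt_null.
  - by move=> x _ nx hx; apply: contrapT => ex; apply: nx.
have h2 : ae_on TT (fun x => forall k : 'I_(size (enum_fset T)), hull (nth (nil, 0%N) (enum_fset T) k).1 x -> elt (nth (nil, 0%N) (enum_fset T) k) x).
  by apply: ae_on_count => k; apply: h; rewrite mem_nth.
apply: ae_on_imp h2 => x _ hx; have [cx|cx] := pselect (closure E x); last by left.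
right; have [S ST hS] := mesh_cover cx; exists S => //.
have /(nthP (nil, 0%N))[k ks kE] : S \in enum_fset T by [].
by have := hx (Ordinal ks); rewrite /= kE; exact.
Qed.

Lemma mesh_ae_elt : ae_on E (fun x => exists2 S, S \in T & elt S x).
Proof.
by apply: ae_on_imp (ae_on_sub (@subsetT _ E) mesh_ae) => x /subset_closure cx [].
Qed.

(* If [v] is an interior vertex, the contraction towards [v] maps a neighbourhood of [x]
   into a ball around [v], and barycentric coordinates detect the element hit. *)
Lemma star_interior S (i : 'I_d.+1) x : S \in T -> E (S.1`_i) -> hull S.1 x -> 0 < bary S i x -> E x.
Proof.
move=> ST Ev hx bx; apply: (interior_closure_sub lE).
have wS := mesh_wf ST; set v := S.1`_i in Ev *.
have [eps [eps0 hE]] : exists e : R, 0 < e /\ forall y, `|y - v| < e -> E y.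
  by apply/nbhs_rVP; have := oE; rewrite openE => /(_ v Ev).
have xv1 : 0 < `|x - v| + 1 by rewrite ltr_wpDl.
(* With this factor the contraction sends the unit ball around [x] into the ball of radius [eps]
   around [v]. *)
pose t := Num.min 1 (eps / 2 / (`|x - v| + 1)).
have t0 : 0 < t by rewrite lt_min ltr01 !divr_gt0.
have t1 : t <= 1 by rewrite ge_min lexx.
have te : t * (`|x - v| + 1) < eps.
  apply: (@le_lt_trans _ _ (eps / 2)); last by rewrite ltr_pdivrMr// ltr_pMr// ltr1n.
  by rewrite -ler_pdivlMr// ge_min lexx orbT.
pose c y := v + t *: (y - v).
have cb (S' : simplex) j y : bary S' j (c y) = bary S' j v + t * (bary S' j y - bary S' j v).
  by rewrite !bary_affine /c dotDr dotZr dotBr; ring.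
(* Either [c y] misses [S'] for all [y] near [x], or [v] is a vertex of [S']. Then the coordinate of
   [y] at [v] is positive by continuity, and at the other vertices contraction only multiplies the
   coordinates by [t], so membership of [c y] passes to [y]. *)
have Q S' : S' \in T -> exists r : R, 0 < r /\ forall y, `|y - x| < r -> hull S'.1 (c y) -> hull S'.1 y.
  move=> ST'; have wS' := mesh_wf ST'.
  have [hx'|hx'] := pselect (hull S'.1 (c x)); last first.
    have op : open (~` hull S'.1) by apply: closed_openC; exact: closed_hull.
    have := op; rewrite openE => /(_ _ hx') h; have [r [r0 hr]] := (nbhs_rVP _ _).1 h.
    exists r; split => // y yx hy; exfalso; apply: (hr (c y)) => //.
    rewrite /c opprD addrACA subrr add0r -scalerBr opprB addrA subrK normrZ gtr0_norm//.
    by apply: le_lt_trans yx; rewrite ler_piMl.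
  have hcx : hull S.1 (c x).
    apply/(hullP wS) => j; rewrite cb bary_vertex// mulrBr addrCA -[X in _ + (X - _)]mul1r -mulrBl.
    by rewrite addr_ge0 ?mulr_ge0 ?(ltW t0) ?subr_ge0 ?ler0n//; exact: (hullP wS x).1.
  have bcx : 0 < bary S i (c x).
    rewrite cb bary_vertex// eqxx /= mulrBr mulr1 addrCA.
    by rewrite ltr_pwDl ?mulr_gt0// subr_ge0.
  have [w [w0 w1] wE] := mesh_common ST ST' hcx hx'.
  have sub : {subset [seq y <- S.1 | y \in S'.1] <= S.1} by move=> y; rewrite mem_filter => /andP[].
  have vS' : v \in S'.1.
    apply: contraT => nv; have : bary S i (c x) = 0.
      by rewrite -wE bary_notin// mem_filter (negbTE nv).
    by move=> h; rewrite h ltxx in bcx.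
  have /(nthP 0)[m md mE'] := vS'; rewrite (simplex_size wS') in md.
  pose m' := Ordinal md.
  have affb (S1 : simplex) (k : 'I_d.+1) y : simplex_wf S1 -> S1.1`_k = v -> aff S1 (fun z => (z == v)%:R) y = bary S1 k y.
    move=> w1' kE; rewrite /aff (bigD1 k)//= kE eqxx mul1r big1 ?addr0// => l lk.
    rewrite -kE nth_uniq ?(simplex_size w1')//; last exact: vertices_uniq.
    by rewrite -[(l : nat) == k]/(l == k) (negbTE lk) mul0r.
  have E1 := aff_conforming (fun z => (z == v)%:R) ST ST' hcx hx'.
  rewrite (affb S i)// (affb S' m')// !cb in E1.
  have bv1 : bary S i v = 1 by rewrite bary_vertex// eqxx.
  have bv2 : bary S' m' v = 1 by rewrite -mE' (bary_vertex wS' m' m') eqxx.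
  have E2 : bary S' m' x = bary S i x.
    move: E1; rewrite bv1 bv2 => /addrI/(mulfI (lt0r_neq0 t0))/addIr ->//.
  have /continuous_rV cc := @continuous_bary R d S' m'.
  have bx' : 0 < bary S' m' x by rewrite E2.
  have [r [r0 hr]] : exists r : R, 0 < r /\ forall y, `|y - x| < r -> 0 < bary S' m' y.
    apply/nbhs_rVP; have /cvgrPdist_lt/(_ _ bx') := cc x; apply: filterS => y.
    by rewrite ltr_norml => /andP[_]; rewrite ltrBlDr -ltrBlDl subrr.
  exists r; split => // y /hr by0 /(hullP wS') hy; apply/(hullP wS') => j.
  have [->|jm] := eqVneq j m'; first exact: ltW.
  have := hy j; rewrite cb -mE' (bary_vertex wS' j m') (negbTE jm) subr0 add0r.
  by rewrite pmulr_rge0.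
have /boolp.choice[r hr] : forall k : 'I_(size (enum_fset T)), exists r : R, 0 < r /\
    forall y, `|y - x| < r -> hull (nth (nil, 0%N) (enum_fset T) k).1 (c y) -> hull (nth (nil, 0%N) (enum_fset T) k).1 y.
  by move=> k; apply: Q; rewrite mem_nth.
apply/nbhs_rVP; exists (\big[Num.min/1]_k r k); split.
  elim/big_ind: _ => // [a b a0 b0|k _]; first by rewrite lt_min a0 b0.
  by case: (hr k).
move=> y yx.
have yx1 : `|y - x| < 1.
  apply: (lt_le_trans yx); elim/big_rec: _ => // k z _ h; by rewrite ge_min h orbT.
have Ecy : E (c y).
  apply: hE; rewrite /c addrAC subrr add0r normrZ gtr0_norm//; apply: le_lt_trans te.
  rewrite ler_wpM2l ?(ltW t0)//; have := ler_normD (y - x) (x - v); rewrite addrA subrK => h.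
  by apply: (le_trans h); rewrite addrC lerD2l ltW.
have [S' ST' hS'] := mesh_cover (subset_closure Ecy).
apply: (mesh_hull_closure ST').
have /(nthP (nil, 0%N))[k ks kE] : S' \in enum_fset T by [].
rewrite -kE; apply: (hr (Ordinal ks)).2; last by rewrite /= kE.
by apply: (lt_le_trans yx); rewrite (bigD1 (Ordinal ks))//= ge_min lexx.
Qed.

(** The first listed element that contains [x] decides; conformity makes the choice immaterial. *)
Fixpoint pw_list (f : V -> R) (s : seq (@simplex R d)) (x : V) : R :=
  if s is S1 :: s' then (if `[< hull S1.1 x >] then aff S1 f x else pw_list f s' x) else 0.

Definition interp f : V -> R := pw_list f (enum_fset T).

Definition interp_grad f : V -> V := fun x => \sum_(S <- enum_fset T) \1_(elt S) x *: agrad S f.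

Lemma interpE f S x : S \in T -> hull S.1 x -> interp f x = aff S f x.
Proof.
move=> ST hx; rewrite /interp.
have : forall S', S' \in enum_fset T -> S' \in T by [].
have : S \in enum_fset T by [].
elim: (enum_fset T) => //= S' s IH; rewrite inE => h sub.
case: asboolP => [hx'|hx'].
  by apply: aff_conforming => //; apply: sub; rewrite mem_head.
apply: IH => [|S1 S1s]; last by apply: sub; rewrite inE S1s orbT.
by case/orP: h => // /eqP E1; move: hx'; rewrite -E1.
Qed.

Lemma interp_out f x : ~ closure E x -> interp f x = 0.
Proof.
move=> cx; rewrite /interp.
have : forall S', S' \in enum_fset T -> S' \in T by [].
elim: (enum_fset T) => //= S' s IH sub; rewrite asboolF; last first.
  by move=> hx'; apply: cx; apply: mesh_hull_closure hx'; apply: sub; rewrite mem_head.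
by apply: IH => S1 S1s; apply: sub; rewrite inE S1s orbT.
Qed.

Lemma measurable_aff f S : measurable_fun TT (aff S f).
Proof.
have [k hk] := aff_affine S f; apply: lipschitz_fun_measurable.
by have := lipschitz_affine (agrad S f) k; congr lipschitz_fun; apply/funext => x; rewrite hk.
Qed.

Lemma measurable_interp f : measurable_fun TT (interp f).
Proof.
rewrite /interp.
have : forall S', S' \in enum_fset T -> S' \in T by [].
elim: (enum_fset T) => [_|S' s IH sub] /=; first exact: measurable_cst.
have wS : simplex_wf S' by apply: mesh_wf; apply: sub; rewrite mem_head.
have mh : measurable (hull S'.1) by apply: closed_measurable_rV; exact: closed_hull.
apply: measurable_fun_if => //.
- apply: (measurable_fun_bool true).
  rewrite setTI (_ : _ @^-1` _ = hull S'.1)//.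
  by apply/seteqP; split => x /=; [move/asboolP|move=> ?; apply/asboolP].
- by apply: measurable_funS (measurable_aff f S').
- apply: measurable_funS (IH _) => //; by move=> S1 S1s; apply: sub; rewrite inE S1s orbT.
Qed.

Lemma sum_elt (K : zmodType) (F : simplex -> K) S x : S \in T -> elt S x ->
  (forall S', S' \in T -> ~ elt S' x -> F S' = 0) -> \sum_(S' <- enum_fset T) F S' = F S.
Proof.
move=> ST ex F0; rewrite (bigD1_seq S ST (fset_uniq T))/=.
rewrite big_seq_cond big1 ?addr0// => S' /andP[ST' ne]; apply: F0 => // ex'.
by move: ne; rewrite (elt_disjoint ST' ST ex' ex) eqxx.
Qed.

Lemma interp_gradE f S x : S \in T -> elt S x -> interp_grad f x = agrad S f.
Proof.
move=> ST ex; rewrite /interp_grad (sum_elt ST ex) ?indicE ?mem_set ?scale1r// => S' _ ne.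
by rewrite indicE memNset// scale0r.
Qed.

Lemma interp_grad_out f x : (forall S, S \in T -> ~ elt S x) -> interp_grad f x = 0.
Proof.
move=> h; rewrite /interp_grad big_seq_cond big1// => S' /andP[ST' _].
by rewrite indicE memNset ?scale0r//; exact: h.
Qed.

Lemma measurable_interp_grad f i : measurable_fun TT (fun x => interp_grad f x 0 i).
Proof.
rewrite (_ : (fun x => _) = fun x => \sum_(S <- enum_fset T) \1_(elt S) x * agrad S f 0 i); last first.
  by apply/funext => x; rewrite /interp_grad summxE; apply: eq_bigr => S _; rewrite mxE.
apply: measurable_sum => S; apply: measurable_funM => //.
by apply: measurable_indic; apply: open_measurable_rV; exact: open_interior.
Qed.

Lemma interp_bounded f : exists B : R, forall x, `|interp f x| <= B.
Proof.
pose A (S : simplex) := \sum_(i < d.+1) `|f (S.1`_i)|.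
have A0 S : 0 <= A S by exact: sumr_ge0.
exists (\sum_(S <- enum_fset T) A S) => x.
have [cx|cx] := pselect (closure E x); last by rewrite interp_out// normr0; apply: sumr_ge0.
have [S ST hS] := mesh_cover cx; rewrite (interpE f ST hS).
have wS := mesh_wf ST; have b0 := (hullP wS x).1 hS.
rewrite (bigD1_seq S ST (fset_uniq T))/=.
apply: ler_wpDr; first exact: sumr_ge0.
apply: (le_trans (ler_norm_sum _ _ _)); apply: ler_sum => i _.
rewrite normrM ler_piMr// ger0_norm// -(sum_bary S x) (bigD1 i)//= lerDl.
by apply: sumr_ge0 => j _.
Qed.

Lemma interp_grad_bounded f : exists B : R, forall x i, `|interp_grad f x 0 i| <= B.
Proof.
exists (\sum_(S <- enum_fset T) `|agrad S f|) => x i; rewrite /interp_grad summxE.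
apply: (le_trans (ler_norm_sum _ _ _)); apply: ler_sum => S _.
rewrite mxE normrM; apply: (@le_trans _ _ (1 * `|agrad S f|)); last by rewrite mul1r.
by apply: ler_pM => //; [rewrite indicE; case: (_ \in _); rewrite ?normr1 ?normr0|exact: coord_le_norm].
Qed.

Lemma interp_out_bound f : exists M : R, forall x, M < `|x| -> interp f x = 0 /\ interp_grad f x = 0.
Proof.
have [M hM] := lipschitz_domain_bound lE; exists M => x Mx.
have cx : ~ closure E x by move=> /hM; rewrite leNgt Mx.
split; first exact: interp_out.
by apply: interp_grad_out => S ST /elt_hull/(mesh_hull_closure ST).
Qed.

Lemma bounded_support_L2 (f : V -> R) (B M : R) : measurable_fun TT f ->
  (forall x, `|f x| <= B) -> (forall x, M < `|x| -> f x = 0) -> L2 TT f.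
Proof.
move=> mf fB f0; split => //; apply: (@intble_bounded_support _ _ _ (B ^+ 2) M).
- exact: measurable_funX.
- by move=> x; rewrite normrX lerXn2r ?nnegrE//; exact: le_trans (fB x).
- by move=> x /f0 ->; rewrite expr0n.
Qed.

Lemma L2_interp f : L2 TT (interp f).
Proof.
have [B hB] := interp_bounded f; have [M hM] := interp_out_bound f.
by apply: (bounded_support_L2 _ hB) => [|x /hM[]]; [exact: measurable_interp|].
Qed.

Lemma L2_interp_grad f i : L2 TT (fun x => interp_grad f x 0 i).
Proof.
have [B hB] := interp_grad_bounded f; have [M hM] := interp_out_bound f.
apply: (@bounded_support_L2 _ B M); first exact: measurable_interp_grad.
  by move=> x; exact: hB.
by move=> x /hM[_ ->]; rewrite mxE.
Qed.

Lemma is_derive_affine (a : V) (k : R) i (x : V) : is_derive x (e_ i) (fun x => dot a x + k) (a 0 i).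
Proof.
apply: (@is_derive_quadratic _ _ _ _ _ _ 0) => h; rewrite mul0r dotDr dotZr.
have -> : dot a (e_ i) = a 0 i.
  rewrite /dot (bigD1 i)//= !mxE !eqxx mulr1 big1 ?addr0// => j ji.
  by rewrite !mxE (negbTE ji) mulr0.
by rewrite (_ : _ - _ = 0) ?normr0//; ring.
Qed.

(* [interp f * phi] is Lipschitz on every element and on the closed set [C], hence everywhere. *)
Lemma interp_ibp f phi (C : set V) i : C1 phi -> bounded_support phi -> closed C ->
  (forall x, ~ closure E x -> C x) -> (forall x, C x -> interp f x * phi x = 0) ->
  ip TT (interp f) (partial i phi) = - ip TT (fun x => interp_grad f x 0 i) phi.
Proof.
move=> cphi sphi cC outC C0.
pose F x := interp f x * phi x.
have [Lp [Lp0 hLp]] := C1_lipschitz cphi sphi.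
have [Bp hBp] := continuous_bounded_support cphi.1 sphi.
have [B hB] := interp_bounded f.
have B0 : 0 <= B := le_trans (normr_ge0 _) (hB 0).
have Bp0 : 0 <= Bp := le_trans (normr_ge0 _) (hBp 0).
pose s := enum_fset T; pose nS k : simplex := nth (nil, 0%N) s k.
have nT (k : 'I_(size s)) : nS k \in T by rewrite /nS mem_nth.
pose L := B * Lp + Bp * \sum_(S <- s) (d%:R * `|agrad S f|).
have L0 : 0 <= L.
  apply: addr_ge0; first exact: mulr_ge0.
  by apply: mulr_ge0 => //; apply: sumr_ge0 => S _; exact: mulr_ge0.
have lipS S x y : S \in T -> hull S.1 x -> hull S.1 y -> `|F y - F x| <= L * `|y - x|.
  move=> ST hx hy.
  have -> : F y - F x = interp f y * (phi y - phi x) + phi x * (interp f y - interp f x).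
    by rewrite /F; ring.
  apply: (le_trans (ler_normD _ _)); rewrite !normrM /L mulrDl; apply: lerD.
    by rewrite -mulrA; apply: ler_pM.
  rewrite -mulrA; apply: ler_pM => //.
  have [k hk] := aff_affine S f.
  rewrite !(interpE f ST)// !hk opprD addrACA subrr addr0 -dotBr.
  apply: (le_trans (dot_le_norm _ _)); apply: ler_wpM2r => //.
  rewrite (bigD1_seq S ST (fset_uniq T))/=.
  by rewrite lerDl; apply: sumr_ge0 => S' _; exact: mulr_ge0.
have lipF : lipschitz_fun F.
  exists L; split => //.
  apply: (@segment_glue R V (option 'I_(size s)) (fun o => if o is Some k then hull (nS k).1 else C)).
  - by case=> [k|//]; apply: closed_hull; exact: mesh_wf.
  - move=> x; have [cx|/outC cx] := pselect (closure E x); last by exists None.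
    have [S ST hS] := mesh_cover cx.
    have /(nthP (nil, 0%N))[k ks kE] : S \in s by [].
    by exists (Some (Ordinal ks)); rewrite /nS /= kE.
  - case=> [k|] x y; first exact: lipS.
    by move=> /C0 Fx /C0 Fy; rewrite /F Fx Fy subrr normr0 mulr_ge0.
have [M hM] := sphi.
have F0 x : M < `|x| -> F x = 0 by move=> /hM; rewrite /F => ->; rewrite mulr0.
have Lip := continuous_L2 cphi.1 sphi; have Lpp := continuous_L2 (cphi.2 i).2 (bounded_support_partial i sphi).
pose g x := interp f x * partial i phi x + interp_grad f x 0 i * phi x.
have ig1 := L2M mT (L2_interp f) Lpp; have ig2 := L2M mT (L2_interp_grad f i) Lip.
have mg : measurable_fun TT g by apply: intble_meas mT _; exact: intbleD.
have dF : ae_on TT (fun x => is_derive x (e_ i) F (g x)).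
  apply: ae_on_imp mesh_ae => x _ [cx|[S ST ex]].
    have -> : g x = 0.
      rewrite /g interp_out// interp_grad_out ?mul0r ?mxE ?mul0r ?addr0// => S ST /elt_hull.
      by move/(mesh_hull_closure ST).
    have op : open (~` closure E) by apply: closed_openC; exact: closed_closure.
    have nz : \forall y \near x, 0 = F y.
      have : nbhs x (~` closure E) by apply: open_nbhs_nbhs; split.
      by apply: filterS => y /outC/C0.
    exact: (near_eq_is_derive nz (is_derive_cst _ _ _)).
  have [k hk] := aff_affine S f.
  have d1 := is_derive_affine (agrad S f) k i x.
  have d2 := is_derive_partial ((cphi.2 i).1 x).
  have nz : \forall y \near x, (dot (agrad S f) y + k) * phi y = F y.
    have : nbhs x (elt S) by apply: open_nbhs_nbhs; split => //; exact: open_interior.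
    by apply: filterS => y /elt_hull hy; rewrite /F (interpE f ST hy) hk.
  have d3 := near_eq_is_derive nz (is_deriveM d1 d2).
  apply: (is_derive_eq d3).
  by rewrite /g (interpE f ST (elt_hull ex)) (interp_gradE f ST ex) hk -![_ *: _]/(_ * _) [phi x * _]mulrC.
have [_ I0] := Rint_lipschitz_partial lipF F0 mg dF.
by apply/eqP; rewrite -addr_eq0 /ip -RintD// -/(g _); apply/eqP.
Qed.

(** By [star_interior], a point outside [E] has coordinate 0 at every vertex that lies in [E]; at
    the remaining vertices [f] is 0. *)
Lemma interp_zero_boundary f : (forall x, ~ E x -> f x = 0) -> forall x, ~ E x -> interp f x = 0.
Proof.
move=> f0 x Ex; have [cx|/interp_out//] := pselect (closure E x).
have [S ST hS] := mesh_cover cx; rewrite (interpE f ST hS) /aff big1// => i _.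
have [Ev|/f0->] := pselect (E (S.1`_i)); last by rewrite mul0r.
have := (hullP (mesh_wf ST) x).1 hS i; rewrite le_eqVlt => /orP[/eqP<-|b0]; first by rewrite mulr0.
by exfalso; apply: Ex; exact: star_interior ST Ev hS b0.
Qed.

Lemma interp_ext_grad f : (forall x, ~ E x -> f x = 0) -> ext_grad E (interp f) (interp_grad f).
Proof.
move=> f0; split.
- exact: L2_interp.
- by move=> i; exact: L2_interp_grad.
- exact: interp_zero_boundary.
- by move=> x Ex; apply: interp_grad_out => S ST /(elt_sub ST).
(* The interpolant itself vanishes off [E], so [phi] is free at the boundary. *)
move=> phi cphi sphi i; apply: (@interp_ibp _ _ (~` E)) => //.
- exact: open_closedC.
- by move=> x cx /subset_closure.
- by move=> x /(interp_zero_boundary f0) ->; rewrite mul0r.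
Qed.

End triangulated_domain.

(** * Interpolation errors and Raviart-Thomas fields *)

Section interpolation_error.
Context {R : realType} {d : nat}.
Local Notation V := 'rV[R]_d.
Local Notation leb := (@lebesgue_rV R d).
Local Notation e_ i := (delta_mx 0 i : V).
Local Notation TT := [set: V].
Variables (S : @simplex R d) (kappa : R).
Hypotheses (d0 : (0 < d)%N) (wS : simplex_wf S) (k0 : 0 < kappa)
  (shape : diam (hull S.1) ^+ d <= kappa * vol S).

(** [agrad] reproduces the gradients of affine functions, and barycentric gradients are at most
    [kappa * 3 ^+ d] over the diameter; so errors of order [e] times the diameter at the vertices
    become errors of order [e] in the gradient. *)
Lemma agrad_error (f : V -> R) (a : V) (c e : R) j : 0 <= e ->
  (forall i : 'I_d.+1, `|f (S.1`_i) - (dot a (S.1`_i) + c)| <= e * diam (hull S.1)) ->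
  `|agrad S f 0 j - a 0 j| <= d.+1%:R * (e * (kappa * 3 ^+ d)).
Proof.
move=> e0 h.
have E : agrad S (fun x => dot a x + c) = a by apply: (agrad_dot wS (k := c)).
rewrite -{1}E /agrad !summxE -sumrB.
apply: (le_trans (ler_norm_sum _ _ _)).
apply: (@le_trans _ _ (\sum_(i < d.+1) e * (kappa * 3 ^+ d))); last first.
  by rewrite sumr_const card_ord -[X in X <= _]mulr_natl.
apply: ler_sum => i _; rewrite !mxE -mulrBl normrM.
apply: (@le_trans _ _ (e * diam (hull S.1) * `|bgrad S i 0 j|)); first by rewrite ler_wpM2r.
by rewrite -mulrA ler_wpM2l// mulrC; exact: bgrad_bound.
Qed.

Lemma agrad_lipschitz_bound (f : V -> R) (L : R) j : 0 <= L ->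
  (forall x y, `|f y - f x| <= L * `|y - x|) ->
  `|agrad S f 0 j| <= d.+1%:R * (L * (kappa * 3 ^+ d)).
Proof.
move=> L0 hL; have := @agrad_error f 0 (f (S.1`_0)) L j L0.
rewrite mxE subr0; apply => i.
have -> : dot 0 (S.1`_i) = 0 :> R by rewrite /dot big1// => k _; rewrite mxE mul0r.
rewrite add0r; apply: (le_trans (hL _ _)); rewrite ler_wpM2l//.
by apply: dist_diam => //; [exact: vertex_hull|exact: (vertex_hull wS ord0)].
Qed.

Lemma agrad_frechet (f : V -> R) (x : V) (e r : R) j : 0 <= e -> hull S.1 x -> diam (hull S.1) <= r ->
  (forall y, `|y - x| <= r ->
    `|f y - f x - \sum_(i < d) partial i f x * (y 0 i - x 0 i)| <= e * `|y - x|) ->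
  `|agrad S f 0 j - partial j f x| <= d.+1%:R * (e * (kappa * 3 ^+ d)).
Proof.
move=> e0 hx dr hf; have -> : partial j f x = grad f x 0 j by rewrite mxE.
apply: (@agrad_error f (grad f x) (f x - dot (grad f x) x)) => // i.
have hv := dist_diam wS (vertex_hull wS i) hx.
have -> : f (S.1`_i) - (dot (grad f x) (S.1`_i) + (f x - dot (grad f x) x)) =
   f (S.1`_i) - f x - \sum_(k < d) partial k f x * ((S.1`_i) 0 k - x 0 k).
  have -> : \sum_(k < d) partial k f x * ((S.1`_i) 0 k - x 0 k) = dot (grad f x) (S.1`_i) - dot (grad f x) x.
    by rewrite -dotBr; apply: eq_bigr => k _; rewrite !mxE.
  ring.
apply: (le_trans (hf _ (le_trans hv dr))); by rewrite ler_wpM2l.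
Qed.

Lemma aff_lipschitz_error (f : V -> R) (L : R) x : 0 <= L ->
  (forall x y, `|f y - f x| <= L * `|y - x|) -> hull S.1 x ->
  `|aff S f x - f x| <= L * diam (hull S.1).
Proof.
move=> L0 hL hx; have b0 := (hullP wS x).1 hx.
have -> : aff S f x - f x = \sum_(i < d.+1) (f (S.1`_i) - f x) * bary S i x.
  have E1 : f x = \sum_i f x * bary S i x by rewrite -mulr_sumr sum_bary mulr1.
  rewrite /aff [X in _ - X]E1 -sumrB; apply: eq_bigr => i _.
  by rewrite mulrBl.
apply: (le_trans (ler_norm_sum _ _ _)).
rewrite -[leRHS]mulr1 -(sum_bary S x) mulr_sumr; apply: ler_sum => i _.
rewrite normrM [X in _ * X]ger0_norm// ler_wpM2r//; apply: (le_trans (hL _ _)).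
by rewrite ler_wpM2l//; apply: dist_diam => //; exact: vertex_hull.
Qed.

End interpolation_error.

Section raviart_thomas.
Context {R : realType} {d : nat}.
Local Notation V := 'rV[R]_d.
Local Notation leb := (@lebesgue_rV R d).
Local Notation e_ i := (delta_mx 0 i : V).
Local Notation TT := [set: V].
Variables (E : set V) (T : mesh R d).
Hypotheses (d0 : (0 < d)%N) (lE : lipschitz_domain E) (tT : triangulation E T).
Let oE : open E := lipschitz_domain_open lE.
Let mE : measurable E := open_measurable_rV oE.
Let mT : measurable TT := measurableT.

Definition mulx (f : V -> R) (k : 'I_d) : V -> R := fun x => f x * x 0 k.

(* With [I] the nodal interpolant, this is [I tau] plus [1/d] times the divergence of the
   antisymmetric field [x_j I tau_k - x_k I tau_j + I (tau_j x_k) - I (tau_k x_j)]; the second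
   part is divergence free and turns [I tau] into a Raviart-Thomas field. *)
Definition rt (tau : 'I_d -> V -> R) : V -> V := fun x => \row_j (d%:R^-1 *
  (interp T (tau j) x + \sum_k (x 0 j * interp_grad T (tau k) x 0 k - x 0 k * interp_grad T (tau j) x 0 k
    + interp_grad T (mulx (tau j) k) x 0 k - interp_grad T (mulx (tau k) j) x 0 k))).

Definition rtdiv (tau : 'I_d -> V -> R) : V -> R := fun x => \sum_k interp_grad T (tau k) x 0 k.

Lemma C1_coord j : C1 (fun x : V => x 0 j).
Proof.
have D i x : is_derive x (e_ i) (fun y : V => y 0 j) ((i == j)%:R : R) by exact: partial_coord.
split; first by move=> x; exact: coord_continuous.
move=> i; split; first by move=> x; case: (D i x).
have -> : partial i (fun y : V => y 0 j) = fun=> (i == j)%:R by apply/funext => x; case: (D i x).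
by move=> x; exact: cst_continuous.
Qed.

Lemma interp_ibp_C1 f (phi : V -> R) i : C1 phi -> bounded_support phi -> (forall x, ~ E x -> phi x = 0) ->
  ip TT (fun x => interp_grad T f x 0 i) phi = - ip TT (interp T f) (partial i phi).
Proof.
move=> cphi sphi out; apply/eqP; rewrite eq_sym eqr_oppLR; apply/eqP.
(* Here the interpolant may be nonzero at the boundary and the product vanishes because of [phi], so
   the additional piece is the zero set of [phi]. *)
apply: (interp_ibp d0 lE tT (C := [set x | phi x = 0])) => //.
- rewrite (_ : [set x | phi x = 0] = phi @^-1` [set 0])//; apply: closed_comp; last exact: closed_eq.
  by move=> x _; exact: cphi.1 x.
- by move=> x cx /=; apply: out => /subset_closure.
- by move=> x /= ->; rewrite mulr0.
Qed.

Lemma ip_test (f phi : V -> R) : (forall x, ~ E x -> phi x = 0) -> ip E f phi = ip TT f phi.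
Proof.
move=> out; rewrite /ip Rint_ext; apply: eq_Rintegral => x _; rewrite restrictE.
by case: ifPn => //; rewrite notin_setE => /out->; rewrite mulr0.
Qed.

(** On an element, [interp T (tau j)] is the affine function with gradient [agrad S (tau j)]; its
    linear part cancels against the terms with [x 0 k], and what remains is a constant plus [x 0 j]
    times the divergence. *)
Lemma rt_affine tau S : S \in T -> exists (a : V) (k : R), forall x, elt S x -> rt tau x = a + k *: x.
Proof.
move=> ST; have /boolp.choice[c hc] : forall j, exists c : R, forall x, aff S (tau j) x = dot (agrad S (tau j)) x + c.
  by move=> j; exact: aff_affine.
pose G f k := agrad S f 0 k.
exists (\row_j (d%:R^-1 * (c j + \sum_k (G (mulx (tau j) k) k - G (mulx (tau k) j) k)))),
  (d%:R^-1 * \sum_k G (tau k) k) => x ex.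
apply/rowP => j; rewrite !mxE (interpE tT (tau j) ST (elt_hull ex)) hc.
under eq_bigr do rewrite !(interp_gradE tT _ ST ex).
rewrite -mulrA -mulrDr; congr (_ * _); rewrite /dot mulr_suml -/(G _ _).
rewrite [_ + c j]addrC -!addrA; congr (_ + _); rewrite -!big_split /=; apply: eq_bigr => k _.
rewrite /G; ring.
Qed.

Lemma L2_coord_mul f j : L2 E f -> L2 E (fun x => x 0 j * f x).
Proof.
move=> Lf; have [M hM] := lipschitz_domain_bound lE.
apply: (@L2_bounded_mul _ _ _ _ (fun x : V => x 0 j) M) => //.
  apply: measurable_funTS; apply: continuous_measurable_rV; exact: (C1_coord j).1.
apply: ae_on_all => x /subset_closure/hM; apply: le_trans; exact: coord_le_norm.
Qed.

Lemma L2_rt tau : L2v E (rt tau).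
Proof.
move=> j; rewrite (_ : (fun x => _) = fun x => d%:R^-1 *
  (interp T (tau j) x + \sum_k (x 0 j * interp_grad T (tau k) x 0 k - x 0 k * interp_grad T (tau j) x 0 k
    + interp_grad T (mulx (tau j) k) x 0 k - interp_grad T (mulx (tau k) j) x 0 k))); last first.
  by apply/funext => x; rewrite mxE.
have LI f : L2 E (interp T f) by apply: L2_setT => //; exact: (L2_interp lE tT).
have LG f k : L2 E (fun x => interp_grad T f x 0 k) by apply: L2_setT => //; exact: (L2_interp_grad lE tT).
apply: L2_scale => //; apply: L2_add => //; apply: L2_sum => // k _.
apply: L2_sub => //; apply: L2_add => //; apply: L2_sub => //; exact: L2_coord_mul.
Qed.

Lemma L2_rtdiv tau : L2 E (rtdiv tau).
Proof. by apply: L2_sum => // k _; apply: L2_setT => //; exact: (L2_interp_grad lE tT). Qed.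

(** All derivatives are moved to [phi]. The terms with second derivatives cancel in pairs by their
    symmetry. Differentiating the coordinates in the products [X] contributes [d] times the sum of
    the [a j], minus this sum once; the first term of the field restores it, and the factor [1/d]
    normalizes the result. *)
Lemma rt_wdiv tau : is_wdiv E (rt tau) (rtdiv tau).
Proof.
split; first exact: L2_rtdiv.
move=> phi tp; have dn : d%:R != 0 :> R by rewrite pnatr_eq0 -lt0n.
pose D j : V -> R := partial j phi; pose H j k : V -> R := partial k (partial j phi).
have tD j : test_fun E (D j) := test_fun_partial j tp.
have tH j k : test_fun E (H j k) := test_fun_partial k (tD j).
have symH j k x : H j k x = H k j x by apply: smooth_schwarz; exact: tp.1.
have LI f : L2 TT (interp T f) := L2_interp lE tT f.
have LG f k : L2 TT (fun x => interp_grad T f x 0 k) := L2_interp_grad lE tT f k.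
pose X (m : 'I_d) (psi : V -> R) : V -> R := fun x => x 0 m * psi x.
have outX m psi : test_fun E psi -> forall x, ~ E x -> X m psi x = 0.
  by move=> tpsi x Ex; rewrite /X (test_fun_out tpsi Ex) mulr0.
have C1X m psi : test_fun E psi -> C1 (X m psi).
  by move=> tpsi; apply: C1M; [exact: C1_coord|exact: smooth_C1 tpsi.1].
have bX m psi : test_fun E psi -> bounded_support (X m psi).
  by move=> /test_fun_mollifier[_ [M hM]]; exists M => x /hM; rewrite /X => ->; rewrite mulr0.
have LX m psi : test_fun E psi -> L2 TT (X m psi).
  by move=> tpsi; apply: continuous_L2; [exact: (C1X m psi tpsi).1|exact: bX].
have Lt psi : test_fun E psi -> L2 TT psi by move=> /test_fun_mollifier/mollifier_L2.
have dX m k psi x : test_fun E psi -> partial k (X m psi) x = (k == m)%:R * psi x + x 0 m * partial k psi x.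
  move=> tpsi; have Dm := @partial_coord R d k m x.
  rewrite /X partialM; [|by case: Dm|by apply: smooth_derivable; exact: tpsi.1].
  by rewrite addrC mulrC; congr (_ * _ + _); case: Dm.
have b j : bounded_support (D j) by have [] := test_fun_mollifier (tD j).
have ibp f k psi : test_fun E psi ->
    ip TT (fun x => interp_grad T f x 0 k) psi = - ip TT (interp T f) (partial k psi).
  move=> tpsi; have [? ?] := test_fun_mollifier tpsi; apply: interp_ibp_C1 => //; first exact: smooth_C1.
  by move=> x; exact: test_fun_out.
have ibpX f k m psi : test_fun E psi ->
    ip TT (fun x => interp_grad T f x 0 k) (X m psi) =
    - ((k == m)%:R * ip TT (interp T f) psi + ip TT (interp T f) (X m (partial k psi))).
  move=> tpsi; rewrite interp_ibp_C1//; [|exact: C1X|exact: bX|exact: outX].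
  congr (- _); have tk := test_fun_partial k tpsi.
  rewrite /ip -RintZ//; last by apply: L2M => //; exact: Lt.
  rewrite -RintD//; [|by apply: intbleZ => //; apply: L2M => //; exact: Lt|by apply: L2M => //; exact: LX].
  by apply: eq_Rintegral => x _; rewrite dX// /X; ring.
have symHf j k : H j k = H k j by apply/funext => x.
have ibpD f k j : ip TT (fun x => interp_grad T f x 0 k) (D j) = - ip TT (interp T f) (H j k).
  exact: ibp.
have ibpXD f k m j : ip TT (fun x => interp_grad T f x 0 k) (X m (D j)) =
    - ((k == m)%:R * ip TT (interp T f) (D j) + ip TT (interp T f) (X m (H j k))).
  exact: ibpX.
clearbody H.
pose a j := ip TT (interp T (tau j)) (D j).
pose h j k := ip TT (interp T (tau j)) (X k (H k j)).
pose w j k := ip TT (interp T (mulx (tau j) k)) (H j k).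
have lhs : ipv E (rt tau) (grad phi) = d%:R^-1 * (\sum_j a j + \sum_j \sum_k
    (ip TT (fun x => interp_grad T (tau k) x 0 k) (X j (D j)) -
     ip TT (fun x => interp_grad T (tau j) x 0 k) (X k (D j)) +
     ip TT (fun x => interp_grad T (mulx (tau j) k) x 0 k) (D j) -
     ip TT (fun x => interp_grad T (mulx (tau k) j) x 0 k) (D j))).
  rewrite ipv_sum//; [|exact: L2_rt|exact: grad_L2].
  rewrite -big_split mulr_sumr /=; apply: eq_bigr => j _.
  have -> : (fun x => grad phi x 0 j) = D j by apply/funext => x; rewrite mxE.
  rewrite ip_test; last by move=> x; exact: test_fun_out.
  have I1 := L2M mT (LI (tau j)) (Lt _ (tD j)).
  have I2 k := L2M mT (LG (tau k) k) (LX j _ (tD j)).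
  have I3 k := L2M mT (LG (tau j) k) (LX k _ (tD j)).
  have I4 k := L2M mT (LG (mulx (tau j) k) k) (Lt _ (tD j)).
  have I5 k := L2M mT (LG (mulx (tau k) j) k) (Lt _ (tD j)).
  have I23 k := intbleB mT (I2 k) (I3 k).
  have I234 k := intbleD mT (I23 k) (I4 k).
  have I2345 k := intbleB mT (I234 k) (I5 k).
  have Ek k : ip TT (fun x => interp_grad T (tau k) x 0 k) (X j (D j)) -
     ip TT (fun x => interp_grad T (tau j) x 0 k) (X k (D j)) +
     ip TT (fun x => interp_grad T (mulx (tau j) k) x 0 k) (D j) -
     ip TT (fun x => interp_grad T (mulx (tau k) j) x 0 k) (D j) =
     \int[leb]_x (interp_grad T (tau k) x 0 k * X j (D j) x - interp_grad T (tau j) x 0 k * X k (D j) x +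
       interp_grad T (mulx (tau j) k) x 0 k * D j x - interp_grad T (mulx (tau k) j) x 0 k * D j x).
    by rewrite RintB// RintD// RintB.
  rewrite (eq_bigr _ (fun k _ => Ek k)) -Rint_sum// /a /ip -RintD//; last exact: intble_sum.
  rewrite -RintZ//; last by apply: intbleD => //; exact: intble_sum.
  apply: eq_Rintegral => x _; rewrite mxE -mulrA; congr (_ * _).
  rewrite mulrDl mulr_suml; congr (_ + _); apply: eq_bigr => k _; rewrite /X; ring.
rewrite lhs ip_test; last by move=> x; exact: test_fun_out.
have rhs : ip TT (rtdiv tau) phi = - \sum_j a j.
  have -> : ip TT (rtdiv tau) phi = \sum_k ip TT (fun x => interp_grad T (tau k) x 0 k) phi.
    rewrite /ip -Rint_sum//; last by move=> k _; apply: L2M => //; exact: Lt.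
    by apply: eq_Rintegral => x _; rewrite /rtdiv mulr_suml.
  by rewrite -sumrN; apply: eq_bigr => k _; exact: ibp.
rewrite rhs opprK.
have E1 : \sum_j \sum_k
    (ip TT (fun x => interp_grad T (tau k) x 0 k) (X j (D j)) -
     ip TT (fun x => interp_grad T (tau j) x 0 k) (X k (D j)) +
     ip TT (fun x => interp_grad T (mulx (tau j) k) x 0 k) (D j) -
     ip TT (fun x => interp_grad T (mulx (tau k) j) x 0 k) (D j)) =
   \sum_j \sum_k (- (k == j)%:R * ip TT (interp T (tau k)) (D j) + a j + (h j k - h k j) + (w k j - w j k)).
  apply: eq_bigr => j _; apply: eq_bigr => k _.
  rewrite (ibpXD (tau k) k j j) (ibpXD (tau j) k k j) (ibpD _ k j) (ibpD _ k j) eqxx /h /w /a (symHf k j).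
  generalize (ip TT (interp T (tau k)) (D j)) (ip TT (interp T (tau k)) (X j (H j k)))
    (ip TT (interp T (tau j)) (D j)) (ip TT (interp T (tau j)) (X k (H j k)))
    (ip TT (interp T (mulx (tau j) k)) (H j k)) (ip TT (interp T (mulx (tau k) j)) (H j k)).
  by rewrite -[true%:R]/(1 : R) -[1 *- _]/(- (k == j)%:R); generalize ((k == j)%:R : R); clear; move=> *; ring.
rewrite E1.
have anti (F : 'I_d -> 'I_d -> R) : \sum_j \sum_k (F j k - F k j) = 0.
  rewrite (eq_bigr (fun j => \sum_k F j k - \sum_k F k j)) => [|j _]; last by rewrite sumrB.
  by rewrite sumrB [X in _ - X]exchange_big subrr.
have E3 : \sum_j \sum_k (- (k == j)%:R * ip TT (interp T (tau k)) (D j) + a j + (h j k - h k j) + (w k j - w j k)) =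
  \sum_j ((\sum_k (- (k == j)%:R * ip TT (interp T (tau k)) (D j)) + a j *+ d) +
   (\sum_k (h j k - h k j) + \sum_k (w k j - w j k))).
  by apply: eq_bigr => j _; rewrite big_split big_split big_split /= sumr_const card_ord -addrA.
rewrite E3.
rewrite big_split /= [X in _ * (_ + (_ + X))]big_split /= (anti h) (anti (fun j k => w k j)) !addr0.
rewrite big_split /=.
have -> : \sum_j \sum_k (- (k == j)%:R * ip TT (interp T (tau k)) (D j)) = - \sum_j a j.
  rewrite -sumrN; apply: eq_bigr => j _; rewrite (bigD1 j)//= eqxx mulN1r big1 ?addr0// => k /negbTE ->.
  by rewrite oppr0 mul0r.
by rewrite addrA subrr add0r sumrMnl -[X in _ * X]mulr_natl mulrA mulVf// mul1r.
Qed.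

Lemma rt_Hdiv tau : Hdiv E (rt tau).
Proof. by split; [exact: L2_rt|exists (rtdiv tau); exact: rt_wdiv]. Qed.

End raviart_thomas.

(** * Limits of interpolants along the adaptive meshes *)

Section interpolation_limit.
Context {R : realType} {d : nat}.
Local Notation V := 'rV[R]_d.
Local Notation leb := (@lebesgue_rV R d).
Local Notation e_ i := (delta_mx 0 i : V).
Local Notation TT := [set: V].

Lemma ip_dct (E : set V) (r G : V -> R) (F : nat -> V -> R) (B : R) : measurable E -> intble E r ->
  (forall k, measurable_fun E (F k)) -> measurable_fun E G ->
  (forall k, ae_on E (fun x => `|F k x| <= B)) ->
  ae_on E (fun x => r x = 0 \/ F k x @[k --> \oo] --> G x) ->
  ip E r (F k) @[k --> \oo] --> ip E r G.
Proof.
move=> mE ir mF mG bF cF; have mr := intble_meas mE ir.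
have ig : intble E (fun x => B * `|r x|) by apply: intbleZ => //; exact: intble_norm.
have mp k : measurable_fun E (fun x => r x * F k x) by exact: measurable_funM.
have mg : measurable_fun E (fun x => r x * G x) by exact: measurable_funM.
have ba k : ae_on E (fun x => `|r x * F k x| <= B * `|r x|).
  by apply: ae_on_imp (bF k) => x _ h; rewrite normrM mulrC ler_wpM2r.
have ca : ae_on E (fun x => r x * F k x @[k --> \oo] --> r x * G x).
  apply: ae_on_imp cF => x _ [->|h].
    rewrite mul0r (_ : (fun _ => _) = fun=> 0); first exact: cvg_cst.
    by apply/funext => k; rewrite mul0r.
  by apply: cvgMr.
have [iG c] := Rint_dct mE mp mg ig ca ba.
apply: Rint_cvg c => // k.
have := Rint_dct mE (fun _ : nat => mp k) (mp k) ig _ (fun=> ba k).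
case=> //; apply: ae_on_all => x _; exact: cvg_cst.
Qed.

Lemma aff_bound (S : @simplex R d) (f : V -> R) (B : R) x : simplex_wf S -> (forall x, `|f x| <= B) ->
  hull S.1 x -> `|aff S f x| <= B.
Proof.
move=> wS fB /(hullP wS) hx.
apply: (le_trans (ler_norm_sum _ _ _)).
apply: (@le_trans _ _ (\sum_i B * bary S i x)); last by rewrite -mulr_sumr sum_bary mulr1.
by apply: ler_sum => i _; rewrite normrM (ger0_norm (hx i)) ler_wpM2r.
Qed.

Lemma cvg_ord_sum (n : nat) (F : 'I_n -> nat -> R) (G : 'I_n -> R) :
  (forall j, F j l @[l --> \oo] --> G j) -> \sum_j F j l @[l --> \oo] --> \sum_j G j.
Proof.
move=> h; elim: (index_enum _) => [|j s IH].
  rewrite (_ : (fun _ => _) = fun=> 0); last by apply/funext => l; rewrite big_nil.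
  by rewrite big_nil; exact: cvg_cst.
rewrite (_ : (fun _ => _) = fun l => F j l + \sum_(j <- s) F j l); last first.
  by apply/funext => l; rewrite big_cons.
by rewrite big_cons; exact: cvgD.
Qed.

Lemma cvg_sum_eq0 (u w : nat -> R) (a b : R) : u l @[l --> \oo] --> a -> w l @[l --> \oo] --> b ->
  (forall l, u l + w l = 0) -> a + b = 0.
Proof.
move=> ua wb h; have c : u l + w l @[l --> \oo] --> a + b by exact: cvgD.
apply: (cvg_unique (@Rhausdorff R) c).
by rewrite (_ : (fun _ => _) = fun=> 0); [exact: cvg_cst|apply/funext => l; exact: h].
Qed.

Lemma meshsizeE (T : mesh R d) (E : set V) S x : triangulation E T ->
  S \in T -> elt S x -> meshsize T x = vol S `^ (d%:R^-1).
Proof.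
move=> tT ST Sx; rewrite /meshsize.
rewrite (sum_elt tT ST Sx); first by rewrite indicE mem_set// mulr1.
by move=> S' _ nx; rewrite indicE memNset// mulr0.
Qed.

Lemma powR_root (v : R) : (0 < d)%N -> 0 <= v -> (v `^ (d%:R^-1)) ^+ d = v.
Proof.
by move=> d0 v0; rewrite -powR_mulrn ?powR_ge0// -powRrM mulVf ?pnatr_eq0 -?lt0n// powRr1.
Qed.

(** [k] may be less than 1, so it is enlarged to [k + 1], which is bounded by its own [d]-th
    power. *)
Lemma le_pow_shape (D k h r : R) : (0 < d)%N -> 0 <= D -> 0 < k -> 0 <= h -> 0 < r ->
  D ^+ d <= k * h ^+ d -> h <= r / (k + 1) -> D <= r.
Proof.
move=> d0 D0 k0 h0 r0 Dk hr; rewrite -(@ler_pXn2r _ d)//; last by rewrite nnegrE ltW.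
apply: (le_trans Dk).
have k1 : 1 <= k + 1 by rewrite lerDr ltW.
have h2 : h ^+ d <= (r / (k + 1)) ^+ d by rewrite lerXn2r ?nnegrE// divr_ge0 ?ltW// (lt_le_trans _ k1).
apply: (@le_trans _ _ ((k + 1) * (r / (k + 1)) ^+ d)).
  by apply: ler_pM => //; [exact: ltW|exact: exprn_ge0|rewrite lerDl].
rewrite expr_div_n mulrCA ler_piMr ?exprn_ge0 ?(ltW r0)//.
have k2 : 0 < k + 1 by exact: lt_le_trans k1.
rewrite ler_pdivrMr ?exprn_gt0// mul1r.
by rewrite -[leLHS]expr1 ler_weXn2l.
Qed.

Variables (E : set V) (T : nat -> mesh R d) (kappa : R).
Hypotheses (d0 : (0 < d)%N) (lE : lipschitz_domain E) (tT : forall l, triangulation E (T l)).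
Hypotheses (k0 : 0 < kappa)
  (shape : forall l S, S \in T l -> diam (hull S.1) ^+ d <= kappa * vol S).
Let oE : open E := lipschitz_domain_open lE.
Let fE := lipschitz_domain_fin lE.
Let mE : measurable E := open_measurable_rV oE.
Let mT : measurable TT := measurableT.

Lemma mesh_ae_elts : ae_on E (fun x => forall l, exists2 S, S \in T l & elt S x).
Proof. by apply: ae_on_nat => l; exact: mesh_ae_elt (tT l). Qed.

Lemma diam_small x (r : R) : 0 < r -> meshsize (T l) x @[l --> \oo] --> (0 : R) ->
  \forall l \near \oo, forall S, S \in T l -> elt S x -> diam (hull S.1) <= r.
Proof.
move=> r0 /cvgr0Pnorm_le h; have s0 : 0 < r / (kappa + 1) by rewrite divr_gt0// addr_gt0.
near=> l => S Sl Sx.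
have wS := mesh_wf (tT l) Sl.
have : `|meshsize (T l) x| <= r / (kappa + 1) by near: l; exact: h.
rewrite (meshsizeE (tT l) Sl Sx) ger0_norm ?powR_ge0// => hs.
have sS := shape Sl.
apply: (le_pow_shape d0 _ k0 _ r0 _ hs); rewrite ?powR_ge0//.
  exact/ltW/diam_gt0.
by rewrite powR_root ?vol_ge0.
Unshelve. all: by end_near. Qed.

Lemma mul_div_le (K e : R) : 0 <= K -> 0 <= e -> K * (e / (K + 1)) <= e.
Proof.
move=> K0 e0; have K1 : 0 < K + 1 by apply: ltr_wpDl.
by rewrite mulrCA ler_piMr// ler_pdivrMr// mul1r lerDl.
Qed.

(** Shape regularity turns a vanishing mesh size at [x] into a vanishing diameter of the element
    around [x]. The Lipschitz bound then gives the values, and differentiability at the fixed point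
    [x] gives the gradients. *)
Lemma interp_cvg f : C1 f -> bounded_support f ->
  ae_on E (fun x => meshsize (T l) x @[l --> \oo] --> (0 : R) ->
    interp (T l) f x @[l --> \oo] --> f x /\
    forall j, interp_grad (T l) f x 0 j @[l --> \oo] --> partial j f x).
Proof.
move=> cf bf; have [L [L0 hL]] := C1_lipschitz cf bf.
apply: ae_on_imp mesh_ae_elts => x Ex hx h0; split.
  apply/cvgrPdist_le => e e0.
  have s0 : 0 < e / (L + 1) by rewrite divr_gt0// ltr_wpDl.
  near=> l; have [S Sl Sx] := hx l; have wS := mesh_wf (tT l) Sl.
  have hS := elt_hull Sx.
  rewrite distrC (interpE (tT l) f Sl hS).
  apply: (le_trans (aff_lipschitz_error wS L0 hL hS)).
  apply: (le_trans _ (mul_div_le L0 (ltW e0))); rewrite ler_wpM2l//.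
  by have := Sx; apply: (near (diam_small s0 h0) l) => //.
move=> j; apply/cvgrPdist_le => e e0.
pose K := d.+1%:R * (kappa * 3 ^+ d).
have K0 : 0 <= K by rewrite mulr_ge0// mulr_ge0 ?(ltW k0)// exprn_ge0.
have s0 : 0 < e / (K + 1) by rewrite divr_gt0// ltr_wpDl.
have [r [r0 hr]] := C1_frechet x cf s0.
near=> l; have [S Sl Sx] := hx l; have wS := mesh_wf (tT l) Sl.
have hS := elt_hull Sx.
rewrite distrC (interp_gradE (tT l) f Sl Sx).
have dS : diam (hull S.1) <= r.
  by have := Sx; apply: (near (diam_small r0 h0) l) => //.
have := @agrad_frechet _ _ _ _ d0 wS k0 (shape Sl) f x _ r j (ltW s0) hS dS hr.
move=> ha; apply: (le_trans ha).
apply: (le_trans _ (mul_div_le K0 (ltW e0))).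
by rewrite (mulrC (e / (K + 1)) (kappa * 3 ^+ d)) (mulrA d.+1%:R) lexx.
Unshelve. all: by end_near. Qed.

Lemma interp_grad_dominated f : C1 f -> bounded_support f -> exists B : R, forall l,
  ae_on E (fun x => `|interp (T l) f x| <= B /\ forall j, `|interp_grad (T l) f x 0 j| <= B).
Proof.
move=> cf bf; have [L [L0 hL]] := C1_lipschitz cf bf.
have [M hM] := continuous_bounded_support cf.1 bf.
exists (Num.max M (d.+1%:R * (L * (kappa * 3 ^+ d)))) => l.
apply: ae_on_imp (mesh_ae_elt d0 (tT l)) => x Ex [S Sl Sx].
have wS := mesh_wf (tT l) Sl; have hS := elt_hull Sx.
rewrite (interpE (tT l) f Sl hS) (interp_gradE (tT l) f Sl Sx); split.
  by rewrite le_max (aff_bound wS hM hS).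
by move=> j; rewrite le_max (agrad_lipschitz_bound d0 wS k0 (shape Sl) j L0 hL) orbT.
Qed.

Variables (q : V -> V) (rho : V -> R).
Hypotheses (Lq : L2v E q) (Lr : L2 E rho).
Hypothesis hz : ae_on E (fun x => (q x = 0 /\ rho x = 0) \/ meshsize (T l) x @[l --> \oo] --> (0 : R)).
Let irho : intble E rho := L2_fin_intble mE fE Lr.
Let iq i : intble E (fun x => q x 0 i) := L2_fin_intble mE fE (Lq i).

(** Convergence is asked only where the limit residual does not vanish, which suffices for inner
    products with it. The notion is stable under sums and products, so the Raviart-Thomas field can
    be treated term by term. *)
Definition dominated_cvg (F : nat -> V -> R) (G : V -> R) : Prop :=
  [/\ forall l, measurable_fun E (F l), measurable_fun E G,
    exists B : R, forall l, ae_on E (fun x => `|F l x| <= B) &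
    ae_on E (fun x => (q x = 0 /\ rho x = 0) \/ F l x @[l --> \oo] --> G x)].

Lemma dominated_cvg_ip r F G : intble E r -> (forall x, q x = 0 /\ rho x = 0 -> r x = 0) ->
  dominated_cvg F G -> ip E r (F l) @[l --> \oo] --> ip E r G.
Proof.
move=> ir r0 [mF mG [B hB] c]; apply: (ip_dct mE ir mF mG hB).
by apply: ae_on_imp c => x _ [/r0|]; [left|right].
Qed.

Lemma dominated_cvg_cst (g : V -> R) (B : R) : measurable_fun E g -> (forall x, E x -> `|g x| <= B) ->
  dominated_cvg (fun=> g) g.
Proof.
move=> mg gB; split => //; first by exists B => l; apply: ae_on_all.
by apply: ae_on_all => x _; right; exact: cvg_cst.
Qed.

Lemma dominated_cvgD F F' G G' : dominated_cvg F G -> dominated_cvg F' G' ->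
  dominated_cvg (fun l x => F l x + F' l x) (fun x => G x + G' x).
Proof.
move=> [mF mG [B hB] c] [mF' mG' [B' hB'] c']; split.
- by move=> l; exact: measurable_funD.
- exact: measurable_funD.
- exists (B + B') => l; apply: ae_on_imp (ae_on_and (hB l) (hB' l)) => x _ [h h'].
  by apply: (le_trans (ler_normD _ _)); exact: lerD.
- apply: ae_on_imp (ae_on_and c c') => x _ [[h|h] [h'|h']]; [by left|by left|by left|right].
  exact: cvgD.
Qed.

Lemma dominated_cvgM F F' G G' : dominated_cvg F G -> dominated_cvg F' G' ->
  dominated_cvg (fun l x => F l x * F' l x) (fun x => G x * G' x).
Proof.
move=> [mF mG [B hB] c] [mF' mG' [B' hB'] c']; split.
- by move=> l; exact: measurable_funM.
- exact: measurable_funM.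
- exists (B * B') => l; apply: ae_on_imp (ae_on_and (hB l) (hB' l)) => x _ [h h'].
  by rewrite normrM; exact: ler_pM.
- apply: ae_on_imp (ae_on_and c c') => x _ [[h|h] [h'|h']]; [by left|by left|by left|right].
  exact: cvgM.
Qed.

Lemma dominated_cvgB F F' G G' : dominated_cvg F G -> dominated_cvg F' G' ->
  dominated_cvg (fun l x => F l x - F' l x) (fun x => G x - G' x).
Proof.
move=> [mF mG [B hB] c] [mF' mG' [B' hB'] c']; split.
- by move=> l; exact: measurable_funB.
- exact: measurable_funB.
- exists (B + B') => l; apply: ae_on_imp (ae_on_and (hB l) (hB' l)) => x _ [h h'].
  by apply: (le_trans (ler_normB _ _)); exact: lerD.
- apply: ae_on_imp (ae_on_and c c') => x _ [[h|h] [h'|h']]; [by left|by left|by left|right].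
  exact: cvgB.
Qed.

Lemma dominated_cvg_sum (I : Type) (s : seq I) (F : I -> nat -> V -> R) (G : I -> V -> R) :
  (forall i, dominated_cvg (F i) (G i)) ->
  dominated_cvg (fun l x => \sum_(i <- s) F i l x) (fun x => \sum_(i <- s) G i x).
Proof.
move=> h; elim: s => [|i s IH].
  rewrite (_ : (fun _ _ => _) = fun=> fun=> 0); last by apply/funext => l; apply/funext => x; rewrite big_nil.
  rewrite (_ : (fun _ => _) = fun=> 0); last by apply/funext => x; rewrite big_nil.
  by apply: (@dominated_cvg_cst _ 0) => // x _; rewrite normr0.
have := dominated_cvgD (h i) IH.
congr dominated_cvg; first by apply/funext => l; apply/funext => x; rewrite big_cons.
by apply/funext => x; rewrite big_cons.
Qed.

Lemma dominated_cvg_interp f : C1 f -> bounded_support f -> dominated_cvg (fun l => interp (T l) f) f.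
Proof.
move=> cf bf; have [B hB] := interp_grad_dominated cf bf; split.
- by move=> l; apply: (measurable_funS mT) => //; exact: measurable_interp (tT l) f.
- by apply: (measurable_funS mT) => //; exact: (continuous_measurable_rV cf.1).
- by exists B => l; apply: ae_on_imp (hB l) => x _ [].
- apply: ae_on_imp (ae_on_and hz (interp_cvg cf bf)) => x _ [[h|h] h2]; first by left.
  by right; case: (h2 h).
Qed.

Lemma dominated_cvg_interp_grad f j : C1 f -> bounded_support f ->
  dominated_cvg (fun l x => interp_grad (T l) f x 0 j) (partial j f).
Proof.
move=> cf bf; have [B hB] := interp_grad_dominated cf bf; split.
- by move=> l; apply: (measurable_funS mT) => //; exact: measurable_interp_grad.
- by apply: (measurable_funS mT) => //; exact: (continuous_measurable_rV (cf.2 j).2).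
- by exists B => l; apply: ae_on_imp (hB l) => x _ [].
- apply: ae_on_imp (ae_on_and hz (interp_cvg cf bf)) => x _ [[h|h] h2]; first by left.
  by right; case: (h2 h).
Qed.

Lemma dominated_cvg_coord j : dominated_cvg (fun _ x => x 0 j) (fun x => x 0 j).
Proof.
have [M hM] := lipschitz_domain_bound lE.
apply: (@dominated_cvg_cst _ M).
  by apply: (measurable_funS mT) => //; exact: (continuous_measurable_rV (C1_coord j).1).
move=> x Ex; apply: (le_trans (coord_le_norm _ _)); apply: hM; exact: subset_closure.
Qed.

Lemma bounded_support_mulx (f : V -> R) k : bounded_support f -> bounded_support (mulx f k).
Proof. by case=> M hM; exists M => x /hM h; rewrite /mulx h mul0r. Qed.

Lemma partial_mulx (f : V -> R) j k x : C1 f -> partial k (mulx f j) x = (k == j)%:R * f x + x 0 j * partial k f x.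
Proof.
move=> cf; rewrite partialM.
- rewrite mulrC; congr (_ * _ + _); exact: (@derive_val _ _ _ _ _ _ _ (partial_coord k j x)).
- exact: (cf.2 k).1.
- exact: ((C1_coord j).2 k).1.
Qed.

(** For the exact derivatives the Leibniz rule reduces the [k]-th term to [tau j x], minus [tau k x]
    when [k = j]. The sum is [(d - 1)] times [tau j x], to which the leading term adds one more;
    this is the origin of the factor [1/d]. *)
Lemma rt_limit (tau : 'I_d -> V -> R) j x : (forall k, C1 (tau k)) ->
  d%:R^-1 * (tau j x + \sum_k (x 0 j * partial k (tau k) x - x 0 k * partial k (tau j) x
    + partial k (mulx (tau j) k) x - partial k (mulx (tau k) j) x)) = tau j x.
Proof.
move=> ct; rewrite (eq_bigr (fun k => tau j x - (k == j)%:R * tau k x)); last first.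
  by move=> k _; rewrite !partial_mulx// eqxx mul1r; ring.
rewrite sumrB sumr_const card_ord (bigD1 j)//= eqxx mul1r big1 ?addr0; last first.
  by move=> k /negPf ->; rewrite mul0r.
rewrite addrC subrK -[tau j x *+ d]mulr_natl mulrA mulVf ?mul1r//.
by rewrite pnatr_eq0 -lt0n.
Qed.

Lemma dominated_cvg_rt (tau : 'I_d -> V -> R) j : (forall k, C1 (tau k)) ->
  (forall k, bounded_support (tau k)) ->
  dominated_cvg (fun l x => rt (T l) tau x 0 j) (tau j).
Proof.
move=> ct bt.
have c1 k i : C1 (mulx (tau k) i) by apply: C1M => //; exact: C1_coord.
have b1 k i := bounded_support_mulx i (bt k).
pose G x := d%:R^-1 * (tau j x + \sum_k (x 0 j * partial k (tau k) x - x 0 k * partial k (tau j) x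
    + partial k (mulx (tau j) k) x - partial k (mulx (tau k) j) x)).
have -> : tau j = G by apply/funext => x; rewrite /G rt_limit.
have -> : (fun l x => rt (T l) tau x 0 j) = fun l x => d%:R^-1 *
  (interp (T l) (tau j) x + \sum_k (x 0 j * interp_grad (T l) (tau k) x 0 k - x 0 k * interp_grad (T l) (tau j) x 0 k
    + interp_grad (T l) (mulx (tau j) k) x 0 k - interp_grad (T l) (mulx (tau k) j) x 0 k)).
  by apply/funext => l; apply/funext => x; rewrite mxE.
apply: (@dominated_cvgM (fun _ _ => d%:R^-1) _ (fun=> d%:R^-1)).
  exact: (@dominated_cvg_cst _ `|d%:R^-1|).
apply: (@dominated_cvgD (fun l => interp (T l) (tau j)) _ (tau j)).
  exact: dominated_cvg_interp.
apply: dominated_cvg_sum => k.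
apply: dominated_cvgB; last exact: dominated_cvg_interp_grad.
apply: dominated_cvgD; last exact: dominated_cvg_interp_grad.
apply: dominated_cvgB; apply: dominated_cvgM.
- exact: dominated_cvg_coord.
- exact: dominated_cvg_interp_grad.
- exact: dominated_cvg_coord.
- exact: dominated_cvg_interp_grad.
Qed.

Lemma dominated_cvg_rtdiv (tau : 'I_d -> V -> R) : (forall k, C1 (tau k)) ->
  (forall k, bounded_support (tau k)) ->
  dominated_cvg (fun l => rtdiv (T l) tau) (fun x => \sum_k partial k (tau k) x).
Proof. by move=> ct bt; apply: dominated_cvg_sum => k; exact: dominated_cvg_interp_grad. Qed.

Lemma H10_density (F : V -> V) (g : V -> R) : L2v E F -> L2 E g ->
  (forall phi, test_fun E phi -> ipv E F (grad phi) + ip E g phi = 0) ->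
  forall v, H10 E v -> ipv E F (wgrad E v) + ip E g v = 0.
Proof.
move=> LF Lg h0 v hv; have hv1 := H10_H1 hv.
have [_ [phi [tphi cphi]]] := (H10P oE v).1 hv.
have sv := L2v_sip oE; have s2 := L2_sip mE; have sH := H1_sip oE fE.
pose Phi w := ipv E F (wgrad E w) + ip E g w.
pose C := sip_norm (@ipv R d E) F + sip_norm (@ip R d E) g.
have bnd w : H1 E w -> `|Phi w| <= C * sip_norm (ipH1 E) w.
  move=> hw; have Lw := wgrad_L2 hw; have L2w := hw.1.
  apply: (le_trans (ler_normD _ _)); rewrite mulrDl; apply: lerD.
    apply: (le_trans (sip_CS sv LF Lw)); rewrite ler_wpM2l ?sip_norm_ge0//.
    by rewrite ler_wsqrtr// lerDr; exact: (sip_ge0 s2).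
  apply: (le_trans (sip_CS s2 Lg L2w)); rewrite ler_wpM2l ?sip_norm_ge0//.
  by rewrite ler_wsqrtr// lerDl; exact: (sip_ge0 sv).
have PhiB n : Phi v = Phi (v - phi n).
  have [hp gp] := test_fun_H1 oE (tphi n).
  have hw : H1 E (v - phi n) by exact: (subspaceB (H1_sub oE) hv1 hp).
  have e1 : v - phi n = -1 *: phi n + v by rewrite scaleN1r addrC.
  have ge : ae_on E (fun x => wgrad E (v - phi n) x = (wgrad E v - grad (phi n)) x).
    apply: ae_on_imp (ae_on_and (wgrad_ae oE fE hp.1 gp) (wgrad_lin oE fE (-1) hp hv1)) => x _ [a b].
    by rewrite e1 b a scaleN1r addrC.
  have Lgr := grad_L2 oE (tphi n).
  rewrite /Phi (ipv_ae oE LF LF (wgrad_L2 hw) (subspaceB (L2v_sub oE) (wgrad_L2 hv1) Lgr) _ ge); last first.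
    exact: ae_on_all.
  rewrite (sipBr sv (wgrad_L2 hv1) Lgr LF) (sipBr s2 hv1.1 hp.1 Lg) addrACA -opprD h0//.
  by rewrite subr0.
apply/eqP; rewrite -normr_eq0; apply/eqP.
have c0 : C * sip_norm (ipH1 E) (v - phi n) @[n --> \oo] --> (0 : R).
  by rewrite -(mulr0 C); apply: cvgMr.
have cv : `|Phi v| @[_ --> \oo] --> (0 : R).
  apply: cvg0_le c0 => n; rewrite normr_ge0/= (PhiB n); apply: bnd.
  by apply: (subspaceB (H1_sub oE) hv1); case: (test_fun_H1 oE (tphi n)).
by apply: (cvg_unique (@Rhausdorff R) _ cv); exact: cvg_cst.
Qed.

Lemma h10_limit : (forall l f, (forall x, ~ E x -> f x = 0) ->
    \sum_j ip E (fun x => q x 0 j) (fun x => interp_grad (T l) f x 0 j) + ip E rho (interp (T l) f) = 0) ->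
  forall v, H10 E v -> ipv E q (wgrad E v) + ip E rho v = 0.
Proof.
move=> h; apply: (H10_density Lq Lr) => phi tphi.
have cphi := smooth_C1 tphi.1; have bphi := (test_fun_mollifier tphi).2.
rewrite (ipv_sum oE Lq (grad_L2 oE tphi)).
have c1 j : ip E (fun x => q x 0 j) (fun x => interp_grad (T l) phi x 0 j) @[l --> \oo] -->
    ip E (fun x => q x 0 j) (fun x => grad phi x 0 j).
  rewrite (_ : (fun x => grad phi x 0 j) = partial j phi); last by apply/funext => x; rewrite mxE.
  apply: dominated_cvg_ip => //; last exact: dominated_cvg_interp_grad.
  by move=> x [-> _]; rewrite mxE.
have c2 : ip E rho (interp (T l) phi) @[l --> \oo] --> ip E rho phi.
  by apply: dominated_cvg_ip => //; [move=> x []|exact: dominated_cvg_interp].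
apply: (cvg_sum_eq0 (cvg_ord_sum c1) c2) => l; apply: h => x nx; exact: (test_fun_out tphi).
Qed.

(** Fields with a single nonzero component isolate one partial derivative, and their limit says that
    [q] is the weak gradient of the zero extension of [rho]. Hence [rho] belongs to H10 and is
    itself an admissible argument in the definition of the weak divergence of [tau], by density of
    test functions. *)
Lemma hdiv_limit : (forall l (tau : 'I_d -> V -> R),
    \sum_j ip E (fun x => q x 0 j) (fun x => rt (T l) tau x 0 j) + ip E rho (rtdiv (T l) tau) = 0) ->
  forall tau, Hdiv E tau -> ipv E q tau + ip E rho (wdiv E tau) = 0.
Proof.
move=> h.
have h1 phi i : C1 phi -> bounded_support phi ->
    ip E rho (partial i phi) = - ip E (fun x => q x 0 i) phi.
  move=> cphi bphi; pose tau j : V -> R := if j == i then phi else fun=> 0.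
  have c0 : C1 (fun _ : V => 0 : R) by exact: smooth_C1 smooth0.
  have ct j : C1 (tau j) by rewrite /tau; case: eqP.
  have bt j : bounded_support (tau j) by rewrite /tau; case: eqP => // _; exists 0.
  have c1 j : ip E (fun x => q x 0 j) (fun x => rt (T l) tau x 0 j) @[l --> \oo] -->
      ip E (fun x => q x 0 j) (tau j).
    apply: dominated_cvg_ip => //; last exact: dominated_cvg_rt.
    by move=> x [-> _]; rewrite mxE.
  have c2 : ip E rho (rtdiv (T l) tau) @[l --> \oo] --> ip E rho (fun x => \sum_k partial k (tau k) x).
    by apply: dominated_cvg_ip => //; [move=> x []|exact: dominated_cvg_rtdiv].
  have /eqP := cvg_sum_eq0 (cvg_ord_sum c1) c2 (h ^~ tau).
  rewrite (bigD1 i)//= {1}/tau eqxx big1 ?addr0; last first.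
    move=> j /negPf ji; rewrite /ip /tau ji (_ : (fun x => _) = fun=> 0) ?Rint0//.
    by apply/funext => x; rewrite mulr0.
  rewrite (_ : (fun x => \sum_k _) = partial i phi); last first.
    apply/funext => x; rewrite (bigD1 i)//= {1}/tau eqxx big1 ?addr0// => j /negPf ji.
    rewrite /tau ji; apply: (@partial_out _ _ _ _ _ setT) => //; exact: openT.
  by rewrite addrC addr_eq0 => /eqP.
pose qe x : V := if x \in E then q x else 0.
have qeE i : (fun x => qe x 0 i) = (fun x => q x 0 i) \_ E.
  by apply/funext => x; rewrite restrictE /qe; case: ifP => //; rewrite mxE.
have eg : ext_grad E (rho \_ E) qe.
  split.
  - exact: L2_ext.
  - by move=> i; rewrite qeE; exact: L2_ext.
  - by move=> x nx; rewrite restrictN.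
  - by move=> x nx; rewrite /qe memNset.
  - by move=> phi cphi bphi i; rewrite qeE -!ip_extl; exact: h1.
have hr := ext_grad_H10 lE eg; have gr := ext_grad_wgrad lE eg.
move=> tau ht; have dt := wdivP ht.
have := H10_density ht.1 (wdiv_L2 ht) _ hr.
have hr1 := H10_H1 hr.
have tt x : E x -> tau x = tau x by [].
rewrite (ipv_ae oE ht.1 ht.1 (wgrad_L2 hr1) Lq (ae_on_all tt)); last first.
  by apply: ae_on_imp (wgrad_ae oE fE hr1.1 gr) => x Ex ->; rewrite /qe mem_set.
have tr x : E x -> wdiv E tau x = wdiv E tau x by [].
rewrite (ip_ae mE (wdiv_L2 ht) (wdiv_L2 ht) hr1.1 Lr (ae_on_all tr)); last first.
  by apply: ae_on_all => x Ex; rewrite restrictT.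
rewrite ipvC ipC; apply => phi tphi; rewrite (dt.2 _ tphi); exact: addNr.
Qed.
End interpolation_limit.

(** * Elliptic coefficients *)

Section nonneg_integrals.
Local Open Scope ereal_scope.
Context {dd : measure_display} {X : measurableType dd} {R : realType}.
Variable mu : {measure set X -> \bar R}.
Implicit Types (f g : X -> \bar R) (D : set X).

(* No measurability: the integral of a nonnegative function is a supremum over the simple
   functions below it. *)
Lemma ge0_le_integral_nm D f g : (forall x, D x -> 0 <= f x) -> (forall x, D x -> f x <= g x) ->
  \int[mu]_(x in D) f x <= \int[mu]_(x in D) g x.
Proof.
move=> f0 fg; rewrite !ge0_integralE//; last by move=> x Dx; exact: le_trans (f0 _ Dx) (fg _ Dx).
apply: le_ereal_sup => _ [h /= hf <-]; exists h => // x.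
by apply: (le_trans (hf x)); rewrite /patch; case: ifP => // /set_mem /fg.
Qed.

(** [f] may be nonmeasurable, but it lies between [k], which is 0 on the null set, and [h], which is
    infinite there; both are measurable and have the integral of [g]. *)
Lemma ge0_integral_ae_nm D f g : measurable D -> (forall x, D x -> 0 <= f x) ->
  (forall x, D x -> 0 <= g x) -> measurable_fun D g -> {ae mu, forall x, D x -> f x = g x} ->
  \int[mu]_(x in D) f x = \int[mu]_(x in D) g x.
Proof.
move=> mD f0 g0 mg [N [mN N0 subN]].
have fgE x : D x -> ~ N x -> f x = g x.
  by move=> Dx nx; apply: contrapT => h; apply: nx; apply: subN => /= hh; exact: h (hh Dx).
have mi (A : set X) : measurable A -> measurable_fun D (fun x => (\1_A x)%:E : \bar R).
  by move=> mA; apply: (measurable_funS measurableT) => //; apply/measurable_EFinP; exact: measurable_indic.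
pose h x := g x + +oo * (\1_N x)%:E.
pose k x := g x * (\1_(~` N) x)%:E.
have mh : measurable_fun D h.
  by apply: emeasurable_funD => //; apply: measurable_funeM; exact: mi.
have mk : measurable_fun D k by apply: emeasurable_funM => //; apply: mi; exact: measurableC.
have hN x : N x -> D x -> h x = +oo.
  by move=> Nx Dx; rewrite /h indicE mem_set//= mule1 addey//; have := g0 _ Dx; case: (g x).
have hC x : ~ N x -> h x = g x by move=> Nx; rewrite /h indicE memNset//= mule0 adde0.
have kN x : N x -> k x = 0.
  by move=> Nx; rewrite /k indicE memNset ?mule0//=; exact.
have kC x : ~ N x -> k x = g x by move=> Nx; rewrite /k indicE mem_set ?mule1.
have h0 x : D x -> 0 <= h x.
  by move=> Dx; have [Nx|Nx] := pselect (N x); [rewrite hN ?leey|rewrite hC// g0].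
have k0 x : D x -> 0 <= k x.
  by move=> Dx; have [Nx|Nx] := pselect (N x); [rewrite kN|rewrite kC// g0].
have e1 : \int[mu]_(x in D) h x = \int[mu]_(x in D) g x.
  apply: ge0_ae_eq_integral => //; exists N; split => // x /= nx.
  by apply: contrapT => Nx; apply: nx => Dx; exact: hC.
have e2 : \int[mu]_(x in D) k x = \int[mu]_(x in D) g x.
  apply: ge0_ae_eq_integral => //; exists N; split => // x /= nx.
  by apply: contrapT => Nx; apply: nx => Dx; exact: kC.
apply/eqP; rewrite eq_le -{1}e1 -{1}e2; apply/andP; split; apply: ge0_le_integral_nm => // x Dx.
  by have [Nx|Nx] := pselect (N x); [rewrite hN ?leey|rewrite hC// fgE].
by have [Nx|Nx] := pselect (N x); [rewrite kN ?f0|rewrite kC// fgE].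
Qed.

End nonneg_integrals.

Section elliptic_matrices.
Context {R : realType} {d : nat}.
Local Notation V := 'rV[R]_d.
Implicit Types (M N : 'M[R]_d) (x y z : V).

Lemma mxactD M x y : mxact M (x + y) = mxact M x + mxact M y.
Proof. exact: mulmxDl. Qed.

Lemma mxactB M x y : mxact M (x - y) = mxact M x - mxact M y.
Proof. exact: mulmxBl. Qed.

Lemma mxactZ M a x : mxact M (a *: x) = a *: mxact M x.
Proof. by rewrite /mxact -scalemxAl. Qed.

Lemma mxactM M N x : mxact (M *m N) x = mxact M (mxact N x).
Proof. by rewrite /mxact trmx_mul mulmxA. Qed.

Lemma mxact1 x : mxact 1%:M x = x.
Proof. by rewrite /mxact trmx1 mulmx1. Qed.

Lemma mxactE M x i : mxact M x 0 i = \sum_k x 0 k * M i k.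
Proof. by rewrite mxE; apply: eq_bigr => k _; rewrite mxE. Qed.

Lemma dot_mxact M x y : dot x (mxact M y) = dot (mxact M^T x) y.
Proof.
rewrite /dot (eq_bigr (fun i => \sum_k x 0 i * (y 0 k * M i k))); last first.
  by move=> i _; rewrite mxactE mulr_sumr.
rewrite exchange_big/=; apply: eq_bigr => k _; rewrite mxactE mulr_suml.
by apply: eq_bigr => i _; rewrite mxE mulrCA mulrA [RHS]mulrC -!mulrA; congr (_ * _); rewrite mulrC.
Qed.

Lemma dot_delta i x : dot (delta_mx 0 i) x = x 0 i.
Proof.
rewrite /dot (bigD1 i)//= big1 ?addr0; last by move=> j /negPf ji; rewrite mxE ji andbF mul0r.
by rewrite mxE !eqxx mul1r.
Qed.

Lemma dot_mxact_delta M i j : dot (delta_mx 0 i) (mxact M (delta_mx 0 j)) = M i j.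
Proof.
rewrite dot_delta mxactE (bigD1 j)//= big1 ?addr0; last first.
  by move=> k /negPf kj; rewrite mxE kj andbF mul0r.
by rewrite mxE !eqxx mul1r.
Qed.

(** Polarization: positivity on the sum and the difference of two basis vectors bounds an
    off-diagonal entry by the mean of two diagonal entries, and these are at most [K]. *)
Lemma entry_bound M (K : R) : M^T = M -> (forall y, 0 <= dot y (mxact M y) <= K * dot y y) ->
  forall i j, `|M i j| <= K.
Proof.
move=> sM hM i j; pose e k : V := delta_mx 0 k.
have dK k : M k k <= K.
  have := hM (e k); rewrite /e dot_mxact_delta dot_delta mxE !eqxx/= => /andP[_]; by rewrite mulr1.
have sE : M j i = M i j by rewrite -[in LHS]sM mxE.
have p1 := hM (e i - e j); have p2 := hM (e i + e j).
move: p1 p2; rewrite mxactB mxactD !dotDl !dotNl !dotDr !dotNr /e !dot_mxact_delta sE.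
case/andP=> p1 _ /andP[p2 _]; have := dK i; have := dK j; move: p1 p2.
move: (M i i) (M j j) (M i j) => a b c p1 p2 h1 h2.
rewrite ler_norml; apply/andP; split; lra.
Qed.

Lemma dot_CS x y : (dot x y) ^+ 2 <= dot x x * dot y y.
Proof.
have [y0|] := eqVneq (dot y y) 0.
  by rewrite y0 mulr0 (dot_eq0 y0) -[X in dot x X](scale0r (0 : V)) dotZr mul0r expr0n.
rewrite neq_lt ltNge dot_sqr_ge0/= => y0.
have := dot_sqr_ge0 (dot y y *: x - dot x y *: y).
rewrite dotBl !dotBr !dotZl !dotZr [dot y x]dotC.
move: (dot x x) (dot x y) (dot y y) y0 => a b c c0 h.
have h2 : 0 <= c * (a * c - b ^+ 2) by apply: le_trans h _; rewrite le_eqVlt; apply/orP; left; apply/eqP; ring.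
by rewrite -subr_ge0 -(pmulr_rge0 _ c0).
Qed.

Variables (A : 'M[R]_d) (L0 L1 : R).
Hypotheses (l0 : 0 < L0) (l01 : L0 <= L1) (sA : A^T = A)
  (eA : forall y, L0 * dot y y <= dot y (mxact A y) <= L1 * dot y y).

Let psdA y : 0 <= dot y (mxact A y).
Proof. by have /andP[h _] := eA y; apply: le_trans h; rewrite mulr_ge0 ?dot_sqr_ge0// ltW. Qed.

Lemma elliptic_unit : A \in unitmx.
Proof.
rewrite unitmxE unitfE; apply/det0P => -[v v0 vA].
have /andP[h _] := eA v; move: h; rewrite {2}/dot (_ : mxact A v = 0); last by rewrite /mxact sA.
rewrite big1; last by move=> i _; rewrite mxE mulr0.
rewrite pmulr_rle0// => h; have : dot v v = 0 by apply/eqP; rewrite eq_le h dot_sqr_ge0.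
by move/dot_eq0 => vE; rewrite vE eqxx in v0.
Qed.

Let uA := elliptic_unit.

Lemma elliptic_inv_sym : (invmx A)^T = invmx A.
Proof. by rewrite trmx_inv sA. Qed.

Lemma mxactK y : mxact A (mxact (invmx A) y) = y.
Proof. by rewrite -mxactM mulmxV// mxact1. Qed.

Lemma mxactVK y : mxact (invmx A) (mxact A y) = y.
Proof. by rewrite -mxactM mulVmx// mxact1. Qed.

(** Expansion of the square norm of [y - L0 *: mxact (invmx A) y], combined with the lower bound of
    [A] at [mxact (invmx A) y]. *)
Lemma elliptic_inv_le y : dot y (mxact (invmx A) y) <= L0^-1 * dot y y.
Proof.
rewrite -(ler_pM2l l0) mulrA divff ?lt0r_neq0// mul1r.
have := dot_sqr_ge0 (y - L0 *: mxact (invmx A) y); have /andP[+ _] := eA (mxact (invmx A) y).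
rewrite mxactK; set w := mxact _ y; rewrite dotBl !dotBr !dotZl !dotZr [dot w y]dotC.
move: (dot w w) (dot y w) (dot y y) => a b c h1 h2.
have h3 : L0 * (L0 * a) <= L0 * b by rewrite ler_pM2l.
lra.
Qed.

(** Expansion of the quadratic form of [A] at [L1 *: mxact (invmx A) y - y], combined with the upper
    bound of [A] at [y]. *)
Lemma elliptic_inv_ge y : dot y y <= L1 * dot y (mxact (invmx A) y).
Proof.
have l1 : 0 < L1 by exact: lt_le_trans l01.
have := psdA (L1 *: mxact (invmx A) y - y); have /andP[_ +] := eA y.
rewrite mxactB mxactZ mxactK dotBl !dotBr !dotZl !dotZr (dot_mxact A (mxact (invmx A) y) y) sA mxactK.
rewrite [dot (mxact (invmx A) y) y]dotC.
move: (dot y (mxact (invmx A) y)) (dot y y) (dot y (mxact A y)) => b a c h1 h2.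
have h3 : 0 <= L1 * (L1 * b - a) by lra.
by rewrite -subr_ge0 -(pmulr_rge0 _ l1).
Qed.

Lemma elliptic_sq y : dot (mxact A y) (mxact A y) <= L1 ^+ 2 * dot y y.
Proof.
have l1 : 0 < L1 by exact: lt_le_trans l01.
have := elliptic_inv_ge (mxact A y); rewrite mxactVK [dot (mxact A y) y]dotC => /le_trans; apply.
by have /andP[_ h] := eA y; rewrite expr2 -mulrA ler_pM2l.
Qed.

Lemma elliptic_inv_sq y : dot (mxact (invmx A) y) (mxact (invmx A) y) <= L0^-1 ^+ 2 * dot y y.
Proof.
have /andP[h _] := eA (mxact (invmx A) y); move: h; rewrite mxactK [dot _ y]dotC => h.
have h2 := le_trans h (elliptic_inv_le y).
by rewrite -(ler_pM2l l0) expr2 -mulrA mulVKf ?lt0r_neq0.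
Qed.

Lemma elliptic_inv_entry i j : `|invmx A i j| <= L0^-1.
Proof.
apply: entry_bound; first exact: elliptic_inv_sym.
move=> y; rewrite elliptic_inv_le andbT.
by have := psdA (mxact (invmx A) y); rewrite mxactK dotC.
Qed.

Lemma mxsqrt_residual t v f :
  let Z := mxact (invmx (mxsqrt A)) t + mxact (mxsqrt A) v - mxact (invmx (mxsqrt A)) f in
  let z := t + (mxact A v - f) in
  dot Z Z = dot z (mxact (invmx A) z).
Proof.
move=> Z z; have [sB _ BB] := mxsqrt_spec sA psdA.
rewrite {}/Z {}/z; set B := mxsqrt A in sB BB *; have uB : B \in unitmx.
  by move: uA; rewrite -BB unitmx_mul => /andP[].
have iA : invmx A = invmx B *m invmx B.
  rewrite -[LHS]mul1mx -(mulVmx uB) -[in LHS](mulmx1 (invmx B)) -(mulVmx uB) -!mulmxA.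
  by rewrite (mulmxA B B) BB mulmxV// mulmx1.
have BA : mxact B v = mxact (invmx B) (mxact A v).
  by rewrite -mxactM -BB mulmxA mulVmx// mul1mx.
have -> : mxact (invmx B) t + mxact B v - mxact (invmx B) f = mxact (invmx B) (t + (mxact A v - f)).
  by rewrite BA mxactD mxactB addrA.
by rewrite iA mxactM (dot_mxact (invmx B) (t + _)) trmx_inv sB.
Qed.

End elliptic_matrices.

Section measurable_inverse.
Context {R : realType} {d : nat}.
Local Notation V := 'rV[R]_d.

(* [(t^2) `^ (-1)] is a measurable formula for [1 / t^2]. *)
Definition mxinv n (A : 'M[R]_n) : 'M[R]_n := (\det A * (\det A ^+ 2) `^ (-1)) *: \adj A.

Lemma mxinvE n (A : 'M[R]_n) : A \in unitmx -> mxinv A = invmx A.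
Proof.
move=> uA; rewrite /mxinv /invmx uA powR_inv1 ?sqr_ge0//; congr (_ *: _).
have D0 : \det A != 0 by rewrite -unitfE -unitmxE.
by rewrite expr2 invfM mulrA divff// mul1r.
Qed.

Lemma measurable_det (E : set V) n (A : V -> 'M[R]_n) :
  (forall i j, measurable_fun E (fun x => A x i j)) -> measurable_fun E (fun x => \det (A x)).
Proof.
move=> mA; apply: measurable_sum => s; apply: measurable_funM => //.
by apply: measurable_prod => i _; exact: mA.
Qed.

Lemma measurable_mxinv (E : set V) n (A : V -> 'M[R]_n) :
  (forall i j, measurable_fun E (fun x => A x i j)) ->
  forall i j, measurable_fun E (fun x => mxinv (A x) i j).
Proof.
move=> mA i j; have mD := measurable_det mA.
have -> : (fun x => mxinv (A x) i j) =
    fun x => (\det (A x) * (\det (A x) ^+ 2) `^ (-1)) * cofactor (A x) j i.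
  by apply/funext => x; rewrite !mxE.
apply: measurable_funM; first apply: measurable_funM => //.
  apply: (@measurableT_comp _ _ _ _ _ _ (fun t : R => t `^ (-1)) _ (fun x => \det (A x) ^+ 2)).
    exact: measurable_powR.
  exact: measurable_funX.
apply: measurable_funM => //; apply: measurable_det => k l.
rewrite (_ : (fun x => _) = fun x => A x (lift j k) (lift i l)); first exact: mA.
by apply/funext => x; rewrite !mxE.
Qed.

End measurable_inverse.

(** * Marking *)

Section scalar_sequences.
Context {R : realType}.

Lemma cvg0P (u : nat -> R) : (forall n, 0 <= u n) ->
  (forall e : R, 0 < e -> exists N, forall n, (N <= n)%N -> u n <= e) -> u n @[n --> \oo] --> (0 : R).
Proof.
move=> u0 h; apply/cvgr0Pnorm_le => e e0; have [N hN] := h e e0.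
by exists N => // n /= Nn; rewrite ger0_norm// hN.
Qed.

Lemma cvg0_ex (u : nat -> R) (e : R) : u n @[n --> \oo] --> (0 : R) -> 0 < e ->
  exists N, forall n, (N <= n)%N -> `|u n| <= e.
Proof. by move=> /cvgr0Pnorm_le h e0; have [N _ hN] := h e e0; exists N => n Nn; exact: hN. Qed.

Lemma contraction_cvg0 (h : nat -> R) (q : R) : 0 <= q < 1 -> (forall l, 0 <= h l) ->
  (forall l, h l.+1 <= h l) -> (forall N, exists2 l, (N <= l)%N & h l.+1 <= q * h l) ->
  h l @[l --> \oo] --> (0 : R).
Proof.
move=> /andP[q0 q1] h0 hd hq.
have mono l k : (l <= k)%N -> h k <= h l.
  by move/subnK <-; elim: (k - l)%N => // n IH; rewrite addSn; exact: le_trans (hd _) IH.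
have pw k : exists N, h N <= q ^+ k * h 0%N.
  elim: k => [|k [N hN]]; first by exists 0%N; rewrite expr0 mul1r.
  have [l Nl hl] := hq N; exists l.+1; apply: (le_trans hl).
  by rewrite exprS -mulrA ler_wpM2l//; exact: le_trans (mono _ _ Nl) hN.
have gc : q ^+ k * h 0%N @[k --> \oo] --> (0 : R).
  rewrite -(mul0r (h 0%N)); apply: cvgMl; apply: cvg_expr; by rewrite ger0_norm.
apply: cvg0P => // e e0; have [k hk] := cvg0_ex gc e0.
have [N hN] := pw k; exists N => n Nn; apply: (le_trans (mono _ _ Nn)); apply: (le_trans hN).
exact: le_trans (ler_norm _) (hk _ (leqnn _)).
Qed.

Lemma nonincreasing_diff_cvg0 (u : nat -> R) : (forall l, 0 <= u l) -> (forall l, u l.+1 <= u l) ->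
  u l - u l.+1 @[l --> \oo] --> (0 : R).
Proof.
move=> u0 ud; have c : cvgn u.
  apply: nonincreasing_is_cvgn; first by apply/nonincreasing_seqP.
  by exists 0 => _ [n _ <-].
rewrite -(subrr (limn u)); apply: cvgB => //.
by rewrite (_ : (fun l => u l.+1) = (fun l => u (l + 1)%N)) ?cvg_shiftn//; apply/funext => l; rewrite addn1.
Qed.

Lemma bigmax_attained (I : eqType) (s : seq I) (f : I -> R) : (forall i, 0 <= f i) ->
  \big[Num.max/0]_(i <- s) f i = 0 \/ exists2 i, i \in s & \big[Num.max/0]_(i <- s) f i = f i.
Proof.
move=> f0; elim: s => [|i s IH]; first by left; rewrite big_nil.
rewrite big_cons; right; set m := \big[_/_]_(_ <- _) _ in IH *.
have [mi|im] := leP m (f i); first by exists i; rewrite ?mem_head//; exact: max_l.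
case: IH => [m0|[j js mj]].
  by move: im; rewrite m0 ltNge f0.
by exists j; rewrite ?inE ?js ?orbT// max_r// ltW.
Qed.

Lemma double_quarter (x y e : R) : x <= e / 4 -> y <= e / 2 -> 2 * x + y <= e.
Proof. lra. Qed.

Lemma bigmax_ge (I : eqType) (s : seq I) (f : I -> R) i : i \in s -> f i <= \big[Num.max/0]_(i <- s) f i.
Proof.
elim: s => // j s IH; rewrite big_cons inE le_max => /predU1P[->|/IH ->]; first by rewrite lexx.
by rewrite orbT.
Qed.

End scalar_sequences.

Section marking_argument.
Context {R : realType} {d : nat}.
Local Notation V := 'rV[R]_d.
Local Notation leb := (@lebesgue_rV R d).

Lemma ae_on_seq (E : set V) (I : eqType) (s : seq I) (P : I -> V -> Prop) :
  (forall i, i \in s -> ae_on E (P i)) -> ae_on E (fun x => forall i, i \in s -> P i x).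
Proof.
elim: s => [|i s IH] h; first exact: ae_on_all.
have h1 := h i (mem_head _ _).
have h2 : ae_on E (fun x => forall i, i \in s -> P i x).
  by apply: IH => j js; apply: h; rewrite inE js orbT.
apply: ae_on_imp (ae_on_and h1 h2) => x _ [a b] j; rewrite inE => /predU1P[->//|].
exact: b.
Qed.

Variables (E : set V) (T M : nat -> mesh R d) (q : R).
Hypotheses (d0 : (0 < d)%N) (lE : lipschitz_domain E) (tT : forall l, triangulation E (T l)).
Hypotheses (q01 : 0 < q < 1)
  (h_mono : forall l, ae_on E (fun x => meshsize (T l.+1) x <= meshsize (T l) x))
  (h_red : forall l S, S \in T l -> S \notin T l.+1 ->
    ae_on (elt S) (fun x => meshsize (T l.+1) x <= q * meshsize (T l) x))
  (MT : forall l S, S \in M l -> S \in T l /\ S \notin T l.+1).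
Let oE : open E := lipschitz_domain_open lE.
Let fE := lipschitz_domain_fin lE.
Let mE : measurable E := open_measurable_rV oE.

Lemma meshsize_ge0 (T' : mesh R d) x : 0 <= meshsize T' x.
Proof. by apply: sumr_ge0 => S _; rewrite mulr_ge0 ?powR_ge0// indicE ler0n. Qed.

Lemma intble_meshsize (T' : mesh R d) : (forall S, S \in T' -> simplex_wf S) -> intble E (meshsize T').
Proof.
move=> wT; apply: (intbleS measurableT mE (@subsetT _ _)).
rewrite (_ : meshsize T' =
    fun x => \sum_(S <- enum_fset T' | (S \in T') && true) vol S `^ (d%:R^-1) * \1_(elt S) x); last first.
  by apply/funext => x; rewrite -big_seq_cond.
apply: intble_sum => // S /andP[ST _]; apply: intbleZ => //.
by apply: intble_indic; [exact: measurable_elt|exact: elt_fin (wT _ ST)].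
Qed.

Let im l : intble E (meshsize (T l)) := intble_meshsize (mesh_wf (tT l)).
Let I l := \int[leb]_(x in E) meshsize (T l) x.

Lemma Rint_elt_cst S (k : R) : simplex_wf S -> \int[leb]_(x in elt S) k = k * vol S.
Proof.
move=> wS; rewrite /Rintegral integral_cst; last exact: measurable_elt.
transitivity (fine (k%:E * (vol S)%:E)); last by [].
by congr (fine (_ * _)); exact: vol_fin.
Qed.

Lemma mesh_drop l S : S \in T l -> S \notin T l.+1 ->
  (1 - q) * (vol S `^ (d%:R^-1) * vol S) <= I l - I l.+1.
Proof.
move=> Sl Sl1; have wS := mesh_wf (tT l) Sl; have sS := elt_sub lE (tT l) Sl.
have mS := measurable_elt S.
have i1 := intbleS mE mS sS (im l); have i2 := intbleS mE mS sS (im l.+1).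
(* The mesh size decreases only almost everywhere; the maximum makes the integrand nonnegative
   everywhere, as monotonicity in the domain of integration requires. *)
pose D x := Num.max 0 (meshsize (T l) x - meshsize (T l.+1) x).
have iB := intbleB mE (im l) (im l.+1).
have mD : measurable_fun E D.
  by apply: measurable_maxr; [exact: measurable_cst|exact: intble_meas iB].
have aD : ae_on E (fun x => meshsize (T l) x - meshsize (T l.+1) x = D x).
  by apply: ae_on_imp (h_mono l) => x _ h; rewrite /D max_r// subr_ge0.
have iD : intble E D by apply: intble_ae_eq iB => //; apply: ae_on_imp aD.
rewrite /I -RintB// (@Rint_ae_eq _ _ E _ D)//; last exact: intble_meas iB.
apply: (@le_trans _ _ (\int[leb]_(x in elt S) D x)); last first.
  by apply: Rint_subset => // x _; rewrite /D le_max lexx.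
rewrite mulrA -(Rint_elt_cst _ wS).
have iDS := intbleS mE mS sS iD.
apply: Rint_ae_le => //; first by apply: intble_cst => //; exact: elt_fin.
apply: ae_on_imp (h_red Sl Sl1) => x Sx; rewrite (meshsizeE (tT l) Sl Sx) /D => h.
rewrite (meshsizeE (tT l) Sl Sx) le_max; apply/orP; right.
by rewrite mulrBl mul1r lerD2l lerN2.
Qed.

Lemma marked_vol_small (e : R) : 0 < e ->
  exists N, forall l S, (N <= l)%N -> S \in M l -> vol S <= e.
Proof.
move=> e0; have /andP[q0 q1] := q01.
have I0 l : 0 <= I l by apply: Rintegral_ge0 => x _; exact: meshsize_ge0.
have Id l : I l.+1 <= I l by apply: Rint_ae_le => //; exact: h_mono.
have gc := nonincreasing_diff_cvg0 I0 Id.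
pose s := e `^ (d%:R^-1); have s0 : 0 < s by exact: powR_gt0.
have p1 : 0 < 1 - q by rewrite subr_gt0.
(* A marked element of volume above [e] lowers the integral by at least [(1 - q) * (s * e)]; the
   half makes the contradiction strict. *)
have b0 : 0 < (1 - q) * (s * e) / 2 by rewrite divr_gt0// !mulr_gt0.
have [N hN] := cvg0_ex gc b0; exists N => l S Nl SM; rewrite leNgt; apply/negP => ev.
have [Sl Sl1] := MT SM; have := mesh_drop Sl Sl1; apply/negP; rewrite -ltNge.
apply: (le_lt_trans (ler_norm _)); apply: (le_lt_trans (hN _ Nl)).
apply: (@lt_le_trans _ _ ((1 - q) * (s * e))).
  by rewrite ltr_pdivrMr// ltr_pMr ?mulr_gt0// ltr1n.
rewrite ler_pM2l//; apply: ler_pM => //; [exact: ltW|exact: ltW| |exact: ltW].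
by apply: ge0_ler_powR; rewrite ?invr_ge0 ?nnegrE ?(ltW e0) ?(ltW ev) ?vol_ge0.
Qed.

(** [eta] stands for the indicators and [D] for the density of the limit residual; the two
    comparisons, up to a factor 2 and an error [ee], come from the L2 convergence of the
    residuals. *)
Variables (eta : nat -> @simplex R d -> R) (D : V -> R) (ee : nat -> R) (G : R -> R).
Hypotheses (eta0 : forall l S, 0 <= eta l S) (iD : intble E D) (D0 : forall x, E x -> 0 <= D x).
Hypotheses (eeD : ee l @[l --> \oo] --> (0 : R)) (ee0 : forall l, 0 <= ee l)
  (eta_D : forall l S, S \in T l -> eta l S ^+ 2 <= 2 * \int[leb]_(x in elt S) D x + ee l)
  (D_eta : forall l S, S \in T l -> \int[leb]_(x in elt S) D x <= 2 * eta l S ^+ 2 + ee l).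
Hypotheses (G0 : forall t, 0 <= t -> 0 <= G t) (Gc : G t @[t --> 0^'+] --> G 0) (G00 : G 0 = 0)
  (hG : forall l, \big[Num.max/0]_(S <- (T l `\` M l)%fset) eta l S
    <= G (\big[Num.max/0]_(S <- M l) eta l S)).

Let m l := \big[Num.max/0]_(S <- M l) eta l S.

(** The integral of the fixed function [D] over the element that attains the maximum tends to 0,
    because the volume of this element does; the empty set stands in for it when the maximum is
    0. *)
Lemma marked_eta_cvg0 : m l @[l --> \oo] --> (0 : R).
Proof.
have sel l : exists A : set V, [/\ measurable A, A `<=` E, m l ^+ 2 <= 2 * \int[leb]_(x in A) D x + ee l &
    A = set0 \/ exists2 S, S \in M l & A = elt S].
  have [m0|[S SM mS]] := bigmax_attained (enum_fset (M l)) (eta0 l).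
    exists set0; split => //; last by left.
    by rewrite /m m0 expr0n/= /Rintegral integral_set0 mulr0 add0r.
  have [Sl _] := MT SM; exists (elt S); split; last by right; exists S.
  - exact: measurable_elt.
  - by move=> x; exact: (elt_sub lE (tT l) Sl).
  - by rewrite /m mS; exact: eta_D.
have [A hA] := boolp.choice sel.
have AE l : A l `<=` E by case: (hA l).
have mA l : measurable (A l) by case: (hA l).
have Afin l : (leb (A l) < +oo)%E.
  apply: le_lt_trans fE; apply: le_measure; rewrite ?inE//.
have Avol : fine (leb (A l)) @[l --> \oo] --> (0 : R).
  apply: cvg0P => [l|e e0]; first by rewrite fine_ge0.
  have [N hN] := marked_vol_small e0; exists N => l Nl.
  have [_ _ _ [->|[S SM ->]]] := hA l; first by rewrite measure0/= ltW.
  exact: hN Nl SM.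
have cD := Rint_abs_continuous mE iD D0 mA AE Afin Avol.
have m0 l : 0 <= m l by have [e|[S _ e]] := bigmax_attained (enum_fset (M l)) (eta0 l); rewrite /m e.
have c2 : m l ^+ 2 @[l --> \oo] --> (0 : R).
  have c : 2 * \int[leb]_(x in A l) D x + ee l @[l --> \oo] --> (0 : R).
    have c1 : 2 * \int[leb]_(x in A l) D x @[l --> \oo] --> (2 * 0 : R) by exact: cvgMr.
    by have := cvgD c1 eeD; rewrite mulr0 addr0; exact.
  by apply: cvg0_le c => l; rewrite sqr_ge0/=; case: (hA l).
apply: cvg0P => // e e0; have [N hN] := cvg0_ex c2 (exprn_gt0 2 e0); exists N => l Nl.
by rewrite -(@ler_pXn2r _ 2)// ?nnegrE ?(ltW e0)//; exact: le_trans (ler_norm _) (hN _ Nl).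
Qed.

Lemma all_eta_small (e : R) : 0 < e -> exists N, forall l S, (N <= l)%N -> S \in T l -> eta l S <= e.
Proof.
move=> e0; have [N1 h1] := cvg0_ex marked_eta_cvg0 e0.
have /cvgrPdist_le/(_ e e0) := Gc; rewrite G00 => Ge.
have [dl dl0 hdl] : exists2 dl : R, 0 < dl & forall t, 0 <= t -> t < dl -> G t <= e.
  have [dl/= dl0 hdl] := Ge; exists dl => // t t0 tdl.
  (* The one-sided limit says nothing at [t = 0], where [G 0 = 0] is used. *)
  have [->|tn0] := eqVneq t 0; first by rewrite G00 ltW.
  have tp : 0 < t by rewrite lt_def tn0.
  have := hdl t; rewrite /ball_/= sub0r normrN gtr0_norm// => /(_ tdl tp).
  by rewrite sub0r normrN; exact: le_trans (ler_norm _).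
have dl2 : 0 < dl / 2 by rewrite divr_gt0.
have [N2 h2] := cvg0_ex marked_eta_cvg0 dl2.
exists (maxn N1 N2) => l S; rewrite geq_max => /andP[l1 l2] Sl.
have m0 : 0 <= m l by have [e1|[S' _ e1]] := bigmax_attained (enum_fset (M l)) (eta0 l); rewrite /m e1.
have [SM|SM] := boolP (S \in M l).
  apply: le_trans (h1 _ l1); apply: le_trans (ler_norm _).
  exact: bigmax_ge SM.
apply: le_trans (hdl (m l) m0 _); last first.
  apply: (le_lt_trans (ler_norm _)); apply: (le_lt_trans (h2 _ l2)).
  by rewrite ltr_pdivrMr// ltr_pMr// ltr1n.
apply: le_trans (hG l); apply: bigmax_ge.
by rewrite in_fsetD SM Sl.
Qed.

Lemma persistent_zero N S : (forall l, (N <= l)%N -> S \in T l) -> ae_on (elt S) (fun x => D x = 0).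
Proof.
move=> hS; have SN := hS N (leqnn _).
have sS := elt_sub lE (tT N) SN; have mS := measurable_elt S.
have iS := intbleS mE mS sS iD.
apply: Rint_eq0 => //; first by move=> x /sS /D0.
have I0 : 0 <= \int[leb]_(x in elt S) D x by apply: Rintegral_ge0 => x /sS /D0.
apply/eqP; rewrite eq_le I0 andbT; apply/ler_addgt0Pr => e e0; rewrite add0r.
(* With this bound twice the squared indicator is at most [e / 2]; the error [ee l] takes the other
   half. *)
have e4 : 0 < Num.sqrt (e / 4) by rewrite sqrtr_gt0 divr_gt0.
have [N1 h1] := all_eta_small e4.
have e2 : 0 < e / 2 by rewrite divr_gt0.
have [N2 h2] := cvg0_ex eeD e2.
pose l := maxn N (maxn N1 N2).
have lN : (N <= l)%N by rewrite leq_maxl.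
have lN1 : (N1 <= l)%N by rewrite /l !leq_max leqnn orbT.
have lN2 : (N2 <= l)%N by rewrite /l !leq_max leqnn !orbT.
have SL := hS l lN; apply: (le_trans (D_eta SL)).
have a1 : eta l S ^+ 2 <= e / 4.
  have e40 : 0 <= e / 4 by rewrite divr_ge0 ?ler0n// ltW.
  by rewrite -[leRHS](sqr_sqrtr e40) ler_pXn2r ?nnegrE ?sqrtr_ge0//; exact: h1.
have a2 : ee l <= e / 2 by exact: le_trans (ler_norm _) (h2 _ lN2).
exact: double_quarter.
Qed.

(** Almost every [x] lies in exactly one open element of each mesh. If this element is refined
    infinitely often, the mesh size at [x] never grows and is contracted by [q] infinitely often;
    otherwise it is eventually the same element, to which [persistent_zero] applies. There are only
    countably many elements, so the exceptional sets add up to a null set. *)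
Lemma limit_dichotomy : ae_on E (fun x => D x = 0 \/ meshsize (T l) x @[l --> \oo] --> (0 : R)).
Proof.
have /andP[q0 q1] := q01.
have a1 : ae_on E (fun x => forall N, forall S, S \in enum_fset (T N) ->
    (forall l, (N <= l)%N -> S \in T l) -> elt S x -> D x = 0).
  apply: ae_on_nat => N; apply: ae_on_seq => S SN.
  have [hS|nS] := pselect (forall l, (N <= l)%N -> S \in T l); last first.
    by apply: ae_on_all => x _ h; exfalso; exact: nS h.
  have [N0 [mN0 zN0 sN0]] := persistent_zero hS.
  exists N0; split => // x nx; apply: sN0 => /= h; apply: nx => _ _ Sx; exact: h.
have a2 : ae_on E (fun x => forall l, forall S, S \in enum_fset (T l) -> S \notin T l.+1 -> elt S x ->
    meshsize (T l.+1) x <= q * meshsize (T l) x).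
  apply: ae_on_nat => l; apply: ae_on_seq => S Sl.
  have [Sl1|Sl1] := boolP (S \in T l.+1); first exact: ae_on_all.
  have [N0 [mN0 zN0 sN0]] := h_red Sl Sl1.
  exists N0; split => // x nx; apply: sN0 => /= h; apply: nx => _ _ Sx; exact: h.
have a3 := ae_on_nat h_mono.
have a4 : ae_on E (fun x => forall l, exists2 S, S \in T l & elt S x).
  by apply: ae_on_nat => l; exact: mesh_ae_elt (tT l).
apply: ae_on_imp (ae_on_and (ae_on_and a1 a2) (ae_on_and a3 a4)) => x Ex [[h1 h2] [h3 h4]].
have h5 l : exists S : @simplex R d, S \in T l /\ elt S x by have [S Sl Sx] := h4 l; exists S.
have [S hS] := boolp.choice h5.
have [inf|ninf] := pselect (forall N, exists2 l, (N <= l)%N & S l \notin T l.+1).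
  right; apply: (@contraction_cvg0 _ _ q) => //; first by rewrite ltW.
    by move=> l; exact: meshsize_ge0.
  move=> N; have [l Nl Sl] := inf N; exists l => //.
  by apply: h2 Sl _; case: (hS l).
left; have [N hN] : exists N, forall l, (N <= l)%N -> S l \in T l.+1.
  apply: contrapT => h; apply: ninf => N; apply: contrapT => h'; apply: h; exists N => l Nl.
  by apply: contrapT => /negP nS; apply: h'; exists l.
have SE l : (N <= l)%N -> S l = S N.
  elim: l => [|l IH]; first by rewrite leqn0 => /eqP <-.
  rewrite leq_eqVlt => /orP[/eqP <-//|]; rewrite ltnS => Nl.
  rewrite -(IH Nl); have [a b] := hS l; have [a' b'] := hS l.+1.
  by have := elt_disjoint (tT l.+1) a' (hN _ Nl) b' b.
apply: (h1 N (S N)); [by case: (hS N)| |by case: (hS N)].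
by move=> l Nl; rewrite -(SE l Nl); case: (hS l).
Qed.

End marking_argument.

(** * Discrete spaces *)

Section discrete_spaces.
Context {R : realType} {d : nat}.
Local Notation V := 'rV[R]_d.
Local Notation leb := (@lebesgue_rV R d).
Variable p : pde R d.
Local Notation E := (dom p).
Hypotheses (d0 : (0 < d)%N) (lE : lipschitz_domain E).
Let oE : open E := lipschitz_domain_open lE.
Let fE := lipschitz_domain_fin lE.
Let mE : measurable E := open_measurable_rV oE.
Implicit Types (T : mesh R d).

Lemma P1_sub T : subspace (P1 p T).
Proof.
have [h0 hl] := H10_sub oE fE; split.
  split; first exact: h0.
  move=> S _; exists 0, 0; apply: ae_on_all => x _.
  by rewrite addr0 -[RHS]addr0 /dot big1 ?addr0// => i _; rewrite mxE mul0r.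
move=> a v w [hv pv] [hw pw]; split; first exact: hl.
move=> S ST; have [a1 [k1 h1]] := pv S ST; have [a2 [k2 h2]] := pw S ST.
exists (a *: a1 + a2), (a * k1 + k2); apply: ae_on_imp (ae_on_and h1 h2) => x _ [e1 e2].
by rewrite -[LHS]/(a * v x + w x) e1 e2 dotDl dotZl mulrDr addrACA.
Qed.

Lemma RT0_sub T : subspace (RT0 p T).
Proof.
have [h0 hl] := Hdiv_sub oE; split.
  split; first exact: h0.
  by move=> S _; exists 0, 0; apply: ae_on_all => x _; rewrite scale0r addr0.
move=> a v w [hv pv] [hw pw]; split; first exact: hl.
move=> S ST; have [a1 [k1 h1]] := pv S ST; have [a2 [k2 h2]] := pw S ST.
exists (a *: a1 + a2), (a * k1 + k2); apply: ae_on_imp (ae_on_and h1 h2) => x _ [e1 e2].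
by rewrite -[LHS]/(a *: v x + w x) e1 e2 scalerDr scalerA scalerDl addrACA.
Qed.

Lemma elt_refine T T' S' : triangulation E T -> bisections T T' -> S' \in T' ->
  exists2 S, S \in T & elt S' `<=` elt S.
Proof.
move=> tT bT ST'; have sz S : S \in T -> size S.1 = d.+1.
  by move=> ST; have [] := mesh_wf tT ST.
have [_ [S ST hS]] := bisections_hull d0 sz bT ST'.
by exists S => //; exact: interiorS.
Qed.

Lemma P1_refine T T' v : triangulation E T -> bisections T T' -> P1 p T v -> P1 p T' v.
Proof.
move=> tT bT [hv pv]; split => // S' ST'; have [S ST sS] := elt_refine tT bT ST'.
by have [a [k h]] := pv S ST; exists a, k; exact: ae_on_sub h.
Qed.

Lemma RT0_refine T T' tau : triangulation E T -> bisections T T' -> RT0 p T tau -> RT0 p T' tau.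
Proof.
move=> tT bT [hv pv]; split => // S' ST'; have [S ST sS] := elt_refine tT bT ST'.
by have [a [k h]] := pv S ST; exists a, k; exact: ae_on_sub h.
Qed.

Lemma interp_P1 T f : triangulation E T -> (forall x, ~ E x -> f x = 0) -> P1 p T (interp T f).
Proof.
move=> tT f0; split; first by have := ext_grad_H10 lE (interp_ext_grad d0 lE tT f0).
move=> S ST; have [k hk] := aff_affine S f; exists (agrad S f), k.
by apply: ae_on_all => x Sx; rewrite (interpE tT f ST (elt_hull Sx)) hk.
Qed.

Lemma rt_RT0 T tau : triangulation E T -> RT0 p T (rt T tau).
Proof.
move=> tT; split; first exact: rt_Hdiv.
move=> S ST; have [a [k h]] := rt_affine tT tau ST; exists a, k; exact: ae_on_all.
Qed.

Lemma Rint_mesh T (f : V -> R) : triangulation E T -> intble E f ->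
  \sum_(S <- T) \int[leb]_(x in elt S) f x = \int[leb]_(x in E) f x.
Proof.
move=> tT if_; have mf := intble_meas mE if_.
have iS S : S \in T -> intble E (fun x => \1_(elt S) x * f x).
  move=> ST; apply: intble_le (intble_norm mE if_) => //.
    apply: measurable_funM => //; apply: (measurable_funS measurableT) => //.
    exact: measurable_indic (measurable_elt S).
  move=> x _; rewrite normrM ler_piMl// indicE; case: (x \in _); by rewrite ?normr1 ?normr0.
have e1 S : S \in T -> \int[leb]_(x in elt S) f x = \int[leb]_(x in E) (\1_(elt S) x * f x).
  move=> ST; rewrite [LHS]Rint_ext [RHS]Rint_ext; congr (Rintegral _ _ _).
  apply/funext => x; rewrite !restrictE indicE; case: ifPn => xS; last by rewrite mul0r if_same.
  by rewrite mul1r mem_set//; apply: (elt_sub lE tT ST); exact: set_mem.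
rewrite big_seq (eq_bigr _ e1) -(Rint_sum (enum_fset T) mE iS); apply: Rint_ae_eq => //.
  exact: intble_meas mE (intble_sum (enum_fset T) mE iS).
apply: ae_on_imp (mesh_ae_elt d0 tT) => x Ex [S ST Sx].
rewrite -big_seq (sum_elt tT ST Sx); first by rewrite indicE mem_set// mul1r.
by move=> S' _ nS; rewrite indicE memNset// mul0r.
Qed.

Lemma infsup_witness (a : (V -> R) -> (V -> R) -> R) (W : set (V -> R)) (beta : R) : 0 < beta ->
  (beta%:E <= inf_sup E a W)%E -> forall w, W w -> normH1 E w != 0 ->
  exists2 v, W v & normH1 E v != 0 /\ beta / 2 * normH1 E w * normH1 E v <= a w v.
Proof.
move=> b0 hb w Ww nw.
have h : (beta%:E <= ereal_sup [set (a w v / (normH1 E w * normH1 E v))%:E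
    | v in [set v | W v /\ normH1 E v != 0%R]])%E.
  by apply: le_trans hb _; apply: ereal_inf_lbound; exists w.
(* The supremum need not be attained, hence the loss of a factor 2. *)
have h2 : ((beta / 2)%:E < ereal_sup [set (a w v / (normH1 E w * normH1 E v))%:E
    | v in [set v | W v /\ normH1 E v != 0%R]])%E.
  by apply: lt_le_trans h; rewrite lte_fin ltr_pdivrMr// ltr_pMr// ltr1n.
have [_ [v [Wv nv] <-]] := ereal_sup_gt h2; rewrite lte_fin => hv.
exists v => //; split => //.
have p0 (z : V -> R) : normH1 E z != 0 -> 0 < normH1 E z by move=> nz; rewrite lt_def nz sqrtr_ge0.
by rewrite -mulrA -ler_pdivlMr ?mulr_gt0 ?p0// ltW.
Qed.

Lemma Linfty_common (n : nat) (f : 'I_n -> V -> R) : (forall i, Linfty E (f i)) ->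
  exists K : R, 0 <= K /\ ae_on E (fun x => forall i, `|f i x| <= K).
Proof.
move=> h; have h2 i : exists K : R, ae_on E (fun x => `|f i x| <= K) by case: (h i).
have [K hK] := boolp.choice h2; exists (\sum_i `|K i|); split; first exact: sumr_ge0.
apply: ae_on_imp (ae_on_count hK) => x _ hx i; apply: (le_trans (hx i)).
apply: (le_trans (ler_norm _)); rewrite (bigD1 i)//= lerDl; exact: sumr_ge0.
Qed.

Variables (T0 : mesh R d) (T M : nat -> mesh R d).
Hypotheses (tT0 : triangulation E T0) (T00 : T 0%N = T0)
  (hM : forall l, (M l `<=` T l)%fset) (hT : forall l, is_refine E (T l) (M l) (T l.+1)).

Lemma run_triangulation l : triangulation E (T l).
Proof. by case: l => [|l]; [rewrite T00|have [[]] := hT l]. Qed.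

Lemma run_refines l : refines E T0 (T l).
Proof.
elim: l => [|l IH]; first by rewrite T00; exact: refines0.
exact: refinesS IH (hM l) (hT l).
Qed.

Lemma run_refines1 l : refines E (T l) (T l.+1).
Proof. exact: refinesS (refines0 _ _) (hM l) (hT l). Qed.

Lemma run_bisections l : bisections (T l) (T l.+1).
Proof. by have [[]] := hT l. Qed.

Lemma run_marked l S : S \in M l -> S \in T l /\ S \notin T l.+1.
Proof.
move=> SM; split; first exact: (fsubsetP (hM l)).
have [[_ _ e] _] := hT l; apply/negP => ST; have : S \in (M l `&` T l.+1)%fset by rewrite in_fsetI SM.
by rewrite e in_fset0.
Qed.

Lemma run_P1 n k v : (n <= k)%N -> P1 p (T n) v -> P1 p (T k) v.
Proof.
move/subnK <-; elim: (k - n)%N => // m IH h; rewrite addSn.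
exact: P1_refine (run_triangulation _) (run_bisections _) (IH h).
Qed.

Lemma run_RT0 n k tau : (n <= k)%N -> RT0 p (T n) tau -> RT0 p (T k) tau.
Proof.
move/subnK <-; elim: (k - n)%N => // m IH h; rewrite addSn.
exact: RT0_refine (run_triangulation _) (run_bisections _) (IH h).
Qed.

End discrete_spaces.

(** * The least-squares functional *)

Lemma zmod_resid_identity (Z : zmodType) (x y z t g : Z) :
  x - y + (z - t) = x + (z - g) - (y + (t - g)).
Proof. by rewrite opprD [RHS]addrACA opprB; congr (_ + _); rewrite addrA subrK. Qed.

Section L2_comparisons.
Context {R : realType} {d : nat}.
Local Notation V := 'rV[R]_d.
Local Notation leb := (@lebesgue_rV R d).
Variable E : set V.
Hypotheses (oE : open E) (fE : (leb E < +oo)%E).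
Let mE : measurable E := open_measurable_rV oE.
Local Notation nV := (sip_norm (@ipv R d E)).
Local Notation n2 := (sip_norm (@ip R d E)).

Lemma sqrt_le_scale (a b C : R) : 0 <= C -> 0 <= b -> a <= C ^+ 2 * b -> Num.sqrt a <= C * Num.sqrt b.
Proof.
move=> C0 b0 h; rewrite -[C in leRHS]ger0_norm// -sqrtr_sqr -sqrtrM ?sqr_ge0//.
exact: ler_wsqrtr.
Qed.

Lemma nV_le (F G : V -> V) (C : R) : 0 <= C -> L2v E F -> L2v E G ->
  ae_on E (fun x => dot (F x) (F x) <= C ^+ 2 * dot (G x) (G x)) -> nV F <= C * nV G.
Proof.
move=> C0 LF LG h; apply: sqrt_le_scale => //; first exact: (sip_ge0 (L2v_sip oE)).
have iG := L2v_dot oE LG LG; rewrite /ipv -RintZ//.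
by apply: Rint_ae_le => //; [exact: L2v_dot|exact: intbleZ].
Qed.

Lemma n2_le_nV (f : V -> R) (G : V -> V) (C : R) : 0 <= C -> L2 E f -> L2v E G ->
  ae_on E (fun x => f x ^+ 2 <= C ^+ 2 * dot (G x) (G x)) -> n2 f <= C * nV G.
Proof.
move=> C0 Lf LG h; apply: sqrt_le_scale => //; first exact: (sip_ge0 (L2v_sip oE)).
have iG := L2v_dot oE LG LG; rewrite /ipv /ip -RintZ//.
by apply: Rint_ae_le => //; [exact: ip_intble|exact: intbleZ].
Qed.

Lemma n2_le (f g : V -> R) (C : R) : 0 <= C -> L2 E f -> L2 E g ->
  ae_on E (fun x => f x ^+ 2 <= C ^+ 2 * g x ^+ 2) -> n2 f <= C * n2 g.
Proof.
move=> C0 Lf Lg h; apply: sqrt_le_scale => //; first exact: (sip_ge0 (L2_sip mE)).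
have ig := ip_intble mE Lg Lg; rewrite /ip -RintZ//.
by apply: Rint_ae_le => //; [exact: ip_intble|exact: intbleZ].
Qed.

Lemma L2v_mxact (M : V -> 'M[R]_d) (C : R) (F : V -> V) :
  (forall i j, measurable_fun E (fun x => M x i j)) ->
  ae_on E (fun x => forall i j, `|M x i j| <= C) -> L2v E F -> L2v E (fun x => mxact (M x) (F x)).
Proof.
move=> mM bM LF i; rewrite (_ : (fun x => _) = fun x => \sum_k M x i k * F x 0 k).
  apply: L2_sum => // k _; apply: (L2_bounded_mul (M := C)) => //.
  by apply: ae_on_imp bM => x _; exact.
by apply/funext => x; rewrite mxactE; apply: eq_bigr => k _; rewrite mulrC.
Qed.

Lemma L2_dot_bounded (b F : V -> V) (C : R) : (forall i, measurable_fun E (fun x => b x 0 i)) ->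
  ae_on E (fun x => forall i, `|b x 0 i| <= C) -> L2v E F -> L2 E (fun x => dot (b x) (F x)).
Proof.
move=> mb bb LF; apply: L2_sum => // k _; apply: (L2_bounded_mul (M := C)) => //.
by apply: ae_on_imp bb => x _; exact.
Qed.

Lemma dot_bounded_sq (b y : V) (K : R) : 0 <= K -> (forall i, `|b 0 i| <= K) ->
  dot b y ^+ 2 <= (d%:R * K) ^+ 2 * dot y y.
Proof.
move=> K0 hb; apply: (le_trans (dot_CS _ _)); rewrite ler_wpM2r ?dot_sqr_ge0//.
apply: (@le_trans _ _ (\sum_(i < d) K ^+ 2)).
  by apply: ler_sum => i _; rewrite -expr2 -real_normK ?num_real// lerXn2r ?nnegrE.
rewrite sumr_const card_ord -[_ *+ d]mulr_natl exprMn ler_wpM2r ?sqr_ge0// expr2.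
by case: d => [|n]; rewrite ?mul0r// ler_peMl ?ler1n.
Qed.

End L2_comparisons.

Section scalar_identities.
Context {R : comPzRingType}.
Implicit Types a g s t u v : R.

Lemma lin_opL a g s t u v : a * s + t - g * (a * u + v) = a * (s - g * u) + (t - g * v).
Proof. ring. Qed.

Lemma lin_opD a g c s t u v : g * (a * s + t) + c * (a * u + v) = a * (g * s + c * u) + (g * t + c * v).
Proof. ring. Qed.

(** Here [dv] is the divergence of the field, [bt], [bA] and [bf] are the products of [b] with
    [A^-1 tau], with the gradient and with [A^-1 f2], and [cu] is the zeroth-order term. *)
Lemma resY_identity (dv g bt bA bf cu f : R) :
  - (dv - (1 - g) * bt + (g * bA + cu - (f - (1 - g) * bf)) + (1 - g) * (bt + (bA - bf))) =
  f - (1 * bA + cu) - dv.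
Proof. ring. Qed.

Lemma flux_identity (g bA bf cu f : R) :
  f - (1 * bA + cu) - (1 - g) * (bf - bA) + (g * bA + cu - (f - (1 - g) * bf)) = 0.
Proof. ring. Qed.

Lemma ls_identity (dv g bt bA bf cu f : R) :
  dv + (g * bA - (1 - g) * bt + cu) - (f - (1 - g) * bf) =
  dv - (1 - g) * bt + (g * bA + cu - (f - (1 - g) * bf)).
Proof. ring. Qed.

End scalar_identities.

Section least_squares_operators.
Context {R : realType} {d : nat}.
Local Notation V := 'rV[R]_d.
Local Notation leb := (@lebesgue_rV R d).
Local Notation Y := ((V -> V) * (V -> R))%type.
Variables (p : pde R d) (L0 L1 K gamma : R).
Local Notation E := (dom p).
Local Notation A := (coefA p).
Local Notation Ai := (fun x => mxinv (coefA p x)).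
Local Notation b := (coefb p).
Local Notation c := (coefc p).
Hypotheses (lE : lipschitz_domain E) (l0 : 0 < L0) (l01 : L0 <= L1) (K0 : 0 <= K).
Hypotheses (mA : forall i j, measurable_fun E (fun x => A x i j))
  (mb : forall i, measurable_fun E (fun x => b x 0 i)) (mc : measurable_fun E c)
  (L2f1 : L2 E (rhs1 p)) (L2f2 : L2v E (rhs2 p)).
Hypothesis coef : ae_on E (fun x => [/\ (A x)^T = A x,
  forall y, L0 * dot y y <= dot y (mxact (A x) y) <= L1 * dot y y,
  forall i, `|b x 0 i| <= K & `|c x| <= K]).
Let oE : open E := lipschitz_domain_open lE.
Let fE := lipschitz_domain_fin lE.
Let mE : measurable E := open_measurable_rV oE.
Let l1 : 0 < L1 := lt_le_trans l0 l01.
Let sv := L2v_sip oE.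
Let s2 := L2_sip mE.
Let sH := H1_sip oE fE.
Local Notation nV := (sip_norm (@ipv R d E)).
Local Notation n2 := (sip_norm (@ip R d E)).
Local Notation nH := (sip_norm (@ipH1 R d E)).

Lemma coef_inv : ae_on E (fun x => [/\ mxinv (A x) = invmx (A x), (mxinv (A x))^T = mxinv (A x),
  forall y, dot y y <= L1 * dot y (mxact (mxinv (A x)) y),
  forall y, dot y (mxact (mxinv (A x)) y) <= L0^-1 * dot y y &
  forall y, mxact (mxinv (A x)) (mxact (A x) y) = y]).
Proof.
apply: ae_on_imp coef => x _ [sA eA _ _].
have uA := elliptic_unit l0 sA eA; rewrite mxinvE//; split => //.
- exact: elliptic_inv_sym.
- exact: elliptic_inv_ge l0 l01 sA eA.
- exact: elliptic_inv_le l0 sA eA.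
- exact: mxactVK l0 sA eA.
Qed.

Lemma L2v_A F : L2v E F -> L2v E (fun x => mxact (A x) (F x)).
Proof.
apply: (L2v_mxact oE (C := L1)) => //; apply: ae_on_imp coef => x _ [sA eA _ _].
apply: entry_bound => // y; have /andP[h1 ->] := eA y; rewrite andbT.
by apply: le_trans h1; rewrite mulr_ge0 ?dot_sqr_ge0// ltW.
Qed.

Lemma L2v_Ai F : L2v E F -> L2v E (fun x => mxact (Ai x) (F x)).
Proof.
apply: (L2v_mxact oE (C := L0^-1)); first exact: measurable_mxinv.
apply: ae_on_imp coef => x _ [sA eA _ _]; rewrite mxinvE; last exact: elliptic_unit l0 sA eA.
exact: elliptic_inv_entry l0 sA eA.
Qed.

Lemma L2_b F : L2v E F -> L2 E (fun x => dot (b x) (F x)).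
Proof. by apply: (L2_dot_bounded oE (C := K)) => //; apply: ae_on_imp coef => x _ []. Qed.

Lemma L2_c v : L2 E v -> L2 E (fun x => c x * v x).
Proof. by apply: (L2_bounded_mul (M := K)) => //; apply: ae_on_imp coef => x _ []. Qed.

Lemma n2_b F : L2v E F -> n2 (fun x => dot (b x) (F x)) <= d%:R * K * nV F.
Proof.
move=> LF; apply: n2_le_nV => //; [by rewrite mulr_ge0|exact: L2_b|].
by apply: ae_on_imp coef => x _ [_ _ hb _]; exact: dot_bounded_sq.
Qed.

Lemma n2_c v : L2 E v -> n2 (fun x => c x * v x) <= K * n2 v.
Proof.
move=> Lv; apply: n2_le => //; first exact: L2_c.
apply: ae_on_imp coef => x _ [_ _ _ hc]; rewrite exprMn ler_wpM2r ?sqr_ge0//.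
by rewrite -real_normK ?num_real// lerXn2r ?nnegrE.
Qed.

Lemma nV_A F : L2v E F -> nV (fun x => mxact (A x) (F x)) <= L1 * nV F.
Proof.
move=> LF; apply: nV_le => //; [exact: ltW|exact: L2v_A|].
by apply: ae_on_imp coef => x _ [sA eA _ _]; exact: elliptic_sq l0 l01 sA eA _.
Qed.

Lemma nV_grad v : H1 E v -> nV (wgrad E v) <= nH v.
Proof. by move=> hv; rewrite ler_wsqrtr// /ipH1 lerDr; exact: (sip_ge0 s2 hv.1). Qed.

Lemma n2_nH v : H1 E v -> n2 v <= nH v.
Proof. by move=> hv; rewrite ler_wsqrtr// /ipH1 lerDl; exact: (sip_ge0 sv (wgrad_L2 hv)). Qed.

(* The residual lives in pairs (vector field, scalar); weighting its first component with
   [A^-1] removes the matrix square roots, as [|A^(-1/2) z|^2 = z . A^-1 z]. *)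
Definition DY (y : Y) : Prop := L2v E y.1 /\ L2 E y.2.

Definition sY (y y' : Y) : R :=
  ipv E (fun x => mxact (Ai x) (y.1 x)) y'.1 + ip E y.2 y'.2.

Local Notation nY := (sip_norm sY).

Definition dens (y : Y) : V -> R := fun x => dot (y.1 x) (mxact (Ai x) (y.1 x)) + y.2 x ^+ 2.

Lemma Ai_lin a F G : (fun x => mxact (Ai x) ((a *: F + G) x)) =
  a *: (fun x => mxact (Ai x) (F x)) + (fun x => mxact (Ai x) (G x)).
Proof. by apply/funext => x; rewrite [LHS]mxactD mxactZ. Qed.

Lemma sY_sip : semi_ip DY sY.
Proof.
have s0 := sip_sub sv; have s0' := sip_sub s2.
split.
- split; first by split; [exact: s0.1|exact: s0'.1].
  by move=> a x y [x1 x2] [y1 y2]; split; [exact: s0.2|exact: s0'.2].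
- move=> a x y z [x1 x2] [y1 y2] [z1 z2].
  rewrite /sY (Ai_lin a x.1 y.1) (sip_lin sv) ?(sip_lin s2)//; try exact: L2v_Ai.
  by rewrite mulrDr addrACA.
- move=> x y [x1 x2] [y1 y2]; rewrite /sY (ipC E x.2); congr (_ + _).
  have i1 := L2v_dot oE (L2v_Ai x1) y1; have i2 := L2v_dot oE (L2v_Ai y1) x1.
  apply: Rint_ae_eq => //; [exact: intble_meas i1|exact: intble_meas i2|].
  apply: ae_on_imp coef_inv => t _ [_ sI _ _ _].
  by rewrite [RHS]dotC dot_mxact sI.
- move=> x [x1 x2]; apply: addr_ge0; last exact: (sip_ge0 s2 x2).
  rewrite -[0](@Rint0 R d E); apply: Rint_ae_le => //.
  + exact: intble_cst.
  + by have := L2v_dot oE (L2v_Ai x1) x1.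
  + apply: ae_on_imp coef_inv => t _ [_ _ h _ _]; rewrite dotC.
    by rewrite -(pmulr_rge0 _ l1); apply: le_trans (h _); exact: dot_sqr_ge0.
Qed.

Lemma intble_dens y : DY y -> intble E (dens y).
Proof.
move=> [y1 y2]; apply: intbleD => //; last exact: L2_intble.
by have := L2v_dot oE y1 (L2v_Ai y1).
Qed.

Lemma sY_dens y : DY y -> sY y y = \int[leb]_(x in E) dens y x.
Proof.
move=> [y1 y2]; have i1 := L2v_dot oE y1 (L2v_Ai y1).
rewrite /dens RintD//; last exact: L2_intble.
by rewrite /sY ipvC /ipv /ip; congr (_ + _).
Qed.

Lemma dens_ge0 y : ae_on E (fun x => 0 <= dens y x /\ (dens y x = 0 -> y.1 x = 0 /\ y.2 x = 0)).
Proof.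
apply: ae_on_imp coef_inv => t _ [_ _ h _ _]; have ht := h (y.1 t).
have p0 : 0 <= dot (y.1 t) (mxact (Ai t) (y.1 t)).
  by rewrite -(pmulr_rge0 _ l1); apply: le_trans ht; exact: dot_sqr_ge0.
rewrite /dens; split; first by rewrite addr_ge0 ?sqr_ge0.
move/eqP; rewrite paddr_eq0 ?sqr_ge0// => /andP[/eqP e1 /eqP e2]; split.
  by apply: dot_eq0; apply/eqP; rewrite eq_le dot_sqr_ge0 andbT; move: ht; rewrite e1 mulr0.
by apply/eqP; rewrite -sqrf_eq0 e2.
Qed.

Lemma nV_nY y : DY y -> nV y.1 <= Num.sqrt L1 * nY y.
Proof.
move=> hy; have [y1 y2] := hy; apply: sqrt_le_scale => //; first exact: (sip_ge0 sY_sip).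
rewrite sqr_sqrtr ?(ltW l1)//.
apply: (@le_trans _ _ (L1 * ipv E (fun x => mxact (Ai x) (y.1 x)) y.1)); last first.
  by rewrite ler_pM2l// lerDl; exact: (sip_ge0 s2 y2).
have i2 := L2v_dot oE (L2v_Ai y1) y1; rewrite /ipv -RintZ//.
apply: Rint_ae_le => //; [exact: L2v_dot|exact: intbleZ|].
by apply: ae_on_imp coef_inv => t _ [_ _ h _ _]; rewrite [X in _ * X]dotC.
Qed.

Lemma nY_2 y : DY y -> n2 y.2 <= nY y.
Proof.
move=> hy; have [y1 y2] := hy; rewrite ler_wsqrtr// /sY lerDr.
have h0 : DY (y.1, 0) by split => //; exact: (sip_sub s2).1.
have := sip_ge0 sY_sip h0; rewrite /sY/= (_ : ip E 0 0 = 0) ?addr0//.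
exact: (sip0l s2 (sip_sub s2).1).
Qed.

Lemma sqrtrD_le (a a' : R) : 0 <= a -> 0 <= a' -> Num.sqrt (a + a') <= Num.sqrt a + Num.sqrt a'.
Proof.
move=> a0 a'0; have h : 0 <= Num.sqrt a + Num.sqrt a' by rewrite addr_ge0 ?sqrtr_ge0.
rewrite -[leRHS]ger0_norm// -sqrtr_sqr ler_wsqrtr// sqrrD !sqr_sqrtr//.
by rewrite -addrA lerD2l lerDr mulrn_wge0// mulr_ge0 ?sqrtr_ge0.
Qed.

Lemma nY_le y : DY y -> nY y <= Num.sqrt L0^-1 * nV y.1 + n2 y.2.
Proof.
move=> hy; have [y1 y2] := hy; have i2 := L2v_dot oE (L2v_Ai y1) y1.
have L0i : 0 <= L0^-1 by rewrite invr_ge0 ltW.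
have h1 : ipv E (fun x => mxact (Ai x) (y.1 x)) y.1 <= Num.sqrt L0^-1 ^+ 2 * ipv E y.1 y.1.
  rewrite sqr_sqrtr// /ipv -RintZ//; last exact: L2v_dot.
  apply: Rint_ae_le => //; first by apply: intbleZ => //; exact: L2v_dot.
  by apply: ae_on_imp coef_inv => t _ [_ _ _ h _]; rewrite dotC.
have p0 := sip_ge0 sv y1; have q0 := sip_ge0 s2 y2.
apply: (@le_trans _ _ (Num.sqrt (Num.sqrt L0^-1 ^+ 2 * ipv E y.1 y.1 + ip E y.2 y.2))).
  by rewrite ler_wsqrtr// /sY lerD2r.
apply: (le_trans (sqrtrD_le _ _)) => //; first by rewrite mulr_ge0 ?sqr_ge0.
by rewrite lerD2r sqrtrM ?sqr_ge0// sqrtr_sqr ger0_norm ?sqrtr_ge0.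
Qed.

Definition opL (tau : V -> V) : Y :=
  (tau, fun x => wdiv E tau x - (1 - gamma) * dot (b x) (mxact (Ai x) (tau x))).

(** With [g = 1] it represents the bilinear form, with [g = gamma] the part of the residual that
    depends on [v]. *)
Definition opD (g : R) (v : V -> R) : Y :=
  (fun x => mxact (A x) (wgrad E v x), fun x => g * dot (b x) (wgrad E v x) + c x * v x).

Definition datY : Y :=
  (rhs2 p, fun x => rhs1 p x - (1 - gamma) * dot (b x) (mxact (Ai x) (rhs2 p x))).

Definition resid tau v : Y := opL tau + (opD gamma v - datY).

Lemma DY_opL tau : Hdiv E tau -> DY (opL tau).
Proof.
move=> ht; split; first exact: ht.1.
apply: L2_sub => //; first exact: wdiv_L2.
by apply: L2_scale => //; apply: L2_b; apply: L2v_Ai; exact: ht.1.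
Qed.

Lemma DY_opD g v : H1 E v -> DY (opD g v).
Proof.
move=> hv; have gv := wgrad_L2 hv; split; first exact: L2v_A.
by apply: L2_add => //; [apply: L2_scale => //; exact: L2_b|apply: L2_c; exact: hv.1].
Qed.

Lemma DY_dat : DY datY.
Proof. by split => //; apply: L2_sub => //; apply: L2_scale => //; apply: L2_b; exact: L2v_Ai. Qed.

Lemma DY_resid tau v : Hdiv E tau -> H1 E v -> DY (resid tau v).
Proof.
move=> ht hv; have sb := sip_sub sY_sip.
apply: (subspaceD sb (DY_opL ht)); exact: (subspaceB sb (DY_opD gamma hv) DY_dat).
Qed.

(** [wgrad] and [wdiv] are chosen representatives, so [opL] and [opD] are linear only in this
    sense. *)
Definition eqY (y y' : Y) : Prop := ae_on E (fun x => y.1 x = y'.1 x /\ y.2 x = y'.2 x).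

Lemma eqYxx y : eqY y y. Proof. exact: ae_on_all. Qed.

Lemma eqYD x x' y y' : eqY x x' -> eqY y y' -> eqY (x + y) (x' + y').
Proof.
move=> h1 h2; apply: ae_on_imp (ae_on_and h1 h2) => t _ [[a1 a2] [b1 b2]]; split.
  by rewrite -[LHS]/(x.1 t + y.1 t) a1 b1.
by rewrite -[LHS]/(x.2 t + y.2 t) a2 b2.
Qed.

Lemma sY_ae x x' y y' : DY x -> DY x' -> DY y -> DY y' -> eqY x x' -> eqY y y' -> sY x y = sY x' y'.
Proof.
move=> [x1 x2] [x1' x2'] [y1 y2] [y1' y2'] ex ey; rewrite /sY.
rewrite (ipv_ae oE (L2v_Ai x1) (L2v_Ai x1') y1 y1'); last 2 first.
- by apply: ae_on_imp ex => t _ [-> _].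
- by apply: ae_on_imp ey => t _ [].
rewrite (ip_ae mE x2 x2' y2 y2')//; first by apply: ae_on_imp ex => t _ [].
by apply: ae_on_imp ey => t _ [].
Qed.

Lemma nY_ae x x' : DY x -> DY x' -> eqY x x' -> nY x = nY x'.
Proof. by move=> hx hx' e; rewrite /sip_norm (sY_ae hx hx' hx hx' e e). Qed.

Lemma opL_lin a tau tau' : Hdiv E tau -> Hdiv E tau' ->
  eqY (opL (a *: tau + tau')) (a *: opL tau + opL tau').
Proof.
move=> ht ht'; apply: ae_on_imp (wdiv_lin oE fE a ht ht') => x _ /= h; split => //=.
rewrite h mxactD mxactZ dotDr dotZr; exact: lin_opL.
Qed.

Lemma opD_lin g a v w : H1 E v -> H1 E w -> eqY (opD g (a *: v + w)) (a *: opD g v + opD g w).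
Proof.
move=> hv hw; apply: ae_on_imp (wgrad_lin oE fE a hv hw) => x _ /= h; split => /=.
  by rewrite h mxactD mxactZ.
rewrite h dotDr dotZr; exact: lin_opD.
Qed.

Definition sumnorm (y : Y) := nV y.1 + n2 y.2.

Definition normD (g : R) := L1 + (`|g| * (d%:R * K) + K).

Lemma normD_ge0 g : 0 <= normD g.
Proof. by rewrite /normD !addr_ge0 ?mulr_ge0// ltW. Qed.

Lemma sumnorm_opD g v : H1 E v -> sumnorm (opD g v) <= normD g * nH v.
Proof.
move=> hv; have gv := wgrad_L2 hv; rewrite /normD mulrDl; apply: lerD.
  apply: (le_trans (nV_A gv)); rewrite ler_pM2l//; exact: nV_grad.
have Lb := L2_b gv; have Lgb := L2_scale g mE Lb; have Lc := L2_c hv.1.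
apply: (le_trans (sip_triangle s2 Lgb Lc)); rewrite mulrDl; apply: lerD.
  rewrite (sip_normZ s2 g Lb) -mulrA ler_wpM2l//; apply: (le_trans (n2_b gv)).
  by rewrite ler_wpM2l ?mulr_ge0//; exact: nV_grad.
by apply: (le_trans (n2_c hv.1)); rewrite ler_wpM2l//; exact: n2_nH.
Qed.

Definition pairY (y : Y) (v : V -> R) : R := ipv E y.1 (wgrad E v) + ip E y.2 v.

Lemma pairY_bnd y v : DY y -> H1 E v -> `|pairY y v| <= sumnorm y * nH v.
Proof.
move=> [y1 y2] hv; apply: (le_trans (ler_normD _ _)); rewrite mulrDl; apply: lerD.
  apply: (le_trans (sip_CS sv y1 (wgrad_L2 hv))); rewrite ler_wpM2l ?sip_norm_ge0//; exact: nV_grad.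
apply: (le_trans (sip_CS s2 y2 hv.1)); rewrite ler_wpM2l ?sip_norm_ge0//; exact: n2_nH.
Qed.

Lemma pairY_linl a x y v : DY x -> DY y -> H1 E v -> pairY (a *: x + y) v = a * pairY x v + pairY y v.
Proof.
move=> [x1 x2] [y1 y2] hv.
by rewrite /pairY (sip_lin sv a x1 y1 (wgrad_L2 hv)) (sip_lin s2 a x2 y2 hv.1) mulrDr addrACA.
Qed.

Lemma pairY_ae x y v : DY x -> DY y -> H1 E v -> eqY x y -> pairY x v = pairY y v.
Proof.
move=> [x1 x2] [y1 y2] hv e; have gv := wgrad_L2 hv; rewrite /pairY.
rewrite (ipv_ae oE x1 y1 gv gv); last 2 first.
- by apply: ae_on_imp e => t _ [].
- exact: ae_on_all.
rewrite (ip_ae mE x2 y2 hv.1 hv.1)//; first by apply: ae_on_imp e => t _ [].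
exact: ae_on_all.
Qed.

Lemma pairYB x y v : DY x -> DY y -> H1 E v -> pairY (x - y) v = pairY x v - pairY y v.
Proof.
move=> hx hy hv; have := pairY_linl (-1) hy hx hv.
by rewrite scaleN1r mulN1r [- y + x]addrC [RHS]addrC.
Qed.

Lemma formE w v : Defs.form p w v = pairY (opD 1 w) v.
Proof.
rewrite /Defs.form /pairY /pdeGrad /=; congr (_ + ip _ _ _).
by apply/funext => x; rewrite mul1r.
Qed.

Lemma loadE v : load p v = pairY (rhs2 p, rhs1 p) v.
Proof. by rewrite /load /pairY addrC. Qed.

Lemma form_linl k x y z : H1 E x -> H1 E y -> H1 E z ->
  Defs.form p (k *: x + y) z = k * Defs.form p x z + Defs.form p y z.
Proof.
move=> hx hy hz; have hxy : H1 E (k *: x + y) := (H1_sub oE).2 k x y hx hy.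
have dx := DY_opD 1 hx; have dy := DY_opD 1 hy; rewrite !formE -pairY_linl//.
apply: pairY_ae => //; [exact: DY_opD|exact: (sip_sub sY_sip).2|exact: opD_lin].
Qed.

Lemma form_bnd w v : H1 E w -> H1 E v -> Defs.form p w v <= normD 1 * nH w * nH v.
Proof.
move=> hw hv; rewrite formE; apply: (le_trans (ler_norm _)).
apply: (le_trans (pairY_bnd (DY_opD 1 hw) hv)).
rewrite ler_wpM2r ?sip_norm_ge0//; exact: sumnorm_opD.
Qed.

Lemma load_bnd v : H1 E v -> load p v <= sumnorm (rhs2 p, rhs1 p) * nH v.
Proof. by move=> hv; rewrite loadE; apply: (le_trans (ler_norm _)); apply: pairY_bnd. Qed.

(** Adding [(1 - gamma) b.A^-1] of the first component to the second restores the full convection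
    term, whatever [gamma] is. In the pairing with an H10 function the flux then drops out by the
    definition of the weak divergence, and the residual of the weak equation remains. *)
Definition resY (r : Y) : Y :=
  (fun x => - r.1 x, fun x => - (r.2 x + (1 - gamma) * dot (b x) (mxact (Ai x) (r.1 x)))).

Lemma DY_resY r : DY r -> DY (resY r).
Proof.
move=> [r1 r2]; split.
  move=> i; rewrite (_ : (fun x => _) = fun x => - r.1 x 0 i); first exact: L2_opp.
  by apply/funext => x; rewrite mxE.
apply: L2_opp => //; apply: L2_add => //; apply: L2_scale => //.
by apply: L2_b; exact: L2v_Ai.
Qed.

Lemma resY_resid tau v phi : Hdiv E tau -> H1 E v -> H10 E phi ->
  pairY (resY (resid tau v)) phi = load p phi - Defs.form p v phi.
Proof.
move=> ht hv hphi; have hphi1 := H10_H1 hphi.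
have dr := DY_resY (DY_resid ht hv); have dv := DY_opD 1 hv.
have df : DY (rhs2 p, rhs1 p) by [].
have sb := sip_sub sY_sip; have dfv := subspaceB sb df dv.
have dt : DY (tau, wdiv E tau) by split; [exact: ht.1|exact: wdiv_L2].
have pt : pairY (tau, wdiv E tau) phi = 0.
  apply: (H10_density lE ht.1 (wdiv_L2 ht)) => // psi tpsi.
  by rewrite ((wdivP ht).2 _ tpsi) addNr.
rewrite formE loadE -pairYB//; rewrite -[RHS]subr0 -pt -pairYB//.
apply: pairY_ae => //; first exact: subspaceB.
apply: ae_on_imp coef_inv => x _ [_ _ _ _ hI]; split.
  transitivity (- (tau x + (mxact (A x) (wgrad E v x) - rhs2 p x))); first by [].
  by rewrite !opprD opprK [LHS]addrC [- _ + rhs2 p x]addrC.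
pose r1 := tau x + (mxact (A x) (wgrad E v x) - rhs2 p x).
transitivity (- (wdiv E tau x - (1 - gamma) * dot (b x) (mxact (Ai x) (tau x)) +
  (gamma * dot (b x) (wgrad E v x) + c x * v x -
   (rhs1 p x - (1 - gamma) * dot (b x) (mxact (Ai x) (rhs2 p x)))) +
  (1 - gamma) * dot (b x) (mxact (Ai x) r1))); first by [].
rewrite /r1 mxactD mxactB hI dotDr dotBr; exact: resY_identity.
Qed.

(** The integrand of [ls_sq] contains the pointwise chosen square root of [A], whose measurability
    is not established; it agrees with the measurable weighted density only almost everywhere. *)
Lemma sub_measurable_ae (E' : set V) (f g : V -> R) : measurable E' -> (forall x, E' x -> 0 <= f x) ->
  measurable_fun E' g -> ae_on E' (fun x => f x = g x /\ 0 <= g x) ->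
  \int[leb]_(x in E') f x = \int[leb]_(x in E') g x.
Proof.
move=> mE' f0 mg h.
have mg' : measurable_fun E' (fun x => Num.max 0 (g x)).
  by apply: measurable_maxr => //; exact: measurable_cst.
transitivity (\int[leb]_(x in E') Num.max 0 (g x)).
  rewrite /Rintegral; congr fine; apply: ge0_integral_ae_nm => //.
  - by move=> x _; rewrite lee_fin le_max lexx.
  - exact/measurable_EFinP.
  - by apply: (@ae_on_imp _ _ E') h => x _ [-> g0]; rewrite max_r.
by apply: Rint_ae_eq => //; apply: ae_on_imp h => x _ [_ g0]; rewrite max_r.
Qed.

Lemma ls_sqE (E' : set V) tau v : measurable E' -> E' `<=` E -> Hdiv E tau -> H1 E v ->
  ls_sq p gamma E' tau v = \int[leb]_(x in E') dens (resid tau v) x.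
Proof.
move=> mE' sE ht hv; have hr := DY_resid ht hv; have [r1 r2] := hr.
have i1 : intble E' (fun x => dot ((resid tau v).1 x) (mxact (Ai x) ((resid tau v).1 x))).
  by have := L2v_dot oE r1 (L2v_Ai r1); apply: intbleS.
have i2 : intble E' (fun x => (resid tau v).2 x ^+ 2) by apply: intbleS (L2_intble r2).
have p0 := ae_on_sub sE coef_inv.
rewrite /dens RintD// /ls_sq /normL2v /normL2 !sqr_sqrtr; last 2 first.
- by apply: Rintegral_ge0 => x _; rewrite -expr2 sqr_ge0.
- by apply: Rintegral_ge0 => x _; exact: dot_sqr_ge0.
congr (_ + _); apply: sub_measurable_ae => //.
- by move=> x _; exact: dot_sqr_ge0.
- exact: intble_meas i1.
- apply: ae_on_imp (ae_on_and p0 (ae_on_sub sE coef)) => x _ [[hI _ hg _ _] [sA eA _ _]]; split.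
    by rewrite (mxsqrt_residual l0 sA eA) hI.
  by rewrite -(pmulr_rge0 _ l1); apply: le_trans (hg _); exact: dot_sqr_ge0.
- by move=> x _; rewrite -expr2 sqr_ge0.
- exact: intble_meas i2.
- apply: ae_on_imp p0 => x _ [hI _ _ _ _]; rewrite sqr_ge0 -expr2; split => //.
  congr (_ ^+ 2); rewrite /lsB /lsg -hI; exact: ls_identity.
Qed.

Lemma quadratic_step (x y z t : R) : z <= t * (t * x) + 2 * (t * y) + z -> 0 <= 2 * t * y + t ^+ 2 * x.
Proof. lra. Qed.

Lemma eq0_quadratic (a e : R) : 0 <= e -> (forall t, 0 <= 2 * t * a + t ^+ 2 * e) -> a = 0.
Proof.
move=> e0 h; have e1 : 0 < e + 1 by apply: ltr_wpDl.
(* Nearly the minimizer of the quadratic; the shift by 1 avoids a division by zero, and the value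
   becomes [- (a / (e + 1)) ^+ 2 * (e + 2)]. *)
have := h (- a / (e + 1)).
rewrite (_ : _ + _ = - (a / (e + 1)) ^+ 2 * (e + 2)); last by field; rewrite lt0r_neq0.
rewrite mulNr oppr_ge0 pmulr_lle0; last by apply: ltr_wpDl.
move=> h2; have /eqP : (a / (e + 1)) ^+ 2 = 0 by apply/eqP; rewrite eq_le h2 sqr_ge0.
rewrite sqrf_eq0 mulf_eq0 invr_eq0 (gt_eqF e1) orbF => /eqP //.
Qed.

Lemma resid_orthogonal (W : (V -> V) -> Prop) sr v : (forall tau, W tau -> Hdiv E tau) ->
  (forall a tau tau', W tau -> W tau' -> W (a *: tau + tau')) -> W sr -> H1 E v ->
  (forall tau, W tau -> ls_sq p gamma E sr v <= ls_sq p gamma E tau v) ->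
  forall tau, W tau -> sY (resid sr v) (opL tau) = 0.
Proof.
move=> WH Wl Wsr hv hmin tau Wt; have ht := WH _ Wt; have hs := WH _ Wsr.
have dr := DY_resid hs hv; have dl := DY_opL ht; have sb := sip_sub sY_sip.
apply: (eq0_quadratic (sip_ge0 sY_sip dl)) => t.
have Wts := Wl t _ _ Wt Wsr; have := hmin _ Wts.
have hts := WH _ Wts; rewrite !ls_sqE// -!sY_dens//; last exact: DY_resid.
have e1 : eqY (resid (t *: tau + sr) v) (t *: opL tau + resid sr v).
  by rewrite {2}/resid addrA; apply: eqYD (eqYxx _); exact: opL_lin.
have dt := DY_resid hts hv; have dtl := subspaceZ t sb dl; have dd := subspaceD sb dtl dr.
rewrite (sY_ae dt dd dt dd e1 e1) (sip_sqD sY_sip dtl dr).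
rewrite (sipZl sY_sip t dl dtl) (sipZr sY_sip t dl dl) (sipZl sY_sip t dl dr) (sip_sym sY_sip dl dr).
exact: quadratic_step.
Qed.

Definition normYD (g : R) := (Num.sqrt L0^-1 + 1) * normD g.

Lemma nY_sumnorm y : DY y -> nY y <= (Num.sqrt L0^-1 + 1) * sumnorm y.
Proof.
move=> hy; apply: (le_trans (nY_le hy)); rewrite mulrDr; apply: lerD.
  by rewrite ler_wpM2r ?sip_norm_ge0// lerDl.
by rewrite ler_peMl ?sip_norm_ge0// lerDr sqrtr_ge0.
Qed.

Lemma nY_opD g v : H1 E v -> nY (opD g v) <= normYD g * nH v.
Proof.
move=> hv; apply: (le_trans (nY_sumnorm (DY_opD g hv))); rewrite -mulrA; apply: ler_wpM2l.
  by rewrite addr_ge0 ?sqrtr_ge0.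
exact: sumnorm_opD.
Qed.

Lemma nV_Ai F : L2v E F -> nV (fun x => mxact (Ai x) (F x)) <= L0^-1 * nV F.
Proof.
move=> LF; apply: nV_le => //; [by rewrite invr_ge0 ltW|exact: L2v_Ai|].
apply: ae_on_imp coef => x _ [sA eA _ _]; rewrite mxinvE; last exact: elliptic_unit l0 sA eA.
exact: elliptic_inv_sq l0 sA eA _.
Qed.

Definition normbAi := `|1 - gamma| * (d%:R * K * L0^-1).

Lemma normbAi_ge0 : 0 <= normbAi.
Proof. by rewrite /normbAi mulr_ge0// mulr_ge0 ?mulr_ge0// invr_ge0 ltW. Qed.

Lemma n2_bAi F : L2v E F -> n2 (fun x => (1 - gamma) * dot (b x) (mxact (Ai x) (F x))) <= normbAi * nV F.
Proof.
move=> LF; have LA := L2v_Ai LF; have Lb := L2_b LA.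
rewrite (sip_normZ s2 (1 - gamma) Lb) /normbAi -mulrA ler_wpM2l//.
apply: (le_trans (n2_b LA)); rewrite -[leRHS]mulrA ler_wpM2l ?mulr_ge0//; exact: nV_Ai.
Qed.

Definition normRes := Num.sqrt L1 * (1 + normbAi) + 1.

Lemma normRes_ge0 : 0 <= normRes.
Proof. by rewrite addr_ge0 ?mulr_ge0 ?sqrtr_ge0// addr_ge0// normbAi_ge0. Qed.

Lemma sumnorm_resY y : DY y -> sumnorm (resY y) <= normRes * nY y.
Proof.
move=> hy; have [y1 y2] := hy; have Lb := L2_scale (1 - gamma) mE (L2_b (L2v_Ai y1)).
have e1 : nV (resY y).1 = nV y.1 by exact: (sip_normN sv y1).
have Ls := L2_add mE y2 Lb.
have e2 : n2 (resY y).2 = n2 (y.2 + (fun x => (1 - gamma) * dot (b x) (mxact (Ai x) (y.1 x)))).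
  exact: (sip_normN s2 Ls).
rewrite /sumnorm e1 e2; have h1 := nV_nY hy; have h2 := nY_2 hy.
have h3 := sip_triangle s2 y2 Lb; have h4 := n2_bAi y1.
have h5 : normbAi * nV y.1 <= normbAi * (Num.sqrt L1 * nY y) by rewrite ler_wpM2l// normbAi_ge0.
apply: (le_trans (lerD h1 (le_trans h3 (lerD h2 (le_trans h4 h5))))).
rewrite /normRes; move: (nY y) (Num.sqrt L1) normbAi => a s t; lra.
Qed.

Lemma resYB x y : resY (x - y) = resY x - resY y.
Proof.
rewrite /resY; congr pair; apply/funext => t.
  by rewrite -[(x - y).1 t]/(x.1 t - y.1 t) -[RHS]/(- x.1 t - - y.1 t) opprB opprK addrC.
rewrite -[(x - y).1 t]/(x.1 t - y.1 t) -[(x - y).2 t]/(x.2 t - y.2 t) mxactB dotBr.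
rewrite -[RHS]/(- (x.2 t + _) - - (y.2 t + _)).
move: (dot _ _) (dot _ _) => u v; ring.
Qed.

(* The adjoint of [opL] composed with the weight [Ai]. *)
Definition adjL (y : Y) : V -> V := fun x => mxact (Ai x) (y.1 x - ((1 - gamma) * y.2 x) *: b x).

Lemma L2v_adjL y : DY y -> L2v E (adjL y).
Proof.
move=> [y1 y2]; apply: L2v_Ai; apply: (subspaceB (sip_sub sv) y1) => i.
rewrite (_ : (fun x => _) = fun x => (1 - gamma) * (b x 0 i * y.2 x)); last first.
  by apply/funext => x; rewrite !mxE mulrAC mulrA.
apply: L2_scale => //; apply: (L2_bounded_mul (M := K)) => //.
by apply: ae_on_imp coef => x _ [].
Qed.

Lemma sY_opL y tau : DY y -> Hdiv E tau -> sY y (opL tau) = ipv E (adjL y) tau + ip E y.2 (wdiv E tau).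
Proof.
move=> hy ht; have [y1 y2] := hy; have t1 := ht.1; have t2 := wdiv_L2 ht.
have Lb := L2_scale (1 - gamma) mE (L2_b (L2v_Ai t1)).
have La := L2v_adjL hy.
have e2 : ip E y.2 (opL tau).2 = ip E y.2 (wdiv E tau) -
    ip E y.2 (fun x => (1 - gamma) * dot (b x) (mxact (Ai x) (tau x))) by exact: (sipBr s2 t2 Lb y2).
rewrite /sY e2 addrCA addrC; congr (_ + _).
have i1 := L2v_dot oE (L2v_Ai y1) t1; have i2 := ip_intble mE y2 Lb.
have i3 := L2v_dot oE La t1.
rewrite /ipv /ip -RintB//; apply: Rint_ae_eq => //.
- exact: intble_meas (intbleB mE i1 i2).
- exact: intble_meas i3.
- apply: ae_on_imp coef_inv => x _ [_ sI _ _ _].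
  rewrite /adjL mxactB mxactZ dotBl dotZl; congr (_ - _).
  by rewrite mulrCA -[RHS]mulrA (dot_mxact (Ai x) (b x)) sI.
Qed.

(** The difference of the two sides is the density of [x - 2 *: y], which is nonnegative wherever
    [A^-1] is. *)
Lemma dens_le x y : ae_on E (fun t => dens x t <= 2 * dens y t + 2 * dens (x - y) t).
Proof.
apply: ae_on_imp coef_inv => t _ [_ _ h _ _].
have p0 z : 0 <= dot z (mxact (Ai t) z).
  by rewrite -(pmulr_rge0 _ l1); apply: le_trans (h _); exact: dot_sqr_ge0.
rewrite /dens -[(x - y).1 t]/(x.1 t - y.1 t) -[(x - y).2 t]/(x.2 t - y.2 t).
have := p0 (x.1 t - 2 *: y.1 t); rewrite !mxactB !mxactZ !dotBl !dotBr !dotZl !dotZr.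
have := sqr_ge0 (x.2 t - 2 * y.2 t).
move: (x.2 t) (y.2 t) (dot _ _) (dot _ _) (dot _ _) (dot _ _) => a c p1 p2 p3 p4; nra.
Qed.

Lemma Rint_sub_ae (F : set V) (f : V -> R) : measurable F -> F `<=` E -> intble E f ->
  ae_on E (fun x => 0 <= f x) -> \int[leb]_(x in F) f x <= \int[leb]_(x in E) f x.
Proof.
move=> mF sF if_ h; have ia := intble_norm mE if_.
rewrite (@Rint_ae_eq _ _ E f (fun x => `|f x|))//; [|exact: intble_meas if_|exact: intble_meas ia|]; last first.
  by apply: ae_on_imp h => x _ /ger0_norm.
apply: le_trans (Rint_subset mE mF sF ia _) => //.
apply: Rint_le => //; [exact: intbleS if_|exact: intbleS ia|by move=> x _; exact: ler_norm].
Qed.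

Lemma dens_split (F : set V) x y : measurable F -> F `<=` E -> DY x -> DY y ->
  \int[leb]_(t in F) dens x t <= 2 * \int[leb]_(t in F) dens y t + 2 * nY (x - y) ^+ 2.
Proof.
move=> mF sF hx hy; have hxy := subspaceB (sip_sub sY_sip) hx hy.
have ix := intbleS mE mF sF (intble_dens hx); have iy := intbleS mE mF sF (intble_dens hy).
have ixy := intbleS mE mF sF (intble_dens hxy).
have i2 := intbleZ 2 mF iy; have i3 := intbleZ 2 mF ixy.
apply: (@le_trans _ _ (\int[leb]_(t in F) (2 * dens y t + 2 * dens (x - y) t))).
  by apply: Rint_ae_le => //; [exact: intbleD|exact: ae_on_sub (dens_le x y)].
rewrite RintD// !RintZ// lerD2l ler_pM2l// (sip_norm_sq sY_sip hxy) sY_dens//.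
apply: Rint_sub_ae => //; first exact: intble_dens.
by apply: ae_on_imp (dens_ge0 (x - y)) => t _ [].
Qed.

Lemma sqrt_sum_le (I : Type) (s : seq I) (f : I -> R) : (forall i, 0 <= f i) ->
  Num.sqrt (\sum_(i <- s) f i) <= \sum_(i <- s) Num.sqrt (f i).
Proof.
move=> f0; elim: s => [|i s IH]; first by rewrite !big_nil sqrtr0.
rewrite !big_cons; apply: (le_trans (sqrtrD_le _ _)) => //; first exact: sumr_ge0.
by rewrite lerD2l.
Qed.

Lemma nV_le_sum F : L2v E F -> nV F <= \sum_i n2 (fun x => F x 0 i).
Proof.
move=> LF; rewrite /sip_norm (ipv_sum oE LF LF); apply: sqrt_sum_le => i.
exact: (sip_ge0 s2 (LF i)).
Qed.

Lemma n2_le_nV_coord F i : L2v E F -> n2 (fun x => F x 0 i) <= nV F.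
Proof.
move=> LF; rewrite /sip_norm (ipv_sum oE LF LF) ler_wsqrtr// (bigD1 i)//= lerDl.
by apply: sumr_ge0 => j _; exact: (sip_ge0 s2 (LF j)).
Qed.

Lemma Y_complete (r : nat -> Y) : (forall n, DY (r n)) ->
  (forall e : R, 0 < e -> exists N, forall n k, (N <= n)%N -> (N <= k)%N -> nY (r n - r k) <= e) ->
  exists r', DY r' /\ nY (r n - r') @[n --> \oo] --> (0 : R).
Proof.
move=> hr hc; have sb := sip_sub sY_sip.
have hrB n k : DY (r n - r k) by exact: subspaceB.
have [g [Lg cg]] : exists g, L2 E g /\ normL2 E ((r k).2 - g) @[k --> \oo] --> (0 : R).
  apply: L2_complete => //; first by move=> k; case: (hr k).
  move=> e e0; have [N hN] := hc e e0; exists N => n k Nn Nk.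
  exact: le_trans (nY_2 (hrB n k)) (hN _ _ Nn Nk).
have s0 : 0 < Num.sqrt L1 by rewrite sqrtr_gt0.
have hf i : exists f, L2 E f /\ normL2 E ((fun x => (r k).1 x 0 i) - f) @[k --> \oo] --> (0 : R).
  apply: L2_complete => //; first by move=> k; case: (hr k).
  move=> e e0; have e1 : 0 < e / Num.sqrt L1 by rewrite divr_gt0.
  have [N hN] := hc _ e1; exists N => n k Nn Nk; have [d1 _] := hrB n k.
  have -> : (fun x => (r n).1 x 0 i) - (fun x => (r k).1 x 0 i) = fun x => (r n - r k).1 x 0 i.
    by apply/funext => x; rewrite -[(r n - r k).1 x]/((r n).1 x - (r k).1 x) !mxE.
  apply: (le_trans (n2_le_nV_coord i d1)); apply: (le_trans (nV_nY (hrB n k))).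
  by rewrite mulrC -ler_pdivlMr//; exact: hN.
have [f hf'] := boolp.choice hf.
pose r' : Y := (fun x => \row_i f i x, g).
have hr' : DY r'.
  split => // i; rewrite (_ : (fun x => _) = f i); first by case: (hf' i).
  by apply/funext => x; rewrite mxE.
exists r'; split => //.
have c : Num.sqrt L0^-1 * (\sum_i normL2 E ((fun x => (r n).1 x 0 i) - f i)) + normL2 E ((r n).2 - g)
    @[n --> \oo] --> (0 : R).
  have c1 := cvg_ord_sum (fun i => (hf' i).2).
  rewrite big1 // in c1.
  have c2 : Num.sqrt L0^-1 * (\sum_i normL2 E ((fun x => (r n).1 x 0 i) - f i)) @[n --> \oo] --> (0 : R).
    by rewrite -[X in _ --> X](mulr0 (Num.sqrt L0^-1)); apply: cvgMr.
  by have := cvgD c2 cg; rewrite addr0; exact.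
apply: cvg0_le c => n; rewrite sip_norm_ge0/=.
have hB := subspaceB sb (hr n) hr'; have [d1 _] := hB.
apply: (le_trans (nY_le hB)); rewrite lerD2r ler_wpM2l ?sqrtr_ge0//.
apply: (le_trans (nV_le_sum d1)); apply: ler_sum => i _.
rewrite (_ : (fun x => (r n - r').1 x 0 i) = (fun x => (r n).1 x 0 i) - f i)//.
by apply/funext => x; rewrite -[(r n - r').1 x]/((r n).1 x - \row_i f i x) !mxE.
Qed.

(** The field is itself the first component of [opL tau], so [opL] is bounded below on Hdiv: small
    values of the operator force small flux errors. *)
Lemma nV_opL tau : Hdiv E tau -> nV tau <= Num.sqrt L1 * nY (opL tau).
Proof. by move=> ht; exact: nV_nY (DY_opL ht). Qed.

Lemma n2_wdiv_opL tau : Hdiv E tau ->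
  n2 (wdiv E tau) <= (1 + normbAi * Num.sqrt L1) * nY (opL tau).
Proof.
move=> ht; have hL := DY_opL ht; have Lb := L2_scale (1 - gamma) mE (L2_b (L2v_Ai ht.1)).
have [_ L2] := hL.
have e : wdiv E tau = (opL tau).2 + (fun x => (1 - gamma) * dot (b x) (mxact (Ai x) (tau x))).
  by apply/funext => x; rewrite -[RHS]/(wdiv E tau x - _ + _) subrK.
rewrite e; apply: (le_trans (sip_triangle s2 L2 Lb)); rewrite mulrDl mul1r; apply: lerD.
  exact: nY_2.
apply: (le_trans (n2_bAi ht.1)); rewrite -mulrA ler_wpM2l ?normbAi_ge0//; exact: nV_opL.
Qed.

(** * Convergence of the adaptive sequence *)

Section adaptive_sequence.
Variables (T : nat -> mesh R d) (kappa : R) (sr : nat -> V -> V) (uc : nat -> V -> R) (beta0 : R).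
Hypotheses (d0 : (0 < d)%N) (tT : forall l, triangulation E (T l)) (kap0 : 0 < kappa)
  (shape : forall l S, S \in T l -> diam (hull S.1) ^+ d <= kappa * vol S)
  (nP1 : forall n k v, (n <= k)%N -> P1 p (T n) v -> P1 p (T k) v)
  (nRT0 : forall n k tau, (n <= k)%N -> RT0 p (T n) tau -> RT0 p (T k) tau)
  (ucP : forall l, galerkin p (T l) (uc l))
  (srP : forall l, ls_recovery p gamma (T l) (uc l) (sr l))
  (b0 : 0 < beta0)
  (hb0 : forall l, (beta0%:E <= inf_sup E (Defs.form p) (P1 p (T l)))%E).
Let sS := sY_sip.

Let P1_H1 l v : P1 p (T l) v -> H1 E v. Proof. by case=> /H10_H1. Qed.
Let RT0_Hdiv l tau : RT0 p (T l) tau -> Hdiv E tau. Proof. by case. Qed.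
Let hu l : H1 E (uc l). Proof. by have [h _] := ucP l; exact: P1_H1 h. Qed.
Let hs l : Hdiv E (sr l). Proof. by have [h _] := srP l; exact: RT0_Hdiv h. Qed.

Lemma uc_cauchy (e : R) : 0 < e -> exists N, forall n k, (N <= n)%N -> (N <= k)%N ->
  nH (uc n - uc k) <= e.
Proof.
apply: (@galerkin_cauchy _ _ _ _ sH (fun n => P1 p (T n)) (Defs.form p) (load p) uc (normD 1) (beta0 / 2)
  (sumnorm (rhs2 p, rhs1 p))).
- by move=> n; exact: P1_sub.
- by move=> n x; exact: P1_H1.
- exact: nP1.
- exact: form_linl.
- exact: form_bnd.
- exact: load_bnd.
- by rewrite divr_gt0.
- move=> n w hw nw; have hw1 := P1_H1 hw.
  rewrite -(normH1E oE hw1) in nw *.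
  have [v hv [nv h]] := infsup_witness b0 (hb0 n) hw nw; have hv1 := P1_H1 hv.
  by exists v => //; rewrite -(normH1E oE hv1).
- by move=> n; case: (ucP n).
- by move=> n v; case: (ucP n) => _; exact.
Qed.

Let r l : Y := resid (sr l) (uc l).
Let DYr l : DY (r l) := DY_resid (hs l) (hu l).

Lemma r_orthogonal l tau : RT0 p (T l) tau -> sY (r l) (opL tau) = 0.
Proof.
have [s1 hmin] := srP l.
apply: (resid_orthogonal (W := RT0 p (T l))) => //; first by move=> t; exact: RT0_Hdiv.
exact: (RT0_sub lE (T l)).2.
Qed.

Lemma r_cauchy (e : R) : 0 < e -> exists N, forall n k, (N <= n)%N -> (N <= k)%N -> nY (r n - r k) <= e.
Proof.
pose dd l := opD gamma (uc l) - datY.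
have hd l : DY (dd l) := subspaceB (sip_sub sS) (DY_opD gamma (hu l)) DY_dat.
(* [opL] is linear only almost everywhere, so the subspaces collect all pairs that are equal almost
   everywhere to some [opL tau]. The data cancel in [dd n - dd k], which the Galerkin sequence
   controls. *)
apply: (@least_squares_cauchy _ _ _ _ sS
  (fun n y => DY y /\ exists2 tau, RT0 p (T n) tau & eqY y (opL tau)) r (fun l => opL (sr l)) dd).
- move=> n; split.
    split; first exact: (sip_sub sS).1.
    exists 0; first exact: (RT0_sub lE (T n)).1.
    have z := RT0_Hdiv (RT0_sub lE (T n)).1; have := opL_lin (-1) z z.
    by rewrite scaleN1r addNr scaleN1r addNr; apply: ae_on_imp => x _ [-> ->].
  move=> a x y [hx [t1 ht1 e1]] [hy [t2 ht2 e2]]; split; first exact: (sip_sub sS).2.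
  exists (a *: t1 + t2); first exact: (RT0_sub lE (T n)).2.
  have h := opL_lin a (RT0_Hdiv ht1) (RT0_Hdiv ht2).
  apply: ae_on_imp (ae_on_and h (ae_on_and e1 e2)) => t _ [[-> ->] [[a1 a2] [c1 c2]]]; split.
    by rewrite -[LHS]/(a *: x.1 t + y.1 t) a1 c1.
  by rewrite -[LHS]/(a *: x.2 t + y.2 t) a2 c2.
- by move=> n x [].
- move=> n k x nk [hx [t ht ex]]; split => //; exists t => //; exact: nRT0 nk ht.
- move=> n; split; first exact: DY_opL.
  by have [s1 _] := srP n; exists (sr n) => //; exact: eqYxx.
- exact: hd.
- by [].
- move=> n x [hx [t ht ex]].
  rewrite (sY_ae (DYr n) (DYr n) hx (DY_opL (RT0_Hdiv ht)) (eqYxx _) ex); exact: r_orthogonal.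
- move=> e' e0; have C0 : 0 <= normYD gamma.
    by rewrite mulr_ge0 ?normD_ge0// addr_ge0 ?sqrtr_ge0.
  have C1 : 0 < normYD gamma + 1 by exact: ltr_wpDl.
  have [N hN] := uc_cauchy (divr_gt0 e0 C1); exists N => n k Nn Nk.
  have hB := subspaceB (H1_sub oE) (hu n) (hu k).
  have e1 : dd n - dd k = opD gamma (uc n) - opD gamma (uc k).
    by rewrite /dd opprB addrA subrK.
  have h2 : eqY (opD gamma (uc n - uc k)) (opD gamma (uc n) - opD gamma (uc k)).
    have := opD_lin gamma (-1) (hu k) (hu n).
    by rewrite !scaleN1r [- uc k + _]addrC [- opD _ _ + _]addrC.
  have dB := subspaceB (sip_sub sS) (DY_opD gamma (hu n)) (DY_opD gamma (hu k)).
  rewrite e1 -(nY_ae (DY_opD gamma hB) dB h2); apply: (le_trans (nY_opD gamma hB)).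
  by apply: le_trans (mul_div_le C0 (ltW e0)); rewrite ler_wpM2l//; exact: hN.
Qed.

Lemma eq0_of_cvg (a C : R) (w : nat -> R) N : w n @[n --> \oo] --> (0 : R) ->
  (forall n, (N <= n)%N -> `|a| <= C * w n) -> a = 0.
Proof.
move=> cw h; have c : C * w (n + N)%N @[n --> \oo] --> (0 : R).
  by rewrite -[X in _ --> X](mulr0 C); apply: cvgMr; rewrite cvg_shiftn.
have c1 : `|a| @[_ --> \oo] --> (0 : R).
  by apply: cvg0_le c => n; rewrite normr_ge0 h// leq_addl.
apply/eqP; rewrite -normr_eq0; apply/eqP.
by apply: (cvg_unique (@Rhausdorff R) _ c1); exact: cvg_cst.
Qed.

Lemma ls_sq_ge0 (F : set V) tau v : 0 <= ls_sq p gamma F tau v.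
Proof. by rewrite addr_ge0 ?sqr_ge0. Qed.

Section marking_limit.
Variables (M : nat -> mesh R d) (q : R).
Hypotheses (q01 : 0 < q < 1)
  (h_mono : forall l, ae_on E (fun x => meshsize (T l.+1) x <= meshsize (T l) x))
  (h_red : forall l S, S \in T l -> S \notin T l.+1 ->
    ae_on (elt S) (fun x => meshsize (T l.+1) x <= q * meshsize (T l) x))
  (MT : forall l S, S \in M l -> S \in T l /\ S \notin T l.+1)
  (hM : marking p gamma T M sr uc).

Lemma residual_limit : exists r' : Y, [/\ DY r', nY (r n - r') @[n --> \oo] --> (0 : R) &
  ae_on E (fun x => (r'.1 x = 0 /\ r'.2 x = 0) \/ meshsize (T l) x @[l --> \oo] --> (0 : R))].
Proof.
have [r' [hr' cr]] := Y_complete DYr r_cauchy; exists r'; split => //.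
have [G [G0 Gc G00 hG]] := hM.
pose ee n := 2 * nY (r n - r') ^+ 2.
have ceD : ee n @[n --> \oo] --> (0 : R).
  have c : 2 * (nY (r n - r') * nY (r n - r')) @[n --> \oo] --> (2 * (0 * 0) : R).
    by apply: cvgMr; exact: cvgM.
  by rewrite !mulr0 in c; exact: c.
have ee0 n : 0 <= ee n by rewrite mulr_ge0 ?sqr_ge0.
have id := intble_dens hr'; have ia := intble_norm mE id.
have aeE (F : set V) : measurable F -> F `<=` E ->
    \int[leb]_(x in F) `|dens r' x| = \int[leb]_(x in F) dens r' x.
  move=> mF sF; have i1 := intbleS mE mF sF id; have i2 := intbleS mE mF sF ia.
  apply: Rint_ae_eq => //; [exact: intble_meas i2|exact: intble_meas i1|].
  by apply: ae_on_imp (ae_on_sub sF (dens_ge0 r')) => x _ [h _]; rewrite ger0_norm.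
have etaE l S : S \in T l -> eta_elt p gamma (sr l) (uc l) S ^+ 2 = \int[leb]_(x in elt S) dens (r l) x.
  move=> Sl; rewrite sqr_sqrtr ?ls_sq_ge0// ls_sqE//; first exact: measurable_elt.
  by move=> x; exact: (elt_sub lE (tT l) Sl).
(* [dens r'] is nonnegative only almost everywhere, while the marking argument asks for this
   everywhere; hence the absolute value. *)
have := @limit_dichotomy _ _ E T M q d0 lE tT q01 h_mono h_red MT
  (fun l S => eta_elt p gamma (sr l) (uc l) S) (fun x => `|dens r' x|) ee G.
move=> h; have {}h : ae_on E (fun x => `|dens r' x| = 0 \/ meshsize (T l) x @[l --> \oo] --> (0 : R)).
  apply: h => //.
  - by move=> l S; exact: sqrtr_ge0.
  - move=> l S Sl; have sS' : elt S `<=` E by move=> x; exact: (elt_sub lE (tT l) Sl).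
    have mS := measurable_elt S.
    by rewrite etaE// aeE//; exact: dens_split.
  - move=> l S Sl; have sS' : elt S `<=` E by move=> x; exact: (elt_sub lE (tT l) Sl).
    have mS := measurable_elt S.
    by rewrite etaE// aeE// /ee (sip_normBC sS (DYr l) hr'); exact: dens_split.
apply: ae_on_imp (ae_on_and h (dens_ge0 r')) => x _ [[h1|h1] [_ h2]]; last by right.
by left; apply: h2; exact: normr0_eq0.
Qed.

End marking_limit.

Variable r' : Y.
Hypotheses (hr' : DY r') (cr : nY (r n - r') @[n --> \oo] --> (0 : R)).
Let dB n : DY (r n - r') := subspaceB (sip_sub sS) (DYr n) hr'.

Lemma lim_orthogonal l tau : RT0 p (T l) tau -> sY r' (opL tau) = 0.
Proof.
move=> ht; have hL := DY_opL (RT0_Hdiv ht).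
apply: (@eq0_of_cvg _ (nY (opL tau)) _ l cr) => n ln.
have e : sY (r n - r') (opL tau) = - sY r' (opL tau).
  by rewrite (sipBl sS (DYr n) hr' hL) (r_orthogonal (nRT0 ln ht)) sub0r.
by rewrite -normrN -e mulrC; exact: (sip_CS sS (dB n) hL).
Qed.

(** For [n >= l] the function [v] is a Galerkin test function at level [n], so the residual [r n]
    pairs to zero with it, and the pairing is continuous in the residual. *)
Lemma lim_residual l v : P1 p (T l) v -> pairY (resY r') v = 0.
Proof.
move=> hv; have hv1 := P1_H1 hv.
apply: (@eq0_of_cvg _ (normRes * nH v) _ l cr) => n ln.
have e : pairY (resY (r n)) v = 0.
  have vn := nP1 ln hv; rewrite (resY_resid (hs n) (hu n) vn.1).
  by have [_ ->] := ucP n; rewrite // subrr.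
have h : pairY (resY (r n - r')) v = - pairY (resY r') v.
  by rewrite resYB (pairYB (DY_resY (DYr n)) (DY_resY hr') hv1) e sub0r.
rewrite -normrN -h; apply: (le_trans (pairY_bnd (DY_resY (dB n)) hv1)).
by rewrite mulrAC ler_wpM2r ?sip_norm_ge0//; exact: sumnorm_resY.
Qed.

Hypothesis hz : ae_on E (fun x => (r'.1 x = 0 /\ r'.2 x = 0) \/
  meshsize (T l) x @[l --> \oo] --> (0 : R)).

Lemma mxact0 (B : 'M[R]_d) : mxact B 0 = 0.
Proof. exact: mul0mx. Qed.

(** [adjL] moves the weight and the lower-order term to [r'], which leaves the plain pairing with a
    field and its divergence that [hdiv_limit] treats. *)
Lemma lim_orthogonal_Hdiv tau : Hdiv E tau -> sY r' (opL tau) = 0.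
Proof.
move=> ht; rewrite sY_opL//.
apply: (hdiv_limit d0 lE tT kap0 shape (L2v_adjL hr') hr'.2) => //.
  apply: ae_on_imp hz => x _ [[a b']|h]; [left|by right].
  by rewrite /adjL a b' mulr0 scale0r subr0 mxact0.
move=> l t; have hrt := rt_RT0 d0 lE t (tT l).
have h1 := RT0_Hdiv hrt; have h2 := wdiv_ae oE fE h1.1 (rt_wdiv d0 lE (tT l) t).
rewrite -(ipv_sum oE (L2v_adjL hr') h1.1).
rewrite -[RHS](lim_orthogonal hrt) (sY_opL hr' h1); congr (_ + _).
apply: (ip_ae mE hr'.2 hr'.2 (L2_rtdiv lE (tT l) t) (wdiv_L2 h1)); first exact: ae_on_all.
by apply: ae_on_imp h2 => x _ ->.
Qed.

Lemma lim_residual_H10 v : H10 E v -> pairY (resY r') v = 0.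
Proof.
have [q1 q2] := DY_resY hr'.
apply: (h10_limit d0 lE tT kap0 shape q1 q2).
  apply: ae_on_imp hz => x _ [[a b']|h]; [left|by right].
  rewrite /resY /= a b' oppr0 mxact0; split => //.
  by rewrite /dot big1 ?mulr0 ?addr0 ?oppr0// => i _; rewrite mxE mulr0.
move=> l f f0; have hf := interp_P1 d0 lE (tT l) f0; have hf1 := P1_H1 hf.
have eg := interp_ext_grad d0 lE (tT l) f0; have wg := ext_grad_wgrad lE eg.
have Lg : L2v E (interp_grad (T l) f) := wg.1.
rewrite -(ipv_sum oE q1 Lg) -[RHS](lim_residual hf) /pairY; congr (_ + _).
apply: (ipv_ae oE q1 q1 Lg (wgrad_L2 hf1)); first exact: ae_on_all.
by apply: ae_on_imp (wgrad_ae oE fE hf1.1 wg) => x _ ->.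
Qed.

Variables (u : V -> R) (beta : R).
Hypotheses (hw : weak_solution p u) (beta_gt0 : 0 < beta)
  (hbeta : (beta%:E <= inf_sup E (Defs.form p) (H10 E))%E).
Let u10 : H10 E u. Proof. by case: hw. Qed.
Let u1 : H1 E u := H10_H1 u10.
Let uc10 l : H10 E (uc l). Proof. by have [[]] := ucP l. Qed.
Let w l : V -> R := u - uc l.
Let w10 l : H10 E (w l) := subspaceB (H10_sub oE fE) u10 (uc10 l).
Let w1 l : H1 E (w l) := H10_H1 (w10 l).

(** The form at [u - uc l] is the pairing with the residual [r l]. The limit residual pairs to zero
    with all of H10 and can be subtracted, so the continuous inf-sup condition bounds the error by
    [r l - r']. *)
Lemma error_bound l : nH (w l) <= 2 / beta * normRes * nY (r l - r').
Proof.
have [->|nw] := eqVneq (nH (w l)) 0.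
  apply: mulr_ge0; last exact: sip_norm_ge0.
  by apply: mulr_ge0; [rewrite divr_ge0 ?ler0n// ltW|exact: normRes_ge0].
have nw' : normH1 E (w l) != 0 by rewrite (normH1E oE (w1 l)).
have [v hv [nv h]] := infsup_witness beta_gt0 hbeta (w10 l) nw'; have hv1 := H10_H1 hv.
have e1 : Defs.form p (w l) v = pairY (resY (r l - r')) v.
  rewrite resYB (pairYB (DY_resY (DYr l)) (DY_resY hr') hv1) (lim_residual_H10 hv) subr0.
  rewrite (resY_resid (hs l) (hu l) hv) -(hw.2 v hv).
  have := form_linl (-1) (hu l) u1 hv1.
  by rewrite scaleN1r mulN1r [- uc l + u]addrC [RHS]addrC.
move: h; rewrite e1 (normH1E oE (w1 l)) (normH1E oE hv1) => h.
have vp : 0 < nH v by rewrite lt_def -(normH1E oE hv1) nv sqrtr_ge0.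
have h2 := le_trans h (le_trans (ler_norm _) (pairY_bnd (DY_resY (dB l)) hv1)).
rewrite ler_pM2r// in h2; have h3 := le_trans h2 (sumnorm_resY (dB l)).
have b2 : 0 < beta / 2 by rewrite divr_gt0.
rewrite -(ler_pM2l b2); apply: (le_trans h3); rewrite !mulrA.
by rewrite (_ : beta / 2 * 2 / beta = 1) ?mul1r//; field; rewrite gt_eqF.
Qed.

Lemma uc_cvg : nH (w l) @[l --> \oo] --> (0 : R).
Proof.
have c : 2 / beta * normRes * nY (r l - r') @[l --> \oo] --> (0 : R).
  by rewrite -[X in _ --> X](mulr0 (2 / beta * normRes)); apply: cvgMr.
by apply: cvg0_le c => l; rewrite sip_norm_ge0 error_bound.
Qed.

Let sigma : V -> V := flux p u.
Let divsigma : V -> R := fun x => rhs1 p x - (1 * dot (b x) (wgrad E u x) + c x * u x).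

Lemma flux_pair phi : H1 E phi ->
  pairY (sigma, divsigma) phi = load p phi - Defs.form p u phi.
Proof.
move=> h; have df : DY (rhs2 p, rhs1 p) by [].
by rewrite loadE formE -(pairYB df (DY_opD 1 u1) h).
Qed.

Lemma flux_DY : DY (sigma, divsigma).
Proof. by have := subspaceB (sip_sub sS) ((conj L2f2 L2f1) : DY (rhs2 p, rhs1 p)) (DY_opD 1 u1). Qed.

Lemma flux_wdiv : is_wdiv E sigma divsigma.
Proof.
have [f1 f2] := flux_DY; split => // phi tphi.
have [h1 gp] := test_fun_H1 oE tphi; have h10 := test_fun_H10 oE fE tphi.
have := flux_pair h1; rewrite (hw.2 phi h10) subrr /pairY => /eqP; rewrite addr_eq0 => /eqP <-.
apply: (ipv_ae oE f1 f1 (grad_L2 oE tphi) (wgrad_L2 h1)); first exact: ae_on_all.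
by apply: ae_on_imp (wgrad_ae oE fE h1.1 gp) => x _ ->.
Qed.

Lemma flux_Hdiv : Hdiv E sigma.
Proof. by split; [exact: flux_DY.1|exists divsigma; exact: flux_wdiv]. Qed.

Lemma resid_flux : eqY (resid sigma u) 0.
Proof.
have h := wdiv_ae oE fE flux_DY.1 flux_wdiv.
apply: ae_on_imp (ae_on_and h coef_inv) => x _ [hd [_ _ _ _ hI]]; split.
  rewrite -[LHS]/((rhs2 p x - mxact (A x) (wgrad E u x)) + (mxact (A x) (wgrad E u x) - rhs2 p x)).
  by rewrite addrA subrK subrr.
rewrite -[LHS]/((wdiv E sigma x - (1 - gamma) *
  dot (b x) (mxact (Ai x) (rhs2 p x - mxact (A x) (wgrad E u x)))) +
  ((gamma * dot (b x) (wgrad E u x) + c x * u x) -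
   (rhs1 p x - (1 - gamma) * dot (b x) (mxact (Ai x) (rhs2 p x))))) hd mxactB hI dotBr.
exact: flux_identity.
Qed.

Let err l : V -> V := sigma - sr l.
Let err_Hdiv l : Hdiv E (err l) := subspaceB (Hdiv_sub oE) flux_Hdiv (hs l).

(** Subtracting the vanishing residual of the exact pair removes the data and leaves the homogeneous
    operators applied to the errors. *)
Lemma opL_error l : eqY (- r l) (opL (err l) + opD gamma (w l)).
Proof.
have h1 : eqY (opL (err l)) (opL sigma - opL (sr l)).
  have := opL_lin (-1) (hs l) flux_Hdiv.
  by rewrite !scaleN1r [- sr l + _]addrC [- opL _ + _]addrC.
have h2 : eqY (opD gamma (w l)) (opD gamma u - opD gamma (uc l)).
  have := opD_lin gamma (-1) (hu l) u1.
  by rewrite !scaleN1r [- uc l + _]addrC [- opD _ _ + _]addrC.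
apply: ae_on_imp (ae_on_and resid_flux (eqYD h1 h2)) => x _ [[a1 a2] [b1 b2]].
have e : opL sigma - opL (sr l) + (opD gamma u - opD gamma (uc l)) = resid sigma u - r l.
  exact: zmod_resid_identity.
rewrite e in b1 b2; split.
  by rewrite b1 -[RHS]/((resid sigma u).1 x - (r l).1 x) a1 sub0r.
by rewrite b2 -[RHS]/((resid sigma u).2 x - (r l).2 x) a2 sub0r.
Qed.

Let dL l : DY (opL (err l)) := DY_opL (err_Hdiv l).
Let dD l : DY (opD gamma (w l)) := DY_opD gamma (w1 l).
Let dN l : DY (- r l).
Proof. by have := subspaceZ (-1) (sip_sub sS) (DYr l); rewrite scaleN1r. Qed.

(** The flux error [err l] is known to be in Hdiv and not in a discrete space, which is why
    orthogonality of [r'] to all of Hdiv is required. *)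
Lemma lim_zero : nY r' = 0.
Proof.
have h l : sY (r l) r' = - sY (opD gamma (w l)) r'.
  have hLD := subspaceD (sip_sub sS) (dL l) (dD l).
  have e := sY_ae (dN l) hLD hr' hr' (opL_error l) (eqYxx _).
  have e2 : sY (- r l) r' = - sY (r l) r' by rewrite -scaleN1r (sipZl sS) // mulN1r.
  rewrite -[LHS]opprK -e2 e (sipDl sS (dL l) (dD l) hr').
  by rewrite (sip_sym sS (dL l) hr') (lim_orthogonal_Hdiv (err_Hdiv l)) add0r.
have cc : normYD gamma * nH (w l) + nY (r l - r') @[l --> \oo] --> (0 : R).
  have c1 : normYD gamma * nH (w l) @[l --> \oo] --> (0 : R).
    by rewrite -[X in _ --> X](mulr0 (normYD gamma)); apply: cvgMr; exact: uc_cvg.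
  by have := cvgD c1 cr; rewrite addr0; exact.
have z : sY r' r' = 0.
  apply: (@eq0_of_cvg _ (nY r') _ 0%N cc) => n _.
  have -> : sY r' r' = sY (r n) r' - sY (r n - r') r'.
    by rewrite (sipBl sS (DYr n) hr' hr') opprB addrC subrK.
  apply: (le_trans (ler_normB _ _)); rewrite h normrN mulrDr; apply: lerD.
    apply: (le_trans (sip_CS sS (dD n) hr')); rewrite mulrC ler_wpM2l ?sip_norm_ge0//; exact: nY_opD.
  by rewrite mulrC; exact: (sip_CS sS (dB n) hr').
by rewrite /sip_norm z sqrtr0.
Qed.

Lemma r_cvg : nY (r l) @[l --> \oo] --> (0 : R).
Proof.
apply: cvg0_le cr => l; rewrite sip_norm_ge0/=.
have e : r l = (r l - r') + r' by rewrite subrK.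
by rewrite {1}e; apply: (le_trans (sip_triangle sS (dB l) hr')); rewrite lim_zero addr0.
Qed.

Lemma opL_cvg : nY (opL (err l)) @[l --> \oo] --> (0 : R).
Proof.
have cc : nY (r l) + normYD gamma * nH (w l) @[l --> \oo] --> (0 : R).
  have c1 : normYD gamma * nH (w l) @[l --> \oo] --> (0 : R).
    by rewrite -[X in _ --> X](mulr0 (normYD gamma)); apply: cvgMr; exact: uc_cvg.
  by have := cvgD r_cvg c1; rewrite addr0; exact.
apply: cvg0_le cc => l; rewrite sip_norm_ge0/=.
have hLD := subspaceD (sip_sub sS) (dL l) (dD l).
have e : opL (err l) = (opL (err l) + opD gamma (w l)) - opD gamma (w l) by rewrite addrK.
rewrite {1}e; apply: (le_trans (sip_triangleB sS hLD (dD l))).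
rewrite -(nY_ae (dN l) hLD (opL_error l)) (sip_normN sS (DYr l)) lerD2l; exact: nY_opD.
Qed.

Lemma normX_cvg : normX E (err l) (w l) @[l --> \oo] --> (0 : R).
Proof.
pose C := Num.sqrt L1 + (1 + normbAi * Num.sqrt L1).
have cc : nH (w l) + C * nY (opL (err l)) @[l --> \oo] --> (0 : R).
  have c1 : C * nY (opL (err l)) @[l --> \oo] --> (0 : R).
    by rewrite -[X in _ --> X](mulr0 C); apply: cvgMr; exact: opL_cvg.
  by have := cvgD uc_cvg c1; rewrite addr0; exact.
apply: cvg0_le cc => l; rewrite sqrtr_ge0/= /normX.
have n0 : 0 <= normH1 E (w l) by exact: sqrtr_ge0.
have n1 : 0 <= normHdiv E (err l) by exact: sqrtr_ge0.
apply: (le_trans (sqrtrD_le (sqr_ge0 _) (sqr_ge0 _))); rewrite !sqrtr_sqr !ger0_norm//.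
rewrite (normH1E oE (w1 l)) lerD2l /normHdiv.
apply: (le_trans (sqrtrD_le (sqr_ge0 _) (sqr_ge0 _))).
rewrite !sqrtr_sqr !ger0_norm ?sqrtr_ge0// /C mulrDl; apply: lerD; first exact: nV_opL.
exact: n2_wdiv_opL.
Qed.

Lemma eta_cvg : eta p gamma (T l) (sr l) (uc l) @[l --> \oo] --> (0 : R).
Proof.
rewrite (_ : (fun l => _) = fun l => nY (r l)); first exact: r_cvg.
apply/funext => l; rewrite /eta /sip_norm sY_dens//; congr Num.sqrt.
rewrite -(Rint_mesh d0 lE (tT l) (intble_dens (DYr l))) big_seq [RHS]big_seq; apply: eq_bigr => S Sl.
rewrite /eta_elt ls_sqE//; [|exact: measurable_elt|by move=> x; exact: (elt_sub lE (tT l) Sl)].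
by rewrite sqr_sqrtr// -ls_sqE//; [exact: ls_sq_ge0|exact: measurable_elt|move=> x; exact: (elt_sub lE (tT l) Sl)].
Qed.

End adaptive_sequence.
End least_squares_operators.

Theorem theorem7p3 (R : realType) (d : nat) (p : pde R d) (u : 'rV[R]_d -> R)
    (T0 : mesh R d) (hfix gamma : R) (T M : nat -> mesh R d)
    (sr : nat -> 'rV[R]_d -> 'rV[R]_d) (uc : nat -> 'rV[R]_d -> R)
    (hd : d = 2%N \/ d = 3%N)
    (hp : pde_data p) (hwp : well_posed p) (hu : weak_solution p u)
    (hT0 : triangulation (dom p) T0)
    (hR1 : R1 (dom p) T0) (hR2 : R2 (dom p) T0) (hR3 : R3 (dom p) T0)
    (hfixP : is_hfix p T0 hfix)
    (hmesh : ae_on (dom p) (fun x => meshsize T0 x < hfix))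
    (hgamma : 0 <= gamma <= 1)
    (hrun : adaptive_run p gamma T0 T M sr uc)
    (hM : marking p gamma T M sr uc) :
  normX (dom p) (fun x => flux p u x - sr l x) (u \- uc l) @[l --> \oo] --> (0 : R)
  /\ eta p gamma (T l) (sr l) (uc l) @[l --> \oo] --> (0 : R).
Proof.
have d0 : (0 < d)%N by case: hd => ->.
have [lE [hA [L0 [L1 [/andP[l0 l01] hL]]]] [hb hc] [Lf1 Lf2]] := hp.
have [T00 hl] := hrun.
have hgal l : galerkin p (T l) (uc l) by case: (hl l).
have hls l : ls_recovery p gamma (T l) (uc l) (sr l) by case: (hl l).
have hMT l : (M l `<=` T l)%fset by case: (hl l).
have href l : is_refine (dom p) (T l) (M l) (T l.+1) by case: (hl l).
have tT l := run_triangulation hT0 T00 href l.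
have rT l := run_refines T00 hMT href l.
have rT1 l := run_refines1 hMT href l.
have MT l S := @run_marked _ _ _ _ _ hMT href l S.
have nP1 n k v := @run_P1 _ _ _ d0 _ _ _ hT0 T00 href n k v.
have nRT0 n k tau := @run_RT0 _ _ _ d0 _ _ _ hT0 T00 href n k tau.
have [q [q01 hq]] := hR1; have [kappa [kap0 hk]] := hR2.
have hmono l : ae_on (dom p) (fun x => meshsize (T l.+1) x <= meshsize (T l) x).
  by have [] := hq _ _ (rT l) (rT1 l).
have hred l S : S \in T l -> S \notin T l.+1 ->
    ae_on (elt S) (fun x => meshsize (T l.+1) x <= q * meshsize (T l) x).
  by move=> Sl Sl1; have [_] := hq _ _ (rT l) (rT1 l); apply; rewrite in_fsetD Sl1 Sl.
have shape l S (Sl : S \in T l) := hk _ _ (rT l) Sl.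
(* The smallness of the initial mesh enters here, as a discrete inf-sup constant common to all
   refinements. *)
have [beta0 [b0 hb0]] := hfixP.2 hmesh.
have hb0' l := hb0 _ (rT l).
have [[beta [beta_gt0 hbeta]] _] := hwp.
have [Kb [Kb0 hKb]] := Linfty_common hb.
have [Kc hKc] := hc.2.
pose K := Num.max Kb `|Kc|.
have K0 : 0 <= K by rewrite le_max Kb0.
have coef : ae_on (dom p) (fun x => [/\ (coefA p x)^T = coefA p x,
    forall y, L0 * dot y y <= dot y (mxact (coefA p x) y) <= L1 * dot y y,
    forall i, `|coefb p x 0 i| <= K & `|coefc p x| <= K]).
  apply: ae_on_imp (ae_on_and hL (ae_on_and hKb hKc)) => x _ [[sA eA] [kb kc]]; split => //.
    by move=> i; rewrite le_max kb.
  by rewrite le_max (le_trans kc (ler_norm _)) orbT.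
have mA i j := (hA i j).1; have mb i := (hb i).1; have mc := hc.1.
have [r' [hr' cr hz]] := residual_limit lE l0 l01 K0 mA mb mc Lf1 Lf2 coef d0 tT nP1 nRT0 hgal hls
  b0 hb0' q01 hmono hred MT hM.
split.
  by have := @normX_cvg _ _ _ _ _ _ _ lE l0 l01 K0 mA mb mc Lf1 Lf2 coef _ _ _ _ d0 tT kap0 shape nP1 nRT0
    hgal hls _ hr' cr hz _ _ hu beta_gt0 hbeta.
exact: (@eta_cvg _ _ _ _ _ _ _ lE l0 l01 K0 mA mb mc Lf1 Lf2 coef _ _ _ _ d0 tT kap0 shape nP1 nRT0
    hgal hls _ hr' cr hz _ _ hu beta_gt0 hbeta).
Qed.
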